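(* Let $a,b,c,d$ be real numbers with $a<c<b<d$ and $c<2a$. For $0<p\leq q$ let \[E(p,q)=\left\{(z_1,z_2)\in\mathbb{C}^2 \;\middle|\; \frac{\pi|z_1|^2}{p}+\frac{\pi|z_2|^2}{q}\leq 1\right\}\] with the restriction of the standard symplectic form $\omega_{\mathrm{std}}=dx_1\wedge dy_1+dx_2\wedge dy_2$. Let $\{\Phi_t\}_{t\in[0,1]}\subset \mathrm{Sp}(4,\mathbb{R})$ be the loop \[\Phi_t(z_1,z_2)=\begin{cases}(e^{4\pi i t}z_1,z_2), & t\in[0,\tfrac12],\\ (z_1,e^{-4\pi i t}z_2), & t\in[\tfrac12,1].\end{cases}\] Then the loop of symplectic embeddings $\{\varphi_t=\Phi_t|_{E(a,b)}\}_{t\in[0,1]}$ is noncontractible in $\mathrm{SympEmb}(E(a,b),E(c,d))$.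
   Context: $\mathrm{SympEmb}(M,N)$ denotes the space of symplectic embeddings of the symplectic manifold $M$ into the symplectic manifold $N$ (with its natural topology). Note that $E(a,b)\subset E(c,d)$ under the stated inequalities, so each $\varphi_t$ is indeed a symplectic embedding of $E(a,b)$ into $E(c,d)$. *)

(* Defs.v *)
From HB Require Import structures.
From mathcomp Require Import all_boot all_order all_algebra.
From mathcomp Require Import all_classical all_reals all_analysis.
Set Implicit Arguments. Unset Strict Implicit. Unset Printing Implicit Defensive.
Import Order.TTheory GRing.Theory Num.Theory.
Import numFieldNormedType.Exports.
Local Open Scope classical_set_scope.
Local Open Scope ring_scope.

(* C^2 is identified with R^4 = 'rV[R]_4, with coordinates (x1, y1, x2, y2),
   z1 = x1 + i y1, z2 = x2 + i y2. *)
Notation R4 R := 'rV[R]_4.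

Definition coord {R : realType} (v : R4 R) (i : nat) : R := v ord0 (inord i).

Definition mk4 {R : realType} (x1 y1 x2 y2 : R) : R4 R :=
  \row_(i < 4) (nth 0 [:: x1; y1; x2; y2] i).

Definition ellipsoid {R : realType} (p q : R) : set (R4 R) :=
  [set v | pi * (coord v 0 ^+ 2 + coord v 1 ^+ 2) / p
         + pi * (coord v 2 ^+ 2 + coord v 3 ^+ 2) / q <= 1].

Definition omega_std {R : realType} (u v : R4 R) : R :=
  coord u 0 * coord v 1 - coord u 1 * coord v 0
  + coord u 2 * coord v 3 - coord u 3 * coord v 2.

Definition Phi {R : realType} (t : R) (v : R4 R) : R4 R :=
  let x1 := coord v 0 in let y1 := coord v 1 in
  let x2 := coord v 2 in let y2 := coord v 3 in
  if t <= 2^-1 then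
    let th := 4 * pi * t in
    mk4 (x1 * cos th - y1 * sin th) (x1 * sin th + y1 * cos th) x2 y2
  else
    let th := - (4 * pi * t) in
    mk4 x1 y1 (x2 * cos th - y2 * sin th) (x2 * sin th + y2 * cos th).

Fixpoint iterD {R : realType} (s : seq (R4 R)) (f : R4 R -> R4 R)
  : R4 R -> R4 R :=
  match s with
  | [::] => f
  | v :: s' => fun x => 'D_v (iterD s' f) x
  end.

(* A family H : K -> SympEmb(E, F), parametrized by k in K, which is continuous
   for the C^infinity topology on SympEmb(E,F) (E compact with nonempty interior):
   - each H k is smooth on E: all iterated derivatives exist on the interior
     of E and (jointly with the parameter) extend continuously to K x E;
   - H itself is jointly continuous on K x E;
   - each H k is injective on E, maps E into F, and preserves omega_std. *)
Definition SympEmb_family {R : realType} {P : topologicalType}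
  (E F : set (R4 R)) (K : set P) (H : P -> R4 R -> R4 R) : Prop :=
  [/\ (forall k s x, K k -> E° x -> differentiable (iterD s (H k)) x),
      {within K `*` E, continuous (fun kx : P * R4 R => H kx.1 kx.2)},
      (forall s, exists G : P * R4 R -> R4 R,
          {within K `*` E, continuous G} /\
          forall k x, K k -> E° x -> G (k, x) = iterD s (H k) x),
      (forall k, K k ->
         (forall x y, E x -> E y -> H k x = H k y -> x = y) /\
         (forall x, E x -> F (H k x))) &
      (forall k x u v, K k -> E° x ->
          omega_std ('D_u (H k) x) ('D_v (H k) x) = omega_std u v)].

Definition unit_square {R : realType} : set (R * R) :=
  [set st | 0 <= st.1 <= 1 /\ 0 <= st.2 <= 1].

Definition contractible_loop {R : realType} (E F : set (R4 R))
  (phi : R -> R4 R -> R4 R) : Prop :=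
  exists H : R * R -> R4 R -> R4 R,
    [/\ SympEmb_family E F unit_square H,
        (forall t x, 0 <= t <= 1 -> E x -> H (0, t) x = phi t x),
        (forall t x, 0 <= t <= 1 -> E x -> H (1, t) x = H (1, 0) x) &
        (forall s x, 0 <= s <= 1 -> E x -> H (s, 0) x = H (s, 1) x)].

(* Main.v *)
Require Import Defs.
From HB Require Import structures.
From mathcomp Require Import all_boot all_order all_algebra.
From mathcomp Require Import all_classical all_reals all_analysis.
From mathcomp Require Import ring lra zify.
Set Implicit Arguments. Unset Strict Implicit. Unset Printing Implicit Defensive.
Import Order.TTheory GRing.Theory Num.Theory.
Import numFieldNormedType.Exports.
Local Open Scope classical_set_scope.
Local Open Scope ring_scope.

(* Suppose that the loop contracts through embeddings phi_z, z in the unit square. Push forward to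
   C^2 the function h(rho) + m k(rho), where rho = pi |z1|^2 / a + pi |z2|^2 / b, and add a function of
   quadratic growth outside E(c, d); this gives Hamiltonians H_z vanishing near phi_z(0) and larger
   than la (Q - 1), where Q is the quadratic form of E(c, d) and c < la < min(2a, b). On loops,
   discretised so that they form a finite-dimensional space V + E^+ (nonpositive and positive
   eigenvectors of the symmetric operator - J d/dt), the action is at most la on the half space
   B = V + R_+ e, nonpositive on the boundary of a large box of B, and positive on a small sphere
   centred at phi_z(0) in phi_z(0) + E^+. Almost critical loops of action in (0, la] either spend much
   time where k is large (upper), or follow the image by phi_z of the circle of action a in the plane
   z2 = 0, because the frequency is below min(2a, b) (lower). Run the negative gradient flow from B
   while m grows. The upper critical loops lose all their action, so a flow line that ends on the
   sphere has to stay near lower loops in between, where the first Fourier coefficient Theta of the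
   z1-component of phi_z^-1(x) does not vanish. For s = 0 the Hamiltonian does not depend on t
   whereas Theta turns exactly once around 0, and the set of flow lines ending on the sphere has odd
   degree (deform the flow to the identity); for s = 1 nothing depends on t. Modulo 2 intersection
   theory on the product of the unit square with the box then gives a contradiction. *)

(** * Compactness *)

(** The gap between [c] and [min(2a, b)] enters twice. A slope [la > c] makes the Hamiltonian win
    over the positive direction [e] of the half space. A closed orbit of action at most [la] on the
    convex part of the profile has frequency below [2a] and below [b], so it closes up only by
    turning exactly once in the plane z2 = 0. Why [m] grows in two equal phases: without lower
    loops, a single phase would already exhaust the available action. A surviving line therefore
    meets the lower action level in both phases, which leaves it too little action to be away from
    the lower loops at the middle time, when Theta is tested. Discretising removes
    infinite-dimensional analysis, but the quadratic action is a half-derivative norm and does not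
    control the supremum. The estimates on almost critical loops are therefore made uniform in the
    number of samples, which is fixed only after them. Transversality is avoided: zeros are replaced
    by sign changes on a fine cubical grid, and only the sign bits and their cup products modulo 2
    are kept. *)

Section Compactness.
Variable R : realType.

(* Both quantifiers over scales are handled at once by the filter [0^'+]. *)
Lemma compact_scale (T : pseudoMetricType R) (C : set T) (P : R -> T -> Prop) :
  compact C -> (forall x, C x -> exists2 e, 0 < e & forall d y, 0 < d < e -> ball x e y -> P d y) ->
  exists2 d, 0 < d & forall e x, 0 < e < d -> C x -> P e x.
Proof.
move=> /compact_near_coveringP cC loc.
have := cC R (0 : R)^'+ P _.
case.
  move=> x Cx; have [e e0 Pe] := loc x Cx.
  exists (ball x e, [set d | 0 < d < e]) => /=; last by move=> [y d] /= [xy de]; exact: Pe.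
  split; first exact: nbhsx_ballx.
  exists e => //= d; rewrite /= sub0r normrN => de d0.
  by rewrite d0 -(gtr0_norm d0).
move=> d /= d0 H; exists d => // e x /andP[e0 ed] Cx; apply: (H e) => //=.
by rewrite sub0r normrN gtr0_norm.
Qed.

(** Continuity is that of the ambient space, so only the first point is confined to the compact set.
    This matters later, when the second point may leave it. *)
Lemma heine (T : pseudoMetricType R) (V : normedModType R) (f : T -> V) (C : set T) :
  compact C -> (forall x, C x -> {for x, continuous f}) -> forall e, 0 < e ->
  exists2 d, 0 < d & forall x y, C x -> ball x d y -> `|f x - f y| < e.
Proof.
move=> cC fc e e0.
pose P d x := forall y, ball x d y -> `|f x - f y| < e.
suff loc x : C x -> exists2 r, 0 < r & forall d y, 0 < d < r -> ball x r y -> P d y.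
  have [d d0 H] := compact_scale cC loc.
  have d20 : 0 < d / 2 by rewrite divr_gt0.
  exists (d / 2) => // x y Cx; apply: H => //.
  by rewrite d20 ltr_pdivrMr // mulr_natr mulr2n ltrDl.
move=> Cx; have e20 : 0 < e / 2 by rewrite divr_gt0.
have /cvgrPdist_lt /(_ _ e20) /nbhs_ballP[r /= r0 Hr] := fc x Cx.
exists (r / 2); first by rewrite divr_gt0.
move=> d y /andP[d0 dr] xy z yz.
have xyr : ball x r y by apply: le_ball xy; rewrite ler_pdivrMr // mulr_natr mulr2n lerDl ltW.
have xzr : ball x r z.
  by rewrite [r]splitr; apply: ball_triangle xy _; apply: le_ball yz; exact: ltW.
rewrite -[f y](subrK (f x)) -addrA (le_lt_trans (ler_normD _ _)) //.
by rewrite [e]splitr ltrD //; [rewrite distrC; apply: Hr|apply: Hr].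
Qed.

(** The norm of matrices is the maximum of the entries, not the Euclidean norm [dot u u]; this is
    the bridge to entrywise estimates. *)
Lemma mx_norm_leP (m n : nat) (A : 'M[R]_(m, n)) (c : R) : 0 <= c ->
  `|A| <= c <-> forall i j, `|A i j| <= c.
Proof.
move=> c0; have -> : `|A| = \big[Num.max/0]_ij `|A ij.1 ij.2| by rewrite -mx_normrE.
split=> [/bigmax_leP[_ H] i j|H]; first exact: (H (i, j)).
by apply/bigmax_leP; split => // ij _.
Qed.

Lemma le_mx_norm (m n : nat) (A : 'M[R]_(m, n)) i j : `|A i j| <= `|A|.
Proof. exact: (proj1 (mx_norm_leP A (normr_ge0 A)) (lexx _) i j). Qed.

Lemma cts_ball (T : pseudoMetricType R) (V : normedModType R) (f : T -> V) (x : T) :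
  (forall e : R, 0 < e -> exists2 d : R, 0 < d & forall y, ball x d y -> `|f x - f y| < e) ->
  {for x, continuous f}.
Proof.
move=> H; apply/cvgrPdist_lt => e /H[d d0 Hd].
by apply/nbhs_ballP; exists d => // y /Hd.
Qed.

Lemma ball_cts (T : pseudoMetricType R) (V : normedModType R) (f : T -> V) (x : T) :
  {for x, continuous f} ->
  forall e : R, 0 < e -> exists2 d : R, 0 < d & forall y, ball x d y -> `|f x - f y| < e.
Proof.
by move=> fc e e0; have /cvgrPdist_lt /(_ _ e0) /nbhs_ballP[d /= d0 Hd] := fc; exists d.
Qed.

End Compactness.

(** * Cochains modulo 2 on cubical grids *)

Section Cochains.
Implicit Types (x : nat -> nat) (J : seq nat) (f : (nat -> nat) -> 'F_2).

Definition set_at x (j i : nat) : nat -> nat := fun l => if l == j then i else x l.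
Definition up x (j : nat) : nat -> nat := set_at x j (x j).+1.

Definition del (j : nat) J := [seq i <- J | i != j].

(* Evaluation, on the cell at [x] spanned by the axes [J], of the cup product of the coboundaries
   of the 0-cochains [fs]: a sum over the monotone edge paths of the cell. *)
Fixpoint pathsum J (fs : seq ((nat -> nat) -> 'F_2)) x : 'F_2 :=
  if fs is f :: fs' then
    \sum_(j <- J) (f x + f (up x j)) * pathsum (del j J) fs' (up x j)
  else 1.

Lemma addF2 (u : 'F_2) : u + u = 0.
Proof. by apply: addrr_pchar2; rewrite pchar_Fp. Qed.

Lemma oppF2 (u : 'F_2) : - u = u.
Proof. by apply/eqP; rewrite eq_sym -subr_eq0 opprK addF2. Qed.

Lemma addrK2 (u v : 'F_2) : u + v + v = u.
Proof. by rewrite -addrA addF2 addr0. Qed.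

Lemma up_upC x i j : up (up x i) j = up (up x j) i.
Proof.
apply: boolp.funext => l; rewrite /up /set_at.
have [->|nij] := eqVneq i j; first by [].
have nji : (j == i) = false by rewrite eq_sym (negbTE nij).
by case: (eqVneq l j) => [->|_]; rewrite ?eqxx ?nji ?(negbTE nij).
Qed.

Lemma delC i j J : del i (del j J) = del j (del i J).
Proof. by rewrite /del -!filter_predI; apply: eq_filter => l /=; rewrite andbC. Qed.

Lemma sum_delC (J : seq nat) (s : nat -> nat -> 'F_2) :
  \sum_(j <- J) \sum_(i <- del j J) s i j = \sum_(j <- J) \sum_(i <- del j J) s j i.
Proof.
under eq_bigr do rewrite big_filter.
rewrite (exchange_big_dep xpredT) //=; apply: eq_bigr => i _.
by rewrite big_filter; apply: eq_bigl => j; rewrite eq_sym.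
Qed.

(** Each unordered pair of axes is counted twice, which is zero modulo 2. *)
Lemma sum_del_sym (J : seq nat) (s : nat -> nat -> 'F_2) :
  (forall i j, s i j = s j i) -> \sum_(j <- J) \sum_(i <- del j J) s i j = 0.
Proof.
move=> sC; pose u := \sum_(j <- J) \sum_(i <- J | (i < j)%N) s i j.
rewrite -[RHS](addF2 u) {2}/u (exchange_big_dep xpredT) //= /u -big_split /=.
apply: eq_bigr => j _; rewrite big_filter (bigID (fun i => (i < j)%N)) /=.
congr (_ + _); first by apply: eq_bigl => i; case: ltngtP.
under [RHS]eq_bigr do rewrite sC.
by apply: eq_bigl => i; case: ltngtP.
Qed.

(** A cup product of coboundaries is a cocycle: its sum over the faces of a cell vanishes. Expanding
    the first factor turns the face sum into a sum over ordered pairs of axes, whose terms are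
    either symmetric or occur twice. *)
Lemma pathsum_closed fs J x :
  \sum_(j <- J) (pathsum (del j J) fs (up x j) + pathsum (del j J) fs x) = 0.
Proof.
elim: fs J x => [|f fs IH] J x.
  by rewrite big1 // => j _; rewrite addF2.
(* The induction hypothesis, multiplied by [f y], trades the coboundary of [f] for the values of [f]
   at both ends of the edge. *)
have Stk K y : pathsum K (f :: fs) y = \sum_(i <- K)
    (f (up y i) * pathsum (del i K) fs (up y i) + f y * pathsum (del i K) fs y).
  rewrite /=; apply/eqP; rewrite -subr_eq0 -sumrB; apply/eqP.
  rewrite -[RHS](mulr0 (f y)) -[in RHS](IH K y) mulr_sumr; apply: eq_bigr => i _.
  by rewrite oppF2 mulrDl mulrDr addrA addrK2.
under eq_bigr do rewrite !Stk -big_split /=.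
set A := fun i j => f (up (up x j) i) * pathsum (del i (del j J)) fs (up (up x j) i)
   + f x * pathsum (del i (del j J)) fs x.
set B := fun i j => f (up x j) * pathsum (del i (del j J)) fs (up x j).
transitivity (\sum_(j <- J) \sum_(i <- del j J) (A i j + (B i j + B j i))).
  apply: eq_bigr => j _; apply: eq_bigr => i _.
  rewrite /A /B [del j (del i J)]delC; set u1 := _ * _; set u2 := _ * _; set u3 := _ * _.
  by set u4 := _ * _; rewrite !addrA; ring.
transitivity (\sum_(j <- J) \sum_(i <- del j J) A i j
   + (\sum_(j <- J) \sum_(i <- del j J) B i j + \sum_(j <- J) \sum_(i <- del j J) B j i)).
  by rewrite -!big_split; apply: eq_bigr => j _; rewrite -!big_split; apply: eq_bigr.
rewrite (sum_delC _ B) addF2 addr0 sum_del_sym // => i j.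
by rewrite /A up_upC [del i (del j J)]delC.
Qed.

(** Leibniz rule: the product that starts with the coboundary of [f] is the coboundary of [f] times
    the remaining cocycle. *)
Lemma pathsum_stokes f fs J x : pathsum J (f :: fs) x = \sum_(i <- J)
    (f (up x i) * pathsum (del i J) fs (up x i) + f x * pathsum (del i J) fs x).
Proof.
rewrite /=; apply/eqP; rewrite -subr_eq0 -sumrB; apply/eqP.
rewrite -[RHS](mulr0 (f x)) -[in RHS](pathsum_closed fs J x) mulr_sumr.
apply: eq_bigr => i _.
by rewrite oppF2 mulrDl mulrDr addrA addrK2.
Qed.

(** Cells are indexed by their lowest corner, so [B j] counts cells along the axis [j]; coordinates
    outside [J] stay frozen at their values in [x]. *)
Fixpoint boxsum (B : nat -> nat) J (h : (nat -> nat) -> 'F_2) x : 'F_2 :=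
  if J is j :: J' then \sum_(0 <= i < B j) boxsum B J' h (set_at x j i) else h x.

Lemma set_atC x i j u v : i != j -> set_at (set_at x i u) j v = set_at (set_at x j v) i u.
Proof.
move=> nij; apply: boolp.funext => l; rewrite /set_at.
by case: (eqVneq l j) => [->|//]; rewrite eq_sym (negbTE nij).
Qed.

Lemma set_at_set x i u v : set_at (set_at x i u) i v = set_at x i v.
Proof. by apply: boolp.funext => l; rewrite /set_at; case: eqP. Qed.

Lemma set_atE x i u : set_at x i u i = u.
Proof. by rewrite /set_at eqxx. Qed.

Lemma set_at_neq x i u l : l != i -> set_at x i u l = x l.
Proof. by rewrite /set_at => /negbTE ->. Qed.

Lemma boxsum_sum B J (I : Type) (s : seq I) (h : I -> (nat -> nat) -> 'F_2) x :
  boxsum B J (fun y => \sum_(i <- s) h i y) x = \sum_(i <- s) boxsum B J (h i) x.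
Proof.
elim: J x => [//|j J IH] x /=.
by under eq_bigr do rewrite IH; rewrite exchange_big.
Qed.

Lemma boxsumD B J h h' x :
  boxsum B J (fun y => h y + h' y) x = boxsum B J h x + boxsum B J h' x.
Proof.
elim: J x => [//|j J IH] x /=.
by under eq_bigr do rewrite IH; rewrite big_split.
Qed.

Lemma eq_boxsum B J h h' x : uniq J ->
  (forall y, {in J, forall j, (y j < B j)%N} ->
     (forall l, l \notin J -> y l = x l) -> h y = h' y) ->
  boxsum B J h x = boxsum B J h' x.
Proof.
elim: J x => [|j J IH] x /=; first by move=> _ ->.
move=> /andP[jJ uJ] hh'; apply: eq_big_nat => i /andP[_ iB]; apply: IH => // y yB yx.
have yj : y j = i by rewrite yx // set_atE.
apply: hh' => [l|l].
  by rewrite inE => /orP[/eqP ->|/yB //]; rewrite yj.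
by rewrite inE negb_or => /andP[lj lJ]; rewrite yx // set_at_neq.
Qed.

Lemma boxsum0 B J h x : uniq J ->
  (forall y, {in J, forall j, (y j < B j)%N} ->
     (forall l, l \notin J -> y l = x l) -> h y = 0) -> boxsum B J h x = 0.
Proof.
move=> uJ h0; rewrite (@eq_boxsum _ _ _ (fun _ => 0)) // => {h0 uJ}.
by elim: J x => [//|j J IH] x /=; rewrite big1.
Qed.

Lemma del_id j J : j \notin J -> del j J = J.
Proof.
by move=> jJ; apply/all_filterP/allP => i iJ; apply: contraNneq jJ => <-.
Qed.

Lemma boxsum_del B J h x j : uniq J -> j \in J ->
  boxsum B J h x = \sum_(0 <= i < B j) boxsum B (del j J) h (set_at x j i).
Proof.
elim: J x => [//|k J IH] x /= /andP[kJ uJ]; rewrite inE [k == j]eq_sym.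
have [->|njk] := eqVneq j k; first by rewrite del_id.
move=> /= jJ; rewrite -/(del j J).
under eq_bigr do rewrite (IH _ uJ jJ).
rewrite exchange_big /=; apply: eq_bigr => i _; apply: eq_bigr => l _.
by rewrite set_atC // eq_sym.
Qed.

Lemma sum_telescope (u : nat -> 'F_2) n : \sum_(0 <= i < n) (u i.+1 + u i) = u n + u 0%N.
Proof.
elim: n => [|n IH]; first by rewrite big_nil addF2.
by rewrite big_nat_recr //= IH addrC addrA addrK2.
Qed.

Lemma up_set x j i : up (set_at x j i) j = set_at x j i.+1.
Proof. by rewrite /up set_atE set_at_set. Qed.

(** An inner face belongs to two neighbouring cells and cancels modulo 2. *)
Lemma boxsum_telescope B J (g : (nat -> nat) -> 'F_2) x j : uniq J -> j \in J ->
  boxsum B J (fun y => g (up y j) + g y) x =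
  boxsum B (del j J) g (set_at x j (B j)) + boxsum B (del j J) g (set_at x j 0).
Proof.
move=> uJ jJ; rewrite (boxsum_del _ _ _ uJ jJ).
rewrite -(sum_telescope (fun i => boxsum B (del j J) g (set_at x j i))).
apply: eq_bigr => i _; rewrite boxsumD; congr (_ + _).
have : j \notin del j J by rewrite mem_filter eqxx.
elim: (del j J) x => [|k K IH] x /=; first by rewrite up_set.
rewrite inE negb_or => /andP[njk jK]; apply: eq_bigr => l _.
by rewrite set_atC // IH // [in RHS]set_atC.
Qed.

Lemma boxsum_closed B J fs x : uniq J ->
  \sum_(j <- J) (boxsum B (del j J) (pathsum (del j J) fs) (set_at x j (B j))
    + boxsum B (del j J) (pathsum (del j J) fs) (set_at x j 0)) = 0.
Proof.
move=> uJ; transitivity (\sum_(j <- J)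
   boxsum B J (fun y => pathsum (del j J) fs (up y j) + pathsum (del j J) fs y) x).
  by rewrite !big_seq; apply: eq_bigr => j jJ; rewrite boxsum_telescope.
by rewrite -boxsum_sum; apply: boxsum0 => // y _ _; rewrite pathsum_closed.
Qed.

(** The Stokes formula on a box. The twist theorem applies it twice, once for each component of the
    planar map. *)
Lemma boxsum_stokes B J f fs x : uniq J ->
  boxsum B J (pathsum J (f :: fs)) x =
  \sum_(j <- J) (boxsum B (del j J) (fun y => f y * pathsum (del j J) fs y) (set_at x j (B j))
    + boxsum B (del j J) (fun y => f y * pathsum (del j J) fs y) (set_at x j 0)).
Proof.
move=> uJ; rewrite big_seq.
under [RHS]eq_bigr => j jJ do rewrite -(boxsum_telescope B _ x uJ jJ).
rewrite -big_seq -boxsum_sum; apply: eq_boxsum => // y _ _.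
by rewrite pathsum_stokes.
Qed.

Definition incell x y := forall l, (x l <= y l <= (x l).+1)%N.

(** A nonzero value forces every factor to change between vertices of the same cell; in this way the
    combinatorial totals detect approximate common zeros. *)
Lemma pathsum_neq0 J fs x : uniq J -> pathsum J fs x != 0 -> forall f, List.In f fs ->
  exists y y', [/\ f y != f y', incell x y, incell x y' &
     forall l, l \notin J -> y l = x l /\ y' l = x l].
Proof.
elim: fs J x => [//|f fs IH] J x uJ /=.
move=> nz g gfs; have [j jJ] : exists2 j, j \in J &
    (f x + f (up x j)) * pathsum (del j J) fs (up x j) != 0.
  apply/hasP; apply: contraNT nz => /hasPn H; rewrite big_seq big1 // => j /H.
  by rewrite negbK => /eqP.
rewrite mulf_eq0 negb_or => /andP[fj nz'].
have upc : incell x (up x j).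
  by move=> l; rewrite /up /set_at; case: eqP => [->|]; rewrite ?leqnn ?leqnSn.
have xc : incell x x by move=> l; rewrite leqnn leqnSn.
case: gfs => [<-|gfs].
  exists x, (up x j); split => //.
    by apply: contraNneq fj => ->; rewrite addF2.
  by move=> l lJ; split => //; rewrite /up set_at_neq //; apply: contraNneq lJ => ->.
have [y [y' [gyy' yc yc' yJ]]] := IH _ _ (filter_uniq _ uJ) nz' g gfs.
have yj : y j = (x j).+1 /\ y' j = (x j).+1.
  have [] := yJ j; first by rewrite mem_filter eqxx.
  by rewrite /up set_atE.
have cell w : incell (up x j) w -> w j = (x j).+1 -> incell x w.
  move=> wc wj l; have [->|nlj] := eqVneq l j; first by rewrite wj leqnSn leqnn.
  by have := wc l; rewrite /up set_at_neq.
exists y, y'; split => //; try by apply: cell => //; case: yj.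
move=> l lJ; have nlj : l != j by apply: contraNneq lJ => ->.
have [] := yJ l; first by rewrite mem_filter negb_and lJ orbT.
by rewrite /up set_at_neq.
Qed.

Lemma incell_up x j y : incell (up x j) y -> y j = (x j).+1 -> incell x y.
Proof.
move=> wc wj l; have [->|nlj] := eqVneq l j; first by rewrite wj leqnSn leqnn.
by have := wc l; rewrite /up set_at_neq.
Qed.

Lemma incell_refl x : incell x x.
Proof. by move=> l; rewrite leqnn leqnSn. Qed.

Lemma incell_upx x j : incell x (up x j).
Proof. by move=> l; rewrite /up /set_at; case: eqP => [->|]; rewrite ?leqnn ?leqnSn. Qed.

Lemma eq_pathsum (I : eqType) (s : seq I) (g g' : I -> (nat -> nat) -> 'F_2) J x :
  (forall i y, i \in s -> incell x y -> (forall l, l \notin J -> y l = x l) -> g i y = g' i y) ->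
  pathsum J (map g s) x = pathsum J (map g' s) x.
Proof.
elim: s J x => [//|i s IH] J x gg' /=.
rewrite !big_seq; apply: eq_bigr => j jJ.
have upJ l : l \notin J -> up x j l = x l.
  by move=> lJ; rewrite /up set_at_neq //; apply: contraNneq lJ => ->.
rewrite !gg' ?mem_head //; [|exact: incell_upx|exact: incell_refl].
rewrite (IH (del j J)) // => i' y i's yc yx; apply: gg' => [||l lJ].
- by rewrite inE i's orbT.
- by apply: incell_up yc _; rewrite yx ?mem_filter ?eqxx // /up set_atE.
- by rewrite yx ?upJ // mem_filter negb_and lJ orbT.
Qed.

Lemma size_del j J : uniq J -> j \in J -> size J = (size (del j J)).+1.
Proof.
by move=> uJ jJ; rewrite /del -rem_filter // size_rem // prednK //; case: (J) jJ.
Qed.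

(** With as many factors as axes every edge path moves along every axis, and the step along [j]
    contributes zero. *)
Lemma pathsum_indep fs J x j : uniq J -> j \in J -> size fs = size J ->
  (forall f, List.In f fs -> forall y, f (up y j) = f y) -> pathsum J fs x = 0.
Proof.
elim: fs J x => [|f fs IH] J x uJ jJ sz fj; first by case: (J) jJ sz.
rewrite /= big_seq big1 // => l lJ; have [->|nlj] := eqVneq l j.
  by rewrite fj ?addF2 ?mul0r //; left.
rewrite IH ?mulr0 //; first exact: filter_uniq.
- by rewrite mem_filter eq_sym nlj.
- by apply: succn_inj; rewrite -size_del.
- by move=> f' f'fs; apply: fj; right.
Qed.

Lemma boxsum_set_at B J h x a v : a \notin J ->
  boxsum B J h (set_at x a v) = boxsum B J (fun y => h (set_at y a v)) x.
Proof.
elim: J x => [//|j J IH] x /=; rewrite inE negb_or => /andP[naj aJ].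
by apply: eq_bigr => i _; rewrite set_atC // IH.
Qed.

Lemma eq_boxsum_bound B B' J h x : {in J, B =1 B'} -> boxsum B J h x = boxsum B' J h x.
Proof.
elim: J x => [//|j J IH] x BB' /=; rewrite BB' ?mem_head //.
by apply: eq_bigr => i _; apply: IH => l lJ; rewrite BB' // inE lJ orbT.
Qed.

Lemma pathsum_comp (I : Type) (s : seq I) (g : I -> (nat -> nat) -> 'F_2) J x
    (tau : (nat -> nat) -> nat -> nat) :
  (forall y j, j \in J -> up (tau y) j = tau (up y j)) ->
  pathsum J (map g s) (tau x) = pathsum J (map (fun i y => g i (tau y)) s) x.
Proof.
elim: s J x => [//|i s IH] J x tauU /=.
rewrite !big_seq; apply: eq_bigr => j jJ; rewrite tauU // IH // => y l.
by rewrite mem_filter => /andP[_ lJ]; rewrite tauU.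
Qed.

Lemma pathsum_set_at (I : eqType) (s : seq I) (g : I -> (nat -> nat) -> 'F_2) J x a v :
  a \notin J -> {in s, forall i y, g i (set_at y a v) = g i y} ->
  pathsum J (map g s) (set_at x a v) = pathsum J (map g s) x.
Proof.
elim: s J x => [//|i s IH] J x aJ gs /=.
rewrite !big_seq; apply: eq_bigr => j jJ.
have naj : a != j by apply: contraNneq aJ => ->.
have -> : up (set_at x a v) j = set_at (up x j) a v.
  by rewrite /up set_at_neq 1?eq_sym // set_atC.
rewrite !gs ?mem_head // IH //; first by rewrite mem_filter negb_and aJ orbT.
by move=> i' i's y; rewrite gs // inE i's orbT.
Qed.

(** Each factor changes along its own axis only, so one edge path per cell survives and the total is
    a product of one-dimensional degrees. *)
Lemma pathsum_sep (I : eqType) (s : seq I) (r : I -> nat) (u : I -> nat -> 'F_2) B x :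
  uniq (map r s) ->
  boxsum B (map r s) (pathsum (map r s) [seq (fun y => u i (y (r i))) | i <- s]) x
  = \prod_(i <- s) (u i (B (r i)) + u i 0%N).
Proof.
elim: s x => [|i s IH] x; first by rewrite big_nil.
move=> /= /andP[iJ uJ]; rewrite big_cons.
pose W := pathsum (map r s) [seq (fun y => u i (y (r i))) | i <- s].
have Wset y v : W (set_at y (r i) v) = W y.
  apply: pathsum_set_at => // i' i's z; rewrite set_at_neq //.
  by apply: contraNneq iJ => <-; apply: map_f.
rewrite -(sum_telescope (fun l => u i l)) mulr_suml; apply: eq_big_nat => l lB.
rewrite -(IH (set_at x (r i) l) uJ).
transitivity (boxsum B (map r s) (fun y => (u i l.+1 + u i l) * W y) (set_at x (r i) l)).
  apply: eq_boxsum => // y yB yx; rewrite big_cons big_seq big1 ?addr0; last first.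
    move=> j jJ; rewrite [up y j (r i)]set_at_neq; first by rewrite addF2 mul0r.
    by apply: contraNneq iJ => ->.
  rewrite /= eqxx /= -/(del _ _) del_id // -/W {2}/up Wset.
  by rewrite /up set_atE yx // set_atE addrC.
rewrite -/W; elim: (map r s) (set_at x (r i) l) => [//|j J IHJ] y /=.
by rewrite mulr_sumr; apply: eq_bigr.
Qed.

End Cochains.

(** * Modulo 2 intersection theory for a planar map that turns once *)

Section Twist.
Variables (R : realType) (k : nat).
Notation pts := 'rV[R]_(k.+2).
Implicit Types (p : pts) (x : nat -> nat) (J : seq nat).

Definition upd p (i : nat) (v : R) : pts := \row_l (if l == inord i then v else p ord0 l).
Definition gp (M : nat) x : pts := \row_l ((x l)%:R / M%:R).
Definition box p := forall l, 0 <= p ord0 l <= 1.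
Definition strict_sign (g : pts -> R) p (d : R) :=
  (forall y, ball p d y -> 0 < g y) \/ (forall y, ball p d y -> g y < 0).

(** A Lebesgue number argument: at a uniform scale, one of the functions keeps its sign around each
    point. *)
Lemma small_cells (I : Type) (s : I -> Prop) (g : I -> pts -> R) (C : set pts) :
  compact C -> (forall i, s i -> continuous (g i)) ->
  (forall p, C p -> ~ (forall i, s i -> g i p = 0)) ->
  exists2 d : R, 0 < d & forall p, C p -> exists2 i, s i & strict_sign (g i) p d.
Proof.
move=> cC gc nz.
pose P d p := exists2 i, s i & strict_sign (g i) p d.
suff loc p : C p -> exists2 r, 0 < r & forall d y, 0 < d < r -> ball p r y -> P d y.
  have [d d0 H] := compact_scale cC loc.
  have d20 : 0 < d / 2 by rewrite divr_gt0.
  exists (d / 2) => // p Cp; apply: H => //.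
  by rewrite d20 ltr_pdivrMr // mulr_natr mulr2n ltrDl.
move=> Cp; have [i si gi0] : exists2 i, s i & g i p != 0.
  apply: contrapT => H; apply: (nz p Cp) => i si; apply: contrapT => /eqP gi; apply: H.
  by exists i.
have e0 : 0 < `|g i p| by rewrite normr_gt0.
have /cvgrPdist_lt /(_ _ e0) /nbhs_ballP[r /= r0 Hr] := gc i si p.
exists (r / 2); first by rewrite divr_gt0.
move=> d y /andP[d0 dr] py; exists i => //.
have near z : ball y d z -> `|g i p - g i z| < `|g i p|.
  move=> yz; apply: Hr; rewrite [r]splitr; apply: ball_triangle py _.
  by apply: le_ball yz; exact: ltW.
have [gp0|gn0|] := ltgtP (g i p) 0; last by move/eqP; rewrite (negbTE gi0).
  right=> z /near; rewrite ltr_norml (ltr0_norm gp0) => /andP[]; lra.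
by left=> z /near; rewrite ltr_norml (gtr0_norm gn0) => /andP[]; lra.
Qed.

Lemma box_compact (i : nat) (v : R) : compact [set p | box (upd p i 0) /\ p ord0 (inord i) = v].
Proof.
pose A (l : 'I_(k.+2)) : set R := if l == inord i then [set v] else `[0, 1]%classic.
have -> : [set p | box (upd p i 0) /\ p ord0 (inord i) = v] =
   [set p : pts | forall l, A l (p ord0 l)].
  apply/seteqP; split => p /=.
    move=> [bp pv] l; rewrite /A; case: eqP => [->//|/eqP ne].
    by have := bp l; rewrite mxE (negbTE ne) /= in_itv.
  move=> pA; split; last by have := pA (inord i); rewrite /A eqxx.
  move=> l; rewrite mxE; have := pA l; rewrite /A; case: eqP => [_ _|_].
    by rewrite lexx ler01.
  by rewrite /= in_itv.
apply: rV_compact => l; rewrite /A; case: eqP => _; [exact: compact_set1|exact: segment_compact].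
Qed.

Lemma box_compactT : compact [set p | box p].
Proof.
have := @rV_compact R (k.+2) (fun _ => `[0, 1]%classic) (fun _ => @segment_compact _ 0 1).
congr compact; apply/seteqP; split => p /= H l; have := H l; by rewrite in_itv.
Qed.

Lemma finite_scale (n : nat) (Q : nat -> R -> Prop) :
  (forall i d e, 0 < e <= d -> Q i d -> Q i e) ->
  (forall i, (i < n)%N -> exists2 d : R, 0 < d & Q i d) ->
  exists2 d : R, 0 < d & forall i, (i < n)%N -> Q i d.
Proof.
move=> mono; elim: n => [|n IH] H; first by exists 1.
have [d d0 Hd] := IH (fun i h => H i (ltnW h)).
have [e e0 He] := H n (ltnSn n).
have m0 : 0 < Num.min d e by rewrite lt_min d0 e0.
exists (Num.min d e) => // i; rewrite ltnS leq_eqVlt => /orP[/eqP ->|ilt].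
  by apply: mono He; rewrite m0 ge_min lexx orbT.
by apply: mono (Hd _ ilt); rewrite m0 ge_min lexx.
Qed.

Lemma strict_sign_mono g p d e : e <= d -> strict_sign g p d -> strict_sign g p e.
Proof.
by move=> ed [H|H]; [left|right] => y pe; apply: H; apply: le_ball pe.
Qed.

Lemma gp_set M x i v : (i < k.+2)%N -> gp M (set_at x i v) = upd (gp M x) i (v%:R / M%:R).
Proof.
move=> ik; apply/rowP => l; rewrite !mxE /set_at.
by rewrite -[l == inord i]val_eqE /= inordK //; case: eqP.
Qed.

Lemma gpE M x i : (i < k.+2)%N -> gp M x ord0 (inord i) = (x i)%:R / M%:R.
Proof. by move=> ik; rewrite mxE inordK. Qed.

Lemma gp_dist M x y : (0 < M)%N -> incell x y -> `|gp M x - gp M y| <= M%:R^-1.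
Proof.
move=> M0 c; have i0 : 0 <= M%:R^-1 :> R by rewrite invr_ge0 ler0n.
apply/(mx_norm_leP _ i0) => i l; rewrite !mxE -mulrBl normrM [X in _ * X]ger0_norm //.
rewrite ler_piMl // distrC; have /andP[h1 h2] := c l.
rewrite -natrB // normr_nat -[1]/(1%:R) ler_nat leq_subLR addn1 //.
Qed.

(** The bit is left free where [g] vanishes, which permits a tie-break at zeros. *)
Definition compat (M : nat) (b : (nat -> nat) -> 'F_2) (g : pts -> R) :=
  forall y, (0 < g (gp M y) -> b y = 1) /\ (g (gp M y) < 0 -> b y = 0).

Definition bit (M : nat) (g : pts -> R) : (nat -> nat) -> 'F_2 :=
  fun y => (0 < g (gp M y))%R%:R.

Lemma compat_bit M g : compat M (bit M g) g.
Proof.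
move=> y; rewrite /bit; split=> [->//|]; by rewrite ltNge le_eqVlt negb_or => /andP[_ /negbTE ->].
Qed.

(** A factor whose sign is constant on the cell has a constant bit there, and its coboundary kills
    the product. The factor 2 counts one mesh size from [p] to the corner and one across the
    cell. *)
Lemma sign_pathsum M J bs x b g p d : (0 < M)%N -> uniq J ->
  pathsum J bs x != 0 -> List.In b bs -> compat M b g ->
  `|p - gp M x| <= M%:R^-1 -> 2 * M%:R^-1 < d -> ~ strict_sign g p d.
Proof.
move=> M0 uJ nz bbs cb px Md.
have [y [y' [bne yc yc' _]]] := pathsum_neq0 uJ nz bbs.
have inb z : incell x z -> ball p d (gp M z).
  move=> zc; rewrite -ball_normE /ball_ /=; apply: le_lt_trans Md.
  rewrite -(subrK (gp M x) p) -addrA (le_trans (ler_normD _ _)) //.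
  by rewrite mulr_natl mulr2n lerD // gp_dist.
case=> H; move: bne; have [[h1 h2] [h1' h2']] := (cb y, cb y').
  by rewrite h1 ?h1' ?eqxx //; apply: H; apply: inb.
by rewrite h2 ?h2' ?eqxx //; apply: H; apply: inb.
Qed.

Lemma box_gp M x : (0 < M)%N -> (forall l, (l < k.+2)%N -> (x l <= M)%N) -> box (gp M x).
Proof.
move=> M0 xM l; rewrite mxE divr_ge0 ?ler0n //= ler_pdivrMr ?ltr0n // mul1r ler_nat.
exact: xM.
Qed.

Lemma In_map (f : nat -> (nat -> nat) -> 'F_2) (s : seq nat) i :
  i \in s -> List.In (f i) (map f s).
Proof.
elim: s => [//|j s IH]; rewrite inE => /orP[/eqP ->|/IH h]; [by left|by right].
Qed.

(** Coordinate 0 is the homotopy parameter, coordinate 1 the loop parameter, and the others fill the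
    box. The product of the coboundaries of the bits of [G1], [G2] and the [F i] has total zero,
    since no cell carries sign changes of all of them. By Stokes this total is the contribution of
    the side where coordinate 0 vanishes. There the antipodal symmetry of the planar map reduces it
    to the parity of the common zeros of the [F i] at the base point, and the homotopy [E] shows
    that this parity is odd. *)
Theorem no_twist (G1 G2 : pts -> R) (F E : nat -> pts -> R) (e : nat -> R -> R) :
  continuous G1 -> continuous G2 -> (forall i, continuous (F i)) ->
  (forall i, continuous (E i)) ->
  (forall p, box p -> (forall i, (i < k)%N -> F i p = 0) -> G1 p = 0 -> G2 p = 0 -> False) ->
  (forall p i, box p -> (i < k)%N -> p ord0 (inord i.+2) = 0 \/ p ord0 (inord i.+2) = 1 ->
     ~ (forall j, (j < k)%N -> F j p = 0)) ->
  (forall p, [/\ forall i, F i (upd p 1 0) = F i (upd p 1 1),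
     G1 (upd p 1 0) = G1 (upd p 1 1) & G2 (upd p 1 0) = G2 (upd p 1 1)]) ->
  (forall p (t : R), p ord0 (inord 0) = 1 -> 0 <= t <= 1 ->
     [/\ forall i, F i (upd p 1 t) = F i (upd p 1 0),
       G1 (upd p 1 t) = G1 (upd p 1 0) & G2 (upd p 1 t) = G2 (upd p 1 0)]) ->
  (forall p (t : R) i, p ord0 (inord 0) = 0 -> 0 <= t <= 1 -> F i (upd p 1 t) = F i (upd p 1 0)) ->
  (forall p (t : R), p ord0 (inord 0) = 0 -> 0 <= t <= 4^-1 ->
     G1 (upd p 1 (t + 4^-1)) = - G1 (upd p 1 t) /\ G2 (upd p 1 (t + 4^-1)) = - G2 (upd p 1 t)) ->
  (forall p (t : R), p ord0 (inord 0) = 0 -> 2^-1 <= t <= 1 ->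
     G1 (upd p 1 t) = G1 (upd p 1 0) /\ G2 (upd p 1 t) = G2 (upd p 1 0)) ->
  (forall p i, box p -> (i < k)%N -> p ord0 (inord i.+2) = 0 \/ p ord0 (inord i.+2) = 1 ->
     ~ (forall j, (j < k)%N -> E j p = 0)) ->
  (forall p i, E i (upd p 1 1) = F i (upd (upd p 0 0) 1 0)) ->
  (forall p i, (i < k)%N -> E i (upd p 1 0) = e i (p ord0 (inord i.+2))) ->
  (forall i, e i 0 < 0 < e i 1) -> False.
Proof.
move=> cG1 cG2 cF cE h1 h2 h3 h4 h5F h5a h5b hE hE1 hE0 he.
pose gall i := match i with 0 => G1 | 1 => G2 | i.+2 => F i end.
have [d1 d10 S1] : exists2 d : R, 0 < d & forall p, box p ->
    exists2 i, (i < k.+2)%N & strict_sign (gall i) p d.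
  apply: (@small_cells nat (fun i => is_true (i < k.+2)%N) gall [set p | box p] box_compactT).
    by case=> [|[|i]] _ /=; [exact: cG1|exact: cG2|exact: cF].
  move=> p bp H; apply: (h1 p) => //; [|exact: (H 0%N)|exact: (H 1%N)].
  by move=> i ik; apply: (H i.+2).
have face (H : nat -> pts -> R) : (forall i, continuous (H i)) ->
    (forall p i, box p -> (i < k)%N -> p ord0 (inord i.+2) = 0 \/ p ord0 (inord i.+2) = 1 ->
     ~ (forall j, (j < k)%N -> H j p = 0)) ->
    exists2 d : R, 0 < d & forall i, (i < k)%N -> forall p, box p ->
      p ord0 (inord i.+2) = 0 \/ p ord0 (inord i.+2) = 1 ->
      exists2 j, (j < k)%N & strict_sign (H j) p d.
  move=> cH hH; apply: finite_scale => [i d e' /andP[_ ed] Hd p bp pi|i ik].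
    by have [j jk /(strict_sign_mono ed) sj] := Hd p bp pi; exists j.
  have one v : v = 0 \/ v = 1 -> exists2 d : R, 0 < d & forall p, box p ->
      p ord0 (inord i.+2) = v -> exists2 j, (j < k)%N & strict_sign (H j) p d.
    move=> v01.
    have bv p : box p -> p ord0 (inord i.+2) = v ->
      [set p | box (upd p i.+2 0) /\ p ord0 (inord i.+2) = v] p.
      move=> bp pv; split => // l; rewrite mxE; case: eqP => // _; by rewrite lexx ler01.
    have vb p : [set p | box (upd p i.+2 0) /\ p ord0 (inord i.+2) = v] p -> box p.
      move=> [bp pv] l; have := bp l; rewrite mxE; case: eqP => [-> _|//].
      by rewrite pv; case: v01 => ->; rewrite ?lexx ?ler01.
    have [||d d0 Hd] := @small_cells nat (fun i => is_true (i < k)%N) H _ (@box_compact i.+2 v).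
    - by move=> j _; exact: cH.
    - by move=> p pv; apply: (hH p i) => //; [exact: vb|case: pv => _ ->; case: v01; auto].
    by exists d => // p bp pv; apply: Hd; exact: bv.
  have [d d0 Hd] := one 0 (or_introl erefl); have [d' d'0 Hd'] := one 1 (or_intror erefl).
  exists (Num.min d d'); first by rewrite lt_min d0 d'0.
  move=> p bp [] pv; [have [j jk sj] := Hd p bp pv|have [j jk sj] := Hd' p bp pv];
    exists j => //; apply: strict_sign_mono sj; by rewrite ge_min lexx ?orbT.
have [d2 d20 S2] := face F cF h2; have [d3 d30 S3] := face E cE hE.
pose d := Num.min d1 (Num.min d2 d3).
have d0 : 0 < d by rewrite !lt_min d10 d20 d30.
have [M' M'0 M'd] : exists2 M', (0 < M')%N & 2 * (4 * M')%N%:R^-1 < d.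
  exists (Num.truncn (d^-1)).+1 => //; rewrite natrM invfM.
  have : (d^-1 < (Num.truncn d^-1).+1%:R) by rewrite truncnS_gt.
  move: (_.+1%:R) => m dm; have m0 : 0 < m by apply: lt_trans dm; rewrite invr_gt0.
  rewrite -ltf_pV2 ?posrE ?invr_gt0 // invrK in dm.
  have mi0 : 0 < m^-1 by rewrite invr_gt0.
  by move: dm mi0; lra.
(* The number of grid steps is a multiple of 4, so the shift of the loop parameter by 1/4 maps grid
   points to grid points. *)
set M := (4 * M')%N in M'd.
have M0 : (0 < M)%N by rewrite /M; lia.
have MR0 : 0 < M%:R :> R by rewrite ltr0n.
have Md1 : 2 * M%:R^-1 < d1 by apply: lt_le_trans M'd _; rewrite ge_min lexx.
have Md2 : 2 * M%:R^-1 < d2 by apply: lt_le_trans M'd _; rewrite !ge_min lexx orbT.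
have Md3 : 2 * M%:R^-1 < d3 by apply: lt_le_trans M'd _; rewrite !ge_min lexx !orbT.
pose B := fun _ : nat => M.
pose Q := iota 2 k; pose T := 1%N :: Q; pose A := 0%N :: T.
have uQ : uniq Q by exact: iota_uniq.
have n1Q : 1%N \notin Q by rewrite mem_iota.
have n0Q : 0%N \notin Q by rewrite mem_iota.
have uT : uniq T by rewrite /= n1Q.
have uA : uniq A by rewrite /= inE /= n0Q n1Q.
pose bF i := bit M (F i); pose fs := map bF (iota 0 k).
pose b1 := bit M G1.
(* Ties [G2 p = 0] are broken by the sign of [G1]. This bit then flips under the antipodal map at
   every grid point where the planar map is nonzero. *)
pose Uf p := (0 < G2 p) || ((G2 p == 0) && (0 < G1 p)).
pose U y : 'F_2 := (Uf (gp M y))%:R.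
have cU : compat M U G2.
  move=> y; rewrite /U /Uf; split=> [->//|h].
  by rewrite ltNge (ltW h) /= lt_eqF.
have cell0 x : `|gp M x - gp M x| <= M%:R^-1 by rewrite subrr normr0 invr_ge0 ler0n.
have inF i : (i < k)%N -> List.In (bF i) fs by move=> ik; apply: In_map; rewrite mem_iota.
have gridB (J : seq nat) (y : nat -> nat) : {in J, forall j, (y j < B j)%N} ->
    (forall l, (l < k.+2)%N -> l \notin J -> (y l <= M)%N) -> box (gp M y).
  move=> yJ yn; apply: box_gp => // l lk.
  by case: (boolP (l \in J)) => [/yJ/ltnW//|/yn]; apply.
have allA l : (l < k.+2)%N -> l \in A by rewrite !inE mem_iota; case: l => [|[|l]].
have nzG p J x : box p -> `|p - gp M x| <= M%:R^-1 -> uniq J ->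
    pathsum J fs x != 0 -> ~ (G1 p = 0 /\ G2 p = 0).
  move=> bp px uJ nz [g1 g2]; have [i ik si] := S1 p bp.
  have bpp : ball p d1 p by exact: ballxx.
  case: i ik si => [|[|i]] ik /= si.
  - by case: si => /(_ _ bpp); rewrite g1 ltxx.
  - by case: si => /(_ _ bpp); rewrite g2 ltxx.
  - by apply: (sign_pathsum M0 uJ nz (inF i ik) (compat_bit M (F i)) px Md1 si).
have sgG1 p J x : box p -> `|p - gp M x| <= M%:R^-1 -> uniq J ->
    pathsum J (U :: fs) x != 0 -> strict_sign G1 p d1.
  move=> bp px uJ nz; have [i ik si] := S1 p bp.
  case: i ik si => [//|[|i]] ik /= si; exfalso.
  - exact: (sign_pathsum M0 uJ nz (or_introl erefl) cU px Md1 si).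
  - exact: (sign_pathsum M0 uJ nz (or_intror (inF i ik)) (compat_bit M (F i)) px Md1 si).
pose x0 := fun _ : nat => 0%N.
(* On every cell one of the functions keeps its sign, so each summand vanishes. *)
have tot0 : boxsum B A (pathsum A [:: b1, U & fs]) x0 = 0.
  apply: boxsum0 => // y yB _; apply/eqP; apply: contraT => nz.
  have bp : box (gp M y).
    by apply: (gridB A) => // l /allA ->.
  have [i ik si] := S1 _ bp; exfalso.
  case: i ik si => [|[|i]] ik /= si.
  - exact: (sign_pathsum M0 uA nz (or_introl erefl) (compat_bit M G1) (cell0 _) Md1 si).
  - exact: (sign_pathsum M0 uA nz (or_intror (or_introl erefl)) cU (cell0 _) Md1 si).
  - exact: (sign_pathsum M0 uA nz (or_intror (or_intror (inF i ik))) (compat_bit M (F i)) (cell0 _) Md1 si).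
have face0 (H : nat -> pts -> R) d' (J : seq nat) bs y j :
    (forall i, (i < k)%N -> forall p, box p ->
      p ord0 (inord i.+2) = 0 \/ p ord0 (inord i.+2) = 1 ->
      exists2 j, (j < k)%N & strict_sign (H j) p d') -> 2 * M%:R^-1 < d' ->
    uniq J -> j \in Q -> y j = 0%N \/ y j = M -> box (gp M y) ->
    (forall i, (i < k)%N -> List.In (bit M (H i)) bs) -> pathsum J bs y = 0.
  move=> S Md uJ; rewrite mem_iota => /andP[j2 jk] yj bp inb.
  apply/eqP; apply: contraT => nz; exfalso.
  have ij : (j - 2 < k)%N by rewrite ltn_subLR.
  have [|i ik si] := S (j - 2)%N ij _ bp.
    have -> : (j - 2).+2 = j by rewrite -addn2 subnK.
    rewrite gpE; last exact: jk.
    by case: yj => ->; [left; rewrite mul0r|right; rewrite divff // gt_eqF].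
  exact: (sign_pathsum M0 uJ nz (inb i ik) (compat_bit M (H i)) (cell0 _) Md si).
have dT : del 0 A = T.
  by rewrite /del /= -/(del 0 Q) del_id.
have dQ : del 1 T = Q by rewrite /del /= -/(del 1 Q) del_id.
have d1A : del 1 A = 0%N :: Q by rewrite /del /= -/(del 1 Q) del_id.
have boxT J (y : nat -> nat) : {subset Q <= J} -> {in J, forall j, (y j < M)%N} ->
   (y 0%N <= M)%N -> (y 1%N <= M)%N -> box (gp M y).
  move=> QJ yJ y0 y1; apply: box_gp => // l lk; case: l lk => [|[|l]] // lk.
  by apply/ltnW/yJ/QJ; rewrite mem_iota.
pose tm (y : nat -> nat) : R := (y 1%N)%:R / M%:R.
have t_range (y : nat -> nat) : (y 1 <= M)%N -> 0 <= tm y <= 1.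
  by move=> yM; rewrite /tm divr_ge0 ?ler0n //= ler_pdivrMr // mul1r ler_nat.
have gp1 y : gp M y = upd (gp M y) 1 (tm y).
  by apply/rowP => l; rewrite !mxE; case: eqP => // ->; rewrite inordK.
have gp10 y : gp M (set_at y 1 0) = upd (gp M y) 1 0.
  by rewrite gp_set // mul0r.
(* Bits that ignore the loop parameter cannot change along its axis, which kills the product in top
   degree. *)
have noT (g : nat -> (nat -> nat) -> 'F_2) (s : seq nat) y : size s = size T ->
   (forall i z, incell y z -> z 0%N = y 0%N -> g i z = g i (set_at z 1 0)) ->
   pathsum T (map g s) y = 0.
  move=> sz gz; rewrite (@eq_pathsum _ s g (fun i z => g i (set_at z 1 0))).
    apply: (@pathsum_indep _ _ _ 1%N) => //; first by rewrite size_map.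
    move=> f /List.in_map_iff [i [<- _]] z; by rewrite /up set_at_set.
  by move=> i z _ zc zy; apply: gz => //; apply: zy; rewrite inE.
pose gU i := if i is i'.+1 then bF i' else U.
have fsE : U :: fs = map gU (iota 0 k.+1).
  rewrite /= (_ : iota 1 k = map (addn 1) (iota 0 k)); last by rewrite -iotaDl.
  by rewrite -map_comp; congr (_ :: _); apply: eq_map.
have bF_eq i z z' : F i (gp M z) = F i (gp M z') -> bF i z = bF i z'.
  by rewrite /bF /bit => ->.
have gU_eq z z' : (forall i, F i (gp M z) = F i (gp M z')) ->
    G1 (gp M z) = G1 (gp M z') -> G2 (gp M z) = G2 (gp M z') -> forall i, gU i z = gU i z'.
  by move=> Fz g1 g2 [|i] /=; [rewrite /U /Uf g1 g2|apply: bF_eq].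
have cell1 (y z : nat -> nat) : incell y z -> (y 1 < M)%N -> (z 1 <= M)%N.
  by move=> yz y1; have /andP[_ h] := yz 1%N; apply: leq_trans h y1.
have topS : boxsum B T (fun y => b1 y * pathsum T (U :: fs) y) (set_at x0 0 M) = 0.
  apply: boxsum0 => // y yB yx; rewrite fsE noT ?mulr0 // ?size_iota //=.
    by rewrite size_iota.
  move=> i z zc z0.
  have z1 : (z 1 <= M)%N by apply: (cell1 y) => //; apply: yB; rewrite inE.
  have p0 : gp M z ord0 (inord 0) = 1.
    by rewrite gpE // z0 yx ?set_atE ?divff ?gt_eqF // inE mem_iota.
  have [hF hG1 hG2] := h4 _ _ p0 (t_range z z1).
  by rewrite -gp1 -gp10 in hF hG1 hG2; apply: gU_eq.
have tfaces : boxsum B (0%N :: Q) (fun y => b1 y * pathsum (0%N :: Q) (U :: fs) y) (set_at x0 1 M)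
  = boxsum B (0%N :: Q) (fun y => b1 y * pathsum (0%N :: Q) (U :: fs) y) (set_at x0 1 0).
  have n1 : 1%N \notin 0%N :: Q by rewrite inE.
  rewrite !boxsum_set_at //; apply: eq_boxsum => [|y _ _]; first by rewrite /= n0Q.
  have gM z : gp M (set_at z 1 M) = upd (gp M z) 1 1 by rewrite gp_set // divff // gt_eqF.
  have upT v : forall z j, j \in 0%N :: Q -> up (set_at z 1 v) j = set_at (up z j) 1 v.
    move=> z j jQ; have nj : j != 1%N by apply: contraNneq n1 => <-.
    by rewrite /up set_at_neq // set_atC // eq_sym.
  congr (_ * _).
    by rewrite /b1 /bit gM gp10; have [_ -> _] := h3 (gp M y).
  rewrite fsE (@pathsum_comp _ _ gU _ _ _ (upT M)) (@pathsum_comp _ _ gU _ _ _ (upT 0%N)).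
  apply: eq_pathsum => i z _ _ _; apply: gU_eq; rewrite gM gp10;
    by have [hF hG1 hG2] := h3 (gp M z).
have Qfaces j v : j \in Q -> v = 0%N \/ v = M ->
    boxsum B (del j A) (fun y => b1 y * pathsum (del j A) (U :: fs) y) (set_at x0 j v) = 0.
  move=> jQ v0; have uj : uniq (del j A) by exact: filter_uniq.
  apply: boxsum0 => // y yB yx.
  have yj : y j = v by rewrite yx ?set_atE // mem_filter eqxx.
  rewrite (face0 F d2 (del j A) _ y j) ?mulr0 //; first by rewrite yj.
  - apply: (gridB (del j A)) => // l lk; rewrite mem_filter allA // andbT negbK => /eqP ->.
    by rewrite yj; case: v0 => ->.
  - by move=> i ik; right; apply: inF.
(* The contribution of the face where the homotopy parameter is 0. All other faces vanish or cancel,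
   hence [W = 0]; the remaining proof computes [W = 1]. *)
pose W := boxsum B T (fun y => b1 y * pathsum T (U :: fs) y) (set_at x0 0 0).
have W0 : W = 0.
  have := tot0; rewrite boxsum_stokes // !big_cons dT topS add0r d1A tfaces addF2 add0r.
  rewrite big_seq big1 ?addr0 // => j jQ.
  by rewrite !Qfaces ?addr0 //; [left|right].
suff W1 : W = 1 by move: W0; rewrite W1 => /eqP; rewrite oner_eq0.
pose x1 := set_at x0 0 0.
pose h y := b1 y * pathsum T (U :: fs) y.
pose c i := boxsum B Q h (set_at x1 1 i).
have WE : W = \sum_(0 <= i < M) c i by [].
(* In the second half of the loop nothing depends on the loop parameter. *)
have c_late i : (2 * M' <= i < M)%N -> c i = 0.
  move=> /andP[i1 i2]; apply: boxsum0 => // y yB yx; rewrite /h fsE noT ?mulr0 //.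
    by rewrite size_iota /= size_iota.
  have y0 : y 0%N = 0%N by rewrite yx.
  have y1 : y 1%N = i by rewrite yx // set_atE.
  move=> l z zc z0.
  have /andP[zy zy'] := zc 1%N; rewrite y1 in zy zy'.
  have z1 : (z 1 <= M)%N by apply: leq_trans zy' i2.
  have p0 : gp M z ord0 (inord 0) = 0 by rewrite gpE // z0 y0 mul0r.
  have tr : 2^-1 <= tm z <= 1.
    have /andP[_ ->] := t_range z z1; rewrite andbT /tm ler_pdivlMr //.
    by rewrite mulrC ler_pdivrMr // -natrM ler_nat; clear -zy i1; rewrite /M; lia.
  have hF j := h5F _ _ j p0 (t_range z z1); have [hG1 hG2] := h5b _ _ p0 tr.
  by rewrite -gp1 -gp10 in hF hG1 hG2; apply: gU_eq.
(* A shift by a quarter of the parameter interval, which is a half turn of the planar map. *)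
pose tau (y : nat -> nat) := set_at y 1 (y 1 + M')%N.
have tauU (y : nat -> nat) j : up (tau y) j = tau (up y j).
  rewrite /tau /up; have [->|nj] := eqVneq j 1%N; first by rewrite !set_atE !set_at_set addSn.
  by rewrite set_at_neq // [in RHS]set_at_neq 1?eq_sym // set_atC // eq_sym.
have forced J y : (0%N \notin J) -> y 0%N = 0%N -> (y 1 < M)%N ->
    pathsum J fs y = pathsum J [seq (fun z => bF i (set_at z 1 0)) | i <- iota 0 k] y.
  move=> nJ y0 y1; apply: eq_pathsum => i z _ zc zJ; apply: bF_eq.
  rewrite gp10 [in LHS]gp1; apply: h5F; last by apply: t_range; apply: cell1 zc y1.
  by rewrite gpE // zJ // y0 mul0r.
have tauP J y : (0%N \notin J) -> y 0%N = 0%N -> (y 1 <= M')%N ->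
    pathsum J fs (tau y) = pathsum J fs y.
  move=> nJ y0 y1; rewrite !forced //; first last.
  - by rewrite /tau set_atE; clear -y1 M'0; rewrite /M; lia.
  - by clear -y1 M'0; rewrite /M; lia.
  rewrite pathsum_comp => [|z j _]; last exact: tauU.
  by apply: eq_pathsum => i z _ _ _; rewrite /tau set_at_set.
have gp_tau (z : nat -> nat) : gp M (tau z) = upd (gp M z) 1 (tm z + 4^-1).
  rewrite gp_set // natrD mulrDl; congr (upd _ _ (_ + _)).
  by rewrite /M natrM invfM mulrCA divff ?mulr1 // pnatr_eq0 -lt0n.
have flipG (z : nat -> nat) : z 0%N = 0%N -> (z 1 <= M')%N ->
    G1 (gp M (tau z)) = - G1 (gp M z) /\ G2 (gp M (tau z)) = - G2 (gp M z).
  move=> z0 z1; have p0 : gp M z ord0 (inord 0) = 0 by rewrite gpE // z0 mul0r.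
  have tr : 0 <= tm z <= 4^-1.
    rewrite /tm divr_ge0 ?ler0n //= ler_pdivrMr // mulrC ler_pdivlMr // -natrM ler_nat.
    by clear -z1; rewrite /M; lia.
  by have [g1 g2] := h5a _ _ p0 tr; rewrite -gp1 in g1 g2; rewrite gp_tau g1 g2.
have flipU (z : nat -> nat) : z 0%N = 0%N -> (z 1 <= M')%N ->
    ~ (G1 (gp M z) = 0 /\ G2 (gp M z) = 0) -> U (tau z) = U z + 1.
  move=> z0 z1 nz; have [g1 g2] := flipG z z0 z1; rewrite /U /Uf g1 g2.
  rewrite !oppr_gt0 oppr_eq0; have [h2'|h2'|h2'] /= := ltgtP (G2 (gp M z)) 0.
  - by rewrite add0r.
  - by rewrite addF2.
  - have [h1'|h1'|h1'] := ltgtP (G1 (gp M z)) 0; rewrite ?add0r ?addF2 //.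
    by case: nz.
have tauT (w : nat -> nat) : w 0%N = 0%N -> (w 1 < M')%N -> box (gp M w) ->
    (forall j, j \in T -> box (gp M (up w j))) ->
    pathsum T (U :: fs) (tau w) = pathsum T (U :: fs) w.
  move=> w0 w1 bw bu; rewrite /= -/Q -/T !big_seq; apply: eq_bigr => j jT; rewrite tauU.
  have nj0 : 0%N != j by move: jT; rewrite inE mem_iota; case: (j).
  have uw0 : up w j 0%N = 0%N by rewrite /up set_at_neq.
  have uw1 : (up w j 1 <= M')%N.
    by rewrite /up /set_at; case: eqP => [<-//|_]; apply: ltnW.
  have nT : 0%N \notin del j T by rewrite mem_filter inE negb_and mem_iota orbT.
  rewrite tauP //; have [->|nz] := eqVneq (pathsum (del j T) fs (up w j)) 0.
    by rewrite !mulr0.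
  have uD : uniq (del j T) by exact: filter_uniq.
  have fw : U (tau w) = U w + 1.
    apply: flipU => //; first exact: ltnW.
    by apply: nzG nz => //; apply: gp_dist => //; exact: incell_upx.
  have fu : U (tau (up w j)) = U (up w j) + 1.
    by apply: flipU => //; apply: nzG nz => //; exact: bu.
  by rewrite fw fu; congr (_ * _); rewrite addrACA addF2 addr0.
(* Where the remaining product is nonzero, [G1] has a strict sign and its bit takes opposite values
   at [w] and [tau w], while the product is the same. Adding both contributions removes the bit of
   [G1]. *)
have c_half i : (i < M')%N ->
    c (i + M')%N + c i = boxsum B Q (pathsum T (U :: fs)) (set_at x1 1 i).
  move=> iM; rewrite /c !(@boxsum_set_at _ _ _ x1) // -boxsumD; apply: eq_boxsum => // y yB yx.
  have y0 : y 0%N = 0%N by rewrite yx.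
  cbv beta; set w := set_at y 1 i; have -> : set_at y 1 (i + M')%N = tau w by rewrite /tau /w set_atE set_at_set.
  have w0 : w 0%N = 0%N by [].
  have w1 : w 1%N = i by rewrite /w set_atE.
  have wQ : {in Q, forall j, (w j < M)%N}.
    move=> j jQ; rewrite /w set_at_neq; first exact: yB.
    by apply: contraNneq n1Q => <-.
  have iM4 : (i < M)%N by clear -iM; rewrite /M; lia.
  have bw : box (gp M w) by apply: (boxT Q w (fun _ H => H) wQ); rewrite ?w0 ?w1 // ltnW.
  have bu j : j \in T -> box (gp M (up w j)).
    move=> jT; apply: box_gp => // l lk; rewrite /up /set_at; case: eqP => [_|_].
      by move: jT; rewrite inE => /orP[/eqP ->|/wQ//]; rewrite w1.
    case: l lk => [|[|l]] lk; first by rewrite w0.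
      by rewrite w1; exact: ltnW.
    by apply/ltnW/wQ; rewrite mem_iota.
  rewrite /h tauT // ?w1 //; set P := pathsum _ _ w.
  have [->|nz] := eqVneq P 0; first by rewrite !mulr0 addr0.
  suff -> : b1 (tau w) = b1 w + 1 by rewrite -mulrDl addrAC addF2 add0r mul1r.
  have sg := sgG1 _ _ _ bw (cell0 w) uT nz.
  have wM : (w 1 <= M')%N by rewrite w1 ltnW.
  have [g1 _] := flipG w w0 wM; rewrite /b1 /bit g1 oppr_gt0.
  case: sg => /(_ _ (ballxx _ d10)) sg.
    by rewrite sg ltNge (ltW sg) addF2.
  by rewrite sg ltNge (ltW sg) add0r.
pose B' l := if l == 1%N then M' else M.
have BB' : {in Q, B =1 B'}.
  by move=> l lQ; rewrite /B' ifN //; apply: contraNneq n1Q => <-.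
have W' : W = boxsum B' T (pathsum T (U :: fs)) x1.
  rewrite WE (@big_cat_nat _ _ _ (2 * M')%N) //=; last by clear; rewrite /M; lia.
  rewrite [X in _ + X]big_nat_cond [X in _ + X]big1 ?addr0; last first.
    by move=> i; rewrite andbT; exact: c_late.
  rewrite (@big_cat_nat _ _ _ M') //=; last by clear; lia.
  rewrite -{2}[M']add0n big_addn (_ : 2 * M' - M' = M')%N; last by clear; lia.
  rewrite -big_split /=; apply: eq_big_nat => i /andP[_ iM].
  by rewrite addrC c_half //; apply: eq_boxsum_bound.
have zeroQ (b : (nat -> nat) -> 'F_2) (bs : seq ((nat -> nat) -> 'F_2))
    (H : nat -> pts -> R) d' BB j v y :
    (forall i, (i < k)%N -> forall p, box p ->
      p ord0 (inord i.+2) = 0 \/ p ord0 (inord i.+2) = 1 ->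
      exists2 j, (j < k)%N & strict_sign (H j) p d') -> 2 * M%:R^-1 < d' ->
    (forall i, (i < k)%N -> List.In (bit M (H i)) bs) ->
    (forall l, (BB l <= M)%N) -> y 0%N = 0%N -> (y 1 <= M)%N ->
    j \in Q -> v = 0%N \/ v = M ->
    boxsum BB (del j T) (fun y => b y * pathsum (del j T) bs y) (set_at y j v) = 0.
  move=> S Md inb BM y0 y1 jQ v0; have uj : uniq (del j T) by exact: filter_uniq.
  apply: boxsum0 => // z zB zx.
  have zj : z j = v by rewrite zx ?set_atE // mem_filter eqxx.
  rewrite (face0 H d' (del j T) _ z j) ?mulr0 //; first by rewrite zj.
  apply: box_gp => // l lk; have [->|nlj] := eqVneq l j; first by rewrite zj; case: v0 => ->.
  case: l nlj lk => [|l] nlj lk.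
    by rewrite zx ?set_at_neq ?y0 // mem_filter inE mem_iota andbF.
  apply: ltnW; apply: leq_trans (BM l.+1); apply: zB; rewrite mem_filter nlj /= inE mem_iota.
  by case: (l) lk.
have del1E : del 1 T = Q := dQ.
(* Second use of Stokes, now on the first quarter of the loop. *)
rewrite W' boxsum_stokes // big_cons del1E [X in _ + X]big_seq [X in _ + X]big1 ?addr0; last first.
  move=> j jQ; have BM l : (B' l <= M)%N by rewrite /B'; case: ifP => // _; clear; rewrite /M; lia.
  have nj : j != 1%N by apply: contraNneq n1Q => <-.
  have Bj : B' j = M by rewrite /B' (negbTE nj).
  by rewrite !(zeroQ U fs F d2) ?addr0 //; [left|right].
(* The bit [U] flips between the two ends of the quarter, so the boundary contribution is the total
   of [fs] alone: the parity of the zeros of [F] at the base point. *)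
have UQ : boxsum B' Q (fun y => U y * pathsum Q fs y) (set_at x1 1 (B' 1%N))
   + boxsum B' Q (fun y => U y * pathsum Q fs y) (set_at x1 1 0) =
   boxsum B' Q (pathsum Q fs) (set_at x1 1 0).
  rewrite (_ : B' 1%N = M') // !(@boxsum_set_at _ _ _ x1) // -boxsumD; apply: eq_boxsum => // y yB yx.
  have y0 : y 0%N = 0%N by rewrite yx.
  cbv beta; set w := set_at y 1 0; have -> : set_at y 1 M' = tau w by rewrite /tau /w set_atE set_at_set.
  have w1 : w 1%N = 0%N by rewrite /w set_atE.
  rewrite tauP ?w1 //; have [->|nz] := eqVneq (pathsum Q fs w) 0; first by rewrite !mulr0 addr0.
  rewrite flipU ?w1 // -?mulrDl; first by rewrite addrAC addF2 add0r mul1r.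
  apply: nzG nz => //; apply: (boxT Q w (fun _ H => H)) => [j jQ||].
  - rewrite /w set_at_neq; first by have := yB j jQ; rewrite -BB'.
    by apply: contraNneq n1Q => <-.
  - by rewrite /w set_at_neq // y0.
  - by rewrite w1.
rewrite UQ; pose es := map (fun i => bit M (E i)) (iota 0 k).
have inE' i : (i < k)%N -> List.In (bit M (E i)) es.
  by move=> ik; apply: (In_map (fun i => bit M (E i))); rewrite mem_iota.
rewrite -(eq_boxsum_bound _ _ BB').
have -> : boxsum B Q (pathsum Q fs) (set_at x1 1 0) = boxsum B Q (pathsum Q es) (set_at x1 1 M).
  rewrite !(@boxsum_set_at _ _ _ x1) //; apply: eq_boxsum => // y yB yx.
  have upT v : forall z j, j \in Q -> up (set_at z 1 v) j = set_at (up z j) 1 v.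
    move=> z j jQ; have nj : j != 1%N by apply: contraNneq n1Q => <-.
    by rewrite /up set_at_neq // set_atC // eq_sym.
  rewrite (@pathsum_comp _ _ bF _ _ _ (upT 0%N)) (@pathsum_comp _ _ _ _ _ _ (upT M)).
  apply: eq_pathsum => i z _ zc zx; rewrite /bF /bit gp10 gp_set // divff ?gt_eqF // hE1.
  congr (_ %:R); congr (nat_of_bool (0 < F i (upd _ _ _))); apply/rowP => l; rewrite !mxE.
  by case: eqP => // ->; rewrite inordK // zx // yx // mul0r.
(* The cocycle property of [es] identifies the totals at both ends of the homotopy [E], because its
   faces on the boundary of the box contribute nothing. *)
have := boxsum_closed B es x1 uT; rewrite big_cons del1E big_seq big1 ?addr0; last first.
  move=> j jQ; have z v : v = 0%N \/ v = M ->
      boxsum B (del j T) (pathsum (del j T) es) (set_at x1 j v) = 0.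
    move=> v0; rewrite -[RHS](zeroQ (fun _ => 1) es E d3 B j v x1 S3 Md3 inE') //.
    by apply: eq_boxsum => [|y _ _]; [exact: filter_uniq|rewrite mul1r].
  by rewrite !z ?addr0 //; [left|right].
move=> /eqP; rewrite addr_eq0 oppF2 => /eqP ->.
pose u i l : 'F_2 := (0 < e i (l%:R / M%:R))%R%:R.
have -> : boxsum B Q (pathsum Q es) (set_at x1 1 0) =
    boxsum B Q (pathsum Q [seq (fun y : nat -> nat => u i (y (i.+2))) | i <- iota 0 k]) (set_at x1 1 0).
  apply: eq_boxsum => // y yB yx; apply: eq_pathsum => i z; rewrite mem_iota => ik _ zx.
  have z1 : z = set_at z 1 0.
    apply: boolp.funext => l; rewrite /set_at; case: eqP => // ->.
    by rewrite zx // yx // set_atE.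
  rewrite /bit /u [in LHS]z1 gp10 hE0 // gpE //.
have rQ : map (fun i => i.+2) (iota 0 k) = Q.
  by rewrite /Q -[2%N]addn0 iotaDl.
have /= := @pathsum_sep _ (iota 0 k) (fun i => i.+2) u B (set_at x1 1 0); rewrite rQ => -> //.
rewrite big1 // => i _; have /andP[e0 e1] := he i.
by rewrite /u mul0r divff ?gt_eqF // e1 ltNge (ltW e0) addr0.
Qed.

End Twist.

(** * Euclidean geometry and spectral theorem *)

Section Dot.
Variable R : realType.

Definition dot (n : nat) (u v : 'rV[R]_n) : R := \sum_i u ord0 i * v ord0 i.

Lemma dotE n (u v : 'rV[R]_n) : dot u v = (u *m v^T) ord0 ord0.
Proof. by rewrite mxE; apply: eq_bigr => i _; rewrite mxE. Qed.

Lemma dotC n (u v : 'rV[R]_n) : dot u v = dot v u.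
Proof. by apply: eq_bigr => i _; rewrite mulrC. Qed.

Lemma dotDl n (u v w : 'rV[R]_n) : dot (u + v) w = dot u w + dot v w.
Proof. by rewrite -big_split; apply: eq_bigr => i _; rewrite mxE mulrDl. Qed.

Lemma dotZl n (a : R) (u v : 'rV[R]_n) : dot (a *: u) v = a * dot u v.
Proof. by rewrite mulr_sumr; apply: eq_bigr => i _; rewrite mxE mulrA. Qed.

Lemma dotDr n (u v w : 'rV[R]_n) : dot w (u + v) = dot w u + dot w v.
Proof. by rewrite dotC dotDl !(dotC w). Qed.

Lemma dotZr n (a : R) (u v : 'rV[R]_n) : dot u (a *: v) = a * dot u v.
Proof. by rewrite dotC dotZl dotC. Qed.

Lemma dotNl n (u v : 'rV[R]_n) : dot (- u) v = - dot u v.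
Proof. by rewrite -scaleN1r dotZl mulN1r. Qed.

Lemma dotNr n (u v : 'rV[R]_n) : dot u (- v) = - dot u v.
Proof. by rewrite dotC dotNl dotC. Qed.

Lemma dotBl n (u v w : 'rV[R]_n) : dot (u - v) w = dot u w - dot v w.
Proof. by rewrite dotDl dotNl. Qed.

Lemma dotBr n (u v w : 'rV[R]_n) : dot w (u - v) = dot w u - dot w v.
Proof. by rewrite dotDr dotNr. Qed.

Lemma dot0l n (u : 'rV[R]_n) : dot 0 u = 0.
Proof. by rewrite -(scale0r u) dotZl mul0r. Qed.

Lemma dot_sqrD n (u v : 'rV[R]_n) : dot (u + v) (u + v) = dot u u + 2 * dot u v + dot v v.
Proof. by rewrite dotDl !dotDr (dotC v u); ring. Qed.

Lemma dot_ge0 n (u : 'rV[R]_n) : 0 <= dot u u.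
Proof. by apply: sumr_ge0 => i _; rewrite -expr2 sqr_ge0. Qed.

Lemma dot_eq0 n (u : 'rV[R]_n) : dot u u = 0 -> u = 0.
Proof.
move=> /eqP; rewrite psumr_eq0 => [/allP H|i _]; last by rewrite -expr2 sqr_ge0.
apply/rowP => i; rewrite mxE; apply/eqP; rewrite -sqrf_eq0 expr2.
exact: (implyP (H i (mem_index_enum i))).
Qed.

Lemma coordc m n i j : continuous (fun y : 'M[R]_(m, n) => y i j).
Proof. exact: coord_continuous. Qed.

Lemma cvg_coord (T : Type) (F : set_system T) m n (f : T -> 'M[R]_(m, n))
    (l : 'M[R]_(m, n)) i j : f x @[x --> F] --> l -> f x i j @[x --> F] --> l i j.
Proof. by move=> fl; have h := @coordc m n i j l; exact: (cvg_comp _ _ fl h). Qed.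

Lemma contM (T : topologicalType) (f g : T -> R) :
  continuous f -> continuous g -> continuous (fun x => f x * g x).
Proof. by move=> fc gc x; exact: (continuousM (fc x) (gc x)). Qed.

Lemma contD (T : topologicalType) (V : normedModType R) (f g : T -> V) :
  continuous f -> continuous g -> continuous (fun x => f x + g x).
Proof. by move=> fc gc x; exact: (continuousD (fc x) (gc x)). Qed.

Lemma contN (T : topologicalType) (V : normedModType R) (f : T -> V) :
  continuous f -> continuous (fun x => - f x).
Proof. by move=> fc x; exact: (continuousN (fc x)). Qed.

Lemma contB (T : topologicalType) (V : normedModType R) (f g : T -> V) :
  continuous f -> continuous g -> continuous (fun x => f x - g x).
Proof. by move=> fc gc; apply: contD => //; exact: contN. Qed.

Lemma contZ (T : topologicalType) (V : normedModType R) (f : T -> R) (g : T -> V) :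
  continuous f -> continuous g -> continuous (fun x => f x *: g x).
Proof. by move=> fc gc x; exact: (continuousZ (fc x) (gc x)). Qed.

Lemma contC (T U : topologicalType) (c : U) : continuous (fun _ : T => c).
Proof. by move=> x; exact: cvg_cst. Qed.

Lemma continuous_sum (T : topologicalType) (I : Type) (s : seq I) (f : I -> T -> R) :
  (forall i, continuous (f i)) -> continuous (fun x => \sum_(i <- s) f i x).
Proof.
move=> fc; elim: s => [|i s IH] x.
  by under eq_fun do rewrite big_nil; exact: cst_continuous.
by under eq_fun do rewrite big_cons; apply: continuousD; [exact: fc|exact: IH].
Qed.

Lemma continuous_dot (T : topologicalType) n (f g : T -> 'rV[R]_n) :
  continuous f -> continuous g -> continuous (fun x => dot (f x) (g x)).
Proof.
move=> fc gc; apply: continuous_sum => i x; apply: continuousM.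
  exact: (continuous_comp (fc x) (@coord_continuous _ _ _ _ _ _)).
exact: (continuous_comp (gc x) (@coord_continuous _ _ _ _ _ _)).
Qed.

Lemma cvg_sumR (T I : Type) (F : set_system T) {FF : Filter F} (s : seq I) (f : I -> T -> R)
    (l : I -> R) : (forall i, f i x @[x --> F] --> l i) ->
  \sum_(i <- s) f i x @[x --> F] --> \sum_(i <- s) l i.
Proof.
move=> fc; elim: s => [|i s IH].
  by rewrite big_nil; under eq_fun do rewrite big_nil; exact: cvg_cst.
by rewrite big_cons; under eq_fun do rewrite big_cons; exact: cvgD (fc i) IH.
Qed.

Lemma cvg_dot (T : Type) (F : set_system T) {FF : Filter F} n (f g : T -> 'rV[R]_n)
    (l m : 'rV[R]_n) : f x @[x --> F] --> l -> g x @[x --> F] --> m ->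
  dot (f x) (g x) @[x --> F] --> dot l m.
Proof.
move=> fl gm; apply: cvg_sumR => i.
have cl := cvg_coord (i := ord0) (j := i) fl; have cm := cvg_coord (i := ord0) (j := i) gm.
exact: (cvgM cl cm).
Qed.

Lemma norm_le_dot n (u : 'rV[R]_n) : `|u| ^+ 2 <= dot u u.
Proof.
have d0 := dot_ge0 u; rewrite -[leRHS]sqr_sqrtr // ler_pXn2r ?nnegrE ?sqrtr_ge0 //.
apply/mx_norm_leP; first exact: sqrtr_ge0.
move=> i j; rewrite ord1 -sqrtr_sqr ler_sqrt // /dot (bigD1 j) //= -expr2 lerDl.
by apply: sumr_ge0 => l _; rewrite -expr2 sqr_ge0.
Qed.

Lemma cvg_mx (T : topologicalType) (F : set_system T) {FF : Filter F} m n
  (f : T -> 'M[R]_(m, n)) (l : 'M[R]_(m, n)) :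
  (forall i j, f y i j @[y --> F] --> l i j) -> f y @[y --> F] --> l.
Proof.
move=> fc; apply/cvgrPdist_le => e e0.
have H : \forall y \near F, forall ij : 'I_m * 'I_n, `|l ij.1 ij.2 - f y ij.1 ij.2| <= e.
  by apply: filter_forall => -[i j] /=; have /cvgrPdist_le := fc i j; apply.
near=> y; apply/mx_norm_leP; first exact: ltW.
move=> i j; rewrite !mxE; have Hy : forall ij : 'I_m * 'I_n, `|l ij.1 ij.2 - f y ij.1 ij.2| <= e.
  by near: y.
exact: (Hy (i, j)).
Unshelve. all: by end_near. Qed.

Lemma continuous_mx (T : topologicalType) m n (f : T -> 'M[R]_(m, n)) :
  (forall i j, continuous (fun y => f y i j)) -> continuous f.
Proof. by move=> fc x; apply: cvg_mx => i j; exact: fc. Qed.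

Lemma continuous_mulmxr (m n p : nat) (A : 'M[R]_(n, p)) :
  continuous (fun u : 'M[R]_(m, n) => u *m A).
Proof.
apply: continuous_mx => i j.
have -> : (fun u : 'M[R]_(m, n) => (u *m A) i j) = fun u => \sum_l u i l * A l j.
  by apply/funext => u; rewrite mxE.
apply: (@continuous_sum _ _ _ (fun l (x : 'M[R]_(m, n)) => x i l * A l j)) => l u.
by apply: continuousM; [exact: coord_continuous|exact: cst_continuous].
Qed.

(** First-order condition at a maximum: for a nonzero linear coefficient, a small [s] of the same
    sign would let the linear term win. *)
Lemma quad_le0 (p q : R) : (forall s : R, s * p + s ^+ 2 * q <= 0) -> p = 0.
Proof.
move=> H; apply/eqP; apply: contraT => p0.
have p20 : 0 < p ^+ 2 by rewrite lt_neqAle sqr_ge0 eq_sym sqrf_eq0 p0.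
have q1 : 0 < 1 + `|q| by rewrite ltr_pwDl.
have := H (p / (1 + `|q|)); rewrite expr_div_n leNgt => /negP; case.
have -> : p / (1 + `|q|) * p + p ^+ 2 / (1 + `|q|) ^+ 2 * q =
   p ^+ 2 / (1 + `|q|) ^+ 2 * (1 + `|q| + q) by field; rewrite gt_eqF.
apply: mulr_gt0; first by apply: divr_gt0 => //; apply: exprn_gt0.
by rewrite -addrA ltr_pwDl // -lerBlDr sub0r -normrN ler_norm.
Qed.

Lemma dot_mulmx m n (u : 'rV[R]_m) (v : 'rV[R]_n) (A : 'M[R]_(m, n)) :
  dot (u *m A) v = dot u (v *m A^T).
Proof. by rewrite !dotE trmx_mul trmxK mulmxA. Qed.

(* The maximum of the Rayleigh quotient on an invariant orthogonal complement is attained at an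
   eigenvector. *)
Lemma eigenvector_orth m n (A : 'M[R]_n) (P : 'M[R]_(m, n)) (d : 'rV[R]_m) :
  A^T = A -> P *m A = diag_mx d *m P -> (m < n)%N ->
  exists (u : 'rV[R]_n) (l : R), [/\ dot u u = 1, u *m P^T = 0 & u *m A = l *: u].
Proof.
move=> As PA mn.
have AP : A *m P^T = P^T *m diag_mx d.
  by have := congr1 trmx PA; rewrite !trmx_mul As tr_diag_mx.
pose C : set 'rV[R]_n := [set u | dot u u = 1 /\ u *m P^T = 0].
have unit u : u != 0 -> u *m P^T = 0 -> C ((Num.sqrt (dot u u))^-1 *: u).
  move=> u0 uP; have d0 : 0 < dot u u.
    by rewrite lt_neqAle dot_ge0 andbT eq_sym; apply: contraNneq u0 => /dot_eq0 ->.
  split; last by rewrite -scalemxAl uP scaler0.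
  rewrite dotZl dotZr mulrA -expr2 exprVn sqr_sqrtr ?dot_ge0 // mulVf // gt_eqF //.
have C0 : C !=set0.
  have : kermx P^T != 0.
    rewrite -mxrank_eq0 mxrank_ker mxrank_tr -lt0n subn_gt0.
    exact: leq_ltn_trans (rank_leq_row P) mn.
  move=> /rowV0Pn [u /sub_kermxP uP u0].
  by exists ((Num.sqrt (dot u u))^-1 *: u); apply: unit.
have dc : continuous (fun u : 'rV[R]_n => dot u u).
  by apply: continuous_dot => x; exact: cvg_id.
have cC : compact C.
  apply: bounded_closed_compact.
    exists 1; split; first exact: num_real.
    move=> M M1 u [uu _]; apply: le_trans (ltW M1).
    by rewrite -(@ler_pXn2r _ 2) ?nnegrE // expr1n -uu norm_le_dot.
  rewrite (_ : C = (fun u => dot u u) @^-1` [set 1] `&` (fun u => u *m P^T) @^-1` [set 0]) //.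
  apply: closedI; apply: preimage_closed.
  - by move=> u _; exact: dc.
  - by apply: compact_closed; [exact: norm_hausdorff|exact: compact_set1].
  - by move=> u _; exact: continuous_mulmxr.
  - by apply: compact_closed; [exact: norm_hausdorff|exact: compact_set1].
have fc : continuous (fun u : 'rV[R]_n => dot (u *m A) u).
  apply: continuous_dot; first exact: continuous_mulmxr.
  by move=> x; exact: cvg_id.
have [u uC umax] := compact_EVT_max C0 cC (continuous_subspaceT fc).
move: uC; rewrite inE => -[uu uP]; pose l := dot (u *m A) u.
exists u, l; split => //.
have hom v : v *m P^T = 0 -> dot (v *m A) v <= l * dot v v.
  move=> vP; have [->|v0] := eqVneq v 0; first by rewrite mul0mx dot0l mulr0.
  have /mem_set /umax := unit v v0 vP; rewrite -/l.
  have d0 : 0 < dot v v.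
    by rewrite lt_neqAle dot_ge0 andbT eq_sym; apply: contraNneq v0 => /dot_eq0 ->.
  rewrite -scalemxAl dotZl dotZr mulrA -expr2 exprVn sqr_sqrtr ?dot_ge0 //.
  by rewrite mulrC ler_pdivrMr.
have wP v : v *m P^T = 0 -> v *m A *m P^T = 0.
  by move=> vP; rewrite -mulmxA AP mulmxA vP mul0mx.
apply/eqP; rewrite -subr_eq0; apply/eqP.
(* The defect of the eigenvalue equation is itself an admissible variation, and the first-order
   condition along it gives [dot w w = 0]. *)
set w := _ - _; have wPT : w *m P^T = 0.
  by rewrite /w mulmxBl wP // -scalemxAl uP scaler0 subrr.
have uw : dot (u *m A) w = l * dot u w + dot w w.
  by rewrite -[u *m A](subrK (l *: u)) dotDl dotZl addrC.
clearbody w; apply: dot_eq0.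
apply: (@quad_le0 _ (dot (w *m A) w / 2 - l / 2 * dot w w)) => s.
have := hom (u + s *: w); rewrite mulmxDl -scalemxAl uP wPT scaler0 addr0 => /(_ erefl).
rewrite mulmxDl -scalemxAl !dotDl !dotDr !dotZl !dotZr uu -/l.
have -> : dot (w *m A) u = dot (u *m A) w by rewrite dot_mulmx As dotC.
rewrite uw (dotC w u); set X := dot u w; set Y := dot w w; set Z := dot (w *m A) w; clear.
have -> : s * Y + s ^+ 2 * (Z / 2 - l / 2 * Y) = ((l + s * (l * X + Y) + (s * (l * X + Y) + s * (s * Z)))
  - l * (1 + s * X + (s * X + s * (s * Y)))) / 2 by field.
by move=> h; rewrite mulr_le0_ge0 ?subr_le0 // invr_ge0.
Qed.

(** Eigenvectors are added one row at a time for a fixed [A], so the induction runs on the number of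
    rows and not on the size of the matrix. *)
Theorem spectral_real n (A : 'M[R]_n) : A^T = A ->
  exists (P : 'M[R]_n) (d : 'rV[R]_n), P *m P^T = 1%:M /\ P *m A = diag_mx d *m P.
Proof.
move=> As; suff H m : (m <= n)%N -> exists (P : 'M[R]_(m, n)) (d : 'rV[R]_m),
    P *m P^T = 1%:M /\ P *m A = diag_mx d *m P by exact: (H n).
elim: m => [|m IH] mn.
  by exists 0, 0; split; [apply/matrixP => -[]|rewrite mul0mx mulmx0].
have [P [d [PP PA]]] := IH (ltnW mn).
have [u [l [uu uP uA]]] := eigenvector_orth As PA mn.
rewrite -[m.+1]add1n; exists (col_mx u P), (row_mx l%:M d); split.
  rewrite tr_col_mx mul_col_mx !mul_mx_row PP uP.
  have -> : P *m u^T = 0 by rewrite -[P *m _]trmxK trmx_mul trmxK uP trmx0.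
  have -> : u *m u^T = 1%:M.
    by apply/matrixP => i j; rewrite !ord1 -dotE uu mxE eqxx.
  by rewrite -block_mxEv scalar_mx_block.
rewrite diag_mx_row mul_block_col !mul0mx addr0 add0r mul_col_mx PA uA.
by congr col_mx; apply/rowP => i; rewrite !mxE big_ord1 !mxE eqxx !mulr1n.
Qed.

End Dot.

Definition o0 : 'I_4 := @Ordinal 4 0 isT.
Definition o1 : 'I_4 := @Ordinal 4 1 isT.
Definition o2 : 'I_4 := @Ordinal 4 2 isT.
Definition o3 : 'I_4 := @Ordinal 4 3 isT.

Lemma ord4P (P : 'I_4 -> Prop) : P o0 -> P o1 -> P o2 -> P o3 -> forall i, P i.
Proof.
move=> p0 p1 p2 p3 [[|[|[|[|//]]]] h].
- by rewrite (_ : Ordinal h = o0) //; apply: val_inj.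
- by rewrite (_ : Ordinal h = o1) //; apply: val_inj.
- by rewrite (_ : Ordinal h = o2) //; apply: val_inj.
- by rewrite (_ : Ordinal h = o3) //; apply: val_inj.
Qed.

Lemma sum4 (V : nmodType) (f : 'I_4 -> V) : \sum_i f i = f o0 + f o1 + f o2 + f o3.
Proof.
rewrite !big_ord_recl big_ord0 addr0 !addrA.
by congr (f _ + f _ + f _ + f _); apply: val_inj.
Qed.

(** * Discretised loops *)

Section Loops.
Variables (R : realType) (n : nat).
Notation N := n.+1.
Notation loop := 'M[R]_(N, 4).
Implicit Types x y : loop.

(** Averages over the samples stand for integrals over the unit circle; with this normalisation
    estimates can be uniform in [n]. *)
Definition avg (f : 'I_N -> R) : R := N%:R^-1 * \sum_j f j.

Lemma N_gt0 : 0 < N%:R :> R. Proof. by rewrite ltr0n. Qed.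

Lemma N_neq0 : N%:R != 0 :> R. Proof. by rewrite pnatr_eq0. Qed.

Lemma avgD f g : avg (fun j => f j + g j) = avg f + avg g.
Proof. by rewrite /avg big_split mulrDr. Qed.

Lemma avgZ a f : avg (fun j => a * f j) = a * avg f.
Proof. by rewrite /avg -mulr_sumr mulrCA. Qed.

Lemma avgN f : avg (fun j => - f j) = - avg f.
Proof. by rewrite /avg sumrN mulrN. Qed.

Lemma avg_cst a : avg (fun _ => a) = a.
Proof. by rewrite /avg sumr_const card_ord -[a *+ _]mulr_natl mulKf // gt_eqF // N_gt0. Qed.

Lemma ler_avg f g : (forall j, f j <= g j) -> avg f <= avg g.
Proof. by move=> fg; rewrite ler_wpM2l ?invr_ge0 ?ler0n // ler_sum. Qed.

Lemma avg_ge0 f : (forall j, 0 <= f j) -> 0 <= avg f.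
Proof. by move=> f0; rewrite -(avg_cst 0) ler_avg. Qed.

Lemma ler_norm_avg f : `|avg f| <= avg (fun j => `|f j|).
Proof.
rewrite /avg normrM ger0_norm ?invr_ge0 ?ler0n // ler_wpM2l ?invr_ge0 ?ler0n //.
exact: ler_norm_sum.
Qed.

Lemma avg_sqr f : avg f ^+ 2 <= avg (fun j => f j ^+ 2).
Proof.
pose m := avg f; rewrite -subr_ge0 -/m.
have -> : avg (fun j => f j ^+ 2) - m ^+ 2 = avg (fun j => (f j - m) ^+ 2).
  have -> : (fun j => (f j - m) ^+ 2) = fun j => f j ^+ 2 + (- (2 * m) * f j + m ^+ 2).
    by apply/funext => j; ring.
  by rewrite avgD avgD avgZ avg_cst -/m; ring.
by apply: avg_ge0 => j; exact: sqr_ge0.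
Qed.

Definition ip x y : R := avg (fun j => \sum_i x j i * y j i).

Lemma ipE x y : ip x y = N%:R^-1 * \tr (x *m y^T).
Proof.
rewrite /ip /avg; congr (_ * _); apply: eq_bigr => j _; rewrite mxE.
by apply: eq_bigr => i _; rewrite mxE.
Qed.

Lemma ipC x y : ip x y = ip y x.
Proof. by rewrite !ipE -mxtrace_tr trmx_mul trmxK. Qed.

Lemma ipDl x y z : ip (x + y) z = ip x z + ip y z.
Proof. by rewrite !ipE mulmxDl mxtraceD mulrDr. Qed.

Lemma ipZl a x y : ip (a *: x) y = a * ip x y.
Proof. by rewrite !ipE -scalemxAl mxtraceZ mulrCA. Qed.

Lemma ipDr x y z : ip z (x + y) = ip z x + ip z y.
Proof. by rewrite ipC ipDl !(ipC z). Qed.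

Lemma ipZr a x y : ip x (a *: y) = a * ip x y.
Proof. by rewrite ipC ipZl ipC. Qed.

Lemma ipNl x y : ip (- x) y = - ip x y.
Proof. by rewrite -scaleN1r ipZl mulN1r. Qed.

Lemma ipNr x y : ip x (- y) = - ip x y.
Proof. by rewrite ipC ipNl ipC. Qed.

Lemma ipBl x y z : ip (x - y) z = ip x z - ip y z.
Proof. by rewrite ipDl ipNl. Qed.

Lemma ip0l x : ip 0 x = 0.
Proof. by rewrite -(scale0r x) ipZl mul0r. Qed.

Lemma ip_suml (I : Type) (s : seq I) (P : pred I) (f : I -> loop) y :
  ip (\sum_(i <- s | P i) f i) y = \sum_(i <- s | P i) ip (f i) y.
Proof. by apply: (big_morph (fun x => ip x y)); [move=> *; rewrite ipDl|rewrite ip0l]. Qed.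

Lemma ip_ge0 x : 0 <= ip x x.
Proof. by apply: avg_ge0 => j; apply: sumr_ge0 => i _; rewrite -expr2 sqr_ge0. Qed.

Definition nL2 x : R := Num.sqrt (ip x x).

Lemma nL2_ge0 x : 0 <= nL2 x. Proof. exact: sqrtr_ge0. Qed.

Lemma nL2_sqr x : nL2 x ^+ 2 = ip x x. Proof. by rewrite sqr_sqrtr // ip_ge0. Qed.

Lemma ip_sqr x y : ip x y ^+ 2 <= ip x x * ip y y.
Proof.
have [y0|y0] := eqVneq (ip y y) 0.
  have : ip x y = 0.
    apply: (@quad_le0 R _ (- (ip y y + 1) * 0 + 0)) => s; rewrite addr0 mulr0 mulr0 addr0.
    have h t : 0 <= ip x x + t * ip x y * 2.
      have := ip_ge0 (x + t *: y); rewrite ipDl !ipDr !ipZl !ipZr y0 (ipC y x); lra.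
    have [p0|p0] := eqVneq (ip x y) 0; first by rewrite p0 mulr0.
    by have := h (- (ip x x + 1) / (2 * ip x y)); rewrite (_ : _ * 2 = - (ip x x + 1)); [lra|field].
  by move=> ->; rewrite expr0n /= mulr_ge0 // ip_ge0.
have yp : 0 < ip y y by rewrite lt_neqAle eq_sym y0 ip_ge0.
have := ip_ge0 (x - (ip x y / ip y y) *: y).
rewrite ipDl !ipDr !ipNl !ipNr !ipZl !ipZr (ipC y x).
have -> : ip x x - ip x y / ip y y * ip x y + (- (ip x y / ip y y * ip x y)
    - - (ip x y / ip y y * (ip x y / ip y y * ip y y))) = (ip x x * ip y y - ip x y ^+ 2) / ip y y.
  by field.
by rewrite pmulr_lge0 ?invr_gt0 // subr_ge0.
Qed.

Lemma ip_le x y : `|ip x y| <= nL2 x * nL2 y.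
Proof.
rewrite -(@ler_pXn2r _ 2) ?nnegrE ?mulr_ge0 ?nL2_ge0 // exprMn !nL2_sqr real_normK ?num_real //.
exact: ip_sqr.
Qed.

Lemma nL2D x y : nL2 (x + y) <= nL2 x + nL2 y.
Proof.
rewrite -(@ler_pXn2r _ 2) ?nnegrE ?addr_ge0 ?nL2_ge0 // sqrrD !nL2_sqr ipDl !ipDr (ipC y x).
have := le_trans (ler_norm _) (ip_le x y); lra.
Qed.

Lemma nL2Z a x : nL2 (a *: x) = `|a| * nL2 x.
Proof. by rewrite /nL2 ipZl ipZr mulrA -expr2 sqrtrM ?sqr_ge0 // sqrtr_sqr. Qed.

(** Multiplication from the left acts on time, here by a cyclic shift; multiplication from the right
    acts on coordinates. [Ev] moves the odd coordinate of each plane to the even place. *)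
Definition Cm : 'M[R]_N := \matrix_(j, l) (l == ordS j)%:R.
Definition Ev : 'M[R]_4 :=
  \matrix_(i, i') (((i == o1) && (i' == o0)) || ((i == o3) && (i' == o2)))%:R.

Lemma CmE x j i : (Cm *m x) j i = x (ordS j) i.
Proof.
rewrite mxE (bigD1 (ordS j)) //= mxE eqxx mul1r big1 ?addr0 // => l lj.
by rewrite mxE (negbTE lj) mul0r.
Qed.

Lemma CmTE x j i : (Cm^T *m x) j i = x (ord_pred j) i.
Proof.
rewrite mxE (bigD1 (ord_pred j)) //= !mxE ord_predK eqxx mul1r big1 ?addr0 // => l lj.
rewrite !mxE -(inj_eq (@ord_pred_inj _)) ordSK eq_sym (negbTE lj) mul0r //.
Qed.

(* Symplectic Euler discretisation of [- J d/dt]: staggering the odd coordinates by one step makes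
   the operator symmetric. *)
Definition Lop x : loop :=
  N%:R *: ((x - Cm^T *m x) *m Ev - (Cm *m x - x) *m Ev^T).

Lemma EvE (y : loop) j : [/\ (y *m Ev) j o0 = y j o1, (y *m Ev) j o1 = 0,
  (y *m Ev) j o2 = y j o3 & (y *m Ev) j o3 = 0].
Proof. by split; rewrite mxE sum4 !mxE /= ?(mulr0, mulr1, addr0, add0r). Qed.

Lemma EvTE (y : loop) j : [/\ (y *m Ev^T) j o0 = 0, (y *m Ev^T) j o1 = y j o0,
  (y *m Ev^T) j o2 = 0 & (y *m Ev^T) j o3 = y j o2].
Proof. by split; rewrite mxE sum4 !mxE /= ?(mulr0, mulr1, addr0, add0r). Qed.

Lemma LopE x j : [/\ Lop x j o0 = N%:R * (x j o1 - x (ord_pred j) o1),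
  Lop x j o1 = - (N%:R * (x (ordS j) o0 - x j o0)),
  Lop x j o2 = N%:R * (x j o3 - x (ord_pred j) o3) &
  Lop x j o3 = - (N%:R * (x (ordS j) o2 - x j o2))].
Proof.
have sub (A B : loop) i : (A - B) j i = A j i - B j i by rewrite !mxE.
have [a0 a1 a2 a3] := EvE (x - Cm^T *m x) j; have [b0 b1 b2 b3] := EvTE (Cm *m x - x) j.
split; rewrite /Lop mxE sub ?(a0, a1, a2, a3) ?(b0, b1, b2, b3) ?sub0r ?subr0 ?mulrN sub ?CmE ?CmTE //.
Qed.

Lemma Lop_linear : linear Lop.
Proof.
move=> a x y; apply/matrixP => j.
have [e0 e1 e2 e3] := LopE (a *: x + y) j; have [f0 f1 f2 f3] := LopE x j.
have [g0 g1 g2 g3] := LopE y j.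
by apply: ord4P; rewrite [RHS]mxE [X in _ = X + _]mxE ?(e0, e1, e2, e3) ?(f0, f1, f2, f3)
  ?(g0, g1, g2, g3) !mxE; ring.
Qed.

HB.instance Definition _ := GRing.isLinear.Build R loop loop _ Lop Lop_linear.

Lemma ip_mull (A : 'M[R]_N) x y : ip (A *m x) y = ip x (A^T *m y).
Proof. by rewrite !ipE trmx_mul trmxK -[A *m x *m _]mulmxA mxtrace_mulC mulmxA. Qed.

Lemma ip_mulr (A : 'M[R]_4) x y : ip (x *m A) y = ip x (y *m A^T).
Proof. by rewrite !ipE trmx_mul trmxK mulmxA. Qed.

Lemma Lop_sym x y : ip (Lop x) y = ip x (Lop y).
Proof.
rewrite /Lop !(ipZl, ipZr) !(ipDl, ipDr, ipNl, ipNr) !ip_mulr trmxK.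
rewrite !(ipDl, ipDr, ipNl, ipNr) !ip_mull trmxK !mulmxDl !mulNmx !(ipDr, ipNr).
rewrite !mulmxA; ring.
Qed.

(** Loops are flattened to row vectors, where the symmetry of [Lop] becomes that of a matrix. *)
Lemma eigenbasis : exists (b : 'I_(N * 4) -> loop) (s : 'I_(N * 4) -> R),
  [/\ forall i j, ip (b i) (b j) = (i == j)%:R,
      forall i, Lop (b i) = s i *: b i &
      forall x, x = \sum_i ip x (b i) *: b i].
Proof.
pose A := lin_mx (@Lop).
have AE x : mxvec x *m A = mxvec (Lop x) by rewrite mul_vec_lin.
have ipv x y : ip x y = N%:R^-1 * (mxvec x *m (mxvec y)^T) ord0 ord0.
  rewrite /ip /avg mxE (reindex _ (curry_mxvec_bij _ _)) /= pair_bigA.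
  congr (_ * _); apply: eq_bigr => -[j i] /= _; by rewrite mxE !mxvecE.
have As : A^T = A.
  apply/matrixP => k l.
  have E (B : 'M[R]_(N * 4)) (p q : 'I_(N * 4)) :
      B p q = dot ((delta_mx 0 p : 'rV[R]_(N * 4)) *m B) (delta_mx 0 q).
    rewrite -rowE /dot (bigD1 q) //= !mxE !eqxx mulr1 big1 ?addr0 // => r rq.
    by rewrite !mxE (negbTE rq) andbF mulr0.
  rewrite mxE [LHS]E [RHS]E -[delta_mx _ l]vec_mxK -[delta_mx _ k]vec_mxK.
  set u := vec_mx _; set v := vec_mx _; rewrite !AE !dotE.
  have nz : N%:R^-1 != 0 :> R by rewrite invr_eq0 gt_eqF // N_gt0.
  by have := Lop_sym u v; rewrite !ipv => /(mulfI nz) ->; rewrite -!dotE dotC.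
have [P [d [PP PA]]] := spectral_real As.
(* Compensates the factor 1/N in [ip]. *)
pose c : R := Num.sqrt N%:R.
have cc : c * c = N%:R by rewrite -expr2 sqr_sqrtr // ler0n.
pose b i : loop := c *: vec_mx (row i P).
have ipb x i : ip x (b i) = N%:R^-1 * c * (mxvec x *m P^T) ord0 i.
  rewrite ipv /b linearZ /= vec_mxK linearZ -scalemxAr /= mxE mulrA; congr (_ * _).
  by rewrite tr_row colE mulmxA -colE mxE.
exists b, (fun i => d ord0 i); split.
- move=> i j; rewrite ipb /b linearZ /= vec_mxK -scalemxAl mxE -row_mul PP !mxE.
  by rewrite mulrA -[_ * c * c]mulrA cc mulVf ?mul1r ?N_neq0.
- move=> i; rewrite /b linearZ /= scalerA mulrC -scalerA; congr (_ *: _).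
  apply: (can_inj mxvecK); rewrite -AE linearZ /= vec_mxK -row_mul PA.
  by rewrite row_mul row_diag_mx -scalemxAl -rowE.
- move=> x; apply: (can_inj mxvecK); rewrite linear_sum /=.
  transitivity (\sum_i (mxvec x *m P^T) ord0 i *: row i P).
    by rewrite -mulmx_sum_row -mulmxA (mulmx1C PP) mulmx1.
  apply: eq_bigr => i _; rewrite ipb !linearZ /= vec_mxK scalerA; congr (_ *: _).
  by rewrite mulrAC -[_ * c * c]mulrA cc mulVf ?mul1r ?N_neq0.
Qed.

(** Samples are indexed by all natural numbers modulo N, so that time windows may cross the starting
    point. *)
Definition xs x (m : nat) : 'rV[R]_4 := row (inZp m) x.

Lemma xsE x m i : xs x m ord0 i = x (inZp m) i. Proof. by rewrite mxE. Qed.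

Lemma inZpS m : (inZp m.+1 : 'I_N) = ordS (inZp m).
Proof. by apply: val_inj; rewrite /= -addn1 -modnDml addn1. Qed.

Lemma inZp_ord (j : 'I_N) : inZp j = j.
Proof. by apply: val_inj; rewrite /= modn_small. Qed.

Lemma inZpN m : (inZp (m + N) : 'I_N) = inZp m.
Proof. by apply: val_inj; rewrite /= modnDr. Qed.

Lemma xsN x m : xs x (m + N) = xs x m.
Proof. by rewrite /xs inZpN. Qed.

Lemma sum_period (g : 'I_N -> R) m : \sum_(m <= l < m + N) g (inZp l) = \sum_j g j.
Proof.
elim: m => [|m IH].
  by rewrite add0n big_mkord; apply: eq_bigr => j _; rewrite inZp_ord.
have mN : (m < m + N)%N by rewrite addnS ltnS leq_addr.
by rewrite -IH addSn [LHS]big_nat_recr //= [RHS]big_ltn // addrC; congr (_ + _); congr g; rewrite inZpN.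
Qed.

Lemma sum_window (g : 'I_N -> R) m h : (forall j, 0 <= g j) -> (h <= N)%N ->
  \sum_(m <= l < m + h) g (inZp l) <= \sum_j g j.
Proof.
move=> g0 hN; rewrite -(sum_period g m) [leRHS](@big_cat_nat _ _ _ (m + h)) ?leq_addr ?leq_add2l //=.
by rewrite lerDl; apply: sumr_ge0.
Qed.

Definition dx x (j : 'I_N) (i : 'I_4) : R := N%:R * (x (ordS j) i - x j i).

Lemma xs_diff x m h i :
  xs x (m + h)%N ord0 i - xs x m ord0 i = N%:R^-1 * \sum_(m <= l < m + h) dx x (inZp l) i.
Proof.
rewrite -mulr_sumr mulKf ?N_neq0 //.
elim: h => [|h IH]; first by rewrite addn0 subrr big_geq.
rewrite addnS big_nat_recr ?leq_addr //= -IH !xsE inZpS; ring.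
Qed.

Lemma sum_sqr (m h : nat) (f : nat -> R) :
  (\sum_(m <= l < m + h) f l) ^+ 2 <= h%:R * \sum_(m <= l < m + h) f l ^+ 2.
Proof.
elim: h => [|h IH]; first by rewrite addn0 !big_geq // expr0n mulr0.
case: h IH => [_|h0 IH]; first by rewrite addn1 !big_nat1 mul1r.
set h := h0.+1 in IH *; rewrite addnS !big_nat_recr ?leq_addr //=.
set S := \sum_(_ <= _ < _) _ in IH *; set T := \sum_(_ <= _ < _) _ in IH *.
have h0' : 0 < h%:R :> R by rewrite ltr0n.
have T0 : S ^+ 2 / h%:R <= T by rewrite ler_pdivrMr // mulrC.
have key : 2 * S * f (m + h)%N <= S ^+ 2 / h%:R + h%:R * f (m + h)%N ^+ 2.
  rewrite -subr_ge0 (_ : _ - _ = (S - h%:R * f (m + h)%N) ^+ 2 / h%:R).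
    by rewrite divr_ge0 ?sqr_ge0 // ltW.
  by field; rewrite gt_eqF.
rewrite sqrrD -natr1 mulrDl mul1r mulrDr; move: IH T0 key; lra.
Qed.

Lemma dx_L x i : avg (fun j => dx x j i ^+ 2) <= ip (Lop x) (Lop x).
Proof.
have E : ip (Lop x) (Lop x) = \sum_i avg (fun j => dx x j i ^+ 2).
  rewrite sum4 -!avgD /ip /avg; congr (_ * _).
  have sh i' : \sum_j (N%:R * (x j i' - x (ord_pred j) i')) ^+ 2 = \sum_j dx x j i' ^+ 2.
    rewrite (reindex (@ordS N)) /=; last exact: onW_bij (ordS_bij N).
    by apply: eq_bigr => j _; rewrite ordSK.
  rewrite [RHS](_ : _ = \sum_j ((N%:R * (x j o1 - x (ord_pred j) o1)) ^+ 2
     + dx x j o0 ^+ 2 + (N%:R * (x j o3 - x (ord_pred j) o3)) ^+ 2 + dx x j o2 ^+ 2)).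
    by apply: eq_bigr => j _; rewrite sum4; have [-> -> -> ->] := LopE x j; rewrite /dx; ring.
  by rewrite !big_split /= !sh; ring.
rewrite E (bigD1 i) //= lerDl sumr_ge0 // => i' _.
by apply: avg_ge0 => j; exact: sqr_ge0.
Qed.

(** Discrete form of the embedding of H^1 into C^{1/2}, by Cauchy-Schwarz on the increments. *)
Lemma xs_holder x m h i : (h <= N)%N ->
  (xs x (m + h)%N ord0 i - xs x m ord0 i) ^+ 2 <= h%:R / N%:R * ip (Lop x) (Lop x).
Proof.
move=> hN; rewrite xs_diff exprMn.
apply: (@le_trans _ _ (N%:R^-1 ^+ 2 * (h%:R * \sum_j dx x j i ^+ 2))).
  rewrite ler_wpM2l ?sqr_ge0 // (le_trans (sum_sqr _ _ _)) // ler_wpM2l ?ler0n //.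
  by apply: (@sum_window (fun j => dx x j i ^+ 2)) => // j; exact: sqr_ge0.
have -> : N%:R^-1 ^+ 2 * (h%:R * \sum_j dx x j i ^+ 2) = h%:R / N%:R * avg (fun j => dx x j i ^+ 2).
  by rewrite /avg; ring.
by rewrite ler_wpM2l ?dx_L // divr_ge0 ?ler0n.
Qed.

Lemma osc_L x j k i : (x j i - x k i) ^+ 2 <= ip (Lop x) (Lop x).
Proof.
wlog jk : j k / (k <= j)%N.
  move=> H; case: (leqP k j) => [/H//|/ltnW/H].
  by rewrite -sqrrN opprB.
have h : (j - k <= N)%N by rewrite leq_subLR (leq_trans (ltnW (ltn_ord j))) // leq_addl.
have := xs_holder x k i h; rewrite subnKC // !xsE !inZp_ord => /le_trans; apply.
by rewrite ler_piMl ?ip_ge0 // ler_pdivrMr ?N_gt0 // mul1r ler_nat.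
Qed.

Definition mean0 x := forall i, avg (fun j => x j i) = 0.

(** A value of a loop of mean zero is the average of its differences with all other values, and
    these are bounded by the oscillation. *)
Lemma mean0_sup x j i : mean0 x -> x j i ^+ 2 <= ip (Lop x) (Lop x).
Proof.
move=> m0; have -> : x j i = avg (fun k => x j i - x k i).
  by rewrite avgD avg_cst avgN m0 oppr0 addr0.
apply: le_trans (avg_sqr _) _; rewrite -[leRHS](avg_cst).
by apply: ler_avg => k; exact: osc_L.
Qed.

Lemma mean0_L x : mean0 (Lop x).
Proof.
have sh i' : \sum_j x (ord_pred j) i' = \sum_j x j i'.
  rewrite (reindex (@ordS N)) /=; last exact: onW_bij (ordS_bij N).
  by apply: eq_bigr => j _; rewrite ordSK.
have sh' i' : \sum_j x (ordS j) i' = \sum_j x j i'.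
  by rewrite [RHS](reindex (@ordS N)) //=; exact: onW_bij (ordS_bij N).
have z i f g c : (forall j, Lop x j i = c * (f j - g j)) ->
    \sum_j f j = \sum_j g j -> avg (fun j => Lop x j i) = 0.
  move=> E fg; rewrite /avg (eq_bigr _ (fun j _ => E j)) -mulr_sumr sumrB fg subrr.
  by rewrite !mulr0.
apply: ord4P.
- by apply: (z o0 (fun j => x j o1) (fun j => x (ord_pred j) o1) N%:R) => [j|]; rewrite ?sh //; case: (LopE x j).
- by apply: (z o1 (fun j => x (ordS j) o0) (fun j => x j o0) (- N%:R)) => [j|]; rewrite ?sh' // mulNr; case: (LopE x j).
- by apply: (z o2 (fun j => x j o3) (fun j => x (ord_pred j) o3) N%:R) => [j|]; rewrite ?sh //; case: (LopE x j).
- by apply: (z o3 (fun j => x (ordS j) o2) (fun j => x j o2) (- N%:R)) => [j|]; rewrite ?sh' // mulNr; case: (LopE x j).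
Qed.

End Loops.

(** * Trigonometric functions on cyclic indices *)

Section Trig.
Variable R : realType.

Lemma sin_lex (x : R) : 0 <= x -> sin x <= x.
Proof.
rewrite le_eqVlt => /orP[/eqP <-|x0]; first by rewrite sin0.
have dsin y : y \in `]0, x[%R -> is_derive y 1 (sin : R -> R) (cos y).
  by move=> _; exact: is_derive_sin.
have csin : {within `[0, x], continuous (sin : R -> R)}.
  by apply: continuous_subspaceT; exact: continuous_sin.
have [c _] := MVT x0 dsin csin.
by rewrite sin0 !subr0 => ->; rewrite ler_piMl ?cos_le1 // ltW.
Qed.

Lemma cos_modn (m N : nat) (t : R) : (0 < N)%N ->
  cos (2 * pi * (m %% N)%:R / N%:R + t) = cos (2 * pi * m%:R / N%:R + t).
Proof.
move=> N0; have Nz : N%:R != 0 :> R by rewrite pnatr_eq0 -lt0n.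
rewrite [in RHS](divn_eq m N) natrD natrM.
have -> : 2 * pi * ((m %/ N)%:R * N%:R + (m %% N)%:R) / N%:R + t =
   (2 * pi * (m %% N)%:R / N%:R + t) + (pi *+ 2) *+ (m %/ N) :> R.
  by rewrite -[_ *+ (m %/ N)]mulr_natr -[pi *+ 2]mulr_natr; field.
by rewrite (periodicn (@cosD2pi R)).
Qed.

Lemma sin_modn (m N : nat) (t : R) : (0 < N)%N ->
  sin (2 * pi * (m %% N)%:R / N%:R + t) = sin (2 * pi * m%:R / N%:R + t).
Proof.
move=> N0; have := cos_modn m (t - pi / 2) N0.
by rewrite !addrA !cosBpihalf.
Qed.

End Trig.

(** * Positive and nonpositive modes, and the two action estimates *)

Section Splitting.
Variables (R : realType) (n : nat).
Notation N := n.+1.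
Notation loop := 'M[R]_(N, 4).
Implicit Types x y : loop.

(** Discrete counterpart of the circle e^{2 pi i t} in the z1-plane. The odd coordinate is sampled
    half a step later, in accordance with the staggered operator. *)
Definition eloop : loop := \matrix_(j, i)
  if i == o0 then cos (2 * pi * j%:R / N%:R)
  else if i == o1 then sin (2 * pi * j%:R / N%:R + pi / N%:R) else 0.

(** The eigenvalue of [eloop]. It stays below its continuous value 2 pi, which is the favourable
    direction for the upper bound of the action on the half space. *)
Definition sigma1 : R := 2 * N%:R * sin (pi / N%:R).

Lemma eloop_neq0 : 0 < ip eloop eloop.
Proof.
rewrite lt_neqAle ip_ge0 andbT eq_sym; apply/negP => /eqP; rewrite /ip /avg => /eqP.
rewrite mulf_eq0 invr_eq0 (negbTE (N_neq0 R n)) /= psumr_eq0; last first.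
  by move=> j _; apply: sumr_ge0 => i _; rewrite -expr2 sqr_ge0.
move=> /allP /(_ ord0 (mem_index_enum _)) /=; rewrite sum4 -!expr2.
have -> : eloop ord0 o0 = 1 by rewrite mxE /= mulr0 mul0r cos0.
have := sqr_ge0 (eloop ord0 o1); have := sqr_ge0 (eloop ord0 o2); have := sqr_ge0 (eloop ord0 o3).
rewrite expr1n => h1 h2 h3 /eqP; lra.
Qed.

Lemma Lop_eloop : Lop eloop = sigma1 *: eloop.
Proof.
have N0 : N%:R != 0 :> R by exact: N_neq0.
pose cs (l : 'I_N) : R := cos (2 * pi * l%:R / N%:R).
pose sn (l : 'I_N) : R := sin (2 * pi * l%:R / N%:R + pi / N%:R).
have E0 l : eloop l o0 = cs l by rewrite mxE.
have E1 l : eloop l o1 = sn l by rewrite mxE.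
have E2 l : eloop l o2 = 0 by rewrite mxE.
have E3 l : eloop l o3 = 0 by rewrite mxE.
apply/matrixP => j; have [e0 e1 e2 e3] := LopE eloop j.
pose th : R := 2 * pi * j%:R / N%:R; pose de : R := pi / N%:R.
have Sj : cs (ordS j) = cos (th + de + de).
  have := @cos_modn R j.+1 N 0 isT; rewrite !addr0 => E; rewrite /cs E; congr cos.
  by rewrite -[j.+1%:R]natr1 /th /de; field.
have Pj : sn (ord_pred j) = sin (th - de).
  rewrite /sn [LHS](@sin_modn R (j + N).-1 N _ isT) -/de -[RHS]sinD2pi; congr sin.
  rewrite addnS /= natrD /th /de -[pi *+ 2]mulr_natr.
  have -> : n%:R = N%:R - 1 :> R by rewrite -natr1 addrK.
  by field.
have cj : cs j = cos th by [].
have sj : sn j = sin (th + de) by [].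
apply: ord4P; rewrite [RHS]mxE ?(e0, e1, e2, e3) !(E0, E1, E2, E3) ?subrr ?mulr0 ?oppr0 //.
- rewrite sj Pj cj sinB sinD /sigma1 -/de; ring.
- rewrite Sj sj cj; have -> : cos th = cos (th + de - de) by rewrite addrK.
  rewrite cosD cosB /sigma1 -/de; ring.
Qed.

Lemma sigma1_gt0 : (0 < n)%N -> 0 < sigma1.
Proof.
move=> n0; rewrite /sigma1 mulr_gt0 ?mulr_gt0 ?N_gt0 // sin_gt0_pi // divr_gt0 ?pi_gt0 ?N_gt0 //=.
by rewrite ltr_pdivrMr ?N_gt0 // ltr_pMr ?pi_gt0 // ltr1n ltnS.
Qed.

Lemma sigma1_le : sigma1 <= 2 * pi.
Proof.
rewrite /sigma1 -mulrA ler_pM2l // mulrC -ler_pdivlMr ?N_gt0 //; apply: sin_lex.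
by rewrite divr_ge0 ?pi_ge0 ?ler0n.
Qed.

Section Basis.
Variables (b : 'I_(N * 4) -> loop) (s : 'I_(N * 4) -> R).
Hypothesis b_on : forall i j, ip (b i) (b j) = (i == j)%:R.
Hypothesis bL : forall i, Lop (b i) = s i *: b i.
Hypothesis b_span : forall x, x = \sum_i ip x (b i) *: b i.

Definition actQ x : R := 2^-1 * ip x (Lop x).

Lemma ip_basis x y : ip x y = \sum_i ip x (b i) * ip y (b i).
Proof.
rewrite [in LHS](b_span x) ip_suml; apply: eq_bigr => i _; by rewrite ipZl (ipC (b i)).
Qed.

Lemma ipL_basis x i : ip (Lop x) (b i) = s i * ip x (b i).
Proof. by rewrite Lop_sym bL ipZr. Qed.

Lemma actQ_basis x : actQ x = 2^-1 * \sum_i s i * ip x (b i) ^+ 2.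
Proof.
rewrite /actQ ip_basis; congr (_ * _); apply: eq_bigr => i _.
by rewrite ipL_basis expr2 mulrCA.
Qed.

Definition pr (P : pred 'I_(N * 4)) x : loop := \sum_(i | P i) ip x (b i) *: b i.

Lemma ip_pr P x i : ip (pr P x) (b i) = if P i then ip x (b i) else 0.
Proof.
rewrite /pr ip_suml; case: ifP => Pi.
  rewrite (bigD1 i) //= ipZl b_on eqxx mulr1 big1 ?addr0 // => l /andP[_ li].
  by rewrite ipZl b_on (negbTE li) mulr0.
rewrite big1 // => l Pl; rewrite ipZl b_on (_ : (l == i) = false) ?mulr0 //.
by apply/eqP => li; rewrite -li Pl in Pi.
Qed.

Lemma pr_mean0 (P : pred 'I_(N * 4)) x : (forall i, P i -> s i != 0) -> mean0 (pr P x).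
Proof.
move=> Ps; have -> : pr P x = Lop (\sum_(i | P i) (ip x (b i) / s i) *: b i).
  rewrite linear_sum; apply: eq_bigr => i Pi.
  by rewrite linearZ /= bL scalerA divfK // Ps.
exact: mean0_L.
Qed.

Definition cst (c : 'rV[R]_4) : loop := \matrix_(j, i) c ord0 i.

Lemma Lop_cst c : Lop (cst c) = 0.
Proof.
apply/matrixP => j; have [e0 e1 e2 e3] := LopE (cst c) j.
by apply: ord4P; rewrite ?(e0, e1, e2, e3) !mxE subrr mulr0 ?oppr0.
Qed.

Lemma actQ_cstD c x : actQ (cst c + x) = actQ x.
Proof.
by rewrite /actQ linearD /= Lop_cst add0r ipDl -Lop_sym Lop_cst ip0l add0r.
Qed.

(** A mode with eigenvalue above [K] costs at least [K / 2] times its squared norm in action. *)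
Lemma nL2_pr_high (K : R) x : 0 < K -> (forall i, ip x (b i) != 0 -> 0 < s i) ->
  ip (pr (fun i => K < s i) x) (pr (fun i => K < s i) x) <= 2 / K * actQ x.
Proof.
move=> K0 xp; rewrite ip_basis actQ_basis; set S := \sum_(i < _) s i * _.
have -> : 2 / K * (2^-1 * S) = K^-1 * S by field; rewrite gt_eqF.
rewrite mulr_sumr; apply: ler_sum => i _; rewrite ip_pr.
case: ifP => [Ki|_].
  by rewrite -expr2 mulrA ler_peMl ?sqr_ge0 // mulrC ler_pdivlMr // mul1r ltW.
rewrite mul0r mulr_ge0 ?invr_ge0 ?(ltW K0) //.
have [->|/xp/ltW si] := eqVneq (ip x (b i)) 0; first by rewrite expr0n mulr0.
by rewrite mulr_ge0 ?sqr_ge0.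
Qed.

(** On modes with eigenvalue at most [K], the squared norm of [Lop] is at most [2 * K] times the
    action, and it bounds the supremum of a loop of mean zero. *)
Lemma sup_pr_low (K : R) x j i : 0 < K -> (forall i, ip x (b i) != 0 -> 0 < s i) ->
  pr (fun i => 0 < s i <= K) x j i ^+ 2 <= 2 * K * actQ x.
Proof.
move=> K0 xp; set P := fun i => _; apply: (@le_trans _ _ (ip (Lop (pr P x)) (Lop (pr P x)))).
  by apply: mean0_sup; apply: pr_mean0 => l /andP[s0 _]; rewrite gt_eqF.
rewrite ip_basis actQ_basis; set S := \sum_(i < _) s i * _.
have -> : 2 * K * (2^-1 * S) = K * S by field.
rewrite mulr_sumr; apply: ler_sum => l _; rewrite ipL_basis ip_pr; case: ifP => [/andP[s0 sK]|_].
  rewrite mulrACA -!expr2 [s l ^+ 2]expr2 mulrA ler_wpM2r ?sqr_ge0 // ler_wpM2r // ltW //.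
rewrite mulr0 mul0r mulr_ge0 ?(ltW K0) //.
have [->|/xp/ltW sl] := eqVneq (ip x (b l)) 0; first by rewrite expr0n mulr0.
by rewrite mulr_ge0 ?sqr_ge0.
Qed.

(** The action of positive loops is an H^{1/2} norm and does not bound the supremum, so modes are
    separated at the eigenvalue [40 * C]. The low part stays within [r0 / 2] in supremum. A sample
    outside of the region where [H0 <= 0] therefore has a high part of size at least [r0 / 2], and
    the quadratic growth of [H0] is paid by the L2 norm of the high part. The factor 320 makes this
    cost at most half of the action. *)
Lemma action_sphere (C r0 : R) (H0 : 'rV[R]_4 -> R) (c : 'rV[R]_4) x :
  0 < C -> 0 < r0 -> (forall i, ip x (b i) != 0 -> 0 < s i) ->
  actQ x = r0 ^+ 2 / (320 * C) ->
  (forall y : 'rV[R]_4, H0 y <= C * dot (y - c) (y - c)) ->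
  (forall y : 'rV[R]_4, (forall i, `|y ord0 i - c ord0 i| <= r0) -> H0 y <= 0) ->
  r0 ^+ 2 / (320 * C) / 2 <= actQ (cst c + x) - avg (fun j => H0 (row j (cst c + x))).
Proof.
move=> C0 r00 xp xQ HC Hr; rewrite actQ_cstD xQ; pose K := 40 * C.
have K0 : 0 < K by rewrite mulr_gt0.
pose xl := pr (fun i => 0 < s i <= K) x; pose xh := pr (fun i => K < s i) x.
have xE : x = xl + xh.
  rewrite [LHS]b_span /xl /xh /pr [in RHS]big_mkcond [X in _ + X]big_mkcond -big_split /=.
  apply: eq_bigr => i _; have [->|/xp s0] := eqVneq (ip x (b i)) 0.
    by rewrite !scale0r !if_same addr0.
  by rewrite s0 /=; case: leP; rewrite ?addr0 ?add0r.
have xlb j i : xl j i ^+ 2 <= r0 ^+ 2 / 4.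
  apply: le_trans (sup_pr_low j i K0 xp) _; rewrite xQ /K.
  by rewrite le_eqVlt (_ : 2 * _ * _ = r0 ^+ 2 / 4) ?eqxx //; field; rewrite gt_eqF.
suff : avg (fun j => H0 (row j (cst c + x))) <= r0 ^+ 2 / (320 * C) / 2.
  by set u := r0 ^+ 2 / _; lra.
(* The factor 10 arises from |x|^2 <= 2 |xh|^2 + 2 r0^2 together with r0^2 <= 4 |xh|^2, at the
   samples outside of the small region. *)
apply: (@le_trans _ _ (10 * C * ip xh xh)); last first.
  apply: (@le_trans _ _ (10 * C * (2 / K * actQ x))).
    by rewrite ler_wpM2l ?nL2_pr_high // mulr_ge0 // ltW.
  by rewrite xQ /K le_eqVlt (_ : _ * (_ / _ * _) = r0 ^+ 2 / (320 * C) / 2) ?eqxx //; field; rewrite gt_eqF.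
rewrite /ip -avgZ; apply: ler_avg => j.
have rj i : row j (cst c + x) ord0 i - c ord0 i = x j i by rewrite !mxE addrAC subrr add0r.
have S0 : 0 <= \sum_i xh j i * xh j i by apply: sumr_ge0 => i _; rewrite -expr2 sqr_ge0.
have [allr|] := pselect (forall i, `|x j i| <= r0).
  apply: (@le_trans _ _ 0); first by apply: Hr => i; rewrite rj.
  by rewrite mulr_ge0 // mulr_ge0 // ltW.
move=> /existsNP[i0 /negP]; rewrite -ltNge => big.
apply: le_trans (HC _) _; rewrite [X in _ <= X * _]mulrC -mulrA ler_pM2l //.
have -> : dot (row j (cst c + x) - c) (row j (cst c + x) - c) = \sum_i x j i ^+ 2.
  by apply: eq_bigr => i _; rewrite [(_ - c) _ _]mxE [(- c) _ _]mxE rj expr2.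
have xhb : r0 ^+ 2 <= 4 * xh j i0 ^+ 2.
  have l2 : `|xl j i0| <= r0 / 2.
    rewrite -(@ler_pXn2r _ 2) ?nnegrE ?divr_ge0 ?(ltW r00) // real_normK ?num_real //.
    by apply: le_trans (xlb _ _) _; rewrite expr_div_n; lra.
  have h2 : r0 / 2 <= `|xh j i0|.
    have := ler_normD (xl j i0) (xh j i0); rewrite -[xl j i0 + _](_ : x j i0 = _).
      by move: big l2; lra.
    by rewrite {1}xE mxE.
  have : (r0 / 2) ^+ 2 <= `|xh j i0| ^+ 2.
    by rewrite ler_pXn2r ?nnegrE // divr_ge0 // ltW.
  by rewrite real_normK ?num_real // expr_div_n; lra.
have xhS : xh j i0 ^+ 2 <= \sum_i xh j i * xh j i.
  rewrite (bigD1 i0) //= -expr2 lerDl; apply: sumr_ge0 => i _; by rewrite -expr2 sqr_ge0.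
apply: (@le_trans _ _ (\sum_i (2 * (xh j i * xh j i) + r0 ^+ 2 / 2))).
  apply: ler_sum => i _; have -> : x j i = xl j i + xh j i by rewrite {1}xE mxE.
  have := xlb j i; have := sqr_ge0 (xl j i - xh j i); rewrite sqrrB sqrrD !expr2; lra.
rewrite big_split /= -mulr_sumr sumr_const card_ord -mulr_natr; move: xhb xhS; lra.
Qed.

Definition Qcd (c d : R) (y : 'rV[R]_4) : R :=
  pi * (y ord0 o0 ^+ 2 + y ord0 o1 ^+ 2) / c + pi * (y ord0 o2 ^+ 2 + y ord0 o3 ^+ 2) / d.

(** The loop [eloop] is orthogonal to the nonpositive modes and lies in the z1-plane, where the form
    has coefficient [pi / c]. Its quadratic action is at most [pi * r ^+ 2] times its squared norm,
    so for [la > c] the Hamiltonian wins. *)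
Lemma action_plane (la c d r : R) (H0 : 'rV[R]_4 -> R) v : (0 < n)%N ->
  0 < c -> (forall y : 'rV[R]_4, la * (Qcd c d y - 1) <= H0 y) ->
  (forall i, ip v (b i) != 0 -> s i <= 0) ->
  actQ (v + r *: eloop) - avg (fun j => H0 (row j (v + r *: eloop))) <=
  la - la * avg (fun j => Qcd c d (row j v)) - pi * r ^+ 2 * ip eloop eloop * (la / c - 1).
Proof.
move=> n0 c0 HQ vn.
have ve : ip v eloop = 0.
  rewrite ip_basis big1 // => i _; have [->|/vn si] := eqVneq (ip v (b i)) 0.
    by rewrite mul0r.
  have := ipL_basis eloop i; rewrite Lop_eloop ipZl => /eqP.
  rewrite -subr_eq0 -mulrBl mulf_eq0 => /orP[|/eqP ->]; last by rewrite mulr0.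
  by rewrite gt_eqF // subr_gt0 (le_lt_trans si) // sigma1_gt0.
have Qv : actQ v <= 0.
  rewrite actQ_basis pmulr_rle0 // sumr_le0 // => i _.
  have [->|/vn si] := eqVneq (ip v (b i)) 0; first by rewrite expr0n mulr0.
  by rewrite mulr_le0_ge0 ?sqr_ge0.
have ee0 := ip_ge0 eloop.
have aQ : actQ (v + r *: eloop) <= pi * r ^+ 2 * ip eloop eloop.
  have ev : ip eloop (Lop v) = 0 by rewrite -Lop_sym Lop_eloop ipZl ipC ve mulr0.
  have -> : actQ (v + r *: eloop) = actQ v + r ^+ 2 * ip eloop eloop * sigma1 / 2.
    rewrite /actQ (_ : Lop (v + r *: eloop) = Lop v + (r * sigma1) *: eloop).
      by move: (Lop v) ev => w ev; rewrite !ipDl !ipDr !ipZl !ipZr ev ve; field.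
    by rewrite linearD linearZ /= Lop_eloop scalerA.
  have : r ^+ 2 * ip eloop eloop * sigma1 <= r ^+ 2 * ip eloop eloop * (2 * pi).
    by rewrite ler_wpM2l ?sigma1_le // mulr_ge0 ?sqr_ge0.
  by move: Qv; rewrite /actQ; lra.
have avQ : avg (fun j => Qcd c d (row j (v + r *: eloop))) =
    avg (fun j => Qcd c d (row j v)) + pi / c * r ^+ 2 * ip eloop eloop.
  transitivity (avg (fun j => Qcd c d (row j v)) + (pi / c * r ^+ 2 * ip eloop eloop
     + 2 * r * (pi / c) * ip v eloop)); last by rewrite ve mulr0 addr0.
  rewrite /ip -!avgZ -!avgD; congr avg; apply/funext => j; rewrite !sum4 /Qcd.
  have e2 : eloop j o2 = 0 by rewrite mxE. have e3 : eloop j o3 = 0 by rewrite mxE.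
  have rE i : row j (v + r *: eloop) ord0 i = v j i + r * eloop j i.
    by rewrite mxE mxE [X in _ + X]mxE.
  have rv i : row j v ord0 i = v j i by rewrite mxE.
  by rewrite !rE !rv e2 e3; ring.
have : la * (avg (fun j => Qcd c d (row j (v + r *: eloop))) - 1) <=
    avg (fun j => H0 (row j (v + r *: eloop))).
  rewrite -[X in _ - X](avg_cst n) -avgN -avgD -avgZ; apply: ler_avg => j; exact: HQ.
rewrite avQ => h; apply: (@le_trans _ _ (pi * r ^+ 2 * ip eloop eloop - la *
  (avg (fun j => Qcd c d (row j v)) + pi / c * r ^+ 2 * ip eloop eloop - 1))).
  by rewrite lerB.
by rewrite le_eqVlt; apply/orP; left; apply/eqP; field; rewrite gt_eqF.
Qed.

End Basis.
End Splitting.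

(** * Gradients *)

Section Gradient.
Variable R : realType.

Lemma norm_dot n (u v : 'rV[R]_n) : `|dot u v| <= n%:R * (`|u| * `|v|).
Proof.
rewrite (le_trans (ler_norm_sum _ _ _)) // (@le_trans _ _ (\sum_(i < n) `|u| * `|v|)) //.
  by apply: ler_sum => i _; rewrite normrM ler_pM // le_mx_norm.
by rewrite sumr_const card_ord mulr_natl.
Qed.

Lemma norm_mulmx n m (u : 'rV[R]_n) (M : 'M[R]_(n, m)) : `|u *m M| <= n%:R * (`|u| * `|M|).
Proof.
have h0 : 0 <= n%:R * (`|u| * `|M|) by rewrite mulr_ge0 ?ler0n // mulr_ge0.
apply/(mx_norm_leP _ h0) => i j; rewrite ord1 mxE.
rewrite (le_trans (ler_norm_sum _ _ _)) // (@le_trans _ _ (\sum_(i < n) `|u| * `|M|)) //.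
  by apply: ler_sum => l _; rewrite normrM ler_pM // le_mx_norm.
by rewrite sumr_const card_ord mulr_natl.
Qed.

Definition hasgrad n (f : 'rV[R]_n -> R) (x G : 'rV[R]_n) :=
  forall e : R, 0 < e -> exists2 r : R, 0 < r &
    forall h, `|h| < r -> `|f (x + h) - f x - dot G h| <= e * `|h|.

Lemma small_mult (r K : R) : 0 < r -> 0 <= K -> exists2 t : R, 0 < t & t * K < r.
Proof.
move=> r0 K0; have K1 : 0 < K + 1 by rewrite ltr_wpDl.
exists (r / (K + 1)); first by rewrite divr_gt0.
by rewrite mulrAC ltr_pdivrMr // ltr_pM2l // ltrDl.
Qed.

Lemma hasgrad_uniq n (f : 'rV[R]_n -> R) x G G' : hasgrad f x G -> hasgrad f x G' -> G = G'.
Proof.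
move=> H H'; apply/eqP; rewrite -subr_eq0; apply: contraT => d0.
set D := G - G' in d0 *.
have D0 : 0 < `|D| by rewrite normr_gt0.
have DD : 0 < dot D D by rewrite lt_neqAle dot_ge0 andbT eq_sym; apply: contraNneq d0 => /dot_eq0 ->.
have e0 : 0 < dot D D / (4 * `|D|) by rewrite divr_gt0 ?mulr_gt0.
have [r r0 Hr] := H _ e0; have [r' r'0 Hr'] := H' _ e0.
have m0 : 0 < Num.min r r' by rewrite lt_min r0 r'0.
have [t t0 tm] := small_mult m0 (ltW D0).
have nt : `|t *: D| = t * `|D| by rewrite normrZ gtr0_norm.
move: tm; rewrite lt_min -nt => /andP[/Hr h1 /Hr' h2].
have : `|dot D (t *: D)| <= 2 * (dot D D / (4 * `|D|) * `|t *: D|).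
  rewrite /D dotBl; set u := f _ - f _ in h1 h2 *; set v := dot G _ in h1 *; set w := dot G' _ in h2 *.
  rewrite (_ : v - w = (u - w) - (u - v)); last by ring.
  by apply: le_trans (ler_normB _ _) _; rewrite mulr_natl mulr2n lerD.
rewrite dotZr nt normrM (gtr0_norm t0) (gtr0_norm DD).
rewrite (_ : 2 * _ = t * (dot D D / 2)); last by field; rewrite gt_eqF.
by rewrite ler_pM2l // leNgt ltr_pdivrMr // ltr_pMr // ltr1n.
Qed.

Lemma hasgrad_cst_near n (f : 'rV[R]_n -> R) x r : 0 < r ->
  (forall h, `|h| < r -> f (x + h) = f x) -> hasgrad f x 0.
Proof.
move=> r0 fc e e0; exists r => // h /fc ->.
by rewrite subrr dot0l subrr normr0 mulr_ge0 // ltW.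
Qed.

Lemma hasgradD n (f g : 'rV[R]_n -> R) x G G' : hasgrad f x G -> hasgrad g x G' ->
  hasgrad (fun y => f y + g y) x (G + G').
Proof.
move=> H H' e e0; have e20 : 0 < e / 2 by rewrite divr_gt0.
have [r r0 Hr] := H _ e20; have [r' r'0 Hr'] := H' _ e20.
exists (Num.min r r'); first by rewrite lt_min r0 r'0.
move=> h; rewrite lt_min => /andP[/Hr h1 /Hr' h2]; rewrite dotDl.
rewrite (_ : _ - _ = (f (x + h) - f x - dot G h) + (g (x + h) - g x - dot G' h)); last by ring.
apply: le_trans (ler_normD _ _) _; rewrite [e]splitr mulrDl; exact: lerD.
Qed.

Lemma hasgradZ n (c : R) (f : 'rV[R]_n -> R) x G : hasgrad f x G ->
  hasgrad (fun y => c * f y) x (c *: G).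
Proof.
move=> H e e0; have c0 : 0 < `|c| + 1 by rewrite ltr_wpDl.
have [r r0 Hr] := H _ (divr_gt0 e0 c0); exists r => // h /Hr h1.
rewrite dotZl -!mulrBr normrM.
apply: (@le_trans _ _ (`|c| * (e / (`|c| + 1) * `|h|))); first by rewrite ler_wpM2l.
rewrite mulrA ler_wpM2r // mulrA ler_pdivrMr // mulrC ler_pM2l //.
by rewrite lerDl.
Qed.

(* [g] has a Lipschitz derivative [dg], expressed by its quadratic remainder *)
Definition C11 (g dg : R -> R) (C : R) :=
  0 < C /\ forall u v, 0 <= u -> 0 <= v -> `|g v - g u - dg u * (v - u)| <= C * (v - u) ^+ 2.

Lemma hasgrad_comp n (g dg : R -> R) C (f : 'rV[R]_n -> R) x G : C11 g dg C ->
  (forall y, 0 <= f y) -> hasgrad f x G -> hasgrad (fun y => g (f y)) x (dg (f x) *: G).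
Proof.
move=> [C0 gC] f0 H e e0.
pose L := 1 + n%:R * `|G|; have L0 : 0 < L by rewrite ltr_pwDl // mulr_ge0 ?ler0n.
have [r1 r10 Hr1] := H _ ltr01.
have d0 : 0 < `|dg (f x)| + 1 by rewrite ltr_wpDl.
have e20 : 0 < e / 2 / (`|dg (f x)| + 1) by rewrite !divr_gt0.
have [r2 r20 Hr2] := H _ e20.
have [t t0 tK] := small_mult e0 (ltW (mulr_gt0 (mulr_gt0 (ltr0n R 2%N) C0) (exprn_gt0 2 L0))).
exists (Num.min r1 (Num.min r2 t)); first by rewrite !lt_min r10 r20 t0.
move=> h; rewrite !lt_min => /andP[/Hr1 h1 /andP[/Hr2 h2 ht]].
have Lip : `|f (x + h) - f x| <= L * `|h|.
  have -> : f (x + h) - f x = (f (x + h) - f x - dot G h) + dot G h by rewrite subrK.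
  apply: le_trans (ler_normD _ _) _; rewrite /L mulrDl; apply: lerD => //.
  by rewrite -mulrA norm_dot.
rewrite dotZl; set D := f (x + h) - f x in h1 h2 Lip *.
have -> : g (f (x + h)) - g (f x) - dg (f x) * dot G h =
   (g (f (x + h)) - g (f x) - dg (f x) * D) + dg (f x) * (D - dot G h) by ring.
apply: le_trans (ler_normD _ _) _; rewrite [e]splitr mulrDl; apply: lerD.
  apply: le_trans (gC _ _ (f0 _) (f0 _)) _.
  apply: (@le_trans _ _ (C * (L * `|h|) ^+ 2)).
    rewrite ler_pM2l // -[X in X <= _]real_normK ?num_real // ler_pXn2r ?nnegrE //.
    by rewrite mulr_ge0 // ltW.
  rewrite (_ : C * (L * `|h|) ^+ 2 = C * L ^+ 2 * `|h| * `|h|); last by ring.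
  rewrite ler_wpM2r //.
  apply: (@le_trans _ _ (C * L ^+ 2 * t)).
    by apply: ler_wpM2l; [rewrite mulr_ge0 ?sqr_ge0 // ltW|exact: ltW].
  by rewrite ler_pdivlMr //; move: tK; rewrite mulrC => /ltW; lra.
rewrite normrM; apply: (@le_trans _ _ (`|dg (f x)| * (e / 2 / (`|dg (f x)| + 1) * `|h|))).
  by rewrite ler_wpM2l.
rewrite mulrA ler_wpM2r // mulrA ler_pdivrMr // mulrC ler_pM2l ?divr_gt0 //.
by rewrite lerDl.
Qed.

(** Adding the remainders for (u, v) and (v, u) leaves the product of the increments of [dg] and of
    the argument. *)
Lemma C11_lip (g dg : R -> R) C u v : C11 g dg C -> 0 <= u -> 0 <= v ->
  `|dg v - dg u| <= 2 * C * `|v - u|.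
Proof.
move=> [C0 gC] u0 v0; have [->|nuv] := eqVneq v u; first by rewrite !subrr normr0 mulr0.
have d0 : 0 < `|v - u| by rewrite normr_gt0 subr_eq0.
rewrite -(ler_pM2r d0) -normrM (_ : 2 * C * `|v - u| * `|v - u| = 2 * C * (v - u) ^+ 2); last first.
  by rewrite -[(v - u) ^+ 2]real_normK ?num_real //; ring.
have := lerD (gC u v u0 v0) (gC v u v0 u0).
rewrite -[(u - v) ^+ 2]sqrrN opprB => h.
have -> : (dg v - dg u) * (v - u) =
   (g v - g u - dg u * (v - u)) + (g u - g v - dg v * (u - v)) by ring.
by apply: le_trans (ler_normD _ _) _; move: h; lra.
Qed.

Lemma C11_cts (T : pseudoMetricType R) (g dg : R -> R) C (f : T -> R) x : C11 g dg C ->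
  (forall y, 0 <= f y) -> {for x, continuous f} -> {for x, continuous (fun y => dg (f y))}.
Proof.
move=> gC f0 fc; apply: cts_ball => e e0; have C0 : 0 < 2 * C by rewrite mulr_gt0 // (proj1 gC).
have [d d0 Hd] := ball_cts fc (divr_gt0 e0 C0); exists d => // y /Hd fy.
apply: le_lt_trans (C11_lip gC (f0 y) (f0 x)) _.
by rewrite mulrC -ltr_pdivlMr.
Qed.

End Gradient.

Section QuadraticForm.
Variables (R : realType) (a b : R).
Hypotheses (a0 : 0 < a) (b0 : 0 < b).
Notation rho := (Qcd a b).
Implicit Types y k : 'rV[R]_4.

Definition grho y : 'rV[R]_4 :=
  \row_i (2 * pi / (if (i < 2)%N then a else b) * y ord0 i).

Lemma grhoE y : [/\ grho y ord0 o0 = 2 * pi / a * y ord0 o0, grho y ord0 o1 = 2 * pi / a * y ord0 o1,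
  grho y ord0 o2 = 2 * pi / b * y ord0 o2 & grho y ord0 o3 = 2 * pi / b * y ord0 o3].
Proof. by rewrite /grho !mxE. Qed.

Lemma QcdD y k : rho (y + k) = rho y + dot (grho y) k + rho k.
Proof.
rewrite /Qcd /dot sum4; have [-> -> -> ->] := grhoE y; rewrite !mxE.
by field; rewrite !gt_eqF.
Qed.

Lemma dot_grho y : dot (grho y) y = 2 * rho y.
Proof.
rewrite /Qcd /dot sum4; have [-> -> -> ->] := grhoE y.
by field; rewrite !gt_eqF.
Qed.

Lemma QcdZ t y : rho (t *: y) = t ^+ 2 * rho y.
Proof. by rewrite /Qcd !mxE; ring. Qed.

Lemma Qcd_ge0 y : 0 <= rho y.
Proof.
rewrite /Qcd addr_ge0 // mulr_ge0 ?invr_ge0 ?(ltW a0) ?(ltW b0) // mulr_ge0 ?pi_ge0 //;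
  by rewrite addr_ge0 // sqr_ge0.
Qed.

Lemma Qcd0 : rho 0 = 0. Proof. by rewrite /Qcd !mxE; ring. Qed.

Lemma Qcd_le y : rho y <= (2 * pi / a + 2 * pi / b) * `|y| ^+ 2.
Proof.
have h i : y ord0 i ^+ 2 <= `|y| ^+ 2.
  by rewrite -[X in X <= _]real_normK ?num_real // ler_pXn2r ?nnegrE // le_mx_norm.
have two u v (p : R) : 0 < p -> pi * (y ord0 u ^+ 2 + y ord0 v ^+ 2) / p <= 2 * pi / p * `|y| ^+ 2.
  move=> p0; rewrite (_ : 2 * pi / p * _ = pi * (`|y| ^+ 2 + `|y| ^+ 2) / p); last by ring.
  by rewrite ler_pM2r ?invr_gt0 // ler_pM2l ?pi_gt0 // lerD.
by rewrite mulrDl /Qcd lerD // two.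
Qed.

Lemma sup_le_Qcd y i : y ord0 i ^+ 2 <= (a + b) / pi * rho y.
Proof.
have pi0 := pi_gt0 R.
have s j := sqr_ge0 (y ord0 j).
have p1 (j l : 'I_4) (p : R) : 0 < p -> y ord0 j ^+ 2 <= p / pi * (pi * (y ord0 j ^+ 2 + y ord0 l ^+ 2) / p).
  move=> p0; have -> : p / pi * (pi * (y ord0 j ^+ 2 + y ord0 l ^+ 2) / p) = y ord0 j ^+ 2 + y ord0 l ^+ 2.
    by clear -p0 pi0; move: (@pi R) pi0 => P P0; field; rewrite !gt_eqF.
  by rewrite lerDl.
have q (u v : R) : 0 <= u -> 0 <= v -> a / pi * u <= (a + b) / pi * (u + v) /\
   b / pi * v <= (a + b) / pi * (u + v).
  move=> u0 v0; rewrite ![_ / pi * _]mulrAC !ler_pM2r ?invr_gt0 //.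
  have := mulr_ge0 (ltW a0) u0; have := mulr_ge0 (ltW a0) v0.
  have := mulr_ge0 (ltW b0) u0; have := mulr_ge0 (ltW b0) v0.
  by rewrite !mulrDl !mulrDr; split; lra.
have n1 : 0 <= pi * (y ord0 o0 ^+ 2 + y ord0 o1 ^+ 2) / a.
  by rewrite divr_ge0 ?(ltW a0) // mulr_ge0 ?(ltW pi0) // addr_ge0.
have n2 : 0 <= pi * (y ord0 o2 ^+ 2 + y ord0 o3 ^+ 2) / b.
  by rewrite divr_ge0 ?(ltW b0) // mulr_ge0 ?(ltW pi0) // addr_ge0.
have [qa qb] := q _ _ n1 n2.
move: i; apply: ord4P; rewrite /Qcd.
- exact: le_trans (p1 o0 o1 a a0) qa.
- by apply: le_trans (p1 o1 o0 a a0) _; rewrite [X in pi * X]addrC.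
- exact: le_trans (p1 o2 o3 b b0) qb.
- by apply: le_trans (p1 o3 o2 b b0) _; rewrite [X in pi * X]addrC.
Qed.

Lemma hasgrad_Qcd y : hasgrad rho y (grho y).
Proof.
move=> e e0; pose K := 2 * pi / a + 2 * pi / b.
have K0 : 0 < K by rewrite addr_gt0 // divr_gt0 // mulr_gt0 // pi_gt0.
have [t t0 tK] := small_mult e0 (ltW K0); exists t => // h ht.
rewrite QcdD (_ : _ - _ = rho h); last by ring.
rewrite ger0_norm ?Qcd_ge0 //; apply: le_trans (Qcd_le h) _; rewrite -/K expr2 mulrA.
rewrite ler_wpM2r //; apply: le_trans (ltW tK); rewrite mulrC ler_pM2r // ltW //.
Qed.

Lemma continuous_Qcd : continuous rho.
Proof.
have cl (u v : 'I_4) (p : R) :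
    continuous (fun y : 'rV[R]_4 => pi * (y ord0 u * y ord0 u + y ord0 v * y ord0 v) / p).
  apply: contM; last exact: contC; apply: contM; first exact: contC.
  by apply: contD; apply: contM; exact: coordc.
exact: contD (cl _ _ _) (cl _ _ _).
Qed.

Lemma compact_Qcd (r : R) : compact [set y | rho y <= r].
Proof.
apply: bounded_closed_compact.
  pose K := Num.sqrt ((a + b) / pi * `|r|).
  exists K; split; first exact: num_real.
  move=> M MK y yr; apply: le_trans (ltW MK); apply/mx_norm_leP; first exact: sqrtr_ge0.
  move=> i j; rewrite ord1 -sqrtr_sqr ler_sqrt; last first.
    by rewrite mulr_ge0 // divr_ge0 ?pi_ge0 // addr_ge0 // ltW.
  apply: le_trans (sup_le_Qcd y j) _; rewrite ler_wpM2l ?divr_ge0 ?pi_ge0 ?addr_ge0 ?(ltW a0) ?(ltW b0) //.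
  exact: le_trans yr (ler_norm r).
by apply: (@preimage_closed _ _ rho [set x | x <= r]) => [y _|]; [exact: continuous_Qcd|exact: closed_le].
Qed.

End QuadraticForm.

(** * Inverting a family of symplectic embeddings *)

Section Omega.
Variable R : realType.

(* [u *m Om] is [u] rotated by a quarter turn in each plane *)
Definition Om : 'M[R]_4 := \matrix_(i, j)
  (if (i == o0) && (j == o1) || (i == o2) && (j == o3) then 1 else
   if (i == o1) && (j == o0) || (i == o3) && (j == o2) then -1 else 0).

Lemma OmE (u : 'rV[R]_4) : [/\ (u *m Om) ord0 o0 = - u ord0 o1, (u *m Om) ord0 o1 = u ord0 o0,
  (u *m Om) ord0 o2 = - u ord0 o3 & (u *m Om) ord0 o3 = u ord0 o2].
Proof. by split; rewrite mxE sum4 !mxE /= ?(mulr0, mulr1, addr0, add0r, mulrN1). Qed.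

Lemma Om_sqr : Om *m Om = - 1%:M.
Proof.
apply/row_matrixP => i; rewrite row_mul !rowE; move: (delta_mx 0 i : 'rV[R]_4) => u.
rewrite -mulmxA mulmxN mulmx1 mulmxA; have [e0 e1 e2 e3] := OmE (u *m Om).
have [f0 f1 f2 f3] := OmE u; apply/rowP => j; rewrite [RHS]mxE; move: j.
by apply: ord4P; rewrite ?(e0, e1, e2, e3) ?(f0, f1, f2, f3).
Qed.

Lemma Om_tr : Om^T = - Om.
Proof.
by apply/matrixP; apply: ord4P; apply: ord4P; rewrite !mxE /= ?opprK ?oppr0.
Qed.

Lemma dot_Om (u : 'rV[R]_4) : dot (u *m Om) u = 0.
Proof. by rewrite /dot sum4; have [-> -> -> ->] := OmE u; ring. Qed.

Lemma dot_OmC (u v : 'rV[R]_4) : dot (u *m Om) v = - dot (v *m Om) u.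
Proof. by rewrite dot_mulmx Om_tr mulmxN dotNr dotC. Qed.

Lemma dot_Om_Om (u v : 'rV[R]_4) : dot (u *m Om) (v *m Om) = dot u v.
Proof. by rewrite dot_mulmx Om_tr -mulmxA mulmxN Om_sqr opprK mulmx1. Qed.

(** The inverse of a symplectic matrix is its transpose up to quarter turns; inverse Jacobians are
    thus explicit in the Jacobians. *)
Lemma symp_inv (A : 'M[R]_4) : A *m Om *m A^T = Om ->
  [/\ A *m (- (Om *m A^T *m Om)) = 1%:M, - (Om *m A^T *m Om) *m A = 1%:M &
      (- (Om *m A^T *m Om))^T = - (Om *m A *m Om)].
Proof.
move=> E; have E1 : A *m (- (Om *m A^T *m Om)) = 1%:M.
  by rewrite mulmxN !mulmxA E Om_sqr opprK.
split => //; first exact: mulmx1C.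
by rewrite linearN /= !trmx_mul trmxK Om_tr !mulNmx !mulmxN !mulmxA opprK.
Qed.

End Omega.

Section Inverse.
Variables (R : realType) (a b : R).
Hypotheses (a0 : 0 < a) (b0 : 0 < b).
Notation rho := (Qcd a b).
Notation R4 := 'rV[R]_4.
Variables (phi : R * R -> R4 -> R4) (A : R * R -> R4 -> 'M[R]_4).
Hypothesis phi_cont : forall z y, rho y < 1 ->
  {for (z, y), continuous (fun p : (R * R) * R4 => phi p.1 p.2)}.
Hypothesis phi_diff : forall z y (e : R), rho y < 1 -> 0 < e -> exists2 r : R, 0 < r &
  forall h, `|h| < r -> `|phi z (y + h) - phi z y - h *m A z y| <= e * `|h|.
Hypothesis A_symp : forall z y, rho y < 1 -> A z y *m Om R *m (A z y)^T = Om R.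
Hypothesis phi_inj : forall z y y', rho y < 1 -> rho y' < 1 -> phi z y = phi z y' -> y = y'.

Lemma phi_near z0 y0 (e : R) : rho y0 < 1 -> 0 < e -> exists2 de : R, 0 < de &
  forall z y, ball z0 de z -> `|y0 - y| < de -> `|phi z0 y0 - phi z y| < e.
Proof.
move=> ry e0; have /cvgrPdist_lt /(_ _ e0) /nbhs_ballP[de /= de0 H] := @phi_cont z0 y0 ry.
exists de => // z y zz yy; apply: (H (z, y)); split => //=.
by rewrite -ball_normE.
Qed.

Lemma rho_near y0 (r : R) : rho y0 < r -> exists2 s : R, 0 < s &
  forall y, `|y0 - y| <= s -> rho y < r.
Proof.
move=> ry; have r0 : 0 < r - rho y0 by rewrite subr_gt0.
have /cvgrPdist_lt /(_ _ r0) /nbhs_ballP[s /= s0 H] := @continuous_Qcd R a b y0.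
exists (s / 2) => [|y ys]; first by rewrite divr_gt0.
have /H : ball y0 s y by rewrite -ball_normE /ball_ /= (le_lt_trans ys) //; lra.
by rewrite distrC ltr_norml => /andP[_]; lra.
Qed.

Lemma ball_compact (y0 : R4) (s : R) (T : set R) : closed T -> (forall t, T t -> t <= s) ->
  compact [set y | T `|y0 - y|].
Proof.
move=> cT Ts; have nc : continuous (fun y : R4 => `|y0 - y|).
  move=> y; apply: continuous_comp; last exact: norm_continuous.
  by apply: (@contB R _ _ (fun _ => y0) id); [exact: contC|move=> ?; exact: cvg_id].
apply: bounded_closed_compact.
  exists (`|y0| + s); split; first exact: num_real.
  move=> M MK y /Ts ys; apply: le_trans (ltW MK).
  by rewrite -[y](subKr y0) (le_trans (ler_normB _ _)) // lerD2l.
by apply: (@preimage_closed _ _ (fun y : R4 => `|y0 - y|) T) => [y _|//]; exact: nc.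
Qed.

Lemma phi_cvg z (y : R4) : rho y < 1 -> {for y, continuous (phi z)}.
Proof.
move=> yB; apply: cts_ball => e e0; have [de de0 Hde] := @phi_near z y _ yB e0.
exists de => // y' yy' /=; apply: Hde; first exact: ballxx.
by move: yy'; rewrite -ball_normE.
Qed.

Lemma dist_cont z x (y : R4) : rho y < 1 ->
  {for y, continuous (fun y => dot (phi z y - x) (phi z y - x))}.
Proof.
move=> yB; have pc : {for y, continuous (fun y => phi z y - x)}.
  by apply: continuousB; [exact: phi_cvg|exact: cst_continuous].
exact: (cvg_dot pc pc).
Qed.

(* At an interior minimum of |phi_z - x|^2 the differential, being invertible, forces phi_z = x. *)
Lemma open_inv z0 y0 (r : R) : rho y0 < 1 -> 0 < r -> exists2 de : R, 0 < de &
  forall z x, ball z0 de z -> `|phi z0 y0 - x| < de ->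
    exists y, [/\ `|y0 - y| < r, rho y < 1 & phi z y = x].
Proof.
move=> ry r0; have [r1 r10 Hr1] := rho_near ry.
pose s := Num.min (r / 2) r1; have s0 : 0 < s by rewrite lt_min r10 divr_gt0.
have sr : s < r by rewrite gt_min; apply/orP; left; lra.
have Bin y : `|y0 - y| <= s -> rho y < 1.
  by move=> ys; apply: Hr1; rewrite (le_trans ys) // ge_min lexx orbT.
set p0 := phi z0 y0.
have cS : compact [set y : R4 | [set t | t = s] `|y0 - y|].
  by apply: (@ball_compact _ s) => [|t ->//]; exact: closed_eq.
(* By injectivity the sphere of radius [s] around [y0] is mapped away from [p0], uniformly for [z]
   near [z0]. This is what keeps the minimum over the ball off its boundary. *)
have [et et0 Het] : exists2 et : R, 0 < et & forall e y, 0 < e < et -> `|y0 - y| = s ->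
    forall z, ball z0 e z -> e <= `|p0 - phi z y|.
  apply: (@compact_scale R _ _ (fun e y => forall z, ball z0 e z -> e <= `|p0 - phi z y|) cS).
  move=> y /= ys; have yB : rho y < 1 by apply: Bin; rewrite ys.
  have d0 : 0 < `|p0 - phi z0 y|.
    rewrite normr_gt0 subr_eq0; apply/eqP => E.
    have yy : y0 = y by apply: (phi_inj ry yB E).
    by move: ys s0; rewrite yy subrr normr0 => <-; rewrite ltxx.
  have d20 : 0 < `|p0 - phi z0 y| / 2 by rewrite divr_gt0.
  have [de de0 Hde] := @phi_near z0 y _ yB d20.
  exists (Num.min de (`|p0 - phi z0 y| / 2)); first by rewrite lt_min de0 d20.
  move=> e y'; rewrite lt_min => /andP[e0 /andP[ede ed]] yy' z zz.
  have yy : `|y - y'| < de.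
    by move: yy'; rewrite -ball_normE /ball_ /= lt_min => /andP[].
  have h1 := Hde z y' (le_ball (ltW ede) zz) yy.
  have := ler_distD (phi z y') p0 (phi z0 y); rewrite [`|phi z y' - _|]distrC.
  by move: h1 ed; lra.
pose eta := et / 2; have eta0 : 0 < eta by rewrite divr_gt0.
have eta1 : 0 < eta < et by rewrite eta0 /= /eta; lra.
have e80 : 0 < eta / 8 by rewrite divr_gt0.
have [d1 d10 Hd1] := @phi_near z0 y0 _ ry e80.
exists (Num.min (eta / 8) d1); first by rewrite lt_min e80 d10.
move=> z x zz; rewrite lt_min => /andP[x1 _].
have zd1 : ball z0 d1 z by apply: le_ball zz; rewrite ge_min lexx orbT.
have ze : ball z0 eta z by apply: le_ball zz; rewrite ge_min; apply/orP; left; lra.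
pose f y := dot (phi z y - x) (phi z y - x).
have cB : compact [set y : R4 | [set t | t <= s] `|y0 - y|].
  by apply: (@ball_compact _ s) => [|t //]; exact: closed_le.
have B0 : [set y : R4 | [set t | t <= s] `|y0 - y|] !=set0.
  by exists y0; rewrite /= subrr normr0 ltW.
have fc : {within [set y : R4 | [set t | t <= s] `|y0 - y|], continuous f}.
  apply: continuous_in_subspaceT => y; rewrite inE => /= /Bin yB.
  exact: dist_cont.
have [y1 y1B y1min] := compact_EVT_min B0 cB fc.
move: y1B; rewrite inE /= => y1s.
have y1in : `|y0 - y1| < s.
  rewrite lt_neqAle y1s andbT; apply/eqP => E.
  have h1 := Het eta y1 eta1 E z ze.
  have fy0 : f y1 <= f y0 by apply: y1min; rewrite inE /= subrr normr0 ltW.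
  have low : (eta * (7 / 8)) ^+ 2 <= f y1.
    have e78 : 0 <= eta * (7 / 8) by move: eta0; lra.
    apply: le_trans (norm_le_dot _); rewrite ler_pXn2r ?nnegrE //.
    have := ler_distD x p0 (phi z y1); rewrite [`|x - _|]distrC.
    by move: h1 x1; lra.
  have hi : f y0 <= eta ^+ 2 / 4.
    have n1 : `|phi z y0 - x| <= eta / 4.
      have h2 : `|p0 - phi z y0| < eta / 8.
        by apply: Hd1 => //; rewrite subrr normr0.
      have := ler_distD p0 (phi z y0) x; rewrite [`|phi z y0 - p0|]distrC.
      by move: h2 x1; lra.
    apply: le_trans (ler_norm _) _; apply: le_trans (norm_dot _ _) _.
    have : `|phi z y0 - x| * `|phi z y0 - x| <= (eta / 4) * (eta / 4) by rewrite ler_pM.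
    rewrite expr2; lra.
  have : (eta * (7 / 8)) ^+ 2 <= eta ^+ 2 / 4 by apply: le_trans low _; apply: le_trans fy0 hi.
  have : 0 < eta ^+ 2 by rewrite exprn_gt0.
  rewrite (_ : (eta * (7 / 8)) ^+ 2 = 49 / 64 * eta ^+ 2); last by field.
  by move: (eta ^+ 2) => E2; lra.
have ry1 : rho y1 < 1 by apply: Bin.
exists y1; split => //; first exact: lt_trans y1in sr.
apply/eqP; rewrite -subr_eq0; apply: contraT => w0.
set w := phi z y1 - x in w0 *; pose W := `|w|.
have W0 : 0 < W by rewrite normr_gt0.
have [_ BA _] := symp_inv (A_symp z ry1).
(* The differential maps [u] to [w], so moving from [y1] in the direction [- u] decreases the
   distance at first order. *)
set B := - _ in BA; pose u := w *m B.
have uA : u *m A z y1 = w by rewrite -mulmxA BA mulmx1.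
have U1 : 0 < 16 * (`|u| + 1) by rewrite mulr_gt0 // ltr_wpDl.
pose e := W / (16 * (`|u| + 1)); have e0 : 0 < e by rewrite divr_gt0.
have eu : e * `|u| <= W / 16.
  rewrite /e mulrAC ler_pdivrMr // (_ : W / 16 * _ = W * (`|u| + 1)); last by field.
  by rewrite ler_pM2l // lerDl.
have [rd rd0 Hrd] := phi_diff z ry1 e0.
have sl0 : 0 < s - `|y0 - y1| by rewrite subr_gt0.
have m0 : 0 < Num.min rd (s - `|y0 - y1|) by rewrite lt_min rd0.
have [t1 t10 Ht1] := small_mult m0 (normr_ge0 u).
pose t := Num.min t1 (1 / 32); have t0 : 0 < t by rewrite lt_min t10; lra.
have tu : `|(- t) *: u| = t * `|u| by rewrite normrZ normrN gtr0_norm.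
have tum : t * `|u| < Num.min rd (s - `|y0 - y1|).
  by apply: le_lt_trans Ht1; rewrite ler_wpM2r // ge_min lexx.
have t32 : t <= 1 / 32 by rewrite ge_min lexx orbT.
move: (tum); rewrite lt_min => /andP[tr ts].
have Hd := Hrd ((- t) *: u); rewrite tu in Hd; have {}Hd := Hd tr.
set q := _ - _ in Hd; have qb : `|q| <= t * (W / 16).
  by apply: le_trans Hd _; rewrite mulrCA ler_pM2l.
have fE : phi z (y1 + (- t) *: u) - x = w + ((- t) *: w + q).
  by rewrite /q -scalemxAl uA /w; apply/rowP => i; rewrite !mxE; ring.
have inB : (y1 + (- t) *: u) \in [set y : R4 | [set t | t <= s] `|y0 - y|].
  rewrite inE /= opprD addrA; apply: le_trans (ler_normB _ _) _; rewrite tu.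
  by move: ts; lra.
set v := - t *: w + q in fE.
have h : dot w w <= dot w w + 2 * dot w v + dot v v.
  by rewrite -dot_sqrD -fE; exact: (y1min _ inB).
have ww : W ^+ 2 <= dot w w by exact: norm_le_dot.
have vb : `|v| <= 2 * (t * W).
  apply: le_trans (ler_normD _ _) _; rewrite normrZ normrN gtr0_norm // -/W.
  by have := mulr_gt0 t0 W0; move: qb; rewrite mulrA; lra.
have wv : dot w v <= - (t * W ^+ 2) + t * W ^+ 2 / 4.
  rewrite /v dotDr dotZr; have h1 : dot w q <= t * W ^+ 2 / 4.
    apply: le_trans (ler_norm _) _; apply: le_trans (norm_dot _ _) _.
    have : `|w| * `|q| <= W * (t * (W / 16)) by rewrite ler_wpM2l.
    by rewrite expr2 mulrA; lra.
  have : t * W ^+ 2 <= t * dot w w by rewrite ler_pM2l.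
  by move: h1; lra.
have vv : dot v v <= 16 * (t * W) ^+ 2.
  apply: le_trans (ler_norm _) _; apply: le_trans (norm_dot _ _) _.
  have : `|v| * `|v| <= (2 * (t * W)) * (2 * (t * W)) by rewrite ler_pM.
  by rewrite expr2; lra.
have tW : 0 < t * W ^+ 2 by rewrite mulr_gt0 // exprn_gt0.
have t2 : 16 * (t * W) ^+ 2 <= t * W ^+ 2 / 2.
  rewrite exprMn (_ : 16 * _ = 16 * t * (t * W ^+ 2)); last by rewrite [t ^+ 2]expr2; ring.
  have : t * (t * W ^+ 2) <= 1 / 32 * (t * W ^+ 2) by rewrite ler_pM2r.
  lra.
exfalso; move: h wv vv t2 tW; move: (dot w w) (dot w v) (dot v v) (t * W ^+ 2) ((t * W) ^+ 2) => x1' x2' x3' x4' x5'; lra.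
Qed.

Definition inim z x := exists2 y, rho y < 1 & phi z y = x.
Definition Yv z x : R4 := xget 0 [set y | rho y < 1 /\ phi z y = x].

Lemma YvP z y : rho y < 1 -> Yv z (phi z y) = y.
Proof.
move=> ry; rewrite /Yv; case: xgetP => [y' _ [ry' E]|/(_ y) H]; first exact: phi_inj E.
by exfalso; apply: H.
Qed.

(* push-forward by [phi z], extended by [w0] outside of the image of the open ellipsoid *)
Definition pull (W : Type) (Ga : R * R -> R4 -> W) (w0 : W) z x : W :=
  if pselect (inim z x) then Ga z (Yv z x) else w0.

Lemma pull_im (W : Type) (Ga : R * R -> R4 -> W) w0 z y : rho y < 1 ->
  pull Ga w0 z (phi z y) = Ga z y.
Proof. by move=> ry; rewrite /pull YvP //; case: pselect => // H; exfalso; apply: H; exists y. Qed.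

Lemma pull_out (W : Type) (Ga : R * R -> R4 -> W) w0 z x : ~ inim z x -> pull Ga w0 z x = w0.
Proof. by move=> nx; rewrite /pull; case: pselect. Qed.

(** The sublevel sets of [rho] below 1 are compact, so their images stay away from any point outside
    of the image. No information on the boundary of the image is required. *)
Lemma compact_away z0 x0 (r1 : R) : r1 < 1 -> ~ inim z0 x0 -> exists2 de : R, 0 < de &
  forall z x, ball z0 de z -> `|x0 - x| < de -> forall y, rho y <= r1 -> phi z y <> x.
Proof.
move=> r11 nx.
have [et et0 Het] : exists2 et : R, 0 < et & forall e y, 0 < e < et -> rho y <= r1 ->
    forall z, ball z0 e z -> e <= `|x0 - phi z y|.
  apply: (@compact_scale R _ _ (fun e y => forall z, ball z0 e z -> e <= `|x0 - phi z y|)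
    (compact_Qcd a0 b0 (r := r1))) => y /= yr.
  have yB : rho y < 1 by apply: le_lt_trans yr r11.
  have d0 : 0 < `|x0 - phi z0 y|.
    by rewrite normr_gt0 subr_eq0; apply/eqP => E; apply: nx; exists y.
  have d20 : 0 < `|x0 - phi z0 y| / 2 by rewrite divr_gt0.
  have [de de0 Hde] := @phi_near z0 y _ yB d20.
  exists (Num.min de (`|x0 - phi z0 y| / 2)); first by rewrite lt_min de0 d20.
  move=> e y'; rewrite lt_min => /andP[e0 /andP[ede ed]] yy' z zz.
  have yy : `|y - y'| < de.
    by move: yy'; rewrite -ball_normE /ball_ /= lt_min => /andP[].
  have h1 := Hde z y' (le_ball (ltW ede) zz) yy.
  have := ler_distD (phi z y') x0 (phi z0 y); rewrite [`|phi z y' - _|]distrC.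
  by move: h1 ed; lra.
have e20 : 0 < et / 2 by rewrite divr_gt0.
exists (et / 2) => // z x zz xx y yr E.
have := Het (et / 2) y _ yr z zz; rewrite E e20 /= => /(_ _) h.
by have := h ltac:(lra); rewrite leNgt xx.
Qed.

(** Close to a point outside of the image only values at [r1 <= rho] occur, and these already equal
    the default [w0]. *)
Lemma pull_cont (W : normedModType R) (Ga : R * R -> R4 -> W) w0 (r1 : R) : r1 < 1 ->
  (forall z y, rho y < 1 -> {for (z, y), continuous (fun p : (R * R) * R4 => Ga p.1 p.2)}) ->
  (forall z y, r1 <= rho y -> rho y < 1 -> Ga z y = w0) ->
  continuous (fun p : (R * R) * R4 => pull Ga w0 p.1 p.2).
Proof.
move=> r11 Gc Gout [z0 x0]; apply: cts_ball => e e0 /=.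
have [[y0 ry0 <-]|nx] := pselect (inim z0 x0).
  have [d1 d10 Hd1] := ball_cts (@Gc z0 y0 ry0) e0.
  have [d2 d20 Hd2] := @open_inv z0 y0 d1 ry0 d10.
  exists (Num.min d1 d2); first by rewrite lt_min d10 d20.
  move=> [z x] [/= zz xx].
  have [||y [yy ry <-]] := Hd2 z x.
  - by apply: le_ball zz; rewrite ge_min lexx orbT.
  - by move: xx; rewrite -ball_normE /ball_ /= lt_min => /andP[].
  rewrite !pull_im //; apply: (Hd1 (z, y)); split => /=.
    by apply: le_ball zz; rewrite ge_min lexx.
  by rewrite -ball_normE.
have [de de0 Hde] := compact_away r11 nx; exists de => // -[z x] [/= zz xx].
rewrite (pull_out _ _ nx); have [[y ry E]|nx'] := pselect (inim z x).
  rewrite -E pull_im // Gout ?subrr ?normr0 //; rewrite leNgt; apply/negP => yr.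
  by apply: (Hde z x zz _ y (ltW yr) E); move: xx; rewrite -ball_normE.
by rewrite pull_out // subrr normr0.
Qed.

(** Openness provides [k]. Differentiability of [phi z] first bootstraps a linear bound of [k] by
    [h], and then gives the error; [e1 <= 1 / (2 * C)] serves the first purpose, the other term the
    second. *)
Lemma inverse_diff z y (e : R) : rho y < 1 -> 0 < e -> exists2 r : R, 0 < r &
  forall h, `|h| < r -> exists k, [/\ rho (y + k) < 1, phi z (y + k) = phi z y + h &
    `|k - h *m (- (Om R *m (A z y)^T *m Om R))| <= e * `|h|].
Proof.
move=> ry e0; have [AB BA _] := symp_inv (A_symp z ry); set B := - _ in AB BA *.
pose C := 4 * (`|B| + 1); have C0 : 0 < C by rewrite mulr_gt0 // ltr_wpDl.
have BC (v : R4) : `|v *m B| <= C * `|v|.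
  apply: le_trans (norm_mulmx _ _) _; rewrite /C -mulrA ler_pM2l // mulrC ler_wpM2r //.
  by rewrite lerDl.
pose e1 := Num.min (1 / (2 * C)) (e / (2 * C ^+ 2)).
have e10 : 0 < e1 by rewrite lt_min !divr_gt0 // mulr_gt0 // exprn_gt0.
have [r1 r10 Hr1] := phi_diff z ry e10.
have [de de0 Hde] := @open_inv z y r1 ry r10.
exists de => // h hd.
have [||y' [yy ry' E]] := Hde z (phi z y + h); first exact: ballxx.
  by rewrite opprD addrA subrr sub0r normrN.
exists (y' - y); rewrite addrC subrK; split => //.
have kr : `|y' - y| < r1 by rewrite distrC.
have := Hr1 _ kr; rewrite [y + (y' - y)]addrC subrK E [phi z y + h]addrC addrK.
set k := y' - y; set q := _ - _ => qb.
have kE : k = h *m B - q *m B.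
  by rewrite -mulmxBl /q opprB addrC subrK -mulmxA AB mulmx1.
have e1C : C * e1 <= 1 / 2.
  have : e1 <= 1 / (2 * C) by rewrite ge_min lexx.
  rewrite -(ler_pM2l C0) => /le_trans; apply.
  by rewrite le_eqVlt (_ : C * _ = 1 / 2) ?eqxx //; field; rewrite gt_eqF.
have k2 : `|k| <= 2 * (C * `|h|).
  have : `|k| <= C * `|h| + 1 / 2 * `|k|.
    rewrite {1}kE; apply: le_trans (ler_normB _ _) _; apply: lerD (BC _) _.
    apply: le_trans (BC _) _; apply: (@le_trans _ _ (C * (e1 * `|k|))); first by rewrite ler_pM2l.
    by rewrite mulrA ler_wpM2r.
  by lra.
rewrite (_ : k - h *m B = - (q *m B)); last by rewrite kE addrAC subrr add0r.
rewrite normrN; apply: le_trans (BC _) _.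
apply: (@le_trans _ _ (C * (e1 * (2 * (C * `|h|))))).
  by rewrite ler_pM2l //; apply: le_trans qb _; rewrite ler_pM2l.
have : e1 <= e / (2 * C ^+ 2) by rewrite ge_min lexx orbT.
rewrite ler_pdivlMr ?mulr_gt0 ?exprn_gt0 // => h1.
rewrite (_ : C * _ = e1 * (2 * C ^+ 2) * `|h|); last by ring.
by rewrite ler_wpM2r.
Qed.

(** A gradient is transported by the inverse transpose of the Jacobian, which equals
    [- (Om R *m A z y *m Om R)] in the symplectic case. *)
Lemma pull_grad (f : R4 -> R) (G0 : R4 -> R4) (f0 r1 : R) : r1 < 1 ->
  (forall y, hasgrad f y (G0 y)) -> (forall y, r1 <= rho y -> f y = f0) ->
  forall z x, hasgrad (pull (fun _ => f) f0 z) x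
    (pull (fun z y => G0 y *m (- (Om R *m A z y *m Om R))) 0 z x).
Proof.
move=> r11 fG fout z x; have [[y ry <-]|nx] := pselect (inim z x); last first.
  have [de de0 Hde] := compact_away r11 nx.
  rewrite (pull_out _ _ nx); apply: (hasgrad_cst_near de0) => h hd.
  rewrite (pull_out _ _ nx); have [[y ry E]|nx'] := pselect (inim z (x + h)); last by rewrite pull_out.
  rewrite -E pull_im // fout // leNgt; apply/negP => yr.
  apply: (Hde z (x + h) (ballxx _ de0) _ y (ltW yr) E).
  by rewrite opprD addrA subrr sub0r normrN.
rewrite pull_im // => e e0; have [_ BA BT] := symp_inv (A_symp z ry).
set B := - _ in BA BT; rewrite -BT.
pose K := 1 + `|B| * 4; have K0 : 0 < K by rewrite ltr_pwDl // mulr_ge0.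
have e20 : 0 < e / (2 * (K + 1)) by rewrite divr_gt0 // mulr_gt0 // ltr_wpDl // ltW.
have [r2 r20 Hr2] := fG y _ e20.
have g40 : 0 < e / (2 * (4 * (`|G0 y| + 1))) by rewrite divr_gt0 // !mulr_gt0 // ltr_wpDl.
pose e3 := Num.min 1 (e / (2 * (4 * (`|G0 y| + 1)))).
have e30 : 0 < e3 by rewrite lt_min ltr01.
have [r3 r30 Hr3] := @inverse_diff z y e3 ry e30.
exists (Num.min r3 (r2 / (K + 1))).
  by rewrite lt_min r30 divr_gt0 // ltr_wpDl // ltW.
move=> h; rewrite lt_min => /andP[h3 h2]; have [k [rk Ek kb]] := Hr3 h h3.
rewrite -Ek !pull_im //.
have kh : `|k| <= (K + 1) * `|h|.
  rewrite -[k](subrK (h *m B)); apply: le_trans (ler_normD _ _) _.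
  have h1 : `|k - h *m B| <= 1 * `|h|.
    by apply: le_trans kb _; rewrite ler_wpM2r // ge_min lexx.
  have := norm_mulmx h B; move: h1; rewrite /K; have := normr_ge0 h; lra.
have kr2 : `|k| < r2.
  by apply: le_lt_trans kh _; rewrite mulrC -ltr_pdivlMr // ltr_wpDl // ltW.
have := Hr2 k kr2; set D := f (y + k) - f y => Dk.
have -> : D - dot (G0 y *m B^T) h = (D - dot (G0 y) k) + dot (G0 y) (k - h *m B).
  have E : dot (G0 y) (h *m B) = dot (G0 y *m B^T) h by rewrite [LHS]dotC [LHS]dot_mulmx [LHS]dotC.
  by rewrite dotBr E; ring.
apply: le_trans (ler_normD _ _) _; rewrite [e]splitr mulrDl; apply: lerD.
  apply: le_trans Dk _; apply: (@le_trans _ _ (e / (2 * (K + 1)) * ((K + 1) * `|h|))).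
    by rewrite ler_pM2l.
  rewrite le_eqVlt (_ : _ / _ * _ = e / 2 * `|h|) ?eqxx //.
  by field; rewrite gt_eqF // ltr_wpDl // ltW.
apply: le_trans (norm_dot _ _) _.
apply: (@le_trans _ _ (4 * ((`|G0 y| + 1) * (e / (2 * (4 * (`|G0 y| + 1))) * `|h|)))).
  rewrite ler_pM2l // ler_pM //; first by rewrite lerDl.
  by apply: le_trans kb _; rewrite ler_wpM2r // ge_min lexx orbT.
rewrite le_eqVlt (_ : 4 * _ = e / 2 * `|h|) ?eqxx //.
by field; rewrite gt_eqF // ltr_wpDl.
Qed.

End Inverse.

(** * Hamiltonians *)

Section Profiles.
Variable R : realType.

Definition pos (u : R) : R := Num.max 0 u.

Lemma pos_ge0 u : 0 <= pos u. Proof. by rewrite le_max lexx. Qed.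
Lemma posE u : 0 <= u -> pos u = u. Proof. by move=> h; apply/max_idPr. Qed.
Lemma pos0 u : u <= 0 -> pos u = 0. Proof. by move=> h; apply/max_idPl. Qed.

Lemma pos_sqr (u v : R) : `|pos v ^+ 2 - pos u ^+ 2 - 2 * pos u * (v - u)| <= (v - u) ^+ 2.
Proof.
have s0 := sqr_ge0 (v - u).
have [u0|u0] := leP 0 u; have [v0|v0] := leP 0 v; rewrite ?(posE u0) ?(posE v0) ?(pos0 (ltW u0)) ?(pos0 (ltW v0)).
- by rewrite (_ : _ - _ - _ = (v - u) ^+ 2); [rewrite ger0_norm|ring].
- rewrite ler_norml; apply/andP; split; nra.
- rewrite ler_norml; apply/andP; split; nra.
- by rewrite expr0n /= subrr !mulr0 mul0r subr0 normr0.
Qed.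

(** A quadratic spline rising from 0 to 1 on the unit interval: regular enough for [C11], and convex
    up to 1/2. *)
Definition step (u : R) : R := 2 * pos u ^+ 2 - 4 * pos (u - 1/2) ^+ 2 + 2 * pos (u - 1) ^+ 2.
Definition dstep (u : R) : R := 4 * pos u - 8 * pos (u - 1/2) + 4 * pos (u - 1).

Lemma step_low u : u <= 0 -> step u = 0 /\ dstep u = 0.
Proof. by move=> h; rewrite /step /dstep !pos0; [split; lra|lra..]. Qed.

Lemma step_mid1 u : 0 <= u -> u <= 1/2 -> step u = 2 * u ^+ 2 /\ dstep u = 4 * u.
Proof. by move=> h h'; rewrite /step /dstep (posE h) !(@pos0 (_ - _)); [split; lra|lra..]. Qed.

Lemma step_mid2 u : 1/2 <= u -> u <= 1 -> step u = 1 - 2 * (1 - u) ^+ 2 /\ dstep u = 4 * (1 - u).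
Proof.
move=> h h'; rewrite /step /dstep posE; last by lra.
by rewrite posE ?pos0; [split; lra|lra..].
Qed.

Lemma step_high u : 1 <= u -> step u = 1 /\ dstep u = 0.
Proof. by move=> h; rewrite /step /dstep !posE; [split; lra|lra..]. Qed.

Lemma step_itv u : 0 <= step u <= 1 /\ 0 <= dstep u.
Proof.
have [h|h] := leP u 0; first by have [-> ->] := step_low h; rewrite !lexx ler01.
have [h'|h'] := leP u (1/2).
  have [-> ->] := step_mid1 (ltW h) h'; have := sqr_ge0 u; split; last by lra.
  by apply/andP; split; [lra|nra].
have [h2|h2] := leP u 1.
  have [-> ->] := step_mid2 (ltW h') h2; split; last by lra.
  by have := sqr_ge0 (1 - u); move=> s0; apply/andP; split; [nra|lra].
by have [-> ->] := step_high (ltW h2); rewrite lexx ler01.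
Qed.

Lemma step_half u : step u < 1/2 -> u < 1/2.
Proof.
move=> s; rewrite ltNge; apply/negP => h; move: s.
have [h2|h2] := leP u 1; last by have [-> _] := step_high (ltW h2); lra.
have [-> _] := step_mid2 h h2; nra.
Qed.

Lemma C11_step_affine (k u0 w : R) : 0 < k -> 0 < w ->
  C11 (fun u => k * step ((u - u0) / w)) (fun u => k / w * dstep ((u - u0) / w)) (k * 8 / w ^+ 2).
Proof.
move=> k0 w0; split; first by rewrite divr_gt0 ?mulr_gt0 ?exprn_gt0.
move=> u v _ _; set p := (u - u0) / w; set q := (v - u0) / w.
have pq : q - p = (v - u) / w by rewrite /p /q; field; rewrite gt_eqF.
have key : `|step q - step p - dstep p * (q - p)| <= 8 * (q - p) ^+ 2.
  have h1 := pos_sqr p q; have h2 := pos_sqr (p - 1/2) (q - 1/2); have h3 := pos_sqr (p - 1) (q - 1).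
  rewrite (_ : q - 1/2 - (p - 1/2) = q - p) in h2; last by ring.
  rewrite (_ : q - 1 - (p - 1) = q - p) in h3; last by ring.
  set D1 := _ - _ in h1; set D2 := _ - _ in h2; set D3 := _ - _ in h3.
  have -> : step q - step p - dstep p * (q - p) = 2 * D1 - 4 * D2 + 2 * D3.
    by rewrite /step /dstep /D1 /D2 /D3; ring.
  move: h1 h2 h3; move: D1 D2 D3 ((q - p) ^+ 2) => D1 D2 D3 S.
  by rewrite !ler_norml => /andP[a1 a2] /andP[b1 b2] /andP[c1 c2]; apply/andP; split; lra.
have -> : k * step q - k * step p - k / w * dstep p * (v - u) =
    k * (step q - step p - dstep p * (q - p)).
  by rewrite pq; field; rewrite gt_eqF.
rewrite normrM (gtr0_norm k0) (_ : k * 8 / w ^+ 2 * _ = k * (8 * (q - p) ^+ 2)).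
  by rewrite ler_pM2l.
by rewrite pq; field; rewrite gt_eqF.
Qed.

(* Quadratic growth, with [la * (u - 1) <= la + outf la u]; the radial defect of [outf la (Q x)]
   grows linearly in [x], which bounds the almost critical loops. *)
Definition outf (la u : R) : R := 2 * la * pos (Num.sqrt u - 1) ^+ 2.
Definition doutf (la u : R) : R := if 1 <= u then 2 * la * (1 - (Num.sqrt u)^-1) else 0.

Lemma outf_low la u : u <= 1 -> outf la u = 0 /\ doutf la u = 0.
Proof.
move=> u1; have s1 : Num.sqrt u <= 1 by rewrite -sqrtr1 ler_wsqrtr.
rewrite /outf /doutf pos0 ?subr_le0 // expr0n mulr0; split => //.
case: ifP => // u1'; have -> : u = 1 by apply/eqP; rewrite eq_le u1.
by rewrite sqrtr1 invr1 subrr mulr0.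
Qed.

Lemma C11_outf la : 0 < la -> C11 (outf la) (doutf la) (2 * la).
Proof.
move=> la0; split; first by rewrite mulr_gt0.
move=> u v u0 v0; pose p := Num.sqrt u; pose q := Num.sqrt v.
have p0 : 0 <= p by exact: sqrtr_ge0. have q0 : 0 <= q by exact: sqrtr_ge0.
have uE : u = p ^+ 2 by rewrite sqr_sqrtr. have vE : v = q ^+ 2 by rewrite sqr_sqrtr.
have sq (t s : R) : 0 <= s -> 0 <= t -> 1 <= s ^+ 2 -> 1 <= s.
  by move=> s0 t0; rewrite -[X in X <= _](expr1n _ 2) ler_pXn2r ?nnegrE.
have la2 : 0 <= 2 * la by rewrite mulr_ge0 // ltW.
have red (X Y : R) : `|X| <= Y -> `|2 * la * X| <= 2 * la * Y.
  by move=> h; rewrite normrM ger0_norm // ler_wpM2l.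
have [u1|u1] := leP 1 u.
  have p1 : 1 <= p by apply: (sq p) => //; rewrite -uE.
  have pz : p != 0 by rewrite gt_eqF // (lt_le_trans ltr01).
  have -> : doutf la u = 2 * la * (1 - p^-1) by rewrite /doutf u1.
  have -> : outf la u = 2 * la * (p - 1) ^+ 2 by rewrite /outf posE // subr_ge0.
  have [v1|v1] := leP 1 v.
    have q1 : 1 <= q by apply: (sq q) => //; rewrite -vE.
    have -> : outf la v = 2 * la * (q - 1) ^+ 2 by rewrite /outf posE // subr_ge0.
    rewrite (_ : _ - _ - _ = 2 * la * ((q - p) ^+ 2 / p)); last by rewrite uE vE; field.
    apply: red; rewrite ger0_norm ?divr_ge0 ?sqr_ge0 // ler_pdivrMr ?(lt_le_trans ltr01) //.
    rewrite uE vE (_ : q ^+ 2 - p ^+ 2 = (q - p) * (q + p)); last by ring.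
    rewrite exprMn -mulrA ler_peMr ?sqr_ge0 // ; have : 1 <= (q + p) ^+ 2 by nra.
    by move=> h; rewrite -[1]mulr1 ler_pM.
  have [-> _] := outf_low la (ltW v1).
  have q1 : q < 1 by rewrite ltNge; apply/negP => h; move: v1; rewrite vE ltNge; case/negP; nra.
  rewrite (_ : _ - _ - _ = 2 * la * ((p - 1) * (p - q ^+ 2) / p)); last by rewrite uE vE; field.
  apply: red; rewrite ger0_norm; last by rewrite divr_ge0 // mulr_ge0 //; nra.
  rewrite ler_pdivrMr ?(lt_le_trans ltr01) // uE vE -[(_ - _) ^+ 2]sqrrN opprB.
  have e1 : p - 1 <= p ^+ 2 - q ^+ 2 by nra.
  have e2 : p - q ^+ 2 <= p ^+ 2 - q ^+ 2 by nra.
  have e3 : (p - 1) * (p - q ^+ 2) <= (p ^+ 2 - q ^+ 2) ^+ 2.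
    by rewrite expr2 ler_pM //; nra.
  by apply: le_trans e3 _; rewrite ler_peMr ?sqr_ge0.
have [-> ->] := outf_low la (ltW u1); rewrite mul0r !subr0.
have [v1|v1] := leP 1 v; last by have [-> _] := outf_low la (ltW v1); rewrite normr0 mulr_ge0 ?sqr_ge0.
have q1 : 1 <= q by apply: (sq q) => //; rewrite -vE.
have p1 : p < 1 by rewrite ltNge; apply/negP => h; move: u1; rewrite uE ltNge; case/negP; nra.
have -> : outf la v = 2 * la * (q - 1) ^+ 2 by rewrite /outf posE // subr_ge0.
apply: red; rewrite ger0_norm ?sqr_ge0 // ler_pXn2r ?nnegrE ?subr_ge0 //; first by rewrite uE vE; nra.
by rewrite (le_trans (ltW u1)).
Qed.

Lemma outf_defect la u : 0 <= u -> doutf la u * u - outf la u = 2 * la * pos (Num.sqrt u - 1).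
Proof.
move=> u0; have [u1|u1] := leP 1 u; last first.
  have [-> ->] := outf_low la (ltW u1); rewrite mul0r subrr pos0 ?mulr0 // subr_le0.
  by rewrite -sqrtr1 ler_wsqrtr // ltW.
have s1 : 1 <= Num.sqrt u by rewrite -sqrtr1 ler_wsqrtr.
rewrite /doutf /outf u1 posE ?subr_ge0 //; set p := Num.sqrt u in s1 *.
have -> : u = p ^+ 2 by rewrite sqr_sqrtr.
by field; rewrite gt_eqF // (lt_le_trans ltr01).
Qed.

Lemma outf_ge la u M : 0 <= la -> la <= M -> 0 <= u -> la * (u - 1) <= M + outf la u.
Proof.
move=> la0 laM u0; have [u1|u1] := leP 1 u; last first.
  have [-> _] := outf_low la (ltW u1); rewrite addr0; apply: le_trans laM.
  by rewrite ler_piMr //; lra.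
have s1 : 1 <= Num.sqrt u by rewrite -sqrtr1 ler_wsqrtr.
rewrite /outf posE ?subr_ge0 //; set p := Num.sqrt u in s1 *.
have -> : u = p ^+ 2 by rewrite sqr_sqrtr.
(* The difference of both sides is at least [la * (p - 2) ^+ 2]. *)
have := mulr_ge0 la0 (sqr_ge0 (p - 2)); move: laM; rewrite sqrrB sqrrB; nra.
Qed.

Lemma outf_ge0 la u : 0 <= la -> 0 <= outf la u.
Proof. by move=> h; rewrite /outf mulr_ge0 ?sqr_ge0 // mulr_ge0. Qed.

Lemma outf_le la u : 0 <= la -> 0 <= u -> outf la u <= 2 * la * u.
Proof.
move=> la0 u0; rewrite /outf ler_wpM2l ?mulr_ge0 // -[leRHS](sqr_sqrtr u0).
rewrite ler_pXn2r ?nnegrE ?pos_ge0 ?sqrtr_ge0 // ge_max sqrtr_ge0 /=; lra.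
Qed.

Lemma doutf_bound la u : 0 <= la -> 0 <= doutf la u <= 2 * la.
Proof.
move=> la0; have l2 : 0 <= 2 * la by rewrite mulr_ge0.
rewrite /doutf; case: ifP => u1; last by rewrite lexx.
have s1 : 1 <= Num.sqrt u by rewrite -sqrtr1 ler_wsqrtr.
have i1 : (Num.sqrt u)^-1 <= 1 by rewrite invf_le1 // (lt_le_trans ltr01).
have i0 : 0 <= (Num.sqrt u)^-1 by rewrite invr_ge0 sqrtr_ge0.
by rewrite mulr_ge0 ?subr_ge0 //= ler_piMr //; lra.
Qed.

End Profiles.

(* [jac] acts on row vectors. The auxiliary constants satisfy
   [sc < la < rho0 * min (2 * sa) sb] and [rho0 < 1]. *)
Record sympfam (R : realType) := SympFam {
  sa : R; sb : R; sc : R; sd : R; la : R; rho0 : R;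
  phi : R * R -> 'rV[R]_4 -> 'rV[R]_4;
  jac : R * R -> 'rV[R]_4 -> 'M[R]_4;
  sa_gt0 : 0 < sa; sa_sc : sa < sc; sc_sb : sc < sb; sc_sd : sc < sd; sc_la : sc < la;
  rho0_gt0 : 0 < rho0; rho0_lt1 : rho0 < 1; la_sa : la < 2 * sa * rho0; la_sb : la < sb * rho0;
  phi_cont : forall z y, Qcd sa sb y < 1 ->
    {for (z, y), continuous (fun p : (R * R) * 'rV[R]_4 => phi p.1 p.2)};
  phi_diff : forall z y (e : R), Qcd sa sb y < 1 -> 0 < e -> exists2 r : R, 0 < r &
    forall h, `|h| < r -> `|phi z (y + h) - phi z y - h *m jac z y| <= e * `|h|;
  jac_cont : forall z y, Qcd sa sb y < 1 ->
    {for (z, y), continuous (fun p : (R * R) * 'rV[R]_4 => jac p.1 p.2)};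
  jac_symp : forall z y, Qcd sa sb y < 1 -> jac z y *m Om R *m (jac z y)^T = Om R;
  phi_inj : forall z y y', Qcd sa sb y < 1 -> Qcd sa sb y' < 1 -> phi z y = phi z y' -> y = y';
  phi_img : forall z y, Qcd sa sb y < 1 -> Qcd sc sd (phi z y) <= 1 }.

Section ContinuityAt.
Variable R : realType.

Lemma C11_cont (T : pseudoMetricType R) (g dg : R -> R) C (f : T -> R) x : C11 g dg C ->
  (forall y, 0 <= f y) -> {for x, continuous f} -> {for x, continuous (fun y => g (f y))}.
Proof.
move=> gC f0 fc; apply: cts_ball => e e0; have [C0 gC'] := gC.
pose D := `|dg (f x)| + C; have D0 : 0 < D by rewrite ltr_wpDl.
pose r := Num.min 1 (e / D); have r0 : 0 < r by rewrite lt_min ltr01 divr_gt0.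
have [d d0 Hd] := ball_cts fc r0; exists d => // y /Hd; rewrite lt_min distrC => /andP[f1 fe].
rewrite distrC; set D1 := g (f y) - g (f x).
have -> : D1 = (D1 - dg (f x) * (f y - f x)) + dg (f x) * (f y - f x) by rewrite subrK.
apply: le_lt_trans (ler_normD _ _) _.
apply: (@le_lt_trans _ _ (D * `|f y - f x|)); last by rewrite mulrC -ltr_pdivlMr.
rewrite /D (addrC `|dg (f x)| C) mulrDl normrM lerD //; apply: le_trans (gC' _ _ (f0 x) (f0 y)) _.
rewrite ler_pM2l // -real_normK ?num_real // expr2 ler_piMr //; exact: ltW.
Qed.

Lemma contat_mulmx (T : topologicalType) m n p (f : T -> 'M[R]_(m, n)) (g : T -> 'M[R]_(n, p)) x :
  {for x, continuous f} -> {for x, continuous g} -> {for x, continuous (fun y => f y *m g y)}.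
Proof.
move=> fc gc; apply: (@cvg_mx R T (nbhs x)) => i j; rewrite mxE.
rewrite (_ : (fun y => (f y *m g y) i j) = (fun y => \sum_k f y i k * g y k j)); last first.
  by apply/funext => y; rewrite mxE.
apply: cvg_sumR => k; apply: cvgM; [exact: (@cvg_coord R T (nbhs x) _ _ f)|exact: (@cvg_coord R T (nbhs x) _ _ g)].
Qed.

Lemma continuous_grho (a b : R) : continuous (grho a b).
Proof.
apply: continuous_mx => i j; rewrite (_ : (fun y => grho a b y i j) =
  (fun y : 'rV[R]_4 => 2 * pi / (if (j < 2)%N then a else b) * y ord0 j)); last first.
  by apply/funext => y; rewrite mxE.
by apply: contM; [exact: contC|exact: coordc].
Qed.

Definition unitK : set (R * R) := [set st | 0 <= st.1 <= 1 /\ 0 <= st.2 <= 1].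

Lemma compact_unitK : compact unitK.
Proof.
rewrite (_ : unitK = `[0, 1]%classic `*` `[0, 1]%classic).
  by apply: compact_setX; exact: segment_compact.
by apply/seteqP; split=> [[s t]|[s t]] /=; rewrite !in_itv /=.
Qed.

Lemma compact_bd (T : pseudoMetricType R) (W : normedModType R) (f : T -> W) (C : set T) :
  compact C -> (forall x, C x -> {for x, continuous f}) ->
  exists2 M : R, 0 < M & forall x, C x -> `|f x| <= M.
Proof.
move=> cC fc.
have loc p : C p -> exists2 r, 0 < r & forall r' y, 0 < r' < r -> ball p r y -> `|f y| <= r'^-1.
  move=> Cp; have p1 : 0 < `|f p| + 1 by rewrite ltr_wpDl.
  have [r r0 Hr] := ball_cts (fc p Cp) ltr01.
  exists (Num.min r (`|f p| + 1)^-1); first by rewrite lt_min r0 invr_gt0.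
  move=> r' y /andP[r'0]; rewrite lt_min => /andP[r'r r'1] yb.
  have /Hr fy : ball p r y by apply: le_ball yb; rewrite ge_min lexx.
  apply: (@le_trans _ _ (`|f p| + 1)).
    by rewrite -lerBlDl; apply: le_trans (ltW fy); rewrite distrC; exact: lerB_dist.
  by rewrite -[leLHS]invrK lef_pV2 ?posrE ?invr_gt0 // ltW.
have [d d0 Hd] := compact_scale cC loc.
exists (d / 2)^-1 => [|x Cx]; first by rewrite invr_gt0 divr_gt0.
by apply: Hd => //; apply/andP; split; lra.
Qed.

(** Constancy outside of {Q <= 1} extends boundedness and uniform continuity from the compact set {Q
    <= 2} to the whole space. *)
Lemma unif_compact (c d : R) (W : normedModType R) (f : (R * R) * 'rV[R]_4 -> W) w0 :
  0 < c -> 0 < d -> continuous f -> (forall z x, 1 < Qcd c d x -> f (z, x) = w0) ->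
  (exists2 C : R, 0 < C & forall z x, unitK z -> `|f (z, x)| <= C) /\
  (forall e : R, 0 < e -> exists2 r : R, 0 < r & forall z z' x x', unitK z -> unitK z' ->
     ball z r z' -> `|x - x'| < r -> `|f (z, x) - f (z', x')| < e).
Proof.
move=> c0 d0 fc fout.
have cK : compact (unitK `*` [set x | Qcd c d x <= 2]).
  by apply: compact_setX; [exact: compact_unitK|exact: compact_Qcd].
split.
  have [C C0 HC] := compact_bd cK (fun p _ => fc p).
  exists (C + `|w0|); first by rewrite ltr_pwDl.
  move=> z x Kz; have [Qx|Qx] := leP (Qcd c d x) 2.
    by apply: ler_wpDr => //; apply: HC.
  by rewrite fout ?lerDr ?(ltW C0) // (lt_trans _ Qx) // ltr1n.
move=> e e0; have [r r0 Hr] := heine cK (fun p _ => fc p) e0.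
exists r => // z z' x x' Kz Kz' zz xx.
have bx : ball x r x' by rewrite -ball_normE.
have [Qx|Qx] := leP (Qcd c d x) 2; first by apply: Hr.
have [Qx'|Qx'] := leP (Qcd c d x') 2.
  by rewrite distrC; apply: Hr => //; split; apply: ball_sym.
by rewrite !fout ?subrr ?normr0 // (lt_trans _ Qx, lt_trans _ Qx') // ltr1n.
Qed.

End ContinuityAt.

(** * The push-forward Hamiltonians *)

Section Hamiltonian.
Variables (R : realType) (F : sympfam R).
Notation a := (sa F).
Notation b := (sb F).
Notation c := (sc F).
Notation d := (sd F).
Notation la := (la F).
Notation rho0 := (rho0 F).
Notation rho := (Qcd a b).
Notation Q := (Qcd c d).
Notation R4 := 'rV[R]_4.
Implicit Types (z : R * R) (x y : R4) (m : R).

Lemma sb_gt0 : 0 < b. Proof. by have := sa_gt0 F; have := sa_sc F; have := sc_sb F; lra. Qed.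
Lemma sc_gt0 : 0 < c. Proof. by have := sa_gt0 F; have := sa_sc F; lra. Qed.
Lemma sd_gt0 : 0 < d. Proof. by have := sc_gt0; have := sc_sd F; lra. Qed.
Lemma la_gt0 : 0 < la. Proof. by have := sc_gt0; have := sc_la F; lra. Qed.

(** The interval from [rho0] to 1 is cut into four pieces: [hp] rises over the first three, [kp]
    over the second, and both are constant on the last one. *)
Definition ep : R := (1 - rho0) / 4.
Lemma ep_gt0 : 0 < ep. Proof. by rewrite divr_gt0 // subr_gt0 rho0_lt1. Qed.
Lemma ep_rho0 : rho0 + 4 * ep = 1. Proof. by rewrite /ep; lra. Qed.

(** Constancy from [1 - ep] on allows the push-forward to be extended by the constant [g 1]. *)
Definition plateau (g dg : R -> R) := (exists C, C11 g dg C) /\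
  forall u, 1 - ep <= u -> g u = g 1 /\ dg u = 0.

Definition pullf (g : R -> R) z x : R := pull a b (phi F) (fun _ y => g (rho y)) (g 1) z x.
Definition pullG (dg : R -> R) z x : R4 :=
  pull a b (phi F) (fun z y => (dg (rho y) *: grho a b y) *m (- (Om R *m jac F z y *m Om R))) 0 z x.

Lemma ep1 : 1 - ep < 1. Proof. by rewrite ltrBlDr ltrDl ep_gt0. Qed.

Let a0 := sa_gt0 F.
Let b0 := sb_gt0.
Let c0 := sc_gt0.
Let d0 := sd_gt0.

Lemma pullf_im g z y : rho y < 1 -> pullf g z (phi F z y) = g (rho y).
Proof. by move=> ry; rewrite /pullf pull_im //; exact: phi_inj. Qed.

Lemma pullG_im dg z y : rho y < 1 -> pullG dg z (phi F z y) =
  (dg (rho y) *: grho a b y) *m (- (Om R *m jac F z y *m Om R)).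
Proof. by move=> ry; rewrite /pullG pull_im //; exact: phi_inj. Qed.

Lemma out_inim z x : 1 < Q x -> ~ inim a b (phi F) z x.
Proof. by move=> Qx [y ry E]; have := phi_img z ry; rewrite E leNgt Qx. Qed.

Lemma pull_grad_profile g dg : plateau g dg -> forall z x, hasgrad (pullf g z) x (pullG dg z x).
Proof.
move=> [[C gC] gp] z x.
apply: (pull_grad a0 b0 (@phi_cont _ F) (@phi_diff _ F) (@jac_symp _ F) (@phi_inj _ F)
  (f := fun y => g (rho y)) (G0 := fun y => dg (rho y) *: grho a b y) ep1).
- move=> y; apply: hasgrad_comp gC _ _; first by move=> *; exact: Qcd_ge0.
  exact: hasgrad_Qcd.
- by move=> y /gp[].
Qed.

Lemma pullf_cont g dg : plateau g dg ->
  continuous (fun p : (R * R) * R4 => pullf g p.1 p.2).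
Proof.
move=> [[C gC] gp].
apply: (pull_cont a0 b0 (@phi_cont _ F) (@phi_diff _ F) (@jac_symp _ F) (@phi_inj _ F) ep1).
- move=> z y ry; apply: (@C11_cont R _ _ _ _ (fun p : (R * R) * R4 => rho p.2) _ gC).
    by move=> *; exact: Qcd_ge0.
  apply: continuous_comp; [exact: cvg_snd|exact: continuous_Qcd].
- by move=> z y /gp[].
Qed.

Lemma pullG_cont g dg : plateau g dg ->
  continuous (fun p : (R * R) * R4 => pullG dg p.1 p.2).
Proof.
move=> [[C gC] gp].
apply: (pull_cont a0 b0 (@phi_cont _ F) (@phi_diff _ F) (@jac_symp _ F) (@phi_inj _ F) ep1).
- move=> z y ry.
  have c1 : {for (z, y), continuous (fun p : (R * R) * R4 => dg (rho p.2) *: grho a b p.2)}.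
    apply: continuousZ; last first.
      by apply: continuous_comp; [exact: cvg_snd|exact: continuous_grho].
    apply: (@C11_cts R _ _ _ _ (fun p : (R * R) * R4 => rho p.2) _ gC).
      by move=> *; exact: Qcd_ge0.
    apply: continuous_comp; [exact: cvg_snd|exact: continuous_Qcd].
  have c2 : {for (z, y), continuous (fun p : (R * R) * R4 => - (Om R *m jac F p.1 p.2 *m Om R))}.
    apply: continuousN; apply: contat_mulmx; last exact: cst_continuous.
    apply: contat_mulmx; first exact: cst_continuous.
    exact: jac_cont.
  exact: contat_mulmx c1 c2.
- by move=> z y /gp[_ ->]; rewrite scale0r mul0mx.
Qed.

Lemma pullf_out g z x : 1 < Q x -> pullf g z x = g 1.
Proof. by move=> Qx; rewrite /pullf pull_out //; exact: out_inim. Qed.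

Lemma pullG_out dg z x : 1 < Q x -> pullG dg z x = 0.
Proof. by move=> Qx; rewrite /pullG pull_out //; exact: out_inim. Qed.

(* On the part of the ellipsoid where [kp < 1 / 2] the profile [hp + m * kp] is convex; its slope
   equals [sa] exactly at [rho_a], where [kp] vanishes. *)
Definition hp (u : R) : R := (9 * a * ep / 2) * step ((u - rho0) / (3 * ep)).
Definition dhp (u : R) : R := (9 * a * ep / 2) / (3 * ep) * dstep ((u - rho0) / (3 * ep)).
Definition kp (u : R) : R := 1 * step ((u - (rho0 + ep)) / ep).
Definition dkp (u : R) : R := 1 / ep * dstep ((u - (rho0 + ep)) / ep).

Lemma hp_coef : 0 < 9 * a * ep / 2.
Proof. by have e0 := ep_gt0; rewrite divr_gt0 // mulr_gt0 // mulr_gt0. Qed.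

Lemma plateau_hp : plateau hp dhp.
Proof.
have e0 := ep_gt0; have er := ep_rho0; split.
  by eexists; apply: C11_step_affine; [exact: hp_coef|rewrite mulr_gt0].
have hi u : 1 - ep <= u -> 1 <= (u - rho0) / (3 * ep) by move=> h; rewrite ler_pdivlMr ?mulr_gt0 //; lra.
move=> u /hi h1; have h2 : 1 <= (1 - rho0) / (3 * ep) by apply: hi; lra.
rewrite /hp /dhp; have [-> ->] := step_high h1; have [-> _] := step_high h2; split=> //; ring.
Qed.

Lemma plateau_kp : plateau kp dkp.
Proof.
have e0 := ep_gt0; have er := ep_rho0; split.
  by eexists; apply: C11_step_affine.
have hi u : 1 - ep <= u -> 1 <= (u - (rho0 + ep)) / ep by move=> h; rewrite ler_pdivlMr //; lra.
move=> u /hi h1; have h2 : 1 <= (1 - (rho0 + ep)) / ep by apply: hi; lra.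
rewrite /kp /dkp; have [-> ->] := step_high h1; have [-> _] := step_high h2; split=> //; ring.
Qed.

Lemma kp_itv u : 0 <= kp u <= 1.
Proof. by rewrite /kp mul1r; have [] := step_itv ((u - (rho0 + ep)) / ep). Qed.

Lemma kp1 : kp 1 = 1.
Proof.
have e0 := ep_gt0; have er := ep_rho0; rewrite /kp (proj1 (step_high _)) ?mulr1 //.
by rewrite ler_pdivlMr //; lra.
Qed.

Lemma hp_ge0 u : 0 <= hp u.
Proof.
rewrite /hp mulr_ge0 //; last by have [/andP[]] := step_itv ((u - rho0) / (3 * ep)).
exact: ltW hp_coef.
Qed.

Lemma hp_le u : hp u <= 9 * a * ep / 2.
Proof.
rewrite /hp ler_piMr //; first exact: ltW hp_coef.
by have [/andP[]] := step_itv ((u - rho0) / (3 * ep)).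
Qed.

Lemma low_profile u : u <= rho0 -> [/\ hp u = 0, dhp u = 0, kp u = 0 & dkp u = 0].
Proof.
have e0 := ep_gt0 => h; rewrite /hp /dhp /kp /dkp.
have [-> ->] : step ((u - rho0) / (3 * ep)) = 0 /\ dstep ((u - rho0) / (3 * ep)) = 0.
  by apply: step_low; rewrite ler_pdivrMr ?mul0r ?subr_le0 // mulr_gt0.
have [-> ->] : step ((u - (rho0 + ep)) / ep) = 0 /\ dstep ((u - (rho0 + ep)) / ep) = 0.
  by apply: step_low; rewrite ler_pdivrMr // mul0r; lra.
by rewrite !mulr0.
Qed.

Definition khat z x : R := pullf kp z x.
Definition Ham m z x : R := pullf hp z x + m * khat z x + outf la (Q x).
Definition gHam m z x : R4 :=
  pullG dhp z x + m *: pullG dkp z x + doutf la (Q x) *: grho c d x.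
(** The source point of [x], multiplied by [1 - kp] so that it extends continuously by 0. It is
    exact where [kp] vanishes, in particular on the lower orbits. *)
Definition Tf z x : R4 := pull a b (phi F) (fun _ y => (1 - kp (rho y)) *: y) 0 z x.

Lemma hasgrad_Ham m z x : hasgrad (Ham m z) x (gHam m z x).
Proof.
apply: hasgradD; last first.
  apply: hasgrad_comp (C11_outf la_gt0) _ _; first by move=> *; exact: Qcd_ge0.
  exact: hasgrad_Qcd.
apply: hasgradD; first exact: pull_grad_profile plateau_hp z x.
by apply: hasgradZ; exact: pull_grad_profile plateau_kp z x.
Qed.

Lemma khat_itv z x : 0 <= khat z x <= 1.
Proof. by rewrite /khat /pullf /pull; case: (pselect _) => ?; exact: kp_itv. Qed.

Lemma pullf_hp_itv z x : 0 <= pullf hp z x <= 9 * a * ep / 2.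
Proof. by rewrite /pullf /pull; case: (pselect _) => ?; rewrite hp_ge0 hp_le. Qed.

Lemma Ham_ge0 m z x : 0 <= m -> 0 <= Ham m z x.
Proof.
move=> m0; have [/andP[h _] /andP[k _]] := (pullf_hp_itv z x, khat_itv z x).
by apply: addr_ge0; [apply: addr_ge0 => //; exact: mulr_ge0|apply: outf_ge0; exact: ltW la_gt0].
Qed.

(** Inside E(c, d) the left side is nonpositive; outside, [khat] equals 1 and the constant [m] lifts
    the growth of [outf] above [la * (Q x - 1)]. *)
Lemma Ham_ge m z x : la <= m -> la * (Q x - 1) <= Ham m z x.
Proof.
move=> lam; have l0 := la_gt0; have [Qx|Qx] := leP (Q x) 1.
  apply: le_trans (Ham_ge0 z x (le_trans (ltW l0) lam)).
  by apply: mulr_ge0_le0; [exact: ltW|rewrite subr_le0].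
rewrite /Ham /khat [pullf kp _ _]pullf_out // kp1 mulr1.
apply: (@le_trans _ _ (m + outf la (Q x))).
  by apply: (@outf_ge _ la _ m) => //; [exact: ltW|exact: Qcd_ge0].
by rewrite -[leRHS]addrA lerDr; case/andP: (pullf_hp_itv z x).
Qed.

Lemma continuous_doutf : continuous (fun x => doutf la (Q x) *: grho c d x).
Proof.
apply: contZ; last exact: continuous_grho.
move=> x; apply: (C11_cts (C11_outf la_gt0)); first by move=> *; exact: Qcd_ge0.
exact: continuous_Qcd.
Qed.

Lemma gHam_cont m : continuous (fun p : (R * R) * R4 => gHam m p.1 p.2).
Proof.
apply: contD; last first.
  by move=> p; apply: (@continuous_comp _ _ _ snd (fun x => doutf la (Q x) *: grho c d x));
    [exact: cvg_snd|exact: continuous_doutf].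
apply: contD; first exact: pullG_cont plateau_hp.
by apply: contZ; [exact: contC|exact: pullG_cont plateau_kp].
Qed.

Lemma khat_cont : continuous (fun p : (R * R) * R4 => khat p.1 p.2).
Proof. exact: pullf_cont plateau_kp. Qed.

Lemma Tf_out z x : 1 < Q x -> Tf z x = 0.
Proof. by move=> Qx; rewrite /Tf pull_out //; exact: out_inim. Qed.

Lemma Tf_im z y : rho y < 1 -> Tf z (phi F z y) = (1 - kp (rho y)) *: y.
Proof. by move=> ry; rewrite /Tf pull_im //; exact: phi_inj. Qed.

Lemma Tf_cont : continuous (fun p : (R * R) * R4 => Tf p.1 p.2).
Proof.
have [[C kC] kpl] := plateau_kp.
apply: (pull_cont a0 b0 (@phi_cont _ F) (@phi_diff _ F) (@jac_symp _ F) (@phi_inj _ F) ep1).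
- move=> z y ry; apply: continuousZ; last exact: cvg_snd.
  apply: continuousB; first exact: cst_continuous.
  apply: (@C11_cont R _ _ _ _ (fun p : (R * R) * R4 => rho p.2) _ kC).
    by move=> *; exact: Qcd_ge0.
  apply: continuous_comp; [exact: cvg_snd|exact: continuous_Qcd].
- by move=> z y /kpl[-> _]; rewrite kp1 subrr scale0r.
Qed.

Definition ctr z : R4 := phi F z 0.

Lemma ctr_cont : continuous ctr.
Proof.
move=> z; have c1 := @phi_cont R F z 0 ltac:(by rewrite Qcd0 ltr01).
apply: (@continuous_comp _ _ _ (fun z => (z, 0 : R4)) (fun p => phi F p.1 p.2)) => //.
by apply: (@cvg_pair _ _ _ (nbhs z) (nbhs z) (nbhs (0 : R4)) _ _ _ id (fun=> 0)); [exact: cvg_id|exact: cvg_cst].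
Qed.

(** Openness at 0 places a ball around [ctr z] in the image of {rho < rho0}, where both profiles
    vanish; compactness of the square makes the radius uniform. *)
Lemma Ham_small : exists2 r0 : R, 0 < r0 & forall m z x, unitK z ->
  `|ctr z - x| < r0 -> Ham m z x = 0.
Proof.
have [s s0 Hs] := @rho_near R a b 0 rho0 ltac:(by rewrite Qcd0; exact: rho0_gt0).
have r01 := rho0_lt1 F; have rz : rho 0 < 1 by rewrite Qcd0 ltr01.
have loc z : unitK z -> exists2 r, 0 < r & forall r' z', 0 < r' < r -> ball z r z' ->
    forall x, `|ctr z' - x| < r' -> exists2 y, rho y < rho0 & phi F z' y = x.
  move=> _; have [de de0 Hde] :=
    open_inv (@phi_cont _ F) (@phi_diff _ F) (@jac_symp _ F) (@phi_inj _ F) z rz s0.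
  have [t t0 Ht] := ball_cts (@ctr_cont z) (divr_gt0 de0 (ltr0n R 2)).
  exists (Num.min (de / 2) t); first by rewrite lt_min t0 divr_gt0.
  move=> r z' /andP[rr]; rewrite lt_min => /andP[r1 r2] zz' x xr.
  have z1 : ball z de z' by apply: le_ball zz'; rewrite ge_min; apply/orP; left; lra.
  have /Ht z2 : ball z t z' by apply: le_ball zz'; rewrite ge_min lexx orbT.
  have /(Hde _ _ z1) [y [yr y1 yE]] : `|phi F z 0 - x| < de.
    rewrite (_ : _ - x = (ctr z - ctr z') + (ctr z' - x)); last by rewrite addrA subrK.
    by apply: le_lt_trans (ler_normD _ _) _; lra.
  by exists y => //; apply: Hs; exact: ltW.
have [r r0 Hr] := compact_scale (@compact_unitK R) loc.
exists (r / 2) => [|m z x Kz xr]; first by rewrite divr_gt0.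
have [|y yr <-] := Hr (r / 2) z _ Kz x xr; first by apply/andP; split; lra.
have y1 : rho y < 1 by lra.
have [h1 _ k1 _] := low_profile (ltW yr).
rewrite /Ham /khat !pullf_im // h1 k1 mulr0 !add0r.
by have [] := outf_low la (phi_img z y1).
Qed.

(** Since the Hamiltonian vanishes within distance [r0] of the centre, division by [r0 ^+ 2] turns
    the bounded terms into quadratic ones. *)
Lemma Ham_quad (r0 : R) : 0 < r0 -> (forall m z x, unitK z -> `|ctr z - x| < r0 -> Ham m z x = 0) ->
  exists2 C : R, 0 < C & forall m z x, unitK z -> 0 <= m <= 9 * la ->
    Ham m z x <= C * dot (x - ctr z) (x - ctr z).
Proof.
move=> r00 H0; have l0 := la_gt0.
pose P := 2 * pi / c + 2 * pi / d; have P0 : 0 < P by rewrite addr_gt0 // divr_gt0 // mulr_gt0 // pi_gt0.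
pose M := 9 * a * ep / 2 + 9 * la; have M0 : 0 < M.
  by rewrite addr_gt0 ?hp_coef ?mulr_gt0.
pose q := (c + d) / pi; have q0 : 0 < q by rewrite divr_gt0 ?pi_gt0 // addr_gt0.
pose B := M + 4 * la * P * q; have L0 : 0 < 4 * la * P by rewrite mulr_gt0 // mulr_gt0.
have B0 : 0 < B by rewrite addr_gt0 // mulr_gt0.
exists (B / r0 ^+ 2 + 4 * la * P).
  by rewrite addr_gt0 // divr_gt0 // exprn_gt0.
move=> m z x Kz /andP[m0 m9]; set D := dot _ _.
have D0 : 0 <= D by exact: dot_ge0.
have [near|far] := ltP `|ctr z - x| r0.
  rewrite H0 // mulr_ge0 // addr_ge0 ?(ltW L0) //.
  by rewrite divr_ge0 ?sqr_ge0 // ltW.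
have D1 : r0 ^+ 2 <= D.
  apply: le_trans (norm_le_dot _); rewrite ler_pXn2r ?nnegrE ?(ltW r00) //.
  by rewrite distrC.
have nD : `|x - ctr z| ^+ 2 <= D by exact: norm_le_dot.
have nc : `|ctr z| ^+ 2 <= q.
  have Qc : Q (ctr z) <= 1 by apply: phi_img; rewrite Qcd0 ltr01.
  have : `|ctr z| <= Num.sqrt q.
    apply/mx_norm_leP; first exact: sqrtr_ge0.
    move=> i j; rewrite (ord1 i) -sqrtr_sqr ler_wsqrtr //.
    apply: le_trans (sup_le_Qcd c0 d0 _ _) _; by rewrite ler_piMr // -/q ltW.
  by move=> h; rewrite -[q]sqr_sqrtr ?(ltW q0) // ler_pXn2r ?nnegrE ?sqrtr_ge0.
have nx : `|x| ^+ 2 <= 2 * (D + q).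
  have -> : x = (x - ctr z) + ctr z by rewrite subrK.
  have := ler_normD (x - ctr z) (ctr z); move: nD nc.
  have := normr_ge0 (x - ctr z + ctr z); have := normr_ge0 (x - ctr z); have := normr_ge0 (ctr z).
  move: `|x - ctr z + ctr z| `|x - ctr z| `|ctr z| => A1 A2 A3 *.
  by have := sqr_ge0 (A2 - A3); nra.
have QD : Q x <= P * (2 * (D + q)).
  by apply: le_trans (Qcd_le c0 d0 _) _; rewrite ler_wpM2l // ltW.
have : Ham m z x <= M + 2 * la * (P * (2 * (D + q))).
  rewrite /Ham; apply: lerD.
    apply: lerD; first by case/andP: (pullf_hp_itv z x).
    apply: le_trans (m9); rewrite ler_piMr //; by case/andP: (khat_itv z x).
  apply: le_trans (outf_le _ (Qcd_ge0 c0 d0 _)) _; first exact: ltW.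
  by rewrite ler_pM2l ?mulr_gt0.
move=> h; apply: le_trans h _.
have : B <= B / r0 ^+ 2 * D.
  by rewrite mulrAC -[leLHS]mulr1 -mulrA ler_pM2l // ler_pdivlMr ?exprn_gt0 // mul1r.
move=> h; rewrite [leRHS]mulrDl (_ : M + _ = B + 4 * la * P * D); last by rewrite /B; ring.
exact: lerD.
Qed.

End Hamiltonian.

(** * Curves and symplectic area *)

Section DerivativeOnUnitInterval.
Variable R : realType.

(** Only points of [0, 1] are tested, so the derivative is one-sided at the ends. *)
Definition der (V : normedModType R) (f : R -> V) (t : R) (v : V) :=
  forall e : R, 0 < e -> exists2 r : R, 0 < r & forall s : R, 0 <= s <= 1 -> `|s - t| < r ->
    `|f s - f t - (s - t) *: v| <= e * `|s - t|.

Lemma der_lip (V : normedModType R) (f : R -> V) t v : der f t v -> exists2 r : R, 0 < r &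
  forall s : R, 0 <= s <= 1 -> `|s - t| < r -> `|f s - f t| <= (`|v| + 1) * `|s - t|.
Proof.
move=> /(_ _ ltr01)[r r0 H]; exists r => // s s01 /(H s s01) h.
rewrite -[f s - f t](subrK ((s - t) *: v)); apply: le_trans (ler_normD _ _) _.
by rewrite mulrDl addrC normrZ [`|v| * _]mulrC lerD.
Qed.

Lemma is_derive_eps (f : R -> R) (x v : R) : is_derive x (1 : R) f v -> forall e : R, 0 < e ->
  exists2 r : R, 0 < r & forall h, `|h| < r -> `|f (x + h) - f x - h * v| <= e * `|h|.
Proof.
move=> [dv E] e e0; have cv : (fun h => h^-1 *: ((f \o shift x) (h *: 1) - f x)) @ 0^' --> v.
  by rewrite -E; exact: dv.
have /cvgrPdist_lt /(_ e e0) /nbhs_ballP[r /= r0 H] := cv.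
exists r => // h hr; have [->|h0] := eqVneq h 0; first by rewrite addr0 subrr mul0r subr0 normr0 mulr0.
have := H h; rewrite -ball_normE /= sub0r normrN => /(_ hr h0).
rewrite [h *: 1]mulr1 [h + x]addrC => /ltW h1.
rewrite (_ : _ - _ - _ = - (v - h^-1 * (f (x + h) - f x)) * h); last by field.
by rewrite normrM normrN ler_wpM2r.
Qed.

Lemma der_is_derive (f : R -> R) (t v : R) : 0 < t < 1 -> der f t v -> is_derive t (1 : R) f v.
Proof.
move=> /andP[t0 t1] df.
have cv : (fun h => h^-1 *: ((f \o shift t) (h *: 1) - f t)) @ 0^' --> v.
  apply/cvgrPdist_le => e e0; have [r r0 H] := df e e0.
  apply/nbhs_ballP; exists (Num.min r (Num.min t (1 - t))); first by rewrite /= !lt_min r0 t0 subr_gt0.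
  move=> h; rewrite -ball_normE /= sub0r normrN !lt_min => /andP[hr /andP[ht h1]] h0.
  have h01 : 0 <= t + h <= 1 by move: ht h1; rewrite !ltr_norml => /andP[? _] /andP[_ ?]; lra.
  rewrite [h *: 1]mulr1 [h + t]addrC; have := H (t + h) h01.
  rewrite (addrC t h) addrK (addrC h t) => /(_ hr); set D := f (t + h) - f t => HD.
  rewrite (_ : v - _ = - (h^-1 * (D - h * v))); last first.
    by rewrite mulrBr opprB; congr (_ - _); rewrite mulrA mulVf // mul1r.
  by rewrite normrN normrM normfV ler_pdivrMl ?normr_gt0 // [leRHS]mulrC.
by apply: DeriveDef; [apply/cvg_ex; exists v|exact: cvg_lim cv].
Qed.

Lemma mvt (f df : R -> R) : (forall t, 0 <= t <= 1 -> der f t (df t)) ->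
  forall p q, 0 <= p -> p < q -> q <= 1 ->
  exists2 t, p < t < q & f q - f p = df t * (q - p).
Proof.
move=> D p q p0 pq q1.
have itv t : t \in `]p, q[ -> 0 < t < 1 by rewrite in_itv /= => /andP[? ?]; lra.
have [||t tp E] := @MVT R f df p q pq.
- by move=> t /itv t01; apply: der_is_derive => //; apply: D; lra.
- apply/subspace_continuousP => t /=; rewrite in_itv /= => /andP[pt tq].
  have t01 : 0 <= t <= 1 by lra.
  have [r r0 H] := der_lip (D t t01); apply/cvgrPdist_lt => e e0.
  have n0 : 0 < `|df t| + 1 by rewrite ltr_wpDl.
  apply/nbhs_ballP; exists (Num.min r (e / (`|df t| + 1))); first by rewrite /= lt_min r0 divr_gt0.
  move=> s; rewrite -ball_normE /= lt_min distrC => /andP[sr se]; rewrite in_itv /= => /andP[ps sq].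
  rewrite distrC; apply: le_lt_trans (H s _ sr) _; first by lra.
  by rewrite mulrC -ltr_pdivlMr.
- by exists t => //; move: tp; rewrite in_itv.
Qed.

Lemma der0_cst (f : R -> R) : (forall t, 0 <= t <= 1 -> der f t 0) ->
  forall t, 0 <= t <= 1 -> f t = f 0.
Proof.
move=> D t /andP[t0 t1]; move: t0; rewrite le_eqVlt => /predU1P[<-//|t0].
have [s _] := mvt (df := fun _ => 0) D (lexx 0) t0 t1.
by rewrite mul0r => /eqP; rewrite subr_eq0 => /eqP.
Qed.

Lemma mvt_ineq (f df : R -> R) (M : R) : (forall t, 0 <= t <= 1 -> der f t (df t)) ->
  (forall t, 0 <= t <= 1 -> `|df t| <= M) -> `|f 1 - f 0| <= M.
Proof.
move=> D B; have [t t01 ->] := mvt D (lexx 0) ltr01 (lexx 1).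
by rewrite subr0 mulr1; apply: B; lra.
Qed.

Lemma der_coord m n (f : R -> 'M[R]_(m, n)) t v i j : der f t v -> der (fun s => f s i j) t (v i j).
Proof.
move=> D e /D[r r0 H]; exists r => // s s01 sr; apply: le_trans (H s s01 sr).
by apply: le_trans (le_mx_norm _ i j); rewrite !mxE.
Qed.

Lemma mvt_vec n (f V : R -> 'rV[R]_n) (w : 'rV[R]_n) (s t M : R) :
  (forall u, 0 <= u <= 1 -> der f u (V u)) -> 0 <= s <= 1 -> 0 <= t <= 1 -> 0 <= M ->
  (forall u, 0 <= u <= 1 -> `|u - t| <= `|s - t| -> `|V u - w| <= M) ->
  `|f s - f t - (s - t) *: w| <= M * `|s - t|.
Proof.
move=> D s01 t01 M0 HM; apply/mx_norm_leP; first by rewrite mulr_ge0.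
move=> i j; rewrite ord1 {i} !mxE.
have Dj u (u01 : 0 <= u <= 1) := der_coord ord0 j (D u u01).
have [u [u01 us E]] : exists u, [/\ 0 <= u <= 1, `|u - t| <= `|s - t| &
    f s ord0 j - f t ord0 j = V u ord0 j * (s - t)].
  have [st|ts|->] := ltgtP s t; last by exists t; rewrite !subrr mulr0.
    have [u u1 E] := mvt Dj (proj1 (andP s01)) st (proj2 (andP t01)).
    exists u; split; [lra| |by rewrite -opprB E; ring].
    by rewrite distrC (distrC s) !ger0_norm; lra.
  have [u u1 E] := mvt Dj (proj1 (andP t01)) ts (proj2 (andP s01)).
  by exists u; split => //; [lra|rewrite !ger0_norm; lra].
rewrite E (_ : _ - _ = (V u - w) ord0 j * (s - t)); last by rewrite !mxE; ring.
by rewrite normrM ler_wpM2r //; apply: le_trans (le_mx_norm _ _ _) _; exact: HM.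
Qed.

(** Differentiability with a modulus uniform in time, as needed for Riemann sums. *)
Definition udr n (f V : R -> 'rV[R]_n) := forall e : R, 0 < e -> exists2 r : R, 0 < r &
  forall s t : R, 0 <= s <= 1 -> 0 <= t <= 1 -> `|s - t| < r ->
    `|f s - f t - (s - t) *: V t| <= e * `|s - t|.

Lemma udr_der n (f V : R -> 'rV[R]_n) t : udr f V -> 0 <= t <= 1 -> der f t (V t).
Proof. by move=> U t01 e /U[r r0 H]; exists r => // s s01; exact: H. Qed.

(** A bounded solution of a linear equation is Lipschitz, hence so is its velocity, and the mean
    value inequality yields a uniform modulus. *)
Lemma udr_lin n (f : R -> 'rV[R]_n) (W : 'M[R]_n) (M : R) :
  (forall t, 0 <= t <= 1 -> der f t (f t *m W)) -> (forall t, 0 <= t <= 1 -> `|f t| <= M) ->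
  (forall s t, 0 <= s <= 1 -> 0 <= t <= 1 ->
     `|f s - f t| <= n%:R * (M * `|W|) * `|s - t|) /\ udr f (fun t => f t *m W).
Proof.
move=> D B; pose L := n%:R * (M * `|W|).
have M0 : 0 <= M by apply: le_trans (B 0 _); rewrite // lexx ler01.
have L0 : 0 <= L by rewrite mulr_ge0 // mulr_ge0.
have Lip s t : 0 <= s <= 1 -> 0 <= t <= 1 -> `|f s - f t| <= L * `|s - t|.
  move=> s01 t01; have := @mvt_vec n f (fun t => f t *m W) 0 s t L D s01 t01 L0.
  rewrite scaler0 subr0; apply => u u01 _; rewrite subr0; apply: le_trans (norm_mulmx _ _) _.
  by rewrite ler_wpM2l // ler_wpM2r // B.
split => // e e0; pose q := n%:R * (L * `|W|) + 1.
have q0 : 0 < q by rewrite ltr_wpDl // mulr_ge0 // mulr_ge0.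
exists (e / q); first by rewrite divr_gt0.
move=> s t s01 t01 st; apply: (mvt_vec D s01 t01 (ltW e0)) => u u01 ut.
rewrite -mulmxBl; apply: le_trans (norm_mulmx _ _) _.
apply: (@le_trans _ _ (q * `|u - t|)); last first.
  by rewrite mulrC -ler_pdivlMr // (le_trans ut) // ltW.
rewrite mulrDl mul1r; apply: ler_wpDr => //; rewrite -mulrA ler_wpM2l //.
by rewrite mulrAC ler_wpM2r //; exact: Lip.
Qed.

Lemma der_cst (V : normedModType R) (c : V) t : der (fun _ => c) t 0.
Proof. by move=> e e0; exists 1 => // s _ _; rewrite subrr scaler0 subrr normr0 mulr_ge0 // ltW. Qed.

Lemma derD (V : normedModType R) (f g : R -> V) t v w :
  der f t v -> der g t w -> der (fun s => f s + g s) t (v + w).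
Proof.
move=> D1 D2 e e0; have e20 : 0 < e / 2 by rewrite divr_gt0.
have [r1 r10 H1] := D1 _ e20; have [r2 r20 H2] := D2 _ e20.
exists (Num.min r1 r2); first by rewrite lt_min r10.
move=> s s01; rewrite lt_min => /andP[/(H1 s s01) h1 /(H2 s s01) h2].
rewrite scalerDr [e]splitr mulrDl.
rewrite (_ : _ - _ - _ = (f s - f t - (s - t) *: v) + (g s - g t - (s - t) *: w)); last first.
  by rewrite (opprD (f t)) (opprD (_ *: v)) (addrACA (f s)) [LHS]addrACA.
by apply: le_trans (ler_normD _ _) _; exact: lerD.
Qed.

Lemma derM (f g : R -> R) (t v w : R) :
  der f t v -> der g t w -> der (fun s => f s * g s) t (v * g t + f t * w).
Proof.
move=> D1 D2 e e0.
have [r1 r10 L1] := der_lip D1; have [r2 r20 L2] := der_lip D2.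
pose B := `|f t| + `|g t| + (`|v| + 1) * (`|w| + 1).
have B0 : 0 < B by rewrite ltr_wpDl ?addr_ge0 // mulr_gt0 // ltr_wpDl.
have e20 : 0 < e / B by rewrite divr_gt0.
have [r3 r30 H3] := D1 _ e20; have [r4 r40 H4] := D2 _ e20.
exists (Num.min (Num.min r1 r2) (Num.min (Num.min r3 r4) (e / B))); first by rewrite !lt_min r10 r20 r30 r40.
move=> s s01; rewrite !lt_min.
move=> /andP[/andP[/(L1 s s01) l1 /(L2 s s01) l2] /andP[/andP[/(H3 s s01) h3 /(H4 s s01) h4] se]].
rewrite (_ : _ - _ - _ = (f s - f t - (s - t) *: v) * g t + f t * (g s - g t - (s - t) *: w) +
  (f s - f t) * (g s - g t)); last by rewrite /GRing.scale /=; ring.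
apply: le_trans (ler_normD _ _) _; apply: le_trans (lerD (ler_normD _ _) (lexx _)) _.
rewrite !normrM; set q := `|s - t| in l1 l2 h3 h4 se *; have q0 : 0 <= q by exact: normr_ge0.
have -> : e * q = (e / B * q) * `|g t| + `|f t| * (e / B * q) + (`|v| + 1) * (`|w| + 1) * (e / B * q).
  have -> : e * q = (e / B * q) * B by rewrite mulrAC divfK // gt_eqF.
  by move: (e / B * q) => k; rewrite /B; ring.
apply: lerD; first by apply: lerD; rewrite ?ler_wpM2r ?ler_wpM2l.
apply: (@le_trans _ _ ((`|v| + 1) * q * ((`|w| + 1) * q))); first exact: ler_pM.
rewrite (_ : _ * _ = (`|v| + 1) * (`|w| + 1) * (q * q)); last by ring.
by rewrite ler_wpM2l ?mulr_ge0 ?addr_ge0 // ler_wpM2r // ltW.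
Qed.

Lemma der_sum (I : Type) (s : seq I) (f : I -> R -> R) (df : I -> R) (t : R) :
  (forall i, der (f i) t (df i)) -> der (fun u => \sum_(i <- s) f i u) t (\sum_(i <- s) df i).
Proof.
move=> D; elim: s => [|i s IH].
  by rewrite (_ : (fun u => _) = fun _ => 0); [rewrite big_nil; exact: der_cst|apply/funext => u; rewrite big_nil].
rewrite (_ : (fun u => _) = fun u => f i u + \sum_(j <- s) f j u).
  by rewrite big_cons; exact: derD.
by apply/funext => u; rewrite big_cons.
Qed.

Lemma der_dot n (f g : R -> 'rV[R]_n) t v w :
  der f t v -> der g t w -> der (fun s => dot (f s) (g s)) t (dot v (g t) + dot (f t) w).
Proof.
move=> D1 D2; rewrite /dot -big_split /=; apply: der_sum => i.
by apply: derM; exact: der_coord.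
Qed.

Lemma der_mulmx n m (f : R -> 'rV[R]_n) t v (M : 'M[R]_(n, m)) :
  der f t v -> der (fun s => f s *m M) t (v *m M).
Proof.
move=> D e e0; pose B := n%:R * `|M| + 1; have B0 : 0 < B by rewrite ltr_wpDl // mulr_ge0.
have [r r0 H] := D _ (divr_gt0 e0 B0); exists r => // s s01 /(H s s01) h.
rewrite scalemxAl -!mulmxBl; apply: le_trans (norm_mulmx _ _) _.
rewrite [X in _ * X]mulrC mulrA.
apply: (@le_trans _ _ (B * (e / B * `|s - t|))).
  apply: ler_pM => //; rewrite ?mulr_ge0 // /B; first by rewrite lerDl.
by rewrite mulrA (mulrC B) divfK // gt_eqF.
Qed.

Lemma der_grad n (K : 'rV[R]_n -> R) (X : R -> 'rV[R]_n) t v G :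
  hasgrad K (X t) G -> der X t v -> der (fun s => K (X s)) t (dot G v).
Proof.
move=> gK D e e0; have [r1 r10 L] := der_lip D.
pose B := `|v| + 1; have B0 : 0 < B by rewrite ltr_wpDl.
pose B' := n%:R * `|G| + 1; have B'0 : 0 < B' by rewrite ltr_wpDl // mulr_ge0.
have e20 : 0 < e / 2 by rewrite divr_gt0.
have [r2 r20 H2] := gK _ (divr_gt0 e20 B0).
have [r3 r30 H3] := D _ (divr_gt0 e20 B'0).
exists (Num.min r1 (Num.min (r2 / B) r3)); first by rewrite !lt_min r10 r30 divr_gt0.
move=> s s01; rewrite !lt_min => /andP[/(L s s01) l1 /andP[sB /(H3 s s01) h3]].
have hX : `|X s - X t| < r2 by apply: le_lt_trans l1 _; rewrite mulrC -ltr_pdivlMr.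
have := H2 _ hX; rewrite [X t + _]addrC subrK => h2.
rewrite (_ : _ - _ - _ = (K (X s) - K (X t) - dot G (X s - X t)) + dot G (X s - X t - (s - t) *: v)).
  apply: le_trans (ler_normD _ _) _; rewrite [e]splitr mulrDl; apply: lerD.
    apply: le_trans h2 _; apply: (@le_trans _ _ (e / 2 / B * (B * `|s - t|))).
      by rewrite ler_wpM2l // ltW // divr_gt0.
    by rewrite mulrA divfK // gt_eqF.
  apply: le_trans (norm_dot _ _) _; rewrite mulrA.
  apply: (@le_trans _ _ (B' * (e / 2 / B' * `|s - t|))).
    by apply: ler_pM => //; rewrite ?mulr_ge0 // lerDl.
  by rewrite mulrA (mulrC B') divfK // gt_eqF.
by rewrite [dot G (_ - (s - t) *: v)]dotBr dotZr /GRing.scale /=; ring.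
Qed.

Lemma der_scale (f : R -> R) (w t v : R) : is_derive (w * t) (1 : R) f v ->
  der (fun s => f (w * s)) t (w * v).
Proof.
move=> /is_derive_eps D e e0; pose B := `|w| + 1; have B0 : 0 < B by rewrite ltr_wpDl.
have [r r0 H] := D _ (divr_gt0 e0 B0); exists (r / B); first by rewrite divr_gt0.
move=> s s01 sr; have wb : `|w * (s - t)| <= B * `|s - t| by rewrite normrM ler_wpM2r // lerDl.
have /H : `|w * (s - t)| < r by apply: le_lt_trans wb _; rewrite mulrC -ltr_pdivlMr.
rewrite (_ : w * t + w * (s - t) = w * s); last by ring.
rewrite (_ : w * (s - t) * v = (s - t) *: (w * v)); last by rewrite /GRing.scale /=; ring.
move/le_trans; apply; apply: (@le_trans _ _ (e / B * (B * `|s - t|))).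
  by rewrite ler_wpM2l // ltW // divr_gt0.
by rewrite mulrA divfK // gt_eqF.
Qed.

(** The point rotated back by the angle [w * t] has derivative zero. *)
Lemma rotation (p q : R -> R) (w : R) :
  (forall t, 0 <= t <= 1 -> der p t (- (w * q t)) /\ der q t (w * p t)) ->
  forall t, 0 <= t <= 1 ->
    p t = cos (w * t) * p 0 - sin (w * t) * q 0 /\ q t = sin (w * t) * p 0 + cos (w * t) * q 0.
Proof.
move=> D t t01.
have Dc s : der (fun u => cos (w * u)) s (w * - sin (w * s)) by apply: der_scale; exact: is_derive_cos.
have Ds s : der (fun u => sin (w * u)) s (w * cos (w * s)) by apply: der_scale; exact: is_derive_sin.
have E1 : cos (w * t) * p t + sin (w * t) * q t = p 0.
  have -> : p 0 = cos (w * 0) * p 0 + sin (w * 0) * q 0 by rewrite mulr0 cos0 sin0; ring.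
  apply: (@der0_cst (fun t => cos (w * t) * p t + sin (w * t) * q t)) => // s s01.
  have [Dp Dq] := D s s01; have := derD (derM (Dc s) Dp) (derM (Ds s) Dq).
  by congr der; ring.
have E2 : cos (w * t) * q t + (- sin (w * t)) * p t = q 0.
  have -> : q 0 = cos (w * 0) * q 0 + (- sin (w * 0)) * p 0 by rewrite mulr0 cos0 sin0; ring.
  apply: (@der0_cst (fun t => cos (w * t) * q t + (- sin (w * t)) * p t)) => // s s01.
  have [Dp Dq] := D s s01; have Dn := derM (@der_cst R^o (-1) s) (Ds s).
  have := derD (derM (Dc s) Dq) (derM Dn Dp).
  have -> : (fun s0 => cos (w * s0) * q s0 + -1 * sin (w * s0) * p s0) =
    (fun t => cos (w * t) * q t + (- sin (w * t)) * p t) by apply/funext => u; rewrite mulN1r.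
  by congr der; ring.
have cs : cos (w * t) ^+ 2 + sin (w * t) ^+ 2 = 1 by exact: cos2Dsin2.
rewrite -E1 -E2; move: cs; move: (cos _) (sin _) (p t) (q t) => C S P Q cs; split.
  by rewrite -[LHS]mul1r -cs; ring.
by rewrite -[LHS]mul1r -cs; ring.
Qed.

End DerivativeOnUnitInterval.

Section Area.
Variables (R : realType) (F : sympfam R).
Notation a := (sa F).
Notation b := (sb F).
Notation rho := (Qcd a b).
Notation R4 := 'rV[R]_4.
Notation phi := (phi F).
Notation jac := (jac F).
Let a0 := sa_gt0 F.
Let b0 := sb_gt0 F.

Lemma Qcd_convex (r s : R) (u v : R4) : 0 <= s <= 1 -> rho u <= r -> rho (u + v) <= r ->
  rho (u + s *: v) <= r.
Proof.
move=> /andP[s0 s1]; rewrite !(QcdD a0 b0) dotZr QcdZ.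
have := Qcd_ge0 a0 b0 v; move: (rho u) (rho v) (dot _ _) => U V D V0 h1 h2.
have h3 : s * (U + D + V) <= s * r by rewrite ler_wpM2l.
have h4 : (1 - s) * U <= (1 - s) * r by rewrite ler_wpM2l // subr_ge0.
have : 0 <= s * (1 - s) * V by rewrite mulr_ge0 // mulr_ge0 // subr_ge0.
by move: h3 h4; rewrite expr2; nra.
Qed.

Lemma der_phi z (u v : R4) (t : R) : rho (u + t *: v) < 1 ->
  der (fun s => phi z (u + s *: v)) t (v *m jac z (u + t *: v)).
Proof.
move=> ry e e0; pose B := `|v| + 1; have B0 : 0 < B by rewrite ltr_wpDl.
have [r r0 H] := phi_diff z ry (divr_gt0 e0 B0); exists (r / B); first by rewrite divr_gt0.
move=> s s01 sr; have wb : `|(s - t) *: v| <= B * `|s - t| by rewrite normrZ mulrC ler_wpM2r // lerDl.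
have /H : `|(s - t) *: v| < r by apply: le_lt_trans wb _; rewrite mulrC -ltr_pdivlMr.
rewrite -[u + t *: v + _]addrA -scalerDl (addrC t) subrK -scalemxAl => h.
apply: le_trans h _; apply: (@le_trans _ _ (e / B * (B * `|s - t|))).
  by rewrite ler_wpM2l // ltW // divr_gt0.
by rewrite mulrA divfK // gt_eqF.
Qed.

(** Sublevel sets are convex, so the mean value theorem applies on segments, along which the
    Jacobian varies little by uniform continuity. *)
Lemma phi_unif z (r e : R) : r < 1 -> 0 < e -> exists2 d : R, 0 < d & forall u v,
  rho u <= r -> rho (u + v) <= r -> `|v| < d -> `|phi z (u + v) - phi z u - v *m jac z u| <= e * `|v|.
Proof.
move=> r1 e0.
have cC : compact ([set z] `*` [set y | rho y <= r]).
  by apply: compact_setX; [exact: compact_set1|exact: compact_Qcd].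
have jc p : ([set z] `*` [set y | rho y <= r]) p ->
    {for p, continuous (fun p : (R * R) * R4 => jac p.1 p.2)}.
  by case: p => z' y [/= _ yr]; apply: jac_cont; exact: le_lt_trans yr r1.
have [d d0 Hd] := heine cC jc (divr_gt0 e0 (ltr0n R 4)).
exists d => // u v ur uvr vd; apply/mx_norm_leP; first by rewrite mulr_ge0 // ltW.
move=> i j; rewrite ord1 {i}.
pose f s := phi z (u + s *: v) ord0 j - s * (v *m jac z u) ord0 j.
have -> : (phi z (u + v) - phi z u - v *m jac z u) ord0 j = f 1 - f 0.
  by rewrite /f scale1r scale0r addr0 mul1r mul0r subr0 !mxE addrAC.
apply: (@mvt_ineq R f (fun t => (v *m jac z (u + t *: v)) ord0 j + (-1) * (v *m jac z u) ord0 j)) => t t01.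
  have rt := Qcd_convex t01 ur uvr.
  rewrite /f (_ : (fun s => _) = fun s => phi z (u + s *: v) ord0 j +
     s * ((-1) * (v *m jac z u) ord0 j)); last by apply/funext => s; rewrite mulN1r mulrN.
  apply: derD; first by apply: (der_coord (f := fun s => phi z (u + s *: v))); apply: der_phi; exact: le_lt_trans rt r1.
  move: (-1 * _) => k q q0; exists 1 => // s _ _.
  by rewrite /GRing.scale /= mulrBl subrr normr0 mulr_ge0 // ltW.
rewrite mulN1r (_ : _ - _ = (v *m (jac z (u + t *: v) - jac z u)) ord0 j); last by rewrite mulmxBr !mxE.
apply: le_trans (le_mx_norm _ _ _) _; apply: le_trans (norm_mulmx _ _) _.
have : `|jac z u - jac z (u + t *: v)| < e / 4.
  apply: (Hd (z, u) (z, u + t *: v)) => //; split; first exact: ballxx.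
  rewrite -ball_normE /= opprD addrA subrr sub0r normrN normrZ.
  apply: le_lt_trans vd; rewrite ler_piMl //; case/andP: t01 => ? ?; by rewrite ger0_norm.
rewrite distrC => /ltW h; rewrite mulrCA mulrC ler_wpM2r //.
by rewrite mulrC -ler_pdivlMr.
Qed.

(* Invariance of the symplectic area of closed polygons, up to small errors: both sides are
   compared along the homothety [s *: y], where the derivative of the area is controlled. *)
Lemma area z (r B e : R) : r < 1 -> 0 <= B -> 0 < e -> exists2 d : R, 0 < d &
  forall (N : nat) (y : nat -> R4), (0 < N)%N -> (forall j, rho (y j) <= r) -> y N = y 0%N ->
  (forall j, `|y j.+1 - y j| <= B / N%:R) -> B / N%:R < d ->
  `|\sum_(j < N) dot (phi z (y j) *m Om R) (phi z (y j.+1)) -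
    \sum_(j < N) dot (y j *m Om R) (y j.+1)| <= e.
Proof.
move=> r1 B0 e0.
have cC : compact ([set z] `*` [set y | rho y <= r]).
  by apply: compact_setX; [exact: compact_set1|exact: compact_Qcd].
have jc p : ([set z] `*` [set y | rho y <= r]) p ->
    {for p, continuous (fun p : (R * R) * R4 => jac p.1 p.2)}.
  by case: p => z' y [/= _ yr]; apply: jac_cont; exact: le_lt_trans yr r1.
have [MA MA0 HA] := compact_bd cC jc.
pose Y := Num.sqrt ((a + b) / pi).
have Yb (y : R4) : rho y <= r -> `|y| <= Y.
  move=> yr; apply/mx_norm_leP; first exact: sqrtr_ge0.
  move=> i j; rewrite ord1 -sqrtr_sqr ler_wsqrtr //; apply: le_trans (sup_le_Qcd a0 b0 _ _) _.
  rewrite ler_piMr ?divr_ge0 ?pi_ge0 ?addr_ge0 ?ltW //; exact: le_lt_trans yr r1.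
pose C := 4 * (4 * (4 * (Y * MA) * `|Om R|)); have C0 : 0 <= C.
  by do 2 rewrite mulr_ge0 //; rewrite mulr_ge0 // mulr_ge0 // mulr_ge0 // ?sqrtr_ge0 // ltW.
have q0 : 0 < 2 * C * B + 1 by rewrite ltr_wpDl // mulr_ge0 // mulr_ge0.
have [d d0 Hd] := phi_unif z r1 (divr_gt0 e0 q0); set e' := e / _ in Hd.
have e'0 : 0 <= e' by rewrite divr_ge0 // ltW.
exists d => // N y N0 yr yN yB Bd.
have NR : 0 < N%:R :> R by rewrite ltr0n.
pose Q0 := \sum_(j < N) dot (y j *m Om R) (y j.+1).
pose P (s : R) := \sum_(j < N) dot (phi z (s *: y j) *m Om R) (phi z (s *: y j.+1)).
pose u (s : R) j := y j *m jac z (s *: y j).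
pose dP (s : R) := \sum_(j < N) (dot (u s j *m Om R) (phi z (s *: y j.+1)) +
   dot (phi z (s *: y j) *m Om R) (u s j.+1)).
have rs (s : R) j : 0 <= s <= 1 -> rho (s *: y j) <= r.
  move=> /andP[s0 s1]; rewrite QcdZ; apply: le_trans (yr j).
  by rewrite ler_piMl ?Qcd_ge0 // expr_le1.
have DP s : 0 <= s <= 1 -> der P s (dP s).
  move=> s01; apply: der_sum => j.
  have Dj (i : nat) : der (fun s => phi z (s *: y i)) s (u s i).
    have := @der_phi z 0 (y i) s; rewrite add0r => /(_ (le_lt_trans (rs s i s01) r1)).
    by rewrite (_ : (fun s => _) = fun s => phi z (s *: y i)) //; apply/funext => ?; rewrite add0r.
  by apply: der_dot; [apply: der_mulmx; exact: Dj|exact: Dj].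
have P0 : P 0 = 0 by rewrite /P big1 // => j _; rewrite !scale0r dot_Om.
have -> : \sum_(j < N) dot (phi z (y j) *m Om R) (phi z (y j.+1)) = P 1.
  by apply: eq_bigr => j _; rewrite !scale1r.
(* The source area of the polygon shrunk by [s] is [s * s * Q0]; both areas vanish at [s = 0], and
   the mean value theorem is applied to their difference. *)
have -> : P 1 - Q0 = (P 1 + 1 * 1 * (- Q0)) - (P 0 + 0 * 0 * (- Q0)).
  by rewrite P0; ring.
apply: (@mvt_ineq R (fun s => P s + s * s * (- Q0)) (fun s => dP s + (s + s) * (- Q0))) => s s01.
  apply: derD; first exact: DP.
  have Did : der id s (1 : R^o).
    by move=> k k0; exists 1 => // t _ _; rewrite [_ *: 1]mulr1 subrr normr0 mulr_ge0 // ltW.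
  have := derM (derM Did Did) (@der_cst R R^o (- Q0) s); congr der; rewrite /=; ring.
pose w j := y j.+1 - y j.
pose De j := phi z (s *: y j.+1) - phi z (s *: y j).
(* [E1] and [E2] are the linearisation errors of an edge seen from its two ends. The linear parts
   match the source area exactly, by symplecticity. *)
pose E1 j := De j - (s *: w j) *m jac z (s *: y j).
pose E2 j := De j - (s *: w j) *m jac z (s *: y j.+1).
have sw j : s *: y j + s *: w j = s *: y j.+1 by rewrite -scalerDr addrC subrK.
have sd j : `|s *: w j| <= B / N%:R.
  rewrite normrZ; apply: le_trans (yB j); rewrite ler_piMl //; case/andP: s01 => ? ?; by rewrite ger0_norm.
have E1b j : `|E1 j| <= e' * (B / N%:R).
  apply: (@le_trans _ _ (e' * `|s *: w j|)); last by rewrite ler_wpM2l.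
  rewrite /E1 /De -sw; apply: Hd; rewrite ?sw ?rs //; exact: le_lt_trans (sd j) Bd.
have E2b j : `|E2 j| <= e' * (B / N%:R).
  apply: (@le_trans _ _ (e' * `|- (s *: w j)|)); last by rewrite normrN ler_wpM2l.
  have sw' : s *: y j.+1 - s *: w j = s *: y j by rewrite -sw addrK.
  have -> : `|E2 j| = `|phi z (s *: y j.+1 - s *: w j) - phi z (s *: y j.+1) - (- (s *: w j)) *m jac z (s *: y j.+1)|.
    by rewrite sw' mulNmx opprK -[LHS]normrN /E2 /De !opprD !opprK (addrC (- phi _ _)).
  by apply: Hd; rewrite ?sw' ?rs //; rewrite normrN; exact: le_lt_trans (sd j) Bd.
have symp (p q : R4) j : dot ((p *m jac z (s *: y j)) *m Om R) (q *m jac z (s *: y j)) = dot (p *m Om R) q.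
  rewrite [RHS]dotC [LHS]dotC dot_mulmx [in RHS](_ : Om R = jac z (s *: y j) *m Om R *m (jac z (s *: y j))^T).
    by rewrite !mulmxA.
  by rewrite jac_symp //; exact: le_lt_trans (rs s j s01) r1.
have ub j : forall (E : R4), `|E| <= e' * (B / N%:R) -> `|dot (u s j *m Om R) E| <= C * (e' * (B / N%:R)).
  move=> E Eb; apply: le_trans (norm_dot _ _) _; rewrite /C -mulrA ler_pM2l // ler_pM //.
  apply: le_trans (norm_mulmx _ _) _; rewrite ler_pM2l // ler_wpM2r //.
  apply: le_trans (norm_mulmx _ _) _; rewrite ler_pM2l // ler_pM // ?Yb //.
  by apply: (HA (z, s *: y j)); split => //=; exact: rs.
have -> : dP s + (s + s) * - Q0 = \sum_(j < N) (dot (u s j *m Om R) (E1 j) + dot (u s j.+1 *m Om R) (E2 j)).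
  have tel : \sum_(j < N) dot (u s j *m Om R) (phi z (s *: y j)) =
             \sum_(j < N) dot (u s j.+1 *m Om R) (phi z (s *: y j.+1)).
    apply/eqP; rewrite -subr_eq0 -opprB oppr_eq0 -sumrB.
    rewrite -(big_mkord xpredT (fun j => dot (u s j.+1 *m Om R) (phi z (s *: y j.+1)) - dot (u s j *m Om R) (phi z (s *: y j)))).
    by rewrite telescope_sumr // /u yN subrr.
  have -> : dP s = \sum_(j < N) (dot (u s j *m Om R) (De j) + dot (u s j.+1 *m Om R) (De j)).
    transitivity (\sum_(j < N) (dot (u s j *m Om R) (De j) + dot (u s j.+1 *m Om R) (De j)) +
      (\sum_(j < N) dot (u s j *m Om R) (phi z (s *: y j)) -
       \sum_(j < N) dot (u s j.+1 *m Om R) (phi z (s *: y j.+1)))); last by rewrite tel subrr addr0.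
    rewrite -sumrB -big_split; apply: eq_bigr => j _ /=.
    rewrite (dot_OmC (phi z (s *: y j))) /De !dotBr; ring.
  rewrite mulrN mulr_sumr -sumrN -big_split; apply: eq_bigr => j _ /=.
  have e1 : dot (u s j *m Om R) (De j) = dot (u s j *m Om R) (E1 j) + s * dot (y j *m Om R) (w j).
    by rewrite -dotZr -(symp (y j) (s *: w j) j) -dotDr [RHS](congr1 _ (subrK _ _)).
  have e2 : dot (u s j.+1 *m Om R) (De j) = dot (u s j.+1 *m Om R) (E2 j) + s * dot (y j.+1 *m Om R) (w j).
    by rewrite -dotZr -(symp (y j.+1) (s *: w j) j.+1) -dotDr [RHS](congr1 _ (subrK _ _)).
  rewrite e1 e2 /w !dotBr !dot_Om (dot_OmC (y j.+1)); ring.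
apply: le_trans (ler_norm_sum _ _ _) _.
apply: (@le_trans _ _ (\sum_(j < N) (2 * (C * (e' * (B / N%:R)))))).
  apply: ler_sum => j _; apply: le_trans (ler_normD _ _) _.
  by rewrite mulr2n mulrDl mul1r; apply: lerD; apply: ub.
rewrite sumr_const card_ord -[_ *+ N]mulr_natr.
have -> : 2 * (C * (e' * (B / N%:R))) * N%:R = e' * (2 * C * B) by field; rewrite gt_eqF.
apply: (@le_trans _ _ (e' * (2 * C * B + 1))); first by rewrite ler_wpM2l // lerDl.
by rewrite /e' divfK // gt_eqF.
Qed.

End Area.

Section Polygons.
Variable R : realType.
Notation R4 := 'rV[R]_4.

Lemma Qcd_bd (a b : R) (y : R4) : 0 < a -> 0 < b -> Qcd a b y <= 1 -> `|y| <= Num.sqrt ((a + b) / pi).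
Proof.
move=> a0 b0 yr; apply/mx_norm_leP; first exact: sqrtr_ge0.
move=> i j; rewrite ord1 -sqrtr_sqr ler_wsqrtr //; apply: le_trans (sup_le_Qcd a0 b0 _ _) _.
by rewrite ler_piMr // divr_ge0 ?pi_ge0 // addr_ge0 // ltW.
Qed.

Lemma itv_ratio (j N : nat) : (j <= N)%N -> (0 < N)%N -> 0 <= (j%:R / N%:R : R) <= 1.
Proof.
move=> jN N0; have NR : 0 < N%:R :> R by rewrite ltr0n.
by rewrite divr_ge0 //= ler_pdivrMr // mul1r ler_nat.
Qed.

(** A vector is orthogonal to its quarter turn, so each edge of the polygon contributes its velocity
    at first order and the area becomes a Riemann sum. *)
Lemma sum_udr (f V : R -> R4) (B e : R) : udr f V -> (forall t, 0 <= t <= 1 -> `|f t| <= B) ->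
  0 < e -> exists2 d : R, 0 < d & forall N : nat, (0 < N)%N -> N%:R^-1 < d ->
  `|\sum_(j < N) dot (f (j%:R / N%:R) *m Om R) (f (j.+1%:R / N%:R)) -
    N%:R^-1 * \sum_(j < N) dot (f (j%:R / N%:R) *m Om R) (V (j%:R / N%:R))| <= e.
Proof.
move=> U fB e0; have B0 : 0 <= B by apply: le_trans (fB 0 _); rewrite // lexx ler01.
pose C := 4 * (4 * (B * `|Om R|)) + 1; have C0 : 0 < C by rewrite ltr_wpDl // mulr_ge0 // mulr_ge0 // mulr_ge0.
have [d d0 Hd] := U _ (divr_gt0 e0 C0); exists d => // N N0 Nd.
have NR : 0 < N%:R :> R by rewrite ltr0n.
rewrite mulr_sumr -sumrB; apply: le_trans (ler_norm_sum _ _ _) _.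
apply: (@le_trans _ _ (\sum_(j < N) (e / N%:R))); last first.
  by rewrite sumr_const card_ord -[_ *+ N]mulr_natr divfK // gt_eqF.
apply: ler_sum => j _; set t := j%:R / N%:R; set s := j.+1%:R / N%:R.
have t01 : 0 <= t <= 1 by apply: itv_ratio => //; exact: ltnW.
have s01 : 0 <= s <= 1 by apply: itv_ratio.
have st : s - t = N%:R^-1 by rewrite /s /t -mulrBl -natrB // subSnn mul1r.
have := Hd s t s01 t01; rewrite st ger0_norm ?invr_ge0 // => /(_ Nd) h.
have -> : dot (f t *m Om R) (f s) - N%:R^-1 * dot (f t *m Om R) (V t) =
   dot (f t *m Om R) (f s - f t - N%:R^-1 *: V t).
  by rewrite !dotBr dot_Om dotZr subr0.
apply: le_trans (norm_dot _ _) _.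
apply: (@le_trans _ _ (4 * (4 * (B * `|Om R|) * (e / C / N%:R)))).
  rewrite ler_pM2l // ler_pM //; apply: le_trans (norm_mulmx _ _) _.
  by rewrite ler_pM2l // ler_wpM2r // fB.
apply: (@le_trans _ _ (C * (e / C / N%:R))).
  rewrite mulrA ler_wpM2r ?lerDl //; by rewrite divr_ge0 // divr_ge0 // ltW.
by rewrite mulrA (mulrC C) divfK // gt_eqF.
Qed.

Lemma cos_lt1 (w : R) : 0 < w < 2 * pi -> cos w < 1.
Proof.
move=> /andP[w0 w1]; have -> : cos w = 1 - 2 * sin (w / 2) ^+ 2.
  have := cosD (w / 2) (w / 2); rewrite -splitr => ->.
  have := cos2Dsin2 (w / 2); lra.
have : 0 < sin (w / 2) by apply: sin_gt0_pi; rewrite divr_gt0 //=; lra.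
by move=> h; have := exprn_gt0 2 h; lra.
Qed.

Lemma cos_eq1 (w : R) : 0 < w < 4 * pi -> cos w = 1 -> w = 2 * pi.
Proof.
move=> /andP[w0 w1] E; have p0 := pi_gt0 R; have [h|h|//] := ltgtP w (2 * pi).
  by have := @cos_lt1 w; rewrite E ltxx w0 => /(_ h).
have := @cos_lt1 (w - 2 * pi); rewrite (_ : w - 2 * pi = w - pi *+ 2); last by rewrite mulr2n; ring.
rewrite cosB cos2pi sin2pi mulr1 mulr0 addr0 E ltxx; rewrite mulr2n; move=> H; exfalso.
by have : false by apply: H; lra.
Qed.

(** The determinant of a rotation minus the identity is [2 * (1 - C)]. *)
Lemma rot_fix (p q C S : R) : C ^+ 2 + S ^+ 2 = 1 -> p = C * p - S * q -> q = S * p + C * q ->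
  C < 1 -> p = 0 /\ q = 0.
Proof.
move=> cs E1 E2 C1; have d0 : 0 < 2 * (1 - C) by lra.
have p0 : 2 * (1 - C) * p = 0.
  have -> : 2 * (1 - C) = (1 - C) ^+ 2 + S ^+ 2 by rewrite sqrrB; lra.
  have e1 : (1 - C) * p = - (S * q) by lra.
  have e2 : (1 - C) * q = S * p by lra.
  by rewrite mulrDl expr2 -mulrA e1 mulrN mulrCA e2; ring.
have q0 : 2 * (1 - C) * q = 0.
  have -> : 2 * (1 - C) = (1 - C) ^+ 2 + S ^+ 2 by rewrite sqrrB; lra.
  have e1 : (1 - C) * p = - (S * q) by lra.
  have e2 : (1 - C) * q = S * p by lra.
  by rewrite mulrDl expr2 -mulrA e2 mulrCA e1; ring.
by split; apply/eqP; [move/eqP: p0|move/eqP: q0]; rewrite mulf_eq0 (gt_eqF d0).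
Qed.

End Polygons.

(** * Periodic orbits *)

Section LimitOrbit.
Variables (R : realType) (F : sympfam R) (z : R * R) (m : R) (X : R -> 'rV[R]_4).
Notation a := (sa F).
Notation b := (sb F).
Notation rho := (Qcd a b).
Notation Q := (Qcd (sc F) (sd F)).
Notation R4 := 'rV[R]_4.
Notation phi := (phi F).
Notation jac := (jac F).
Notation la := (la F).
Notation rho0 := (rho0 F).
Notation ep := (ep F).
Let a0 := sa_gt0 F.
Let b0 := sb_gt0 F.
Hypothesis mla : la <= m.
Hypothesis XU : udr X (fun t => gHam F m z (X t) *m Om R).
Hypothesis Xper : X 1 = X 0.

Definition freq (u : R) : R := dhp F u + m * dkp F u.
Definition energy (u : R) : R := hp F u + m * kp F u.

Lemma gHam_im y : rho y < 1 -> gHam F m z (phi z y) =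
  (freq (rho y) *: grho a b y) *m (- (Om R *m jac z y *m Om R)).
Proof.
move=> ry; rewrite /gHam !pullG_im // (proj2 (outf_low la (phi_img z ry))) scale0r addr0.
by rewrite /freq scalerDl mulmxDl -!scalemxAl scalerA.
Qed.

(** A substitute for the level [rho], which is defined on the image only: this profile extends by 0
    and still determines the level below [1 - ep]. *)
Definition pkp (u : R) : R := pos (1 - ep - u) ^+ 2.
Definition dpkp (u : R) : R := - (2 * pos (1 - ep - u)).

Lemma plateau_pkp : plateau F pkp dpkp.
Proof.
have e0 := ep_gt0 F; split.
  exists 1; split=> // u v _ _; have := pos_sqr (1 - ep - u) (1 - ep - v).
  rewrite /pkp /dpkp mul1r (_ : 1 - ep - v - (1 - ep - u) = - (v - u)); last by ring.
  by rewrite sqrrN mulrN mulNr.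
by move=> u hu; rewrite /pkp /dpkp !pos0; [split=> //; ring|lra..].
Qed.

(** On the image both gradients are multiples of the transported [grho], and a vector is orthogonal
    to its quarter turn. *)
Lemma Kconst t : 0 <= t <= 1 -> pullf F pkp z (X t) = pullf F pkp z (X 0).
Proof.
apply: (@der0_cst R (fun t => pullf F pkp z (X t))) => s s01.
have := der_grad (pull_grad_profile plateau_pkp z (X s)) (udr_der XU s01).
congr der; have [[y ry <-]|nx] := pselect (inim a b phi z (X s)).
  rewrite pullG_im // gHam_im // -!scalemxAl dotZl dotZr dotC dot_Om !mulr0 //.
by rewrite /pullG pull_out // dot0l.
Qed.

Section Low.
Variable t0 : R.
Hypotheses (t01 : 0 <= t0 <= 1) (klow : khat F z (X t0) < 1/2).

Definition yv t := Yv a b phi z (X t).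
Definition rs := rho (yv t0).

Lemma X_inim0 : inim a b phi z (X t0).
Proof.
have [//|nx] := pselect (inim a b phi z (X t0)); exfalso; move: klow.
by rewrite /khat /pullf pull_out // kp1; lra.
Qed.

Lemma yv_im t : inim a b phi z (X t) -> phi z (yv t) = X t /\ rho (yv t) < 1.
Proof. by case=> y ry E; rewrite /yv -E YvP //; exact: phi_inj. Qed.

Lemma rs_lt : rs < rho0 + 3 / 2 * ep.
Proof.
have [E r1] := yv_im X_inim0; move: klow; rewrite -E /khat pullf_im // /kp mul1r => /step_half.
by rewrite ltr_pdivrMr ?ep_gt0 // /rs; lra.
Qed.

(** As [rs] is below [1 - ep], the conserved quantity is positive; hence the curve never leaves the
    image and its level is constant. *)
Lemma orbit t : 0 <= t <= 1 -> phi z (yv t) = X t /\ rho (yv t) = rs.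
Proof.
move=> tt; have [E r1] := yv_im X_inim0; have e0 := ep_gt0 F; have er := ep_rho0 F; have rl := rs_lt.
have k0 : pullf F pkp z (X t0) = (1 - ep - rs) ^+ 2.
  by rewrite -E pullf_im // /pkp posE // -/rs; lra.
have Kt : pullf F pkp z (X t) = (1 - ep - rs) ^+ 2 by rewrite Kconst // -k0 Kconst.
have [it|nx] := pselect (inim a b phi z (X t)); last first.
  have : 0 < (1 - ep - rs) ^+ 2 by rewrite exprn_gt0 //; lra.
  by rewrite -Kt /pullf pull_out // /pkp pos0 ?expr0n ?ltxx //; lra.
have [Et rt] := yv_im it; split => //; move: Kt; rewrite -Et pullf_im // /pkp => /eqP.
rewrite eqrXn2 ?pos_ge0 //; last by lra.
move/eqP => Ep; have [h|h] := leP 0 (1 - ep - rho (yv t)).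
  by move: Ep; rewrite posE //; lra.
by move: Ep; rewrite pos0 ?ltW //; lra.
Qed.

Lemma rs_lt1 : rs < 1. Proof. by have := rs_lt; have := ep_rho0 F; have := ep_gt0 F; lra. Qed.

(** On a fixed level the frequency is constant, so the pulled-back flow coincides there with a
    linear one. *)
Definition rotW : 'M[R]_4 := freq rs *: (diag_mx (\row_i (2 * pi / (if (i < 2)%N then a else b))) *m Om R).

Lemma rotWE y : y *m rotW = freq rs *: (grho a b y *m Om R).
Proof.
rewrite /rotW -scalemxAr mulmxA; congr (_ *: (_ *m _)).
by apply/rowP => i; rewrite mul_mx_diag !mxE mulrC.
Qed.

(** With [A] the Jacobian, the field of the Hamiltonian carries the factor [- (Om R *m A *m Om R) *m
    Om R = Om R *m A], and the derivative of the inverse embedding cancels [A]. *)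
Lemma der_yv t : 0 <= t <= 1 -> der yv t (yv t *m rotW).
Proof.
move=> tt; have [Et rt] := orbit tt; have ry : rho (yv t) < 1 by rewrite rt rs_lt1.
have [AB BA _] := symp_inv (jac_symp z ry); set B' := - _ in AB BA.
have -> : yv t *m rotW = gHam F m z (X t) *m Om R *m B'.
  rewrite -Et gHam_im // rt rotWE -!scalemxAl; congr (_ *: _).
  have OA : - (Om R *m jac z (yv t) *m Om R) *m Om R = Om R *m jac z (yv t).
    by rewrite mulNmx -[_ *m Om R *m Om R]mulmxA Om_sqr mulmxN mulmx1 opprK.
  by rewrite -(mulmxA (grho _ _ _)) OA -mulmxA -(mulmxA (Om R)) AB mulmx1.
set v := gHam _ _ _ _ *m Om R; have Dv : der X t v by exact: udr_der XU tt.
move=> e e0; pose C := `|v| + 1; have C0 : 0 < C by rewrite ltr_wpDl.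
pose C2 := 4 * `|B'| + 1; have C20 : 0 < C2 by rewrite ltr_wpDl // mulr_ge0.
have e20 : 0 < e / 2 by rewrite divr_gt0.
have [r1 r10 L] := der_lip Dv.
have [r2 r20 H2] := inverse_diff (@phi_cont _ F) (@phi_diff _ F) (@jac_symp _ F) (@phi_inj _ F) z ry (divr_gt0 e20 C0).
have [r3 r30 H3] := Dv _ (divr_gt0 e20 C20).
exists (Num.min r1 (Num.min (r2 / C) r3)); first by rewrite !lt_min r10 r30 divr_gt0.
move=> s s01; rewrite !lt_min => /andP[/(L s s01) l1 /andP[sC /(H3 s s01) h3]].
have [Es rss] := orbit s01; have rys : rho (yv s) < 1 by rewrite rss rs_lt1.
have hX : `|X s - X t| < r2 by apply: le_lt_trans l1 _; rewrite mulrC -ltr_pdivlMr.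
have [k [rk Ek kb]] := H2 _ hX.
have Eyk : yv s - yv t = k.
  suff -> : yv s = yv t + k by rewrite addrC addKr.
  by apply: (@phi_inj _ F z) rys rk _; rewrite Es Ek Et addrC subrK.
rewrite Eyk (_ : k - _ = (k - (X s - X t) *m B') + (X s - X t - (s - t) *: v) *m B'); last first.
  by rewrite (mulmxBl (X s - X t)) -scalemxAl addrA subrK.
apply: le_trans (ler_normD _ _) _; rewrite [e]splitr mulrDl; apply: lerD.
  apply: le_trans kb _; apply: (@le_trans _ _ (e / 2 / C * (C * `|s - t|))).
    by rewrite ler_wpM2l // ltW // divr_gt0.
  by rewrite mulrA divfK // gt_eqF.
apply: le_trans (norm_mulmx _ _) _; rewrite [_ * `|B'|]mulrC mulrA.
apply: (@le_trans _ _ (C2 * (e / 2 / C2 * `|s - t|))).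
  by apply: ler_pM => //; rewrite ?mulr_ge0 // lerDl.
by rewrite mulrA (mulrC C2) divfK // gt_eqF.
Qed.

Let Yb := Num.sqrt ((a + b) / pi).

Lemma yv_bd t : 0 <= t <= 1 -> `|yv t| <= Yb.
Proof. by move=> tt; apply: Qcd_bd => //; rewrite (proj2 (orbit tt)) ltW // rs_lt1. Qed.

(** The sum is a Riemann sum for the area of [X]. Invariance of the area moves it to the source
    curve, where the integrand is constant by Euler's identity for [rho]. *)
Lemma action_limit (e : R) : 0 < e -> exists2 d : R, 0 < d & forall N : nat, (0 < N)%N -> N%:R^-1 < d ->
  `|N%:R^-1 * \sum_(j < N) dot (X (j%:R / N%:R)) (gHam F m z (X (j%:R / N%:R))) -
    2 * (freq rs * rs)| <= e.
Proof.
move=> e0; have e30 : 0 < e / 3 by rewrite divr_gt0.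
have XB t : 0 <= t <= 1 -> `|X t| <= Num.sqrt ((sc F + sd F) / pi).
  move=> tt; have [<- rt] := orbit tt; apply: Qcd_bd; rewrite ?sc_gt0 ?sd_gt0 //.
  by apply: phi_img; rewrite rt rs_lt1.
have [d1 d10 H1] := sum_udr XU XB e30.
have [Lip yU] := udr_lin der_yv yv_bd; set L := 4%:R * _ in Lip.
have [d2 d20 H2] := sum_udr yU yv_bd e30.
have L0 : 0 <= L by rewrite mulr_ge0 // mulr_ge0 // sqrtr_ge0.
have [d3 d30 H3] := area F z rs_lt1 L0 e30.
exists (Num.min (Num.min d1 d2) (d3 / (L + 1))).
  by rewrite !lt_min d10 d20 divr_gt0 // ltr_wpDl.
move=> N N0; rewrite !lt_min => /andP[/andP[/(H1 N N0) h1 /(H2 N N0) h2] Nd].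
have NR : 0 < N%:R :> R by rewrite ltr0n.
(* Times are clamped at 1 because [area] asks for a vertex at every natural index. *)
pose tj (j : nat) : R := Num.min 1 (j%:R / N%:R).
have tj01 j : 0 <= tj j <= 1 by rewrite le_min ler01 divr_ge0 //= ge_min lexx.
have tjE j : (j <= N)%N -> tj j = j%:R / N%:R.
  by move=> jN; apply/min_idPr; have /andP[] := @itv_ratio R j N jN N0.
have yper : yv 1 = yv 0 by rewrite /yv Xper.
have A1 j : rho (yv (tj j)) <= rs by rewrite (proj2 (orbit (tj01 j))).
have A2 : yv (tj N) = yv (tj 0%N) by rewrite !tjE // divff ?gt_eqF // mul0r.
have A3 j : `|yv (tj j.+1) - yv (tj j)| <= L / N%:R.
  apply: le_trans (Lip _ _ (tj01 _) (tj01 _)) _; rewrite ler_wpM2l //.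
  have [jN|jN] := ltnP j N.
    by rewrite !tjE // ?(ltnW jN) // -mulrBl -natrB // subSnn mul1r ger0_norm // invr_ge0.
  have t1 i : (N <= i)%N -> tj i = 1.
    by move=> iN; apply/min_idPl; rewrite ler_pdivlMr // mul1r ler_nat.
  by rewrite !t1 ?(leq_trans jN) // subrr normr0 invr_ge0.
have A4 : L / N%:R < d3.
  apply: (@le_lt_trans _ _ ((L + 1) * N%:R^-1)); first by rewrite ler_wpM2r ?invr_ge0 // lerDl.
  by rewrite mulrC -ltr_pdivlMr // ltr_wpDl.
have := H3 N (fun j => yv (tj j)) N0 A1 A2 A3 A4.
move: h1 h2.
have -> : \sum_(j < N) dot (phi z (yv (tj j)) *m Om R) (phi z (yv (tj j.+1))) =
   \sum_(j < N) dot (X (j%:R / N%:R) *m Om R) (X (j.+1%:R / N%:R)).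
  apply: eq_bigr => j _; rewrite !(proj1 (orbit (tj01 _))) !tjE //; exact: ltnW.
have -> : \sum_(j < N) dot (yv (tj j) *m Om R) (yv (tj j.+1)) =
   \sum_(j < N) dot (yv (j%:R / N%:R) *m Om R) (yv (j.+1%:R / N%:R)).
  by apply: eq_bigr => j _; rewrite !tjE //; exact: ltnW.
have -> : \sum_(j < N) dot (X (j%:R / N%:R) *m Om R) (gHam F m z (X (j%:R / N%:R)) *m Om R) =
   \sum_(j < N) dot (X (j%:R / N%:R)) (gHam F m z (X (j%:R / N%:R))).
  by apply: eq_bigr => j _; rewrite dot_Om_Om.
have -> : N%:R^-1 * \sum_(j < N) dot (yv (j%:R / N%:R) *m Om R) (yv (j%:R / N%:R) *m rotW) =
   2 * (freq rs * rs).
  rewrite (eq_bigr (fun _ => 2 * (freq rs * rs))) => [|j _].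
    by rewrite sumr_const card_ord -[(2 * _) *+ N]mulr_natl mulKf // gt_eqF.
  rewrite rotWE dotZr dot_Om_Om dotC dot_grho // (proj2 (orbit _)); first by ring.
  by apply: itv_ratio => //; exact: ltnW.
move: (\sum_(j < N) dot (X _ *m _) _) (N%:R^-1 * _) (\sum_(j < N) dot (yv _ *m _) _) => S1 S2 S3.
rewrite !ler_norml => /andP[? ?] /andP[? ?] /andP[? ?]; apply/andP; split; lra.
Qed.

Lemma yv_rot t : 0 <= t <= 1 -> let w1 := 2 * pi * freq rs / a in let w2 := 2 * pi * freq rs / b in
  [/\ yv t ord0 o0 = cos (w1 * t) * yv 0 ord0 o0 - sin (w1 * t) * yv 0 ord0 o1,
      yv t ord0 o1 = sin (w1 * t) * yv 0 ord0 o0 + cos (w1 * t) * yv 0 ord0 o1,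
      yv t ord0 o2 = cos (w2 * t) * yv 0 ord0 o2 - sin (w2 * t) * yv 0 ord0 o3 &
      yv t ord0 o3 = sin (w2 * t) * yv 0 ord0 o2 + cos (w2 * t) * yv 0 ord0 o3].
Proof.
move=> tt w1 w2.
have D u i : 0 <= u <= 1 -> der (fun s => yv s ord0 i) u ((freq rs *: (grho a b (yv u) *m Om R)) ord0 i).
  by move=> u01; rewrite -rotWE; apply: der_coord; exact: der_yv.
have W u : [/\ (freq rs *: (grho a b (yv u) *m Om R)) ord0 o0 = - (w1 * yv u ord0 o1),
    (freq rs *: (grho a b (yv u) *m Om R)) ord0 o1 = w1 * yv u ord0 o0,
    (freq rs *: (grho a b (yv u) *m Om R)) ord0 o2 = - (w2 * yv u ord0 o3) &
    (freq rs *: (grho a b (yv u) *m Om R)) ord0 o3 = w2 * yv u ord0 o2].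
  have [e0 e1 e2 e3] := OmE (grho a b (yv u)); have [f0 f1 f2 f3] := grhoE a b (yv u).
  split; rewrite mxE; [rewrite e0 f1|rewrite e1 f0|rewrite e2 f3|rewrite e3 f2];
    rewrite /w1 /w2; move: (freq rs) (yv u) (@pi R) => q y P; ring.
have [] := @rotation R (fun t => yv t ord0 o0) (fun t => yv t ord0 o1) w1 _ t tt.
  by move=> u u01; have [E0 E1 _ _] := W u; rewrite -E0 -E1; split; exact: D.
have [] := @rotation R (fun t => yv t ord0 o2) (fun t => yv t ord0 o3) w2 _ t tt.
  by move=> u u01; have [_ _ E0 E1] := W u; rewrite -E0 -E1; split; exact: D.
by [].
Qed.

End Low.
End LimitOrbit.

(** * Classification of the limit orbits by action *)

Section Classification.
Variables (R : realType) (F : sympfam R) (z : R * R) (m : R) (X : R -> 'rV[R]_4) (t0 : R).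
Notation a := (sa F).
Notation b := (sb F).
Notation rho := (Qcd a b).
Notation la := (la F).
Notation rho0 := (rho0 F).
Notation ep := (ep F).
Notation rs := (rs F z X t0).
Notation yv := (yv F z X).
Let a0 := sa_gt0 F.
Let b0 := sb_gt0 F.
Let e0 := ep_gt0 F.
Hypothesis mla : la <= m.
Hypothesis XU : udr X (fun t => gHam F m z (X t) *m Om R).
Hypothesis Xper : X 1 = X 0.
Hypotheses (t01 : 0 <= t0 <= 1) (klow : khat F z (X t0) < 1/2).

(** The coefficient in [hp] is chosen to give this form: the slope is [a] at [rho0 + ep / 2] and
    [2 * a] at [rho0 + ep]. *)
Lemma hp_quad u : rho0 <= u -> u < rho0 + 3 / 2 * ep ->
  hp F u = a * (u - rho0) ^+ 2 / ep /\ dhp F u = 2 * a * (u - rho0) / ep.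
Proof.
move=> h1 h2; have [] := @step_mid1 R ((u - rho0) / (3 * ep)).
- by apply: divr_ge0; [lra|apply: mulr_ge0 => //; exact: ltW].
- by rewrite ler_pdivrMr; [lra|exact: mulr_gt0].
by move=> E1 E2; rewrite /hp /dhp E1 E2; split; field; rewrite gt_eqF.
Qed.

Lemma kp_low u : u <= rho0 + ep -> kp F u = 0 /\ dkp F u = 0.
Proof.
move=> h; have [] := @step_low R ((u - (rho0 + ep)) / ep).
  by rewrite ler_pdivrMr // mul0r; lra.
by rewrite /kp /dkp => -> ->; rewrite !mulr0.
Qed.

Lemma kp_quad u : rho0 + ep <= u -> u < rho0 + 3 / 2 * ep ->
  kp F u = 2 * ((u - (rho0 + ep)) / ep) ^+ 2 /\ dkp F u = 4 * ((u - (rho0 + ep)) / ep) / ep.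
Proof.
move=> h1 h2; have [] := @step_mid1 R ((u - (rho0 + ep)) / ep).
- by rewrite divr_ge0 ?subr_ge0 // ltW.
- by rewrite ler_pdivrMr //; lra.
by move=> E1 E2; rewrite /kp /dkp E1 E2; split; field; rewrite gt_eqF.
Qed.

(** Tangents of a convex profile that vanishes up to [rho0] meet the axis at or beyond [rho0]. The
    right side is the action of the orbit, so an action at most [la] bounds the frequency by
    [la / rho0]. *)
Lemma freq_defect u : u < rho0 + 3 / 2 * ep -> rho0 * freq F m u <= freq F m u * u - energy F m u.
Proof.
move=> h2; have m0 : 0 <= m by apply: le_trans mla; exact: ltW (la_gt0 F).
have [h1|h1] := leP u rho0.
  by have [E1 E2 E3 E4] := low_profile h1; rewrite /freq /energy E1 E2 E3 E4; lra.
have [E1 E2] := hp_quad (ltW h1) h2; rewrite -subr_ge0 /freq /energy.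
have -> : (dhp F u + m * dkp F u) * u - (hp F u + m * kp F u) - rho0 * (dhp F u + m * dkp F u) =
   (dhp F u * (u - rho0) - hp F u) + m * (dkp F u * (u - rho0) - kp F u) by ring.
apply: addr_ge0.
  rewrite E1 E2 (_ : _ - _ = a * (u - rho0) ^+ 2 / ep); last by field; rewrite gt_eqF.
  by apply: divr_ge0; [apply: mulr_ge0; [exact: ltW|exact: sqr_ge0]|exact: ltW].
apply: mulr_ge0 => //; have [h3|h3] := leP u (rho0 + ep).
  by have [-> ->] := kp_low h3; lra.
have [-> ->] := kp_quad (ltW h3) h2; set w := (u - (rho0 + ep)) / ep.
have w0 : 0 <= w by rewrite divr_ge0 ?subr_ge0 // ltW.
have -> : u - rho0 = (w + 1) * ep by rewrite /w; field; rewrite gt_eqF.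
rewrite (_ : _ - _ = 4 * w * (w + 1) - 2 * w ^+ 2); last by field; rewrite gt_eqF.
nra.
Qed.

Definition rho_a : R := rho0 + ep / 2.
(** The common action of the lower orbits, independent of [z] and [m]. *)
Definition alpha : R := a * rho_a - hp F rho_a.

(** A frequency below [b] turns the z2-plane by less than 2 pi, so closedness forces z2 = 0. A
    frequency below [2 * a] turns the z1-plane by less than 4 pi, hence exactly once, and the slope
    is [a]. This singles out the level [rho_a], since the slope exceeds [2 * a] beyond
    [rho0 + ep]. *)
Lemma classify : 0 < freq F m rs * rs - energy F m rs <= la ->
  [/\ rs = rho_a, freq F m rs = a, energy F m rs = hp F rho_a & kp F rs = 0] /\
  forall t, 0 <= t <= 1 -> [/\ yv t ord0 o0 = cos (2 * pi * t) * yv 0 ord0 o0 - sin (2 * pi * t) * yv 0 ord0 o1,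
    yv t ord0 o1 = sin (2 * pi * t) * yv 0 ord0 o0 + cos (2 * pi * t) * yv 0 ord0 o1 &
    yv 0 ord0 o0 ^+ 2 + yv 0 ord0 o1 ^+ 2 = a * rho_a / pi].
Proof.
move=> /andP[A0 A1]; have rl := rs_lt klow; have r0 := rho0_gt0 F; have p0 := pi_gt0 R.
have m0 : 0 < m by apply: lt_le_trans mla; exact: la_gt0.
have rgt : rho0 < rs.
  rewrite ltNge; apply/negP => h; have [E1 E2 E3 E4] := low_profile h.
  by move: A0; rewrite /freq /energy E1 E2 E3 E4; lra.
have [E1 E2] := hp_quad (ltW rgt) rl.
have dk0 : 0 <= dkp F rs.
  have [h3|h3] := leP rs (rho0 + ep); first by have [_ ->] := kp_low h3.
  have [_ ->] := kp_quad (ltW h3) rl; rewrite divr_ge0 ?(ltW e0) // mulr_ge0 // divr_ge0 ?(ltW e0) //; lra.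
have f0 : 0 < freq F m rs.
  rewrite /freq ltr_pwDl //; last by rewrite mulr_ge0 // ltW.
  by rewrite E2 divr_gt0 // mulr_gt0 ?mulr_gt0 // subr_gt0.
have fd := freq_defect rl.
have fa : freq F m rs < 2 * a.
  by rewrite -(ltr_pM2l r0); have := la_sa F; move: fd A1; lra.
have fb : freq F m rs < b.
  by rewrite -(ltr_pM2l r0); have := la_sb F; move: fd A1; lra.
set f := freq F m rs in A0 A1 f0 fd fa fb *.
pose w1 := 2 * pi * f / a; pose w2 := 2 * pi * f / b.
have w10 : 0 < w1 < 4 * pi.
  rewrite divr_gt0 ?mulr_gt0 //= ltr_pdivrMr // -subr_gt0.
  by rewrite (_ : _ - _ = 2 * pi * (2 * a - f)) ?mulr_gt0 ?subr_gt0 //; ring.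
have w20 : 0 < w2 < 2 * pi.
  rewrite divr_gt0 ?mulr_gt0 //= ltr_pdivrMr // -subr_gt0.
  by rewrite (_ : _ - _ = 2 * pi * (b - f)) ?mulr_gt0 ?subr_gt0 //; ring.
have rot t tt := @yv_rot R F z m X XU t0 t01 klow t tt.
have yper : yv 1 = yv 0 := congr1 (Yv a b (phi F) z) Xper.
have [p1 p2 p3 p4] := rot 1 ltac:(by rewrite ler01 lexx); rewrite yper !mulr1 in p1 p2 p3 p4.
have [y20 y30] := rot_fix (cos2Dsin2 w2) p3 p4 (cos_lt1 w20).
have rho_y : rho (yv 0) = rs by rewrite (proj2 (orbit XU t01 klow _)) // lexx ler01.
have E3 : pi * (yv 0 ord0 o0 ^+ 2 + yv 0 ord0 o1 ^+ 2) / a = rs.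
  by rewrite -rho_y /Qcd y20 y30 expr0n /= addr0 mulr0 mul0r addr0.
have w1E : w1 = 2 * pi.
  apply: cos_eq1 => //; apply/eqP; rewrite eq_le cos_le1 /= leNgt; apply/negP => cl.
  have [y00 y10] := rot_fix (cos2Dsin2 w1) p1 p2 cl.
  by move: E3; rewrite y00 y10 expr0n /= addr0 mulr0 mul0r; lra.
have fE : f = a.
  have : w1 * a = 2 * pi * a by rewrite w1E.
  rewrite /w1 divfK ?gt_eqF // => /(mulfI _); apply; by rewrite mulf_neq0 // gt_eqF.
have rE : rs = rho_a.
  have rle : rs <= rho0 + ep.
    rewrite leNgt; apply/negP => h; have : 2 * a < dhp F rs.
      rewrite E2 ltr_pdivlMr // ltr_pM2l ?mulr_gt0 //; lra.
    by have := mulr_ge0 (ltW m0) dk0; move: fa; rewrite /f /freq; lra.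
  have : dhp F rs = a by rewrite -fE /f /freq (proj2 (kp_low rle)) mulr0 addr0.
  rewrite E2 => /(canRL (divfK _)) E; have {}E := E ltac:(by rewrite gt_eqF).
  have : 2 * (rs - rho0) = ep by apply: (mulfI (x := a)); rewrite ?gt_eqF //; rewrite -E; ring.
  by rewrite /rho_a; lra.
have k0 : kp F rs = 0 by have [] := @kp_low rs => //; rewrite rE /rho_a; move: e0; lra.
split; first by split => //; rewrite /energy k0 mulr0 addr0 rE.
move=> t tt; have [q1 q2 _ _] := rot t tt; rewrite -/f -/w1 w1E in q1 q2; split => //.
by rewrite -rE -E3 [a * _]mulrC divfK ?gt_eqF // [pi * _]mulrC mulfK // gt_eqF.
Qed.

End Classification.

(** * The Palais-Smale property *)

Section SupBound.
Variables (R : realType) (F : sympfam R).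
Notation a := (sa F).
Notation b := (sb F).
Notation c := (sc F).
Notation d := (sd F).
Notation Q := (Qcd c d).
Notation la := (la F).
Notation R4 := 'rV[R]_4.
Let c0 := sc_gt0 F.
Let d0 := sd_gt0 F.
Let l0 := la_gt0 F.

Definition grd n (m : R) (z : R * R) (x : 'M[R]_(n.+1, 4)) : 'M[R]_(n.+1, 4) :=
  Lop x - \matrix_(j, i) gHam F m z (row j x) ord0 i.
Definition Act n (m : R) (z : R * R) (x : 'M[R]_(n.+1, 4)) : R :=
  actQ x - avg (fun j => Ham F m z (row j x)).

(** The last estimate converts an action bound on an almost critical loop into a bound on its mean
    excursion out of E(c, d). *)
Lemma gHam_bounds : exists C : R, [/\ 0 <= C,
  forall m z x, 0 <= m <= 9 * la -> unitK z -> `|gHam F m z x| <= C * (1 + `|x|) &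
  forall m z x, 0 <= m <= 9 * la -> unitK z ->
    2 * la * pos (Num.sqrt (Q x) - 1) - C <= 2^-1 * dot (gHam F m z x) x - Ham F m z x].
Proof.
have [[C1 C10 H1] _] := unif_compact c0 d0 (pullG_cont (plateau_hp F)) (fun z x => @pullG_out R F _ z x).
have [[C2 C20 H2] _] := unif_compact c0 d0 (pullG_cont (plateau_kp F)) (fun z x => @pullG_out R F _ z x).
pose W m z x := pullG F (dhp F) z x + m *: pullG F (dkp F) z x.
pose CW := C1 + 9 * la * C2; have CW0 : 0 < CW by rewrite addr_gt0 // mulr_gt0 // mulr_gt0.
have WC m z x : 0 <= m <= 9 * la -> unitK z -> `|W m z x| <= CW.
  move=> /andP[m0 m9] Kz; apply: le_trans (ler_normD _ _) _; apply: lerD; first exact: H1.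
  by rewrite normrZ ger0_norm // ler_pM //; exact: H2.
pose p := 2 * pi / c + 2 * pi / d; have pi2 := pi_gt0 R.
have pc : 0 <= 2 * pi / c by rewrite divr_ge0 ?mulr_ge0 ?ltW.
have pd : 0 <= 2 * pi / d by rewrite divr_ge0 ?mulr_ge0 ?ltW.
have p0 : 0 <= p by rewrite addr_ge0.
have gb (x : R4) : `|grho c d x| <= p * `|x|.
  apply/mx_norm_leP; first by rewrite mulr_ge0.
  move=> i j; rewrite !mxE ord1 normrM ler_pM ?le_mx_norm //.
  by case: ifP => _; rewrite ger0_norm // ?lerDl ?lerDr.
pose q := Num.sqrt ((c + d) / pi); have q0 : 0 <= q by exact: sqrtr_ge0.
pose C3 := 2 * CW * q + 9 * a * ep F / 2 + 9 * la.
have hc := hp_coef F.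
have C30 : 0 <= C3 by rewrite addr_ge0 ?addr_ge0 ?(ltW hc) // ?mulr_ge0 // ?(ltW CW0) // ltW.
have lp : 0 <= 2 * la * p by rewrite mulr_ge0 // mulr_ge0 // ltW.
exists (CW + 2 * la * p + C3); split; first by apply: addr_ge0 => //; apply: addr_ge0 => //; exact: ltW.
- move=> m z x hm Kz; rewrite /gHam -/(W m z x); apply: le_trans (ler_normD _ _) _.
  have /andP[g0 g1] := doutf_bound (Q x) (ltW l0).
  have : `|doutf la (Q x) *: grho c d x| <= 2 * la * p * `|x|.
    by rewrite normrZ ger0_norm // -mulrA ler_pM.
  have := WC m z x hm Kz; have := normr_ge0 x; move: `|x| `|W m z x| `|_ *: _| => A B D.
  move=> A0 hB hD; have : 0 <= (CW + C3) * A by rewrite mulr_ge0 // addr_ge0 // ltW.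
  by move: (2 * la * p) lp hD => P P0 hD; move: C30 CW0; nra.
- move=> m z x hm Kz; rewrite /gHam -/(W m z x) dotDl dotZl dot_grho //.
  have Wx : - (2 * CW * q) <= 2^-1 * dot (W m z x) x.
    have [Qx|Qx] := leP (Q x) 1; last first.
      by rewrite /W !pullG_out // scaler0 addr0 dot0l mulr0 oppr_le0 mulr_ge0 // mulr_ge0 // ltW.
    have : `|dot (W m z x) x| <= 4 * (CW * q).
      by apply: le_trans (norm_dot _ _) _; rewrite ler_pM2l // ler_pM // ?WC // Qcd_bd.
    by rewrite ler_norml => /andP[h _]; move: h; lra.
  have od := outf_defect la (Qcd_ge0 c0 d0 x).
  have : Ham F m z x <= 9 * a * ep F / 2 + 9 * la + outf la (Q x).
    rewrite lerD2r; apply: lerD; first by case/andP: (pullf_hp_itv F z x).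
    case/andP: hm => m0 m9; apply: le_trans m9; rewrite ler_piMr //.
    by case/andP: (khat_itv F z x).
  rewrite [2^-1 * (_ + _)]mulrDr (_ : 2^-1 * (doutf la (Q x) * (2 * Q x)) = doutf la (Q x) * Q x); last by field.
  rewrite (canRL (subrK _) od) /C3; move: Wx lp (ltW CW0).
  move: (2 * la * p) (outf _ _) (Ham _ _ _ _) (dot _ _) (2 * la * pos _) (9 * a * ep F / 2) (2 * CW * q).
  by move=> P O H W' S e2 T hT P0 CW0' hH; lra.
Qed.

Section Fix_n.
Variable n : nat.
Notation N := n.+1.
Implicit Types x g : 'M[R]_(N, 4).

Lemma avg_shift (f : 'I_N -> R) : avg (fun j => f (ordS j)) = avg f.
Proof. by rewrite /avg [in RHS](reindex (@ordS N)) //=; exact: onW_bij (ordS_bij N). Qed.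

(** Forward differences of a coordinate are, up to sign and a shift in time, the entries of [Lop]
    for the conjugate coordinate. *)
Lemma dx_avg x i : exists i', avg (fun j => `|dx x j i|) = avg (fun j => `|Lop x j i'|).
Proof.
move: i; apply: ord4P.
- exists o1; congr avg; apply/funext => j; have [_ -> _ _] := LopE x j; by rewrite normrN.
- exists o0; rewrite -(avg_shift (fun j => `|Lop x j o0|)); congr avg; apply/funext => j.
  by have [-> _ _ _] := LopE x (ordS j); rewrite ordSK.
- exists o3; congr avg; apply/funext => j; have [_ _ _ ->] := LopE x j; by rewrite normrN.
- exists o2; rewrite -(avg_shift (fun j => `|Lop x j o2|)); congr avg; apply/funext => j.
  by have [_ _ -> _] := LopE x (ordS j); rewrite ordSK.
Qed.

Lemma osc_L1 x j k i : `|x j i - x k i| <= avg (fun l => `|dx x l i|).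
Proof.
wlog kj : j k / (k <= j)%N.
  by move=> H; have /orP[/H//|/H] := leq_total k j; rewrite distrC.
have := xs_diff x k (j - k) i; rewrite subnKC // !xsE !inZp_ord => ->.
rewrite normrM ger0_norm ?invr_ge0 // /avg ler_pM2l ?invr_gt0 //.
apply: le_trans (ler_norm_sum _ _ _) _.
have := @sum_window R n (fun l => `|dx x l i|) k (j - k); rewrite subnKC //; apply => //.
by apply: leq_trans (leq_subr _ _) _; exact: ltnW.
Qed.

Lemma avg_nL2 g i : avg (fun j => `|g j i|) <= nL2 g.
Proof.
rewrite -[leLHS]ger0_norm ?avg_ge0 // -sqrtr_sqr ler_wsqrtr //.
apply: le_trans (avg_sqr _) _; apply: ler_avg => j.
by rewrite real_normK ?num_real // expr2 (bigD1 i) //= lerDl sumr_ge0 // => k _; rewrite -expr2 sqr_ge0.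
Qed.

Lemma nL2_sup x : nL2 x <= 2 * `|x|.
Proof.
have -> : 2 * `|x| = Num.sqrt ((2 * `|x|) ^+ 2) by rewrite sqrtr_sqr ger0_norm // mulr_ge0.
rewrite ler_wsqrtr // -(avg_cst n ((2 * `|x|) ^+ 2)); apply: ler_avg => j.
have h i : x j i * x j i <= `|x| ^+ 2.
  by rewrite -expr2 -[leLHS]real_normK ?num_real // ler_pXn2r ?nnegrE // le_mx_norm.
rewrite sum4; have := h o0; have := h o1; have := h o2; have := h o3; rewrite exprMn; lra.
Qed.

(** Pairing the gradient with the loop removes the quadratic part of the action. *)
Lemma Act_defect m z x : Act m z x - 2^-1 * ip (grd m z x) x =
  avg (fun j => 2^-1 * dot (gHam F m z (row j x)) (row j x) - Ham F m z (row j x)).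
Proof.
rewrite /Act /grd ipBl (avgD (fun j => 2^-1 * _)) avgZ avgN /actQ ipC.
rewrite (_ : ip (\matrix_(_, _) _) x = avg (fun j => dot (gHam F m z (row j x)) (row j x))).
  by ring.
by congr avg; apply/funext => j; apply: eq_bigr => i _; rewrite !mxE.
Qed.

Lemma row_norm x j : `|row j x| <= `|x|.
Proof. by apply/mx_norm_leP => // i k; rewrite mxE le_mx_norm. Qed.

End Fix_n.

(** The defect bounds the mean excursion in terms of [ka * S]; the equation then bounds the L1 norm
    of the derivative, and so the oscillation. The resulting inequality [S <= A0 + A1 * ka * S]
    closes for small [ka], with constants independent of [n]. *)
Lemma sup_bound : exists2 ka : R, 0 < ka & exists2 B : R, 0 < B & forall n m z (x : 'M[R]_(n.+1, 4)),
  0 <= m <= 9 * la -> unitK z -> nL2 (grd m z x) < ka -> Act m z x <= la -> `|x| <= B.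
Proof.
have [C [C0 HC HD]] := gHam_bounds.
pose q := Num.sqrt ((c + d) / pi); have q0 : 0 <= q by exact: sqrtr_ge0.
pose q1 := q + C * q; have q10 : 0 <= q1 by rewrite addr_ge0 // mulr_ge0.
pose A1 := q1 / (2 * la); have A10 : 0 <= A1 by rewrite divr_ge0 // mulr_ge0 // ltW.
pose A0 := q1 * (1 + (la + C) / (2 * la)) + C + 1.
have A00 : 0 < A0.
  apply: ltr_wpDl => //; apply: addr_ge0 => //; apply: mulr_ge0 => //; apply: addr_ge0 => //.
  by apply: divr_ge0; [apply: addr_ge0 => //; exact: ltW|apply: mulr_ge0 => //; exact: ltW].
exists (Num.min 1 (2 * A1 + 1)^-1); first by rewrite lt_min ltr01 invr_gt0 ltr_wpDl // mulr_ge0.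
exists (2 * A0) => [|n m z x hm Kz]; first by rewrite mulr_gt0.
rewrite lt_min; set ka := nL2 _ => /andP[k1 k2] Ala; have ka0 : 0 <= ka by exact: nL2_ge0.
set S := `|x|; have S0 : 0 <= S by exact: normr_ge0.
pose P := avg (fun j => pos (Num.sqrt (Q (row j x)) - 1)).
have P1 : 2 * la * P - C <= la + ka * S.
  have : 2 * la * P - C <= avg (fun j => 2^-1 * dot (gHam F m z (row j x)) (row j x) - Ham F m z (row j x)).
    by rewrite -avgZ -(avg_cst n C) -avgN -avgD; apply: ler_avg => j; exact: HD.
  move/le_trans; apply; rewrite -Act_defect.
  have : `|ip (grd m z x) x| <= ka * (2 * S).
    by apply: le_trans (ip_le _ _) _; rewrite ler_wpM2l // nL2_sup.
  by rewrite ler_norml => /andP[h _]; move: h Ala; move: (ip _ _) (Act _ _ _) => I A h hA; lra.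
have P2 : P <= (la + C + ka * S) / (2 * la).
  by rewrite ler_pdivlMr ?mulr_gt0 // mulrC; move: P1; lra.
have rowQ j : `|row j x| <= q * (1 + pos (Num.sqrt (Q (row j x)) - 1)).
  apply: (@le_trans _ _ (q * Num.sqrt (Q (row j x)))); last first.
    by rewrite ler_wpM2l // addrC -lerBlDr le_max lexx orbT.
  apply/mx_norm_leP; first by rewrite mulr_ge0 // sqrtr_ge0.
  move=> i k; rewrite ord1 -sqrtr_sqr /q -sqrtrM; last by rewrite divr_ge0 ?pi_ge0 // addr_ge0 // ltW.
  by rewrite ler_wsqrtr // sup_le_Qcd.
have rowA : avg (fun j => `|row j x|) <= q * (1 + P).
  by rewrite /P -{1}(avg_cst n 1) -avgD -avgZ; exact: ler_avg.
have LA i : avg (fun j => `|Lop x j i|) <= C * (1 + q * (1 + P)) + ka.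
  have E j : Lop x j i = gHam F m z (row j x) ord0 i + grd m z x j i.
    transitivity ((grd m z x + \matrix_(j, i) gHam F m z (row j x) ord0 i) j i); first by rewrite /grd subrK.
    by rewrite mxE addrC [X in X + _]mxE.
  apply: (@le_trans _ _ (avg (fun j => `|gHam F m z (row j x)| + `|grd m z x j i|))).
    by apply: ler_avg => j; rewrite E; apply: le_trans (ler_normD _ _) _; rewrite lerD2r le_mx_norm.
  rewrite avgD; apply: lerD; last exact: avg_nL2.
  apply: (@le_trans _ _ (avg (fun j => C * (1 + `|row j x|)))).
    by apply: ler_avg => j; exact: HC.
  by rewrite avgZ avgD avg_cst ler_wpM2l // lerD2l.
have Sb : S <= q * (1 + P) + (C * (1 + q * (1 + P)) + ka).
  have P0 : 0 <= P by apply: avg_ge0 => j; exact: pos_ge0.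
  have T0 : 0 <= q * (1 + P) by apply: mulr_ge0 => //; apply: addr_ge0.
  apply/mx_norm_leP; first by apply: addr_ge0 => //; apply: addr_ge0 => //; apply: mulr_ge0 => //; apply: addr_ge0.
  move=> j i; apply: (@le_trans _ _ (avg (fun l => `|x l i| + `|x j i - x l i|))).
    rewrite -{1}(avg_cst n `|x j i|); apply: ler_avg => l.
    by have := ler_normD (x l i) (x j i - x l i); rewrite addrC subrK.
  rewrite avgD; apply: lerD.
    apply: le_trans rowA; apply: ler_avg => l.
    by apply: le_trans (le_mx_norm _ ord0 i); rewrite mxE.
  have [i' Ei'] := dx_avg x i; apply: le_trans (LA i'); rewrite -Ei'.
  by rewrite -[leRHS](avg_cst n); apply: ler_avg => l; exact: osc_L1.
have S1 : S <= A0 + A1 * ka * S.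
  apply: le_trans Sb _; have -> : A0 + A1 * ka * S = q1 * (1 + (la + C + ka * S) / (2 * la)) + C + 1.
    by rewrite /A0 /A1; field; rewrite gt_eqF.
  have : q1 * (1 + P) <= q1 * (1 + (la + C + ka * S) / (2 * la)) by rewrite ler_wpM2l // lerD2l.
  by rewrite {1}/q1; move: (q1 * _) => T h; move: k1; rewrite mulrDl in h; lra.
have : A1 * ka <= 2^-1.
  have : (2 * A1 + 1) * ka < 1 by rewrite -ltr_pdivlMl ?mulr1 // ltr_wpDl // mulr_ge0.
  by move: ka0; lra.
move=> h; have : A1 * ka * S <= 2^-1 * S by rewrite ler_wpM2r.
by move: S1; move: (A1 * ka * S) => T; lra.
Qed.

End SupBound.

(** * Almost critical loops as approximate trajectories *)

Section Window.
Variables (R : realType) (F : sympfam R) (n : nat).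
Notation N := n.+1.
Notation R4 := 'rV[R]_4.
Implicit Types x : 'M[R]_(N, 4).

Lemma LopgE m z x j i : Lop x j i = gHam F m z (row j x) ord0 i + grd F m z x j i.
Proof.
transitivity ((grd F m z x + \matrix_(j, i) gHam F m z (row j x) ord0 i) j i); first by rewrite /grd subrK.
by rewrite mxE addrC [X in X + _]mxE.
Qed.

(** The offset [r] comes from the staggering: the equation of an even coordinate reads the field at
    the current sample, that of an odd coordinate at the next one. *)
Lemma dx_eq m z x i : exists2 G : 'I_N -> R, (forall j, 0 <= G j) /\ avg G <= nL2 (grd F m z x) &
  exists2 r : nat, (r <= 1)%N & forall l,
    `|dx x (inZp l) i - (gHam F m z (xs x (l + r)%N) *m Om R) ord0 i| <= G (inZp l).
Proof.
have ev i1 (P : 'rV[R]_4 -> R) i0 : (forall j, dx x j i0 = - Lop x j i1) ->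
    (forall u : R4, P u = - u ord0 i1) -> exists2 G : 'I_N -> R, (forall j, 0 <= G j) /\ avg G <= nL2 (grd F m z x) &
    exists2 r : nat, (r <= 1)%N & forall l, `|dx x (inZp l) i0 - P (gHam F m z (xs x (l + r)%N))| <= G (inZp l).
  move=> E1 E2; exists (fun j => `|grd F m z x j i1|); first by split => //; exact: avg_nL2.
  exists 0%N => // l; rewrite addn0 E1 E2 (LopgE m z) /xs opprD opprK addrAC addNr add0r normrN //.
have od i1 (P : 'rV[R]_4 -> R) i0 : (forall j, dx x j i0 = Lop x (ordS j) i1) ->
    (forall u : R4, P u = u ord0 i1) -> exists2 G : 'I_N -> R, (forall j, 0 <= G j) /\ avg G <= nL2 (grd F m z x) &
    exists2 r : nat, (r <= 1)%N & forall l, `|dx x (inZp l) i0 - P (gHam F m z (xs x (l + r)%N))| <= G (inZp l).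
  move=> E1 E2; exists (fun j => `|grd F m z x (ordS j) i1|).
    by split => //; rewrite (avg_shift (fun j => `|grd F m z x j i1|)); exact: avg_nL2.
  by exists 1%N => // l; rewrite addn1 E1 E2 (LopgE m z) /xs inZpS addrAC subrr add0r.
move: i; apply: ord4P.
- apply: (ev o1 (fun u => (u *m Om R) ord0 o0)) => [j|u]; last by have [] := OmE u.
  by have [_ -> _ _] := LopE x j; rewrite opprK.
- apply: (od o0 (fun u => (u *m Om R) ord0 o1)) => [j|u]; last by have [] := OmE u.
  by have [-> _ _ _] := LopE x (ordS j); rewrite ordSK.
- apply: (ev o3 (fun u => (u *m Om R) ord0 o2)) => [j|u]; last by have [] := OmE u.
  by have [_ _ _ ->] := LopE x j; rewrite opprK.
- apply: (od o2 (fun u => (u *m Om R) ord0 o3)) => [j|u]; last by have [] := OmE u.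
  by have [_ _ -> _] := LopE x (ordS j); rewrite ordSK.
Qed.

(** The defect of the equation is controlled in mean over the whole circle, so it enters once,
    whatever the length of the window. *)
Lemma window m z x (p h : nat) (V0 : R4) (e : R) : (h <= N)%N ->
  (forall l, (p <= l <= p + h)%N -> `|gHam F m z (xs x l) *m Om R - V0| <= e) ->
  `|xs x (p + h)%N - xs x p - (h%:R / N%:R) *: V0| <= h%:R / N%:R * e + nL2 (grd F m z x).
Proof.
move=> hN HV; have e0 : 0 <= e by apply: le_trans (HV p _); rewrite // leqnn leq_addr.
apply/mx_norm_leP; first by rewrite addr_ge0 ?nL2_ge0 // mulr_ge0 // divr_ge0.
move=> i0 i; rewrite (ord1 i0) {i0}.
have [G [G0 GL] [r r1 HG]] := dx_eq m z x i.
have -> : (xs x (p + h)%N - xs x p - (h%:R / N%:R) *: V0) ord0 i =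
   xs x (p + h)%N ord0 i - xs x p ord0 i - h%:R / N%:R * V0 ord0 i.
  by rewrite !mxE.
rewrite xs_diff (_ : h%:R / N%:R * V0 ord0 i = N%:R^-1 * \sum_(p <= l < p + h) V0 ord0 i); last first.
  by rewrite sumr_const_nat addKn -[V0 ord0 i *+ h]mulr_natl mulrA [N%:R^-1 * _]mulrC.
rewrite -mulrBr -sumrB normrM ger0_norm ?invr_ge0 //.
apply: (@le_trans _ _ (N%:R^-1 * \sum_(p <= l < p + h) (G (inZp l) + e))).
  rewrite ler_pM2l ?invr_gt0 //; apply: le_trans (ler_norm_sum _ _ _) _.
  apply: ler_sum_nat => l /andP[pl lh]; set d1 := dx _ _ _.
  rewrite -(subrK ((gHam F m z (xs x (l + r)%N) *m Om R) ord0 i) d1) -addrA.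
  apply: le_trans (ler_normD _ _) _; apply: lerD; first exact: HG.
  have lr : (p <= l + r <= p + h)%N.
    rewrite (leq_trans pl (leq_addr _ _)) /= (leq_trans (leq_add (leqnn l) r1)) //.
    by rewrite addn1.
  apply: le_trans (HV _ lr); apply: le_trans (le_mx_norm _ ord0 i).
  by rewrite [(_ - V0) _ _]mxE [(- V0) _ _]mxE.
rewrite big_split /= sumr_const_nat addKn -[e *+ h]mulr_natl mulrDr addrC lerD //.
  by rewrite mulrA [N%:R^-1 * _]mulrC.
by apply: le_trans GL; rewrite /avg ler_pM2l ?invr_gt0 // sum_window.
Qed.

End Window.

(** * Limits along an ultrafilter *)

Section Ultra.
Variables (R : realType) (U : set_system nat).
Hypothesis UU : UltraFilter U.
Let UP : ProperFilter U := ultra_proper.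

(** An ultrafilter provides limits of all sequences in compact sets simultaneously, in place of
    repeated extraction of subsequences. *)
Lemma ulim (T : pseudoMetricType R) (C : set T) (u : nat -> T) : compact C ->
  (forall i, C (u i)) -> exists2 l, C l & forall e : R, 0 < e -> U [set i | ball l e (u i)].
Proof.
move=> cC Cu; have [l [Cl cl]] := cC (u @ U) (fmap_proper_filter u UP) (@filterE _ U _ (u @^-1` C) Cu).
exists l => // e e0; have [//|nb] := in_ultra_setVsetC [set i | ball l e (u i)] UU.
have [y [/= ny yb]] := cl [set y | ~ ball l e y] (ball l e) nb (nbhsx_ballx l e e0).
by [].
Qed.

Lemma u_all (K : nat) (P : nat -> nat -> Prop) : (forall k, (k <= K)%N -> U [set i | P k i]) ->
  U [set i | forall k, (k <= K)%N -> P k i].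
Proof.
elim: K => [|K IH] H.
  by apply: filterS (H 0%N (leqnn _)) => i Pi k; rewrite leqn0 => /eqP ->.
apply: filterS2 (IH _) (H K.+1 (leqnn _)) => [i Hi PK k|k kK].
  by rewrite leq_eqVlt => /predU1P[->//|]; exact: Hi.
by apply: H; exact: leq_trans kK _.
Qed.

End Ultra.

Section Joint.
Variables (R : realType) (F : sympfam R).
Notation R4 := 'rV[R]_4.
Notation W := (R * ((R * R) * R4))%type.

Lemma snd_cont (T : topologicalType) (f : (R * R) * R4 -> T) : continuous f ->
  continuous (fun w : W => f w.2).
Proof. by move=> fc w; apply: continuous_comp; [exact: cvg_snd|exact: fc]. Qed.

Lemma Ham_cont : continuous (fun w : W => Ham F w.1 w.2.1 w.2.2).
Proof.
apply: contD; last first.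
  apply: (snd_cont (f := fun p : (R * R) * R4 => outf (la F) (Qcd (sc F) (sd F) p.2))) => p.
  apply: (@C11_cont R _ _ _ _ (fun p : (R * R) * R4 => Qcd (sc F) (sd F) p.2) _ (C11_outf (la_gt0 F))); first by move=> *; apply: Qcd_ge0; [exact: sc_gt0|exact: sd_gt0].
  by apply: continuous_comp; [exact: cvg_snd|exact: continuous_Qcd].
apply: contD; first exact: (snd_cont (pullf_cont (plateau_hp F))).
apply: contM; first by move=> w; exact: cvg_fst.
exact: (snd_cont (@khat_cont R F)).
Qed.

Lemma gHam_cont3 : continuous (fun w : W => gHam F w.1 w.2.1 w.2.2).
Proof.
apply: contD; last first.
  apply: (snd_cont (f := fun p : (R * R) * R4 => doutf (la F) (Qcd (sc F) (sd F) p.2) *: grho (sc F) (sd F) p.2)) => p.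
  by apply: (@continuous_comp _ _ _ snd (fun x => doutf (la F) (Qcd (sc F) (sd F) x) *: grho (sc F) (sd F) x));
    [exact: cvg_snd|exact: continuous_doutf].
apply: contD; first exact: (snd_cont (pullG_cont (plateau_hp F))).
apply: contZ; first by move=> w; exact: cvg_fst.
exact: (snd_cont (pullG_cont (plateau_kp F))).
Qed.

End Joint.

Section Dichotomy.
Variables (R : realType) (F : sympfam R) (n : nat).
Notation N := n.+1.
Implicit Types x : 'M[R]_(N, 4).

(* [Th1] and [Th2] are the components of the first Fourier coefficient of the [z1]-coordinate of the
   loop, seen in the source ellipsoid and cut off where [kp] is nonzero. *)
Definition avk (z : R * R) x : R := avg (fun j => khat F z (row j x)).
Definition Th1 (z : R * R) x : R := avg (fun j : 'I_N =>
  cos (2 * pi * (j%:R / N%:R)) * Tf F z (row j x) ord0 o0 +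
  sin (2 * pi * (j%:R / N%:R)) * Tf F z (row j x) ord0 o1).
Definition Th2 (z : R * R) x : R := avg (fun j : 'I_N =>
  - sin (2 * pi * (j%:R / N%:R)) * Tf F z (row j x) ord0 o0 +
  cos (2 * pi * (j%:R / N%:R)) * Tf F z (row j x) ord0 o1).
Definition th0 : R := sa F * rho_a F / pi.
(** An exact lower orbit has |z1|^2 = [th0] and mean [khat] equal to 0. The constants leave room for
    nearby loops, and the gap between 1/8 and 3/8 keeps the two kinds apart. *)
Definition lower (z : R * R) x := 4 / 9 * th0 <= Th1 z x ^+ 2 + Th2 z x ^+ 2 /\ avk z x <= 1 / 8.
Definition upper (z : R * R) x := 3 / 8 <= avk z x.

Lemma avg_close (f g : 'I_N -> R) (e : R) : (forall j, `|f j - g j| <= e) -> `|avg f - avg g| <= e.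
Proof.
move=> H; rewrite -avgN -avgD; apply: le_trans (ler_norm_avg _) _.
by rewrite -(avg_cst n e); exact: ler_avg.
Qed.

End Dichotomy.

(** * Convergence of almost critical loops as the mesh tends to zero *)

Section Sequence.
Variables (R : realType) (F : sympfam R) (U : set_system nat).
Notation R4 := 'rV[R]_4.
Notation la := (la F).
Hypothesis UU : UltraFilter U.
Let UP : ProperFilter U := ultra_proper.
Hypothesis Uoo : forall k : nat, U [set i | (k <= i)%N].
Variables (n_ : nat -> nat) (z_ : nat -> R * R) (m_ : nat -> R) (x_ : forall i, 'M[R]_((n_ i).+1, 4)).
Variable B : R.
Hypothesis n_ge : forall i, (i <= n_ i)%N.
Hypothesis zK : forall i, unitK (z_ i).
Hypothesis mI : forall i, la <= m_ i <= 9 * la.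
Hypothesis g_small : forall i, nL2 (grd F (m_ i) (z_ i) (x_ i)) < i.+1%:R^-1.
Hypothesis xB : forall i, `|x_ i| <= B.
Notation NN i := ((n_ i).+1%:R : R).

Lemma u_small (e : R) : 0 < e -> U [set i | i.+1%:R^-1 < e].
Proof.
move=> e0; have [k Hk] : exists k : nat, e^-1 < k%:R.
  by exists (Num.truncn e^-1).+1; rewrite truncnS_gt.
apply: filterS (Uoo k) => i /= ki.
rewrite -[e]invrK ltf_pV2 ?posrE ?invr_gt0 // (lt_le_trans Hk) // ler_nat; exact: leq_trans ki (leqnSn _).
Qed.

Lemma NN_inv i : (NN i)^-1 <= i.+1%:R^-1.
Proof. by rewrite lef_pV2 ?posrE // ler_nat ltnS. Qed.

Definition pt i (t : R) : nat := Num.truncn (t * NN i).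

Lemma ball_cpt : compact [set y : R4 | `|y| <= B].
Proof.
have := @ball_compact R 0 B [set t | t <= B] (@closed_le _ B) (fun t h => h).
congr compact; by apply/seteqP; split=> y /=; rewrite sub0r normrN.
Qed.

Lemma xsB i p : `|xs (x_ i) p| <= B.
Proof. by apply: le_trans (xB i); exact: row_norm. Qed.

Lemma X_ex t : exists2 l : R4, `|l| <= B & forall e : R, 0 < e -> U [set i | `|l - xs (x_ i) (pt i t)| < e].
Proof.
have [l lB Hl] := ulim UU ball_cpt (fun i => xsB i (pt i t)).
by exists l => // e /Hl; apply: filterS => i /=; rewrite -ball_normE.
Qed.

(** The limit is chosen for each time separately; regularity in time is derived afterwards. *)
Definition X t : R4 := sval (cid2 (X_ex t)).

Lemma XB t : `|X t| <= B. Proof. by rewrite /X; case: cid2. Qed.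

Lemma Xlim t (e : R) : 0 < e -> U [set i | `|X t - xs (x_ i) (pt i t)| < e].
Proof. by rewrite /X; case: cid2 => l /= _ H /H. Qed.

Lemma B_ge0 : 0 <= B. Proof. by apply: le_trans (XB 0). Qed.

Lemma z_ex : exists2 z, unitK z & forall e : R, 0 < e -> U [set i | ball z e (z_ i)].
Proof. by have [l Kl Hl] := ulim UU (@compact_unitK R) zK; exists l. Qed.

Lemma m_ex : exists2 m : R, la <= m <= 9 * la & forall e : R, 0 < e -> U [set i | ball m e (m_ i)].
Proof.
have [|m mI' H] := ulim UU (@segment_compact R la (9 * la)) (u := m_).
  by move=> i; rewrite /= in_itv /=.
by exists m => //; move: mI'; rewrite /= in_itv.
Qed.

Definition zl := sval (cid2 z_ex).
Definition ml := sval (cid2 m_ex).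
Lemma zlK : unitK zl. Proof. by rewrite /zl; case: cid2. Qed.
Lemma zlP (e : R) : 0 < e -> U [set i | ball zl e (z_ i)].
Proof. by rewrite /zl; case: cid2 => l /= _ H /H. Qed.
Lemma mlI : la <= ml <= 9 * la. Proof. by rewrite /ml; case: cid2. Qed.
Lemma mlP (e : R) : 0 < e -> U [set i | ball ml e (m_ i)].
Proof. by rewrite /ml; case: cid2 => l /= _ H /H. Qed.

Lemma m_ok (m : R) : la <= m <= 9 * la -> 0 <= m <= 9 * la.
Proof. by move=> /andP[h ->]; rewrite (le_trans _ h) // ltW // la_gt0. Qed.

Lemma MV_ex : exists2 MV : R, 0 <= MV & forall i l, `|gHam F (m_ i) (z_ i) (xs (x_ i) l) *m Om R| <= MV.
Proof.
have [C [C0 HC _]] := gHam_bounds F.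
exists (4 * (C * (1 + B) * `|Om R|)).
  by rewrite mulr_ge0 // mulr_ge0 // mulr_ge0 // addr_ge0 // B_ge0.
move=> i l; apply: le_trans (norm_mulmx _ _) _; rewrite ler_pM2l // ler_wpM2r //.
apply: le_trans (HC _ _ _ (m_ok (mI i)) (zK i)) _.
by rewrite ler_wpM2l // lerD2l xsB.
Qed.

Definition MV := sval (cid2 MV_ex).
Lemma MV_ge0 : 0 <= MV. Proof. by rewrite /MV; case: cid2. Qed.
Lemma MVP i l : `|gHam F (m_ i) (z_ i) (xs (x_ i) l) *m Om R| <= MV.
Proof. by rewrite /MV; case: cid2 => /= M _; exact. Qed.

Lemma xs_lip i (p h : nat) : (h <= (n_ i).+1)%N ->
  `|xs (x_ i) (p + h)%N - xs (x_ i) p| <= h%:R / NN i * MV + i.+1%:R^-1.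
Proof.
move=> hN; have := @window R F (n_ i) (m_ i) (z_ i) (x_ i) p h 0 MV hN.
rewrite scaler0 subr0 => H; apply: le_trans (H _) _; last by rewrite lerD2l ltW.
by move=> l _; rewrite subr0 MVP.
Qed.

Lemma pt_itv i t : 0 <= t -> (pt i t)%:R <= t * NN i < (pt i t).+1%:R.
Proof. by move=> t0; apply: truncn_itv; rewrite mulr_ge0. Qed.

Lemma pt_mono i s t : s <= t -> (pt i s <= pt i t)%N.
Proof. by move=> st; apply: le_truncn; rewrite ler_wpM2r. Qed.

Lemma pt_leN i t : t <= 1 -> (pt i t <= (n_ i).+1)%N.
Proof.
move=> t1; have -> : (n_ i).+1 = pt i 1 by rewrite /pt mul1r natrK.
exact: pt_mono.
Qed.

(** The limit form of [window]. With [V0 = 0] it gives the Lipschitz bound, with [V0] the field at a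
    point it gives the differential equation. *)
Lemma lim_window s t (V0 : R4) (e : R) : 0 <= s -> s <= t -> t <= 1 ->
  U [set i | forall l, (pt i s <= l <= pt i t)%N ->
      `|gHam F (m_ i) (z_ i) (xs (x_ i) l) *m Om R - V0| <= e] ->
  `|X t - X s - (t - s) *: V0| <= (t - s) * e.
Proof.
move=> s0 st t1 UV; have t0 := le_trans s0 st.
have e0 : 0 <= e.
  have [i /= Hi] := filter_ex UV; apply: le_trans (Hi (pt i s) _); rewrite // leqnn /=; exact: pt_mono.
apply/ler_addgt0Pr => et et0; pose D := `|V0| + e + 4; have D0 : 0 < D by rewrite ltr_wpDl // addr_ge0.
have eD : 0 < et / D by rewrite divr_gt0.
have [i [[/= Vi xt] [xs_ iD]]] := filter_ex (filterI (filterI UV (Xlim t eD)) (filterI (Xlim s eD) (u_small eD))).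
have st' := pt_mono i st; pose h := (pt i t - pt i s)%N.
have ph : (pt i s + h = pt i t)%N by rewrite subnKC.
have hN : (h <= (n_ i).+1)%N by apply: leq_trans (leq_subr _ _) _; exact: pt_leN.
have := @window R F (n_ i) (m_ i) (z_ i) (x_ i) (pt i s) h V0 e hN; rewrite ph => /(_ Vi) W.
have N0 : 0 < NN i by rewrite ltr0n.
set k := et / D in eD xt xs_ iD *; set q := h%:R / NN i in W *.
have qd : `|q - (t - s)| <= k.
  apply: (@le_trans _ _ (NN i)^-1); last by apply: le_trans (NN_inv i) _; exact: ltW.
  rewrite -(ler_pM2r N0) mulVf ?gt_eqF // -[X in _ * X](gtr0_norm N0) -normrM mulrBl.
  rewrite /q divfK ?gt_eqF // /h natrB // mulrBl.
  have := pt_itv i s0; have := pt_itv i t0; rewrite -[(pt i s).+1%:R]natr1 -[(pt i t).+1%:R]natr1 ler_norml.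
  move: (t * NN i) (s * NN i) => T S /andP[? ?] /andP[? ?]; apply/andP; split; lra.
set A := xs (x_ i) (pt i t) in xt W *; set A' := xs (x_ i) (pt i s) in xs_ W *.
have -> : X t - X s - (t - s) *: V0 = (X t - A) + (A' - X s) + (A - A' - q *: V0) + (q - (t - s)) *: V0.
  have gen (p r u v w1 w2 : R4) : p - r - w2 = (p - u) + (v - r) + (u - v - w1) + (w1 - w2).
    by apply/rowP => j; rewrite !mxE; ring.
  by rewrite [(q - _) *: _]scalerBl; exact: gen.
apply: le_trans (ler_normD _ _) _; apply: le_trans (lerD (ler_normD _ _) (lexx _)) _.
apply: le_trans (lerD (lerD (ler_normD _ _) (lexx _)) (lexx _)) _.
rewrite [`|A' - _|]distrC normrZ.
have b1 : q * e <= (t - s) * e + k * e.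
  by rewrite -mulrDl ler_wpM2r //; move: qd; rewrite ler_norml => /andP[_ ?]; lra.
have b2 : `|q - (t - s)| * `|V0| <= k * `|V0| by rewrite ler_wpM2r.
have gs := g_small i.
have -> : et = k * `|V0| + k * e + k * 4 by rewrite -!mulrDr /k divfK // gt_eqF.
move: W gs iD xt xs_ b1 b2; move: (q * e) (nL2 _) (k * e) (k * `|V0|) (_ * `|V0|) `|A - A' - _| `|X t - A| `|X s - A'| ((t - s) * e) i.+1%:R^-1 => *.
lra.
Qed.

Lemma X_lip s t : 0 <= s <= 1 -> 0 <= t <= 1 -> `|X t - X s| <= MV * `|t - s|.
Proof.
wlog st : s t / s <= t.
  move=> H s01 t01; have /orP[st|ts] := le_total s t; first exact: H.
  by rewrite distrC (distrC t); exact: H.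
move=> /andP[s0 s1] /andP[t0 t1]; rewrite (ger0_norm (x := t - s)) ?subr_ge0 // mulrC.
have := @lim_window s t 0 MV s0 st t1; rewrite scaler0 subr0; apply.
by apply: filterE => i l _; rewrite subr0 MVP.
Qed.

Lemma X_per : X 1 = X 0.
Proof.
apply/eqP; rewrite -subr_eq0 -normr_le0; apply/ler_addgt0Pr => e e0; rewrite add0r.
have e20 : 0 < e / 2 by rewrite divr_gt0.
have [i [/= h1 h2]] := filter_ex (filterI (Xlim 1 e20) (Xlim 0 e20)).
move: h1 h2; rewrite /pt mul1r natrK mul0r truncn0 -[in X in `|_ - xs _ X|](add0n (n_ i).+1) xsN => h1 h2.
rewrite -(subrK (xs (x_ i) 0) (X 1)) -addrA; apply: le_trans (ler_normD _ _) _.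
by rewrite (distrC _ (X 0)); move: h1 h2; lra.
Qed.

(** Arzela-Ascoli argument: convergence at the finitely many times [k / K] controls all samples,
    through the common Lipschitz bounds of the limit and of the loops. *)
Lemma X_close (e : R) : 0 < e ->
  U [set i | forall p, (p <= (n_ i).+1)%N -> `|X (p%:R / NN i) - xs (x_ i) p| < e].
Proof.
move=> e0; have M0 := MV_ge0; have e40 : 0 < e / 4 by rewrite divr_gt0.
have M1 : 0 < MV + 1 by rewrite ltr_wpDl.
pose K := (Num.truncn ((MV + 1) / (e / 8))).+1.
have K0 : 0 < K%:R :> R by rewrite ltr0n.
have KM : (MV + 1) / K%:R < e / 8.
  by rewrite ltr_pdivrMr // mulrC -ltr_pdivrMr ?divr_gt0 // /K truncnS_gt.
have U1 := u_all UU (fun k (_ : (k <= K)%N) => Xlim (k%:R / K%:R) e40).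
apply: filterS2 U1 (u_small (divr_gt0 e40 M1)) => i Hk iM p pN.
have N0 : 0 < NN i by rewrite ltr0n.
set t := p%:R / NN i; have t01 : 0 <= t <= 1 by exact: itv_ratio.
have /andP[t0 t1] := t01; pose k := Num.truncn (t * K%:R).
have /andP[k1 k2] : k%:R <= t * K%:R < k.+1%:R by apply: truncn_itv; rewrite mulr_ge0 // ltW.
have kK : (k <= K)%N by rewrite -(ler_nat R); apply: le_trans k1 _; rewrite ler_piMl // ltW.
pose tk : R := k%:R / K%:R.
have tk01 : 0 <= tk <= 1 by exact: itv_ratio.
have tkt : tk <= t by rewrite /tk ler_pdivrMr.
have tkd : t - tk <= K%:R^-1.
  by rewrite -(ler_pM2r K0) mulVf ?gt_eqF // mulrBl /tk divfK ?gt_eqF //; move: k2; rewrite -natr1; lra.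
have pE : pt i t = p by rewrite /pt /t divfK ?gt_eqF // natrK.
have pp : (pt i tk <= p)%N by rewrite -pE; exact: pt_mono.
pose h := (p - pt i tk)%N; have ph : (pt i tk + h = p)%N by rewrite subnKC.
have hN : (h <= (n_ i).+1)%N by apply: leq_trans (leq_subr _ _) _.
have := xs_lip (pt i tk) hN; rewrite ph => l1.
have hq : h%:R / NN i <= K%:R^-1 + (NN i)^-1.
  rewrite -(ler_pM2r N0) divfK ?gt_eqF // mulrDl mulVf ?gt_eqF // /h natrB //.
  have /andP[tk0 _] := tk01; have /andP[_ ] := pt_itv i tk0; rewrite -[(pt i tk).+1%:R]natr1 => h1.
  have h2 : (t - tk) * NN i <= K%:R^-1 * NN i by rewrite ler_wpM2r // ltW.
  have -> : p%:R = t * NN i by rewrite /t divfK ?gt_eqF.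
  by rewrite mulrBl in h2; move: h1 h2; move: (tk * NN i) (t * NN i) (K%:R^-1 * NN i) => *; lra.
have l2 := X_lip tk01 t01; rewrite (ger0_norm (x := t - tk)) ?subr_ge0 // in l2.
have l3 := Hk k kK; rewrite -/tk in l3.
have iM' : (MV + 1) * i.+1%:R^-1 < e / 4 by rewrite mulrC -ltr_pdivlMr.
have b1 : MV * (t - tk) <= MV / K%:R by rewrite ler_wpM2l.
have b2 : h%:R / NN i * MV <= MV / K%:R + MV * i.+1%:R^-1.
  rewrite mulrC -mulrDr ler_wpM2l // (le_trans hq) // lerD2l; exact: NN_inv.
have b3 : MV / K%:R < e / 8.
  by apply: le_lt_trans KM; rewrite ler_wpM2r ?invr_ge0 ?(ltW K0) // lerDl.
rewrite (_ : X t - _ = (X t - X tk) + (X tk - xs (x_ i) (pt i tk)) + (xs (x_ i) (pt i tk) - xs (x_ i) p)); last first.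
  by apply/rowP => j; rewrite !mxE; ring.
apply: le_lt_trans (ler_normD _ _) _; apply: le_lt_trans (lerD (ler_normD _ _) (lexx _)) _.
rewrite (distrC (xs _ (pt i tk))); rewrite mulrDl mul1r in iM'.
move: l1 l2 l3 iM' b1 b2 b3 e0; clear.
move: `|X t - X tk| `|X tk - _| `|xs _ p - _| (_ * MV) (MV / i.+1%:R) i.+1%:R^-1 (MV * _) (MV / _).
by move=> a1 a2 a3 a4 a5 a6 a7 a8 *; lra.
Qed.

Definition cpt3 : set (R * ((R * R) * R4)) :=
  `[la, 9 * la]%classic `*` (@unitK R `*` [set y | `|y| <= B]).

Lemma cpt3_compact : compact cpt3.
Proof.
apply: compact_setX; first exact: segment_compact.
by apply: compact_setX; [exact: compact_unitK|exact: ball_cpt].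
Qed.

Lemma cpt3X t : cpt3 (ml, (zl, X t)).
Proof. by split; [rewrite /= in_itv /= mlI|split; [exact: zlK|exact: XB]]. Qed.

Lemma unif_near (W : normedModType R) (f : R * ((R * R) * R4) -> W) (e : R) : continuous f -> 0 < e ->
  exists2 d : R, 0 < d & U [set i | forall t y, `|X t - y| < d ->
     `|f (ml, (zl, X t)) - f (m_ i, (z_ i, y))| < e].
Proof.
move=> fc e0; have [d d0 Hd] := heine cpt3_compact (fun p _ => fc p) e0.
exists d => //; apply: filterS2 (mlP d0) (zlP d0) => i mi zi t y ty.
apply: Hd; first exact: cpt3X.
by split => //=; split => //=; rewrite -ball_normE.
Qed.

Lemma unif_seq (W : normedModType R) (f : R * ((R * R) * R4) -> W) (e : R) : continuous f -> 0 < e ->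
  U [set i | forall j : 'I_(n_ i).+1,
     `|f (ml, (zl, X (j%:R / NN i))) - f (m_ i, (z_ i, row j (x_ i)))| < e].
Proof.
move=> fc e0; have [d d0 Hd] := unif_near fc e0.
apply: filterS2 Hd (X_close d0) => i Hi Xi j; apply: Hi.
by have := Xi j (ltnW (ltn_ord j)); rewrite /xs inZp_ord.
Qed.

(** On a short window all samples are close to [X t], hence the field is close to its value there;
    uniform continuity makes the length of the window independent of [t]. *)
Lemma X_udr : udr X (fun t => gHam F ml zl (X t) *m Om R).
Proof.
move=> e e0; have M0 := MV_ge0; have M1 : 0 < MV + 1 by rewrite ltr_wpDl.
have fc : continuous (fun w : R * ((R * R) * R4) => gHam F w.1 w.2.1 w.2.2 *m Om R).
  by move=> w; apply: (contat_mulmx (f := fun w : R * ((R * R) * R4) => gHam F w.1 w.2.1 w.2.2) (g := fun _ => Om R));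
    [exact: gHam_cont3|exact: cst_continuous].
have [d d0 Hd] := unif_near fc e0; have d40 : 0 < d / 4 by rewrite divr_gt0.
pose r := d / 4 / (MV + 1); have r0 : 0 < r by rewrite divr_gt0.
exists r => // s t s01 t01 str.
have U1 := filterI Hd (filterI (X_close (divr_gt0 d0 (ltr0n R 2))) (u_small r0)).
have key lo hi : 0 <= lo -> lo <= hi -> hi <= 1 -> lo <= t <= hi -> hi - lo <= `|s - t| ->
  `|X hi - X lo - (hi - lo) *: (gHam F ml zl (X t) *m Om R)| <= (hi - lo) * e.
  move=> lo0 lohi hi1 /andP[lot thi] hl; apply: lim_window => //.
  apply: filterS (U1 _ _) => i [/= Hi [Xi ir]] l /andP[l1 l2].
  rewrite distrC; apply: ltW; apply: Hi.
  have lN : (l <= (n_ i).+1)%N by apply: leq_trans l2 (pt_leN i hi1).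
  have u01 := @itv_ratio R l (n_ i).+1 lN isT; set u := l%:R / NN i in u01.
  have N0 : 0 < NN i by rewrite ltr0n.
  have ut : `|u - t| <= r + r.
    apply: (@le_trans _ _ ((hi - lo) + (NN i)^-1)); last first.
      by apply: lerD; [apply: le_trans hl _; exact: ltW|apply: le_trans (NN_inv i) _; exact: ltW].
    have uhi : u <= hi.
      rewrite /u ler_pdivrMr //; have /andP[h1 _] := pt_itv i (le_trans lo0 lohi).
      by apply: le_trans h1; rewrite ler_nat.
    have ulo : lo - (NN i)^-1 <= u.
      rewrite /u ler_pdivlMr // mulrBl mulVf ?gt_eqF //; have /andP[_ h1] := pt_itv i lo0.
      have : (pt i lo)%:R <= l%:R :> R by rewrite ler_nat.
      by move: h1; rewrite -[(pt i lo).+1%:R]natr1; lra.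
    have : 0 < (NN i)^-1 by rewrite invr_gt0.
    rewrite ler_norml; move: ulo uhi lot thi; move: (NN i)^-1 => q *; apply/andP; split; lra.
  have l3 := X_lip u01 t01; rewrite (distrC t) in l3.
  have l4 : `|X u - xs (x_ i) l| < d / 2 := Xi l lN.
  have : MV * `|u - t| <= d / 2.
    apply: (@le_trans _ _ ((MV + 1) * (r + r))); first by apply: ler_pM => //; rewrite lerDl.
    have -> : (MV + 1) * (r + r) = d / 4 + d / 4 by rewrite mulrDr mulrC /r divfK // gt_eqF.
    by lra.
  move=> l5; rewrite -(subrK (X u) (X t)) -addrA; apply: le_lt_trans (ler_normD _ _) _.
  by move: l3 l4 l5; move: (MV * `|u - t|) `|X t - X u| `|X u - _| => *; lra.
have [s0 s1] := andP s01; have [t0 t1] := andP t01.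
have [st|ts] := leP s t.
  have := key s t s0 st t1; rewrite st lexx ler0_norm ?subr_le0 // opprB lexx => /(_ isT isT).
  rewrite (_ : X t - X s - _ = - (X s - X t - (s - t) *: (gHam F ml zl (X t) *m Om R))); last first.
    by rewrite -(opprB t s) scaleNr opprK; apply/rowP => j; rewrite !mxE; ring.
  by rewrite normrN mulrC.
have := key t s t0 (ltW ts) s1; rewrite lexx (ltW ts) ger0_norm ?subr_ge0 ?(ltW ts) // lexx => /(_ isT isT).
by rewrite mulrC.
Qed.

Lemma khat3 : continuous (fun w : R * ((R * R) * R4) => khat F w.2.1 w.2.2).
Proof. exact: (snd_cont (@khat_cont R F)). Qed.

Lemma rot_avg (u v p q C S e : R) : C ^+ 2 + S ^+ 2 = 1 -> `|C * p - S * q - u| <= e ->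
  `|S * p + C * q - v| <= e -> `|C * u + S * v - p| <= e * 2 /\ `|- S * u + C * v - q| <= e * 2.
Proof.
move=> cs hu hv.
have C1 : `|C| <= 1 by rewrite -(ler_pXn2r (ltn0Sn 1)) ?nnegrE // expr1n real_normK ?num_real //; have := sqr_ge0 S; lra.
have S1 : `|S| <= 1 by rewrite -(ler_pXn2r (ltn0Sn 1)) ?nnegrE // expr1n real_normK ?num_real //; have := sqr_ge0 C; lra.
set U1 := _ - u in hu; set V1 := _ - v in hv.
have e0 : 0 <= e by apply: le_trans hu.
have m1 (A B' : R) : `|A| <= 1 -> `|B'| <= e -> `|A * B'| <= e.
  by move=> hA hB; rewrite normrM -[e]mul1r ler_pM.
split.
  have -> : C * u + S * v - p = - (C * U1) - S * V1.
    by rewrite /U1 /V1 -{1}[p]mul1r -cs; ring.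
  by apply: le_trans (ler_normB _ _) _; rewrite normrN (_ : e * 2 = e + e) ?lerD ?m1 //; ring.
have -> : - S * u + C * v - q = S * U1 - C * V1.
  by rewrite /U1 /V1 -{1}[q]mul1r -cs; ring.
by apply: le_trans (ler_normB _ _) _; rewrite (_ : e * 2 = e + e) ?lerD ?m1 //; ring.
Qed.

(** The actions converge to that of the limit orbit, which [classify] then identifies. Along it the
    rotating factor of the Fourier coefficient undoes the motion, so the coefficient is close to the
    starting point, of squared modulus [th0]. *)
Lemma low_case (be e' t0 : R) : 0 < be -> 0 < e' ->
  (forall i, be <= Act F (m_ i) (z_ i) (x_ i) <= la) -> 0 <= t0 <= 1 -> khat F zl (X t0) < 1 / 2 ->
  exists i, lower F (z_ i) (x_ i) /\ `|Act F (m_ i) (z_ i) (x_ i) - alpha F| <= e'.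
Proof.
move=> be0 e'0 HA t01 klow; have XU := X_udr; have Xper := X_per.
have mla : la <= ml by case/andP: mlI.
have AL := action_limit XU Xper t01 klow; have ORB := orbit XU t01 klow.
set r := rs F zl X t0 in AL ORB; pose val := freq F ml r * r - energy F ml r.
have r1 : r < 1 := rs_lt1 klow.
have ActU e : 0 < e -> U [set i | `|Act F (m_ i) (z_ i) (x_ i) - val| <= e].
  move=> e0; have e40 : 0 < e / 4 by rewrite divr_gt0.
  have [d d0 Hd] := AL _ e40.
  have f1c : continuous (fun w : R * ((R * R) * R4) => dot (w.2.2) (gHam F w.1 w.2.1 w.2.2)).
    by apply: continuous_dot; [apply: (snd_cont (f := snd)) => p; exact: cvg_snd|exact: gHam_cont3].
  have U1 := unif_seq f1c e40; have U2 := unif_seq (@Ham_cont R F) e40.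
  have B1 : 0 < B + 1 by rewrite ltr_wpDl // B_ge0.
  have U3 := filterI (u_small d0) (u_small (divr_gt0 e40 B1)).
  apply: filterS3 U1 U2 (U3 _) => i H1 H2 [/= H3 H4].
  have := Act_defect F (m_ i) (z_ i) (x_ i); set I := ip _ _ => /(canRL (subrK _)) ->.
  have Ib : `|I| <= e / 2.
    apply: le_trans (ip_le _ _) _; apply: (@le_trans _ _ (i.+1%:R^-1 * (2 * B))).
      apply: ler_pM; rewrite ?nL2_ge0 //; first exact: ltW.
      by apply: le_trans (nL2_sup _) _; rewrite ler_pM2l.
    have : i.+1%:R^-1 * (B + 1) <= e / 4 by rewrite -ler_pdivlMr // ltW.
    have : 0 <= i.+1%:R^-1 :> R by rewrite invr_ge0.
    by move: i.+1%:R^-1 => q q0; rewrite mulrDr mulrCA; move: (q * B) => *; lra.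
  rewrite (avgD (fun j => 2^-1 * _)) avgZ avgN.
  set D1 := avg _; set D2 := avg _.
  have D2b : `|energy F ml r - D2| <= e / 4.
    rewrite -(avg_cst (n_ i) (energy F ml r)); apply: avg_close => j; have := ltW (H2 j) => /=.
    have j01 : 0 <= j%:R / NN i <= 1 by apply: itv_ratio => //; exact: ltnW.
    have [<- rj] := ORB _ j01; rewrite /Ham /khat !pullf_im ?rj //.
    have [-> _] : outf la (Qcd (sc F) (sd F) (phi F zl (yv F zl X (j%:R / NN i)))) = 0 /\ True.
      by split => //; apply: (proj1 (outf_low la _)); apply: phi_img; rewrite rj.
    by rewrite addr0.
  have D1b : `|2 * (freq F ml r * r) - D1| <= e / 4 + e / 4.
    have h := Hd (n_ i).+1 isT (le_lt_trans (NN_inv i) H3).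
    rewrite -(subrK (avg (fun j : 'I_(n_ i).+1 => dot (X (j%:R / NN i)) (gHam F ml zl (X (j%:R / NN i))))) (2 * _)) -addrA.
    apply: le_trans (ler_normD _ _) _; apply: lerD; first by rewrite distrC.
    by apply: avg_close => j; rewrite [dot (gHam _ _ _ _) _]dotC; exact: ltW (H1 j).
  move: Ib D1b D2b; rewrite /val !ler_norml; move: I D1 D2 (freq F ml r * r) (energy F ml r) => *.
  by apply/andP; split; lra.
have valI : 0 < val <= la.
  apply/andP; split.
    have [i /= hi] := filter_ex (ActU _ (divr_gt0 be0 (ltr0n R 2))).
    by have /andP[h1 _] := HA i; move: hi; rewrite ler_norml => /andP[h2 h3]; lra.
  apply/ler_addgt0Pr => e e0; have [i /= hi] := filter_ex (ActU _ e0).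
  by have /andP[_ h1] := HA i; move: hi; rewrite ler_norml => /andP[h2 h3]; lra.
have [[rE fE enE kE] rot] := classify mla XU Xper t01 klow valI; rewrite -/r in rE fE enE kE.
have vE : val = alpha F by rewrite /val /alpha fE enE -rE.
set p := yv F zl X 0 ord0 o0 in rot; set q := yv F zl X 0 ord0 o1 in rot.
have pq : p ^+ 2 + q ^+ 2 = th0 F by have [] := rot 0 ltac:(by rewrite lexx ler01).
have th0_gt0 : 0 < th0 F.
  rewrite divr_gt0 ?pi_gt0 // mulr_gt0 ?sa_gt0 // -rE; have := rs_lt1 klow => _.
  by rewrite rE /rho_a addr_gt0 ?rho0_gt0 // divr_gt0 // ep_gt0.
(* With this tolerance the sum of squares of [Th1] and [Th2] falls below [th0 F] by at most a
   quarter of it. *)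
pose e := th0 F / (16 * (`|p| + `|q| + 1)).
have s0 : 0 < `|p| + `|q| + 1 by rewrite ltr_wpDl // addr_ge0.
have e0 : 0 < e by rewrite divr_gt0 // mulr_gt0.
have e10 : 0 < (1 / 8 : R) by lra.
have U1 := unif_seq khat3 e10; have U2 := unif_seq (snd_cont (@Tf_cont R F)) e0.
have [i [[/= Hk HT] Hi]] := filter_ex (filterI (filterI U1 U2) (ActU e' e'0)).
exists i; rewrite -vE; split => //.
have j01 (j : 'I_(n_ i).+1) : 0 <= j%:R / NN i <= 1 by apply: itv_ratio => //; exact: ltnW.
split; last first.
  have -> : avk F (z_ i) (x_ i) = `|0 - avk F (z_ i) (x_ i)|.
    by rewrite sub0r normrN ger0_norm // avg_ge0 // => j; case/andP: (khat_itv F (z_ i) (row j (x_ i))).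
  rewrite -(avg_cst (n_ i) 0); apply: avg_close => j; have := ltW (Hk j).
  by have [<- rj] := ORB _ (j01 j); rewrite {1}/khat pullf_im ?rj // kE.
have TE (j : 'I_(n_ i).+1) : Tf F zl (X (j%:R / NN i)) = yv F zl X (j%:R / NN i).
  by have [<- rj] := ORB _ (j01 j); rewrite Tf_im ?rj // kE subr0 scale1r.
have Tj (j : 'I_(n_ i).+1) := rot_avg (cos2Dsin2 (2 * pi * (j%:R / NN i)))
   (u := Tf F (z_ i) (row j (x_ i)) ord0 o0) (v := Tf F (z_ i) (row j (x_ i)) ord0 o1) (p := p) (q := q) (e := e).
have {}Tj (j : 'I_(n_ i).+1) := Tj j ltac:(
  have := ltW (HT j); rewrite /= TE => h; apply: le_trans h; apply: le_trans (le_mx_norm _ ord0 o0);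
  rewrite !mxE; have [-> _ _] := rot _ (j01 j); exact: lexx) ltac:(
  have := ltW (HT j); rewrite /= TE => h; apply: le_trans h; apply: le_trans (le_mx_norm _ ord0 o1);
  rewrite !mxE; have [_ -> _] := rot _ (j01 j); exact: lexx).
have h1 : `|Th1 F (z_ i) (x_ i) - p| <= e * 2.
  by rewrite -(avg_cst (n_ i) p); apply: avg_close => j; exact: proj1 (Tj j).
have h2 : `|Th2 F (z_ i) (x_ i) - q| <= e * 2.
  by rewrite -(avg_cst (n_ i) q); apply: avg_close => j; exact: proj2 (Tj j).
have sq (A p' E : R) : `|A - p'| <= E -> p' ^+ 2 - 2 * E * `|p'| <= A ^+ 2.
  move=> h; have := sqr_ge0 (A - p'); have : `|p' * (A - p')| <= `|p'| * E by rewrite normrM ler_wpM2l.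
  rewrite ler_norml => /andP[h3 _]; move: h3; rewrite mulrC; move: `|p'| => P h3 h4.
  by rewrite -[A](subrK p') sqrrD; move: h3 h4; move: (A - p') => D; nra.
have := sq _ _ _ h1; have := sq _ _ _ h2.
have : e * (16 * (`|p| + `|q| + 1)) = th0 F by rewrite /e divfK // gt_eqF // mulr_gt0.
move: pq e0; rewrite !mulrDr mulr1; move: (Th1 _ _ _) (Th2 _ _ _) `|p| `|q| => t1 t2 P Q.
by move=> *; nra.
Qed.

(** Either [khat] drops below 1/2 somewhere on the limit orbit, or it is at least 1/2 everywhere and
    the loops have mean at least 1/2 - 1/8 = 3/8. *)
Lemma seq_case (be e' : R) : 0 < be -> 0 < e' -> (forall i, be <= Act F (m_ i) (z_ i) (x_ i) <= la) ->
  exists i, (lower F (z_ i) (x_ i) /\ `|Act F (m_ i) (z_ i) (x_ i) - alpha F| <= e') \/ upper F (z_ i) (x_ i).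
Proof.
move=> be0 e'0 HA; have [[t0 t01 kl]|nlow] := pselect (exists2 t0, 0 <= t0 <= 1 & khat F zl (X t0) < 1 / 2).
  by have [i Hi] := low_case be0 e'0 HA t01 kl; exists i; left.
have e10 : 0 < (1 / 8 : R) by lra.
have [i /= Hi] := filter_ex (unif_seq khat3 e10); exists i; right.
rewrite /upper /avk -(avg_cst (n_ i) (3 / 8)); apply: ler_avg => j.
have j01 : 0 <= j%:R / NN i <= 1 by apply: itv_ratio => //; exact: ltnW.
have k2 : 1 / 2 <= khat F zl (X (j%:R / NN i)).
  by rewrite leNgt; apply/negP => h; apply: nlow; eexists; first exact: j01.
by have := ltW (Hi j); rewrite /= ler_norml => /andP[_ h]; lra.
Qed.

End Sequence.

(** Counterexamples with mesh and gradient tending to zero would have a limit orbit, to which the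
    classification applies. This makes the threshold valid for all large [n]. *)
Lemma palais_smale (R : realType) (F : sympfam R) (be e' : R) : 0 < be -> 0 < e' ->
  exists2 ka : R, 0 < ka & exists n0 : nat, forall n m z (x : 'M[R]_(n.+1, 4)), (n0 <= n)%N ->
    unitK z -> la F <= m <= 9 * la F -> nL2 (grd F m z x) < ka -> be <= Act F m z x <= la F ->
    (lower F z x /\ `|Act F m z x - alpha F| <= e') \/ upper F z x.
Proof.
move=> be0 e'0; have [ka ka0 [B B0 HB]] := sup_bound F.
apply: contrapT => H.
have S (i : nat) : exists w : {n : nat & ((R * R) * R * 'M[R]_(n.+1, 4))%type},
    let: existT n (z, m, x) := w in
    [/\ (i <= n)%N, unitK z, la F <= m <= 9 * la F, nL2 (grd F m z x) < Num.min ka i.+1%:R^-1 &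
     be <= Act F m z x <= la F /\ ~ ((lower F z x /\ `|Act F m z x - alpha F| <= e') \/ upper F z x)].
  apply: contrapT => nw; apply: H; exists (Num.min ka i.+1%:R^-1); first by rewrite lt_min ka0 invr_gt0 ltr0n.
  exists i => n m z x h1 h2 h3 h4 h5; apply: contrapT => h6; apply: nw.
  by exists (existT _ n (z, m, x)).
have [w Hw] := choice S.
pose n_ i := projT1 (w i); pose z_ i := (projT2 (w i)).1.1; pose m_ i := (projT2 (w i)).1.2.
pose x_ i : 'M[R]_((n_ i).+1, 4) := (projT2 (w i)).2.
have W i : [/\ (i <= n_ i)%N, unitK (z_ i), la F <= m_ i <= 9 * la F, nL2 (grd F (m_ i) (z_ i) (x_ i)) < Num.min ka i.+1%:R^-1 &
     be <= Act F (m_ i) (z_ i) (x_ i) <= la F /\ ~ ((lower F (z_ i) (x_ i) /\ `|Act F (m_ i) (z_ i) (x_ i) - alpha F| <= e') \/ upper F (z_ i) (x_ i))].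
  by have := Hw i; rewrite /n_ /z_ /m_ /x_; case: (w i) => n [[z m] x].
have [U [UU Uoo]] := ultraFilterLemma (eventually_filter).
have Uk (k : nat) : U [set i | (k <= i)%N] by apply: Uoo; exists k.
have [i] := @seq_case R F U UU Uk n_ z_ m_ x_ B (fun i => let: And5 h _ _ _ _ := W i in h)
  (fun i => let: And5 _ h _ _ _ := W i in h) (fun i => let: And5 _ _ h _ _ := W i in h)
  ltac:(by move=> i; have [_ _ _ + _] := W i; rewrite lt_min => /andP[])
  ltac:(by move=> i; have [_ h1 h2 + [/andP[_ h3] _]] := W i; rewrite lt_min => /andP[h4 _]; apply: HB h4 h3 => //; exact: m_ok)
  be e' be0 e'0 (fun i => let: And5 _ _ _ _ (conj h _) := W i in h).
by have [_ _ _ _ [_]] := W i.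
Qed.

(** * The gradient flow *)

Section Modulus.
Variables (R : realType) (F : sympfam R).
Notation R4 := 'rV[R]_4.

(** A difference small in L2 may be large at few samples; there the bound on [f] is paid by a
    Chebyshev estimate. The modulus is therefore independent of [n]. *)
Lemma avg_modulus (W : normedModType R) (f : (R * R) * R4 -> W) w0 (e : R) : continuous f ->
  (forall z x, 1 < Qcd (sc F) (sd F) x -> f (z, x) = w0) -> 0 < e ->
  exists2 w : R, 0 < w & forall n z (x x' : 'M[R]_(n.+1, 4)), unitK z -> nL2 (x - x') <= w ->
    avg (fun j => `|f (z, row j x) - f (z, row j x')|) <= e.
Proof.
move=> fc fo e0; have [[C C0 HC] HU] := unif_compact (sc_gt0 F) (sd_gt0 F) fc fo.
have [d d0 Hd] := HU _ (divr_gt0 e0 (ltr0n R 2)).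
pose k := 2 * C / d ^+ 2; have k0 : 0 < k by rewrite divr_gt0 ?mulr_gt0 ?exprn_gt0.
exists (Num.min 1 (e / 2 / k)); first by rewrite lt_min ltr01 divr_gt0 // divr_gt0.
move=> n z x x' Kz; rewrite le_min => /andP[w1 w2].
have L0 := nL2_ge0 (x - x').
apply: (@le_trans _ _ (e / 2 + k * ip (x - x') (x - x'))); last first.
  rewrite -nL2_sqr; have : nL2 (x - x') ^+ 2 <= nL2 (x - x') by rewrite expr2 ler_piMr.
  move: w2; rewrite ler_pdivlMr // mulrC; move: (nL2 _) => q h1 h2.
  by have := ler_wpM2l (ltW k0) h2; lra.
rewrite -{1}(avg_cst n (e / 2)) -avgZ -avgD; apply: ler_avg => j.
have dE : \sum_i (x - x') j i * (x - x') j i = dot (row j x - row j x') (row j x - row j x').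
  by apply: eq_bigr => i _; rewrite !mxE.
rewrite dE; have nd := norm_le_dot (row j x - row j x').
have [near|far] := ltP `|row j x - row j x'| d.
  apply: ler_wpDr; first by rewrite mulr_ge0 ?dot_ge0 // ltW.
  by apply: ltW; apply: Hd => //; exact: ballxx.
apply: ler_wpDl; first by rewrite divr_ge0 // ltW.
apply: (@le_trans _ _ (2 * C)).
  by apply: le_trans (ler_normB _ _) _; have := HC z (row j x) Kz; have := HC z (row j x') Kz; lra.
have : d ^+ 2 <= dot (row j x - row j x') (row j x - row j x').
  by apply: le_trans nd; rewrite ler_pXn2r ?nnegrE // ltW.
move=> h; apply: le_trans (ler_wpM2l (ltW k0) h).
by rewrite /k divfK // expf_neq0 // gt_eqF.
Qed.

Lemma th0_gt0 : 0 < th0 F.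
Proof.
by rewrite divr_gt0 ?pi_gt0 // mulr_gt0 ?sa_gt0 // addr_gt0 ?rho0_gt0 // divr_gt0 // ep_gt0.
Qed.

Lemma lower_modulus : exists2 w : R, 0 < w & forall n z (x x' : 'M[R]_(n.+1, 4)), unitK z ->
  nL2 (x - x') <= w -> `|avk F z x - avk F z x'| <= 1 / 8 /\
  (lower F z x -> ~ (Th1 F z x' = 0 /\ Th2 F z x' = 0)).
Proof.
(* The minimum with 1 gives e^2 <= th0 / 81 without a square root; errors of [2 * e] in both
   components then add up to at most 8/81 of [th0], less than 4/9 of it. *)
have t0 := th0_gt0; pose e := Num.min 1 (th0 F) / 9.
have m0 : 0 < Num.min 1 (th0 F) by rewrite lt_min ltr01.
have e0 : 0 < e by rewrite divr_gt0.
have e10 : 0 < (1 / 8 : R) by lra.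
have [w1 w10 H1] := avg_modulus (@khat_cont R F) (fun z x => @pullf_out R F _ z x) e10.
have [w2 w20 H2] := avg_modulus (@Tf_cont R F) (fun z x => @Tf_out R F z x) e0.
exists (Num.min w1 w2); first by rewrite lt_min w10.
move=> n z x x' Kz; rewrite le_min => /andP[/(H1 _ _ _ _ Kz) h1 /(H2 _ _ _ _ Kz) h2]; split.
  rewrite /avk -avgN -avgD; apply: le_trans (ler_norm_avg _) _; exact: h1.
move=> [lo _] [T1 T2].
have key (c s : 'I_n.+1 -> R) : (forall j, `|c j| <= 1) -> (forall j, `|s j| <= 1) ->
    `|avg (fun j => c j * Tf F z (row j x) ord0 o0 + s j * Tf F z (row j x) ord0 o1) -
      avg (fun j => c j * Tf F z (row j x') ord0 o0 + s j * Tf F z (row j x') ord0 o1)| <= 2 * e.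
  move=> c1 s1; rewrite -avgN -avgD; apply: le_trans (ler_norm_avg _) _.
  apply: (@le_trans _ _ (avg (fun j => 2 * `|Tf F z (row j x) - Tf F z (row j x')|))); last first.
    by rewrite avgZ ler_pM2l.
  apply: ler_avg => j; set D := Tf F z (row j x) - Tf F z (row j x').
  have -> : forall p q p' q' : R, c j * p + s j * q - (c j * p' + s j * q') = c j * (p - p') + s j * (q - q') by move=> *; ring.
  apply: le_trans (ler_normD _ _) _; rewrite mulrDl mul1r.
  have h (A : R) i : `|A| <= 1 -> `|A * (Tf F z (row j x) ord0 i - Tf F z (row j x') ord0 i)| <= `|D|.
    move=> A1; rewrite normrM -[leRHS]mul1r ler_pM //; apply: le_trans (le_mx_norm _ ord0 i).
    by rewrite !mxE.
  by apply: lerD; apply: h.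
have c1 (t : R) : `|cos t| <= 1 by rewrite ler_norml cos_geN1 cos_le1.
have s1 (t : R) : `|sin t| <= 1 by rewrite ler_norml sin_geN1 sin_le1.
have k1 := key _ _ (fun j : 'I_n.+1 => c1 (2 * pi * (j%:R / n.+1%:R))) (fun j => s1 (2 * pi * (j%:R / n.+1%:R))).
have k2 := key _ _ (fun j : 'I_n.+1 => etrans (f_equal (fun u => u <= 1) (normrN _)) (s1 (2 * pi * (j%:R / n.+1%:R)))) (fun j => c1 (2 * pi * (j%:R / n.+1%:R))).
rewrite -/(Th1 F z x) -/(Th1 F z x') T1 subr0 in k1.
rewrite -/(Th2 F z x) -/(Th2 F z x') T2 subr0 in k2.
have sq (A : R) : `|A| <= 2 * e -> A ^+ 2 <= 4 * e ^+ 2.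
  move=> h; rewrite -[A ^+ 2]real_normK ?num_real // (_ : 4 * e ^+ 2 = (2 * e) ^+ 2); last by ring.
  by rewrite ler_pXn2r ?nnegrE // mulr_ge0 // ltW.
have := sq _ k1; have := sq _ k2.
have : e ^+ 2 <= th0 F / 81.
  rewrite /e exprMn exprVn -natrX ler_pM2r ?invr_gt0 //.
  rewrite expr2; apply: (@le_trans _ _ (1 * th0 F)); last by rewrite mul1r.
  by apply: ler_pM; rewrite ?(ltW m0) // ge_min lexx ?orbT.
by move: lo t0; lra.
Qed.

End Modulus.

(** * Discrete gradient descent of the action *)

Section Descent.
Variables (R : realType) (F : sympfam R) (n : nat).
Notation N := n.+1.
Notation loop := 'M[R]_(N, 4).
Notation R4 := 'rV[R]_4.
Implicit Types x v g : loop.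

Lemma nL20 : nL2 (0 : loop) = 0.
Proof. by rewrite /nL2 ip0l sqrtr0. Qed.

(* The cut-off at [ep] makes the action nonincreasing along the explicit Euler steps. *)
Definition vcoef (ep u : R) : R := pos (u - ep) / (1 + u) ^+ 2.
Definition vfield (ep : R) g : loop := vcoef ep (nL2 g) *: g.
(** A guaranteed rate of action loss where the gradient has norm at least [k]. *)
Definition kz (k : R) : R := k / 4 * (k / (1 + k)) ^+ 2.

Lemma vcoef_ge0 ep u : 0 <= vcoef ep u.
Proof. by rewrite /vcoef divr_ge0 ?pos_ge0 // sqr_ge0. Qed.

Lemma vfield_le1 ep g : 0 <= ep -> nL2 (vfield ep g) <= 1.
Proof.
move=> e0; rewrite nL2Z ger0_norm ?vcoef_ge0 // /vcoef; have := nL2_ge0 g; set u := nL2 g => u0.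
rewrite mulrAC ler_pdivrMr ?exprn_gt0 ?ltr_pwDl // mul1r.
have : pos (u - ep) <= u by rewrite /pos ge_max u0 /=; lra.
by have := pos_ge0 (u - ep); move: (pos _) => p p0 pu; nra.
Qed.

Lemma kz_gt0 k : 0 < k -> 0 < kz k.
Proof. by move=> k0; rewrite mulr_gt0 ?divr_gt0 // exprn_gt0 // divr_gt0 // addr_gt0. Qed.

Lemma vfield_gain ep k g : 0 <= ep -> ep <= k / 2 -> 0 < k -> k <= nL2 g ->
  kz k <= nL2 (vfield ep g) * nL2 g / 2.
Proof.
move=> e0 ek k0; rewrite nL2Z ger0_norm ?vcoef_ge0 // /vcoef /kz; set u := nL2 g => ku.
have u0 : 0 < u by exact: lt_le_trans ku.
have -> : pos (u - ep) / (1 + u) ^+ 2 * u * u / 2 = pos (u - ep) / 2 * (u / (1 + u)) ^+ 2.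
  by field; rewrite gt_eqF // addr_gt0.
apply: ler_pM.
- by rewrite divr_ge0 // ltW.
- exact: sqr_ge0.
- have : u - ep <= pos (u - ep) by rewrite le_max lexx orbT.
  by move: (pos _) => p; lra.
have k1 : 0 < 1 + k by rewrite addr_gt0.
have u1 : 0 < 1 + u by rewrite addr_gt0.
have le : k / (1 + k) <= u / (1 + u) by rewrite ler_pdivrMr // mulrAC ler_pdivlMr //; nra.
by rewrite ler_pXn2r ?nnegrE // divr_ge0 // ltW.
Qed.

Lemma sup_nL2 x : `|x| <= N%:R * nL2 x.
Proof.
apply/mx_norm_leP; first by rewrite mulr_ge0 // nL2_ge0.
move=> j i; rewrite -(ler_pXn2r (ltn0Sn 1)) ?nnegrE ?mulr_ge0 ?nL2_ge0 // real_normK ?num_real //.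
rewrite exprMn nL2_sqr /ip /avg expr2 -mulrA mulVKf ?pnatr_eq0 //.
apply: (@le_trans _ _ (\sum_j' \sum_i x j' i * x j' i)).
  rewrite (bigD1 j) //= (bigD1 i) //= -expr2 -addrA lerDl addr_ge0 // sumr_ge0 // => *.
    by rewrite -expr2 sqr_ge0.
  by rewrite sumr_ge0 // => *; rewrite -expr2 sqr_ge0.
by rewrite ler_peMl ?ler1n // sumr_ge0 // => *; rewrite sumr_ge0 // => *; rewrite -expr2 sqr_ge0.
Qed.

Lemma der_affine (V : normedModType R) (u v : V) t : der (fun s => u + s *: v) t v.
Proof.
move=> e e0; exists 1 => // s _ _; rewrite scalerBl [X in X - _](_ : _ = s *: v - t *: v).
  by rewrite subrr normr0 mulr_ge0 // ltW.
by rewrite opprD addrACA subrr add0r.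
Qed.

Lemma loopBE x v j i : (x - v) j i = x j i - v j i.
Proof. by rewrite !mxE. Qed.

Lemma Lop_lin x v (s : R) : Lop (x + s *: v) = Lop x + s *: Lop v.
Proof. by rewrite addrC Lop_linear addrC. Qed.

Lemma Act_der m z x v t : der (fun s => Act F m z (x + s *: v)) t (ip (grd F m z (x + t *: v)) v).
Proof.
have E : ip (grd F m z (x + t *: v)) v = (ip (Lop x) v + t * (2 * actQ v)) +
    (-1) * (N%:R^-1 * \sum_j dot (gHam F m z (row j (x + t *: v))) (row j v)).
  rewrite /grd ipBl Lop_lin ipDl ipZl (ipC (Lop v)) (_ : 2 * actQ v = ip v (Lop v)) ?mulN1r; last by rewrite /actQ; field.
  congr (_ - _).
  by congr (_ * _); apply: eq_bigr => j _; apply: eq_bigr => i _; rewrite !mxE.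
rewrite E.
have -> : (fun s => Act F m z (x + s *: v)) = (fun s => (actQ x + (s * ip (Lop x) v + s * s * actQ v)) +
    (-1) * (N%:R^-1 * \sum_j Ham F m z (row j x + s *: row j v))).
  apply/funext => s; rewrite /Act mulN1r; congr (_ - _).
    rewrite /actQ Lop_lin; move: (Lop_sym x v); move: (Lop x) (Lop v) => A B Eq.
    by rewrite ipDl !ipDr !ipZl !ipZr -Eq (ipC v A); field.
  by congr (_ * _); apply: eq_bigr => j _; congr Ham; apply/rowP => i; rewrite !mxE.
have did : der id t (1 : R^o).
  by move=> k k0; exists 1 => // s _ _; rewrite [_ *: 1]mulr1 subrr normr0 mulr_ge0 // ltW.
apply: derD.
  have := derD (@der_cst R R^o (actQ x) t) (derD (derM did (@der_cst R R^o (ip (Lop x) v) t))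
    (derM (derM did did) (@der_cst R R^o (actQ v) t))).
  by congr der; rewrite /=; ring.
have S : der (fun s => \sum_j Ham F m z (row j x + s *: row j v)) t
    (\sum_j dot (gHam F m z (row j (x + t *: v))) (row j v)).
  apply: der_sum => j; apply: (der_grad (K := Ham F m z) (X := fun s => row j x + s *: row j v)).
    rewrite (_ : row j (x + t *: v) = row j x + t *: row j v); first exact: hasgrad_Ham.
    by apply/rowP => i; rewrite !mxE.
  exact: der_affine.
have := derM (@der_cst R R^o (-1) t) (derM (@der_cst R R^o N%:R^-1 t) S).
by congr der; rewrite /=; ring.
Qed.

Lemma grd_unif (Rb e : R) : 0 < e -> exists2 d : R, 0 < d & forall m z x x',
  la F <= m <= 9 * la F -> unitK z -> `|x| <= Rb -> `|x - x'| < d -> nL2 (grd F m z x - grd F m z x') <= e.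
Proof.
move=> e0; have e40 : 0 < e / 4 by rewrite divr_gt0.
pose C := `[la F, 9 * la F]%classic `*` (@unitK R `*` [set y : R4 | `|y| <= Rb]).
have cC : compact C.
  apply: compact_setX; first exact: segment_compact.
  by apply: compact_setX; [exact: compact_unitK|exact: ball_cpt].
have [d d0 Hd] := heine cC (fun w _ => @gHam_cont3 R F w) e40.
have N0 : 0 < N%:R :> R by rewrite ltr0n.
exists (Num.min d (e / 4 / (2 * N%:R))); first by rewrite lt_min d0 divr_gt0 // mulr_gt0.
move=> m z x x' mI Kz xR; rewrite lt_min => /andP[xd xe].
apply: le_trans (nL2_sup _) _; rewrite mulrC -ler_pdivlMr //.
apply/mx_norm_leP; first by rewrite divr_ge0 // ltW.
move=> j i.
have -> : (grd F m z x - grd F m z x') j i = Lop (x - x') j i -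
    (gHam F m z (row j x) ord0 i - gHam F m z (row j x') ord0 i).
  have -> : Lop (x - x') = Lop x - Lop x' by rewrite -scaleN1r Lop_lin scaleN1r.
  by rewrite (loopBE (grd F m z x)) (loopBE (Lop x) (Lop x')) (LopgE F m z x) (LopgE F m z x'); ring.
rewrite (_ : e / 2 = e / 4 + e / 4); last by lra.
apply: le_trans (ler_normB _ _) _; apply: lerD.
  have b (p q : R) : `|p| <= `|x - x'| -> `|q| <= `|x - x'| -> `|N%:R * (p - q)| <= e / 4.
    move=> hp hq; rewrite normrM ger0_norm //; apply: (@le_trans _ _ (N%:R * (2 * `|x - x'|))).
      by rewrite ler_pM2l //; apply: le_trans (ler_normB _ _) _; lra.
    by rewrite mulrCA mulrA mulrC -ler_pdivlMr ?mulr_gt0 // ltW.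
  have [E0 E1 E2 E3] := LopE (x - x') j; move: i; apply: ord4P.
  - by rewrite E0 b // le_mx_norm.
  - by rewrite E1 normrN b // le_mx_norm.
  - by rewrite E2 b // le_mx_norm.
  - by rewrite E3 normrN b // le_mx_norm.
have : `|gHam F m z (row j x) - gHam F m z (row j x')| < e / 4.
  apply: (Hd (m, (z, row j x)) (m, (z, row j x'))).
    by split; [rewrite /= in_itv|split => //=; apply: le_trans (row_norm _ _) xR].
  split; first exact: ballxx.
  split; first exact: ballxx.
  rewrite -ball_normE /= (_ : _ - _ = row j (x - x')); last by apply/rowP => k; rewrite !mxE.
  exact: le_lt_trans (row_norm _ _) xd.
by move/ltW/(le_trans _); apply; apply: le_trans (le_mx_norm _ ord0 i); rewrite !mxE.
Qed.

(** No step is taken where the gradient is below [ep]. Elsewhere the gradient changes by at most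
    [ep / 2] along a short step, which costs no more than half of the gain. *)
Lemma descent (Rb ep : R) : 0 < ep -> exists2 t0 : R, 0 < t0 & forall m z x t,
  la F <= m <= 9 * la F -> unitK z -> `|x| <= Rb -> 0 <= t <= t0 ->
  Act F m z (x - t *: vfield ep (grd F m z x)) <=
  Act F m z x - t * (nL2 (vfield ep (grd F m z x)) * nL2 (grd F m z x) / 2).
Proof.
move=> e0; have [d d0 Hd] := grd_unif Rb (divr_gt0 e0 (ltr0n R 2)).
have N0 : 0 < N%:R :> R by rewrite ltr0n.
exists (d / 2 / N%:R); first by rewrite !divr_gt0.
move=> m z x t mI Kz xR /andP[t0 td]; set g := grd F m z x; set v := vfield ep g.
have v1 : nL2 v <= 1 by apply: vfield_le1; exact: ltW.
have [s s01 E] := mvt (fun s _ => Act_der m z x (- (t *: v)) s) (lexx 0) ltr01 (lexx 1).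
move: E; rewrite scale1r scale0r addr0 subr0 mulr1 => /(canRL (subrK _)) ->.
rewrite addrC lerD2l ipNr ipZr lerN2 ler_wpM2l //.
have [ge|gl] := leP ep (nL2 g); last first.
  have -> : v = 0 by rewrite /v /vfield /vcoef pos0 ?mul0r ?scale0r // subr_le0 ltW.
  by rewrite nL20 ipC ip0l !mul0r.
set x' := x + _; have gx : nL2 (g - grd F m z x') <= ep / 2.
  apply: Hd => //; rewrite /x' opprD addrA subrr sub0r normrN normrZ normrN normrZ.
  have s1 : `|s| <= 1 by rewrite ger0_norm; lra.
  apply: (@le_lt_trans _ _ (1 * (t * (N%:R * 1)))).
    apply: ler_pM => //; rewrite ger0_norm // ler_wpM2l //.
    by apply: le_trans (sup_nL2 v) _; rewrite ler_pM2l.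
  by rewrite mul1r mulr1; move: td; rewrite ler_pdivlMr //; lra.
have -> : ip (grd F m z x') v = ip g v - ip (g - grd F m z x') v by rewrite -ipBl subKr.
have gv : ip g v = nL2 v * nL2 g.
  transitivity (vcoef ep (nL2 g) * nL2 g ^+ 2); first by rewrite ipZr nL2_sqr.
  by rewrite nL2Z ger0_norm ?vcoef_ge0 // expr2 mulrA.
have : ip (g - grd F m z x') v <= ep / 2 * nL2 v.
  by apply: le_trans (ler_norm _) _; apply: le_trans (ip_le _ _) _; rewrite ler_wpM2r // nL2_ge0.
rewrite gv; have := nL2_ge0 v; move: (nL2 v) (nL2 g) ge (ip _ _) => p q hq I p0 hI.
by nra.
Qed.

End Descent.

(* A descending sequence that survives both phases passes twice near the lower critical level,
   and leaving the lower critical set in between would cost too much action. *)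
Lemma trap (R : realType) (S : nat) (tau la dl ka kb k0a k0b w be e' al : R) (a gn D av : nat -> R)
    (low up dead : nat -> Prop) :
  (0 < S)%N -> 0 < tau -> 0 <= dl -> 0 < k0a -> 0 <= k0b -> 0 < w ->
  (forall l, (l < S + S)%N -> a l.+1 <= a l - tau * D l - dl * av l.+1) ->
  (forall l, 0 <= D l) -> (forall l, 0 <= av l) ->
  (forall l, (l < S + S)%N -> be <= a l <= la -> gn l < ka -> low l \/ up l) ->
  (forall l, (l < S + S)%N -> be <= a l <= la -> gn l < kb -> (low l /\ `|a l - al| <= e') \/ up l) ->
  (forall l, ka <= gn l -> k0a <= D l) -> (forall l, kb <= gn l -> k0b <= D l) ->
  (forall l, up l -> 1 / 4 <= av l.+1) ->
  (forall l k, k%:R * tau <= w -> low l -> ~ up (l + k)%N /\ ~ dead (l + k)%N) ->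
  a 0%N <= la -> be <= a (S + S)%N -> 0 < be ->
  S%:R * (tau * k0b) = la -> S%:R * dl = 4 * la -> 4 * tau <= w -> e' = k0a * w / 8 -> ~ dead S.
Proof.
move=> S0 tau0 dl0 k0a0 k0b0 w0 Hd D0 av0 PSa PSb Ga Gb Hup Hlow a0 aS be0 Sk Sd tw eE deadS.
have SR : 0 < S%:R :> R by rewrite ltr0n.
have step l : (l < S + S)%N -> a l.+1 <= a l.
  move=> lS; apply: le_trans (Hd l lS) _.
  by have := mulr_ge0 (ltW tau0) (D0 l); have := mulr_ge0 dl0 (av0 l.+1); lra.
have mono k : forall l, (l + k <= S + S)%N -> a (l + k)%N <= a l.
  elim: k => [|k IH] l; first by rewrite addn0.
  by rewrite addnS => h; apply: le_trans (step _ _) (IH _ (ltnW h)).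
have monoP l k : (l <= k)%N -> (k <= S + S)%N -> a k <= a l.
  by move=> lk kS; have := mono (k - l)%N l; rewrite subnKC //; exact.
have aI l : (l <= S + S)%N -> be <= a l <= la.
  by move=> lS; rewrite (le_trans aS (monoP _ _ lS (leqnn _))) (le_trans (monoP _ _ (leq0n _) lS)).
(* Away from the lower loops each step loses at least [tau * k0b], either by descent or, on upper
   loops, by the growth of [m]; [S] such steps would use up [la]. *)
have phase p : (p + S <= S + S)%N -> exists l, [/\ (p <= l)%N, (l < p + S)%N, low l & `|a l - al| <= e'].
  move=> pS; apply: contrapT => nex.
  have dec l : (p <= l < p + S)%N -> a l.+1 <= a l - tau * k0b.
    move=> /andP[pl lp]; have lS : (l < S + S)%N by exact: leq_trans lp pS.
    apply: le_trans (Hd l lS) _.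
    have h1 := mulr_ge0 (ltW tau0) (D0 l); have h2 := mulr_ge0 dl0 (av0 l.+1).
    have [gb|gb] := ltP (gn l) kb; last first.
      by have := ler_wpM2l (ltW tau0) (Gb l gb); lra.
    have [[lo la']|/Hup u] := PSb l lS (aI l (ltnW lS)) gb; first by case: nex; exists l.
    have : dl * (1 / 4) <= dl * av l.+1 by rewrite ler_wpM2l.
    have : tau * k0b = dl * (1 / 4).
      by apply: (mulfI (x := S%:R)); rewrite ?gt_eqF // Sk mulrA Sd; field.
    by lra.
  have : forall k, (k <= S)%N -> a (p + k)%N <= a p - k%:R * (tau * k0b).
    elim=> [|k IH] kS; first by rewrite addn0 mul0r subr0.
    rewrite addnS; apply: le_trans (dec _ _) _; first by rewrite leq_addr ltn_add2l.
    by have := IH (ltnW kS); rewrite -[k.+1%:R]natr1 mulrDl mul1r; lra.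
  move=> /(_ S (leqnn _)); rewrite Sk.
  have /andP[h1 _] := aI (p + S)%N pS.
  have /andP[_ h2] := aI p (leq_trans (leq_addr _ _) pS); lra.
have [l1 [_ l1S lo1 al1]] := phase 0%N (leq_addr _ _).
have [l2 [l2S l22 lo2 al2]] := phase S (leqnn _).
rewrite add0n in l1S.
pose P l := `[< (l <= S)%N /\ low l >].
have exP : exists l, P l by exists l1; apply/asboolP; split => //; exact: ltnW.
have ubP l : P l -> (l <= S)%N by move=> /asboolP[].
(* [l'] is the last lower step up to the middle; [J] below counts the steps that stay within
   distance [w] of it. *)
case: (ex_maxnP exP ubP) => l' /asboolP[l'S lo'] l'max.
have l1l' : (l1 <= l')%N by apply: l'max; apply/asboolP; split => //; exact: ltnW.
pose J := Num.truncn (w / tau).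
have /andP[J1 J2] : J%:R <= w / tau < J.+1%:R by apply: truncn_itv; rewrite divr_ge0 // ltW.
have Jw : J%:R * tau <= w by rewrite -ler_pdivlMr.
have Jw' : w < J%:R * tau + tau by rewrite -[X in _ + X]mul1r -mulrDl natr1 -ltr_pdivrMr.
have kw k : (k <= J)%N -> k%:R * tau <= w.
  by move=> kJ; apply: le_trans Jw; rewrite ler_pM2r // ler_nat.
(* Otherwise the middle step would lie within [w] of a lower loop and could not be dead. *)
have l'J : (l' + J < S)%N.
  rewrite ltnNge; apply/negP => h; have kJ : (S - l' <= J)%N by rewrite leq_subLR.
  by have [_] := Hlow l' (S - l')%N (kw _ kJ) lo'; rewrite subnKC.
(* Between [l'] and [l' + J] the loop is not lower, by maximality, and not upper, by closeness to a
   lower one; hence the gradient is at least [ka]. *)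
have dec k : (k < J)%N -> a (l' + k.+1)%N <= a (l' + 1)%N - k%:R * (tau * k0a).
  elim: k => [|k IH] kJ; first by rewrite mul0r subr0.
  have lS : (l' + k.+1 < S + S)%N.
    by apply: (@leq_trans S); [apply: leq_ltn_trans l'J; rewrite leq_add2l ltnW|exact: leq_addr].
  rewrite addnS; apply: le_trans (Hd _ lS) _.
  have h2 := mulr_ge0 dl0 (av0 (l' + k.+1).+1).
  have gk : k0a <= D (l' + k.+1)%N.
    apply: Ga; rewrite leNgt; apply/negP => h.
    have [lo|u] := PSa _ lS (aI _ (ltnW lS)) h.
      have : (l' + k.+1 <= l')%N.
        apply: l'max; apply/asboolP; split => //; apply: leq_trans (ltnW l'J).
        by rewrite leq_add2l ltnW.
      by rewrite -{2}[l']addn0 leq_add2l.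
    by have [] := Hlow l' k.+1 (kw _ (ltnW kJ)) lo'.
  have := ler_wpM2l (ltW tau0) gk; have := IH (ltnW kJ).
  by rewrite -[k.+1%:R]natr1 mulrDl mul1r; lra.
have J0 : (1 < J)%N by rewrite -(ltr_nat R) -(ltr_pM2r tau0); lra.
have := dec J.-1 ltac:(by rewrite prednK // ltnW); rewrite prednK ?(ltnW J0) // => dJ.
have SS : (S <= S + S)%N by exact: leq_addr.
have m1 : a l2 <= a (l' + J)%N.
  apply: monoP; first by apply: leq_trans (ltnW l'J) l2S.
  exact: ltnW.
have m2 : a (l' + 1)%N <= a l1.
  apply: monoP; first exact: leq_trans l1l' (leq_addr _ _).
  by apply: leq_trans SS; apply: leq_trans (ltnW l'J); rewrite leq_add2l ltnW.
(* The loss is at least [w / 2 * k0a], that is four times [e'], whereas the two visits to the level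
   [al] allow only twice [e']. *)
have : J.-1%:R * (tau * k0a) >= (w - 2 * tau) * k0a.
  rewrite mulrA ler_pM2r //; have JE : J%:R = J.-1%:R + 1 :> R by rewrite natr1 prednK // ltnW.
  by move: Jw'; rewrite JE mulrDl mul1r; move: (_ * tau) => *; lra.
have : (w - 2 * tau) * k0a >= w / 2 * k0a by rewrite ler_pM2r //; lra.
have : 0 < w / 2 * k0a by rewrite mulr_gt0 // divr_gt0.
have E8 : k0a * w / 8 = w / 2 * k0a / 4 by field.
move: al1 al2; rewrite eE E8 !ler_norml => /andP[? ?] /andP[? ?].
move: dJ m1 m2; move: (J.-1%:R * (tau * k0a)) => B dJ m1 m2 hA hB hC; lra.
Qed.

(** * The two-phase flow *)

Section Flow.
Variables (R : realType) (F : sympfam R) (n : nat).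
Notation N := n.+1.
Notation loop := 'M[R]_(N, 4).
Notation la := (la F).
Implicit Types x v g : loop.

(* The flow runs in two phases of [S] steps, while the weight [mS] of [khat] grows from [la] to
   [5 * la] and then to [9 * la]: this exhausts the action of the upper critical loops. *)
Definition mS (S l : nat) : R := la + l%:R * (4 * la / S%:R).

Fixpoint flow (ep tau : R) (S : nat) (z : R * R) x (l : nat) : loop :=
  if l is l'.+1 then
    let y := flow ep tau S z x l' in y - tau *: vfield ep (grd F (mS S l') z y)
  else x.

Lemma mS0 S : mS S 0 = la. Proof. by rewrite /mS mul0r addr0. Qed.

Lemma mSend S : (0 < S)%N -> mS S (S + S) = 9 * la.
Proof. by move=> S0; rewrite /mS natrD; field; rewrite pnatr_eq0 -lt0n. Qed.

Lemma mS_itv S l : (0 < S)%N -> (l <= S + S)%N -> la <= mS S l <= 9 * la.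
Proof.
move=> S0 lS; have l0 := la_gt0 F; have SR : 0 < S%:R :> R by rewrite ltr0n.
have d0 : 0 <= 4 * la / S%:R by rewrite divr_ge0 // mulr_ge0 // ltW.
rewrite -(mSend S0) /mS lerDl mulr_ge0 //= lerD2l ler_wpM2r // ler_nat //.
Qed.

Section Fixed.
Variables (ep tau : R) (S : nat) (z : R * R) (x : loop).
Hypotheses (ep0 : 0 < ep) (tau0 : 0 <= tau) (S0 : (0 < S)%N) (Kz : unitK z).
Notation fl := (flow ep tau S z x).

Lemma flow_L2 l k : nL2 (fl l - fl (l + k)%N) <= k%:R * tau.
Proof.
elim: k => [|k IH]; first by rewrite addn0 subrr nL20 mul0r.
rewrite addnS /= opprB addrCA addrC; apply: le_trans (nL2D _ _) _.
rewrite -[k.+1%:R]natr1 mulrDl mul1r; apply: lerD => //.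
rewrite nL2Z ger0_norm // -[leRHS]mulr1 ler_wpM2l // vfield_le1 //; exact: ltW.
Qed.

Lemma flow_sup l : `|fl l| <= `|x| + l%:R * tau * N%:R.
Proof.
have h := flow_L2 0 l; rewrite add0n /= in h.
rewrite -[fl l](subKr x); apply: le_trans (ler_normB _ _) _; rewrite lerD2l.
apply: le_trans (sup_nL2 _) _; rewrite mulrC ler_wpM2r //.
Qed.

Lemma Act_m m m' (y : loop) : Act F m' z y = Act F m z y - (m' - m) * avk F z y.
Proof.
rewrite /Act /avk -avgZ -addrA -opprD -avgD; congr (_ - avg _); apply/funext => j.
by rewrite /Ham; ring.
Qed.

Variables (Rb t0 : R).
Hypothesis Hdesc : forall m z x t,
  la <= m <= 9 * la -> unitK z -> `|x| <= Rb -> 0 <= t <= t0 ->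
  Act F m z (x - t *: vfield ep (grd F m z x)) <=
  Act F m z x - t * (nL2 (vfield ep (grd F m z x)) * nL2 (grd F m z x) / 2).
Hypotheses (taut0 : tau <= t0) (xRb : `|x| + (S + S)%:R * tau * N%:R <= Rb).

Definition gain l : R := nL2 (vfield ep (grd F (mS S l) z (fl l))) * nL2 (grd F (mS S l) z (fl l)) / 2.

Lemma gain_ge0 l : 0 <= gain l.
Proof. by rewrite divr_ge0 // mulr_ge0 // nL2_ge0. Qed.

Lemma flow_desc l : (l < S + S)%N -> Act F (mS S l.+1) z (fl l.+1) <=
  Act F (mS S l) z (fl l) - tau * gain l - 4 * la / S%:R * avk F z (fl l.+1).
Proof.
move=> lS; rewrite (Act_m (mS S l)) (_ : mS S l.+1 - mS S l = 4 * la / S%:R).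
  rewrite lerD2r /=; apply: Hdesc; rewrite ?tau0 //; first exact: mS_itv (ltnW lS).
  apply: le_trans xRb; apply: le_trans (flow_sup l) _; rewrite lerD2l.
  by rewrite ler_wpM2r // ler_wpM2r // ler_nat ltnW.
by rewrite /mS -[l.+1%:R]natr1; ring.
Qed.

Lemma avk_ge0 (y : loop) : 0 <= avk F z y.
Proof. by apply: avg_ge0 => j; case/andP: (khat_itv F z (row j y)). Qed.

Lemma flow_end : Act F (9 * la) z (fl (S + S)) <= Act F la z x.
Proof.
rewrite -(mSend S0) -(mS0 S).
have : forall l, (l <= S + S)%N -> Act F (mS S l) z (fl l) <= Act F (mS S 0) z x.
  elim=> [//|l IH] lS; apply: le_trans (flow_desc lS) _; apply: le_trans (IH (ltnW lS)).
  have := mulr_ge0 tau0 (gain_ge0 l).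
  have : 0 <= 4 * la / S%:R * avk F z (fl l.+1).
    by rewrite mulr_ge0 ?avk_ge0 // divr_ge0 // mulr_ge0 // ltW // la_gt0.
  by lra.
exact.
Qed.

End Fixed.
End Flow.

(** The order of choices matters: [ka] and the modulus [w] fix the tolerance on the critical level;
    this gives the second threshold [kb], and with it the duration [la / kz kb] of a phase. The step
    size comes last, since it depends on [n] and [R0]. The factor [s] shortens the flow, for its
    deformation to the identity. *)
Lemma flow_alive (R : realType) (F : sympfam R) (be : R) : 0 < be -> exists n0 : nat,
  forall n (R0 : R), (n0 <= n)%N -> exists ep tau0 : R, exists S : nat,
  [/\ 0 < ep, 0 < tau0 & (0 < S)%N] /\ forall z (x : 'M[R]_(n.+1, 4)), unitK z -> `|x| <= R0 ->
  (forall s, 0 <= s <= 1 -> Act F (9 * la F) z (flow F ep (s * tau0) S z x (S + S)) <= Act F (la F) z x) /\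
  (Act F (la F) z x <= la F -> be <= Act F (9 * la F) z (flow F ep tau0 S z x (S + S)) ->
   ~ (Th1 F z (flow F ep tau0 S z x S) = 0 /\ Th2 F z (flow F ep tau0 S z x S) = 0)).
Proof.
move=> be0; have [ka ka0 [na Ha]] := palais_smale F be0 ltr01.
have [w w0 Hw] := lower_modulus F; have k0a := kz_gt0 ka0.
have e'0 : 0 < kz ka * w / 8 by rewrite divr_gt0 // mulr_gt0.
have [kb' kb'0 [nb Hb]] := palais_smale F be0 e'0.
pose kb := Num.min kb' ka; have kb0 : 0 < kb by rewrite lt_min kb'0.
have k0b := kz_gt0 kb0; have l0 := la_gt0 F.
pose ep := kb / 2; have ep0 : 0 < ep by rewrite divr_gt0.
have epa : ep <= ka / 2 by rewrite /ep ler_pM2r // ge_min lexx orbT.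
pose T1 := la F / kz kb; have T10 : 0 < T1 by rewrite divr_gt0.
exists (maxn na nb) => n R0; rewrite geq_max => /andP[nna nnb].
pose Rb := R0 + 2 * T1 * n.+1%:R.
have [t0 t00 Hd] := descent F n Rb ep0.
pose q := Num.min t0 (w / 4); have q0 : 0 < q by rewrite lt_min t00 divr_gt0.
pose S := (Num.truncn (T1 / q)).+1; have S0 : (0 < S)%N by [].
have SR : 0 < S%:R :> R by rewrite ltr0n.
pose tau := T1 / S%:R; have tau0 : 0 < tau by rewrite divr_gt0.
have tq : tau < q by rewrite /tau ltr_pdivrMr // mulrC -ltr_pdivrMr // truncnS_gt.
have [tt tw] : tau < t0 /\ tau < w / 4 by move: tq; rewrite lt_min => /andP[].
exists ep, tau, S; split => // z x Kz xR0.
have Stau s : 0 <= s <= 1 -> [/\ 0 <= s * tau, s * tau <= t0 & `|x| + (S + S)%:R * (s * tau) * n.+1%:R <= Rb].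
  move=> /andP[s0 s1]; have h : s * tau <= tau by rewrite ler_piMl // ltW.
  split; first by rewrite mulr_ge0 // ltW.
    by rewrite (le_trans h) // ltW.
  apply: lerD => //; rewrite ler_wpM2r //; apply: (@le_trans _ _ ((S + S)%:R * tau)); first by rewrite ler_wpM2l.
  by rewrite natrD mulrDl mulrC /tau divfK ?gt_eqF //; lra.
split.
  by move=> s /Stau[h1 h2 h3]; exact: (flow_end ep0 h1 S0 Kz Hd h2 h3).
have [h1 h2 h3] := Stau 1 ltac:(by rewrite ler01 lexx); rewrite !mul1r in h1 h2 h3.
move=> A0 A1; pose fl := flow F ep tau S z x; pose a l := Act F (mS F S l) z (fl l).
pose gn l := nL2 (grd F (mS F S l) z (fl l)).
apply: (@trap R S tau (la F) (4 * la F / S%:R) ka kb (kz ka) (kz kb) w be (kz ka * w / 8) (alpha F)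
  a gn (gain F ep tau S z x) (fun l => avk F z (fl l)) (fun l => lower F z (fl l))
  (fun l => upper F z (fl l)) (fun l => Th1 F z (fl l) = 0 /\ Th2 F z (fl l) = 0)) => //.
- by rewrite divr_ge0 // mulr_ge0 // ltW.
- exact: ltW.
- by move=> l lS; exact: (flow_desc ep0 h1 S0 Kz Hd h2 h3 lS).
- by move=> l; exact: gain_ge0.
- by move=> l; exact: avk_ge0.
- move=> l lS aI gk; have [[lo _]|u] := Ha n _ z (fl l) nna Kz (mS_itv F S0 (ltnW lS)) gk aI; [by left|by right].
- move=> l lS aI gk; apply: (Hb n _ z (fl l) nnb Kz (mS_itv F S0 (ltnW lS)) _ aI).
  by apply: lt_le_trans gk _; rewrite ge_min lexx.
- by move=> l gk; apply: vfield_gain => //; exact: ltW.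
- by move=> l gk; apply: vfield_gain => //; exact: ltW.
- move=> l u; have [|k _] := Hw n z (fl l) (fl l.+1) Kz.
    apply: (@le_trans _ _ tau); last by lra.
    by have := flow_L2 F S z x ep0 h1 l 1; rewrite addn1 mul1r.
  by move: u k; rewrite /upper ler_norml => u /andP[_ k]; lra.
- move=> l k kt lo; have [|k1 k2] := Hw n z (fl l) (fl (l + k)%N) Kz.
    by apply: le_trans kt; exact: flow_L2.
  split; last exact: k2.
  by move: lo k1 => [_ lo]; rewrite /upper ler_norml => /andP[k1 _] u; lra.
- by rewrite /a mS0.
- by rewrite /a mSend.
- by rewrite mulrA /tau mulrC (mulrC S%:R) divfK ?gt_eqF // mulrC /T1 divfK // gt_eqF.
- by rewrite mulrC divfK // gt_eqF.
- lra.
Qed.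

(** * The topological argument *)

Section Rotations.
Variables (R : realType) (F : sympfam R).
Notation R4 := 'rV[R]_4.
Notation rho := (Qcd (sa F) (sb F)).
Notation phi := (phi F).

Definition rot2 (s t : R) (y : R4) : R4 := \row_i
  if i == o0 then cos s * y ord0 o0 - sin s * y ord0 o1
  else if i == o1 then sin s * y ord0 o0 + cos s * y ord0 o1
  else if i == o2 then cos t * y ord0 o2 - sin t * y ord0 o3
  else sin t * y ord0 o2 + cos t * y ord0 o3.

Lemma rot2E s t y : [/\ rot2 s t y ord0 o0 = cos s * y ord0 o0 - sin s * y ord0 o1,
  rot2 s t y ord0 o1 = sin s * y ord0 o0 + cos s * y ord0 o1,
  rot2 s t y ord0 o2 = cos t * y ord0 o2 - sin t * y ord0 o3 &
  rot2 s t y ord0 o3 = sin t * y ord0 o2 + cos t * y ord0 o3].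
Proof. by rewrite /rot2 !mxE. Qed.

Lemma rot2_rho s t y : rho (rot2 s t y) = rho y.
Proof.
rewrite /Qcd; have [-> -> -> ->] := rot2E s t y.
have := cos2Dsin2 s; have := cos2Dsin2 t; move: (cos s) (sin s) (cos t) (sin t) => C S C' S' h1 h2.
congr (_ * _ / _ + _ * _ / _).
  by rewrite -[RHS]mul1r -h2; ring.
by rewrite -[RHS]mul1r -h1; ring.
Qed.

Lemma rot2K s t y : rot2 s t (rot2 (- s) (- t) y) = y.
Proof.
have [e0 e1 e2 e3] := rot2E s t (rot2 (- s) (- t) y); have [f0 f1 f2 f3] := rot2E (- s) (- t) y.
have := cos2Dsin2 s; have := cos2Dsin2 t => h1 h2.
apply/rowP; apply: ord4P; rewrite ?(e0, e1, e2, e3) ?(f0, f1, f2, f3) !cosN !sinN.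
- by rewrite -[RHS]mul1r -h2; ring.
- by rewrite -[RHS]mul1r -h2; ring.
- by rewrite -[RHS]mul1r -h1; ring.
- by rewrite -[RHS]mul1r -h1; ring.
Qed.

Lemma rot2Z s t (k : R) y : rot2 s t (k *: y) = k *: rot2 s t y.
Proof.
have [e0 e1 e2 e3] := rot2E s t (k *: y); have [f0 f1 f2 f3] := rot2E s t y.
by apply/rowP; apply: ord4P; rewrite ?(e0, e1, e2, e3) [RHS]mxE ?(f0, f1, f2, f3) !mxE; ring.
Qed.

Lemma rot20 s t : rot2 s t 0 = 0.
Proof. by have := rot2Z s t 0 0; rewrite !scale0r. Qed.

Lemma rot200 y : rot2 0 0 y = y.
Proof.
have [e0 e1 e2 e3] := rot2E 0 0 y; apply/rowP; apply: ord4P; rewrite ?(e0, e1, e2, e3) cos0 sin0; ring.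
Qed.

(** The two embeddings differ by a rotation of the source, which preserves [rho]; they push
    functions of [rho] forward to the same function. *)
Definition rel_rot (z z' : R * R) s t := forall y, rho y < 1 -> phi z' y = phi z (rot2 s t y).

Section Rel.
Variables (z z' : R * R) (s t : R).
Hypothesis Hrel : rel_rot z z' s t.

Lemma rel_inim x : inim (sa F) (sb F) phi z' x <-> inim (sa F) (sb F) phi z x.
Proof.
split=> -[y ry <-]; first by exists (rot2 s t y); rewrite ?rot2_rho // -Hrel.
by exists (rot2 (- s) (- t) y); rewrite ?rot2_rho // Hrel ?rot2_rho // rot2K.
Qed.

Lemma rel_pull (W : Type) (G : R4 -> W) (h : W -> W) w0 x : h w0 = w0 ->
  (forall y, G (rot2 (- s) (- t) y) = h (G y)) ->
  pull (sa F) (sb F) phi (fun _ => G) w0 z' x = h (pull (sa F) (sb F) phi (fun _ => G) w0 z x).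
Proof.
move=> h0 hG; have [[y ry <-]|nx] := pselect (inim (sa F) (sb F) phi z x); last first.
  by rewrite !pull_out //; move/rel_inim.
rewrite (pull_im (@phi_inj _ F)) // -hG.
rewrite -[X in pull _ _ _ _ _ _ (phi z X)](rot2K s t) -Hrel ?rot2_rho //.
by rewrite (pull_im (@phi_inj _ F)) // rot2_rho.
Qed.

Lemma rel_Ham m : Ham F m z' = Ham F m z.
Proof.
apply/funext => x; rewrite /Ham /khat /pullf; congr (_ + _ * _ + _).
  by apply: (rel_pull (h := id)) => // y; rewrite rot2_rho.
by apply: (rel_pull (h := id)) => // y; rewrite rot2_rho.
Qed.

(** Uniqueness of the gradient transfers the equality of the Hamiltonians, so the Jacobians need not
    be compared. *)
Lemma rel_gHam m x : gHam F m z' x = gHam F m z x.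
Proof.
apply: (@hasgrad_uniq R 4 (Ham F m z')); first exact: hasgrad_Ham.
by rewrite rel_Ham; exact: hasgrad_Ham.
Qed.

Lemma rel_ctr : ctr F z' = ctr F z.
Proof. by rewrite /ctr Hrel ?rot20 // Qcd0 ltr01. Qed.

Lemma rel_Tf x : Tf F z' x = rot2 (- s) (- t) (Tf F z x).
Proof.
apply: rel_pull; first exact: rot20.
by move=> y; rewrite rot2_rho rot2Z.
Qed.

Lemma rel_grd n m (x : 'M[R]_(n.+1, 4)) : grd F m z' x = grd F m z x.
Proof. by rewrite /grd; congr (_ - _); apply/matrixP => j i; rewrite [LHS]mxE [RHS]mxE rel_gHam. Qed.

Lemma rel_flow n ep tau S (x : 'M[R]_(n.+1, 4)) l : flow F ep tau S z' x l = flow F ep tau S z x l.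
Proof.
elim: l => [|l IH]; first by [].
have E w : flow F ep tau S w x l.+1 =
  flow F ep tau S w x l - tau *: vfield ep (grd F (mS F S l) w (flow F ep tau S w x l)) by [].
by rewrite (E z') (E z) IH rel_grd.
Qed.

(** As a complex number the Fourier coefficient is multiplied by e^{-is}. *)
Lemma rel_Th n (x : 'M[R]_(n.+1, 4)) :
  Th1 F z' x = cos s * Th1 F z x + sin s * Th2 F z x /\
  Th2 F z' x = - sin s * Th1 F z x + cos s * Th2 F z x.
Proof.
rewrite /Th1 /Th2 -!avgZ -!avgD; split; congr avg; apply/funext => j;
  rewrite rel_Tf; have [-> -> _ _] := rot2E (- s) (- t) (Tf F z (row j x)); rewrite cosN sinN;
  move: (cos _) (sin _) (Tf _ _ _ _ _) (Tf _ _ _ _ _) (cos s) (sin s) => c1 s1 p q c2 s2; ring.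
Qed.

End Rel.
End Rotations.

(** * Continuity of the flow and of the Fourier coefficient in all parameters *)

Section ContinuousFlow.
Variables (R : realType) (F : sympfam R) (n : nat) (T : topologicalType).
Notation N := n.+1.
Notation loop := 'M[R]_(N, 4).
Notation R4 := 'rV[R]_4.

Lemma cont_mulmx (m k p : nat) (f : T -> 'M[R]_(m, k)) (g : T -> 'M[R]_(k, p)) :
  continuous f -> continuous g -> continuous (fun y => f y *m g y).
Proof. by move=> fc gc y; apply: contat_mulmx; [exact: fc|exact: gc]. Qed.

Lemma cont_entry (x : T -> loop) j i : continuous x -> continuous (fun p => x p j i).
Proof. by move=> xc p; apply: (@cvg_coord R T (nbhs p) _ _ x _ j i); exact: xc. Qed.

Lemma cont_Lop (x : T -> loop) : continuous x -> continuous (fun p => Lop (x p)).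
Proof.
move=> xc; apply: contZ; first exact: contC.
apply: contB.
  apply: cont_mulmx; last exact: contC.
  by apply: contB; [exact: xc|apply: cont_mulmx; [exact: contC|exact: xc]].
apply: cont_mulmx; last exact: contC.
by apply: contB; [apply: cont_mulmx; [exact: contC|exact: xc]|exact: xc].
Qed.

Lemma cont_row (x : T -> loop) j : continuous x -> continuous (fun p => row j (x p)).
Proof.
move=> xc; apply: continuous_mx => i k.
rewrite (_ : (fun p => _) = fun p => x p j k); first exact: cont_entry.
by apply/funext => p; rewrite mxE.
Qed.

Lemma cont_pair (U V : topologicalType) (f : T -> U) (g : T -> V) :
  continuous f -> continuous g -> continuous (fun p => (f p, g p)).
Proof. by move=> fc gc p; apply: cvg_pair; [exact: fc|exact: gc]. Qed.

Lemma cont_zrow (W : topologicalType) (f : (R * R) * R4 -> W) (z : T -> R * R) (x : T -> loop) j :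
  continuous f -> continuous z -> continuous x -> continuous (fun p => f (z p, row j (x p))).
Proof.
move=> fc zc xc p; apply: (@continuous_comp _ _ _ (fun p => (z p, row j (x p))) f); last exact: fc.
by apply: cont_pair => //; exact: cont_row.
Qed.

Lemma cont_avg (f : 'I_N -> T -> R) : (forall j, continuous (f j)) -> continuous (fun p => avg (fun j => f j p)).
Proof.
move=> fc; apply: contM; first exact: contC.
exact: continuous_sum.
Qed.

Lemma cont_ip (x y : T -> loop) : continuous x -> continuous y -> continuous (fun p => ip (x p) (y p)).
Proof.
move=> xc yc; apply: (@cont_avg (fun j p => \sum_i x p j i * y p j i)) => j.
by apply: continuous_sum => i; apply: contM; exact: cont_entry.
Qed.

Lemma cont_actQ (x : T -> loop) : continuous x -> continuous (fun p => actQ (x p)).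
Proof. by move=> xc; apply: contM; [exact: contC|apply: cont_ip => //; exact: cont_Lop]. Qed.

Lemma cont_grd m (z : T -> R * R) (x : T -> loop) : continuous z -> continuous x ->
  continuous (fun p => grd F m (z p) (x p)).
Proof.
move=> zc xc; apply: contB; first exact: cont_Lop.
apply: continuous_mx => j i.
rewrite (_ : (fun p => _) = fun p => gHam F m (z p) (row j (x p)) ord0 i); last first.
  by apply/funext => p; rewrite mxE.
move=> p; apply: (@cvg_coord R T (nbhs p) _ _ (fun p => gHam F m (z p) (row j (x p)))).
exact: (@cont_zrow _ (fun q => gHam F m q.1 q.2) z x j (@gHam_cont R F m) zc xc p).
Qed.

Lemma cont_vfield ep (g : T -> loop) : continuous g -> continuous (fun p => vfield ep (g p)).
Proof.
move=> gc; apply: contZ => //.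
have nc : continuous (fun p => nL2 (g p)).
  move=> p; apply: (@continuous_comp _ _ _ (fun p => ip (g p) (g p)) Num.sqrt); first exact: cont_ip.
  exact: sqrt_continuous.
apply: contM.
  move=> p; apply: (@continuous_comp _ _ _ (fun p => nL2 (g p) - ep) (@pos R)).
    by apply: contB => //; exact: contC.
  by apply: continuous_max; [exact: cst_continuous|move=> ?; exact: cvg_id].
move=> p; apply: cvgV; first by rewrite expf_neq0 // gt_eqF // ltr_pwDl // nL2_ge0.
have sc : continuous (fun p => (1 + nL2 (g p)) * (1 + nL2 (g p))).
  by apply: contM; apply: contD => //; exact: contC.
exact: sc.
Qed.

Lemma cont_flow ep S (tau : T -> R) (z : T -> R * R) (x : T -> loop) l : continuous tau ->
  continuous z -> continuous x -> continuous (fun p => flow F ep (tau p) S (z p) (x p) l).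
Proof.
move=> tc zc xc; elim: l => [//|l IH] /=; apply: contB => //; apply: contZ => //.
by apply: cont_vfield; exact: cont_grd.
Qed.

Lemma cont_Tf (z : T -> R * R) (x : T -> loop) j i : continuous z -> continuous x ->
  continuous (fun p => Tf F (z p) (row j (x p)) ord0 i).
Proof.
move=> zc xc p; apply: (@cvg_coord R T (nbhs p) _ _ (fun p => Tf F (z p) (row j (x p)))).
exact: (@cont_zrow _ (fun q => Tf F q.1 q.2) z x j (@Tf_cont R F) zc xc p).
Qed.

Lemma cont_Th (z : T -> R * R) (x : T -> loop) : continuous z -> continuous x ->
  continuous (fun p => Th1 F (z p) (x p)) /\ continuous (fun p => Th2 F (z p) (x p)).
Proof.
move=> zc xc; split.
  apply: (@cont_avg (fun j p => cos (2 * pi * (j%:R / N%:R)) * Tf F (z p) (row j (x p)) ord0 o0 +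
    sin (2 * pi * (j%:R / N%:R)) * Tf F (z p) (row j (x p)) ord0 o1)) => j.
  by apply: contD; apply: contM; try exact: contC; exact: cont_Tf.
apply: (@cont_avg (fun j p => - sin (2 * pi * (j%:R / N%:R)) * Tf F (z p) (row j (x p)) ord0 o0 +
  cos (2 * pi * (j%:R / N%:R)) * Tf F (z p) (row j (x p)) ord0 o1)) => j.
by apply: contD; apply: contM; try exact: contC; exact: cont_Tf.
Qed.

Lemma cont_cst (f : T -> R4) : continuous f -> continuous (fun p => cst n (f p)).
Proof.
move=> fc; apply: continuous_mx => j i.
rewrite (_ : (fun p => _) = fun p => f p ord0 i); last by apply/funext => p; rewrite mxE.
by move=> p; apply: (@cvg_coord R T (nbhs p) _ _ f); exact: fc.
Qed.

End ContinuousFlow.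

(** * The half space, the sphere, and their intersection *)

Section Assembly.
Variables (R : realType) (F : sympfam R) (n : nat).
Notation N := n.+1.
Notation loop := 'M[R]_(N, 4).
Notation la := (la F).
Notation c := (sc F).
Notation d := (sd F).
Hypothesis n_gt0 : (0 < n)%N.
Variables (b : 'I_(N * 4) -> loop) (s : 'I_(N * 4) -> R).
Hypothesis b_on : forall i j, ip (b i) (b j) = (i == j)%:R.
Hypothesis bL : forall i, Lop (b i) = s i *: b i.
Hypothesis b_span : forall x, x = \sum_i ip x (b i) *: b i.
Variables (r1 C : R).
Hypotheses (r10 : 0 < r1) (C0 : 0 < C).
Hypothesis Hquad : forall m z x, unitK z -> 0 <= m <= 9 * la ->
  Ham F m z x <= C * dot (x - ctr F z) (x - ctr F z).
Hypothesis Hsmall : forall m z x, unitK z -> `|ctr F z - x| <= r1 -> Ham F m z x = 0.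

(** The quadratic action that defines the small sphere, with the constant of [action_sphere]. *)
Let al : R := r1 ^+ 2 / (320 * C).
Let l0 := la_gt0 F.
Let c0 := sc_gt0 F.
Let d0 := sd_gt0 F.

Lemma al_gt0 : 0 < al.
Proof. by apply: divr_gt0; [exact: exprn_gt0|apply: mulr_gt0; [rewrite ltr0n|exact: C0]]. Qed.

Definition negI := [seq i <- enum 'I_(N * 4) | s i <= 0].
Definition kV := size negI.
Definition vI (i : nat) : 'I_(N * 4) := nth ord0 negI i.
Notation pts := 'rV[R]_(kV.+1.+2).
Implicit Types (p : pts) (z : R * R).

Lemma vI_le i : (i < kV)%N -> s (vI i) <= 0.
Proof. by move=> h; have := mem_nth ord0 h; rewrite mem_filter => /andP[]. Qed.

Lemma vI_ex j : s j <= 0 -> exists2 i, (i < kV)%N & vI i = j.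
Proof.
move=> h; have jI : j \in negI by rewrite mem_filter h mem_enum.
by exists (index j negI); [rewrite index_mem|rewrite /vI nth_index].
Qed.

Lemma vI_inj i j : (i < kV)%N -> (j < kV)%N -> vI i = vI j -> i = j.
Proof.
move=> hi hj /eqP; rewrite /vI nth_uniq //; first by move/eqP.
by rewrite filter_uniq // enum_uniq.
Qed.

Definition en : R := ip (eloop R n) (eloop R n).
Let en0 : 0 < en := eloop_neq0 R n.
Let s10 : 0 < sigma1 R n := sigma1_gt0 R n_gt0.

Lemma lac : 0 < la / c - 1.
Proof. by rewrite subr_gt0 ltr_pdivlMr // mul1r sc_la. Qed.

(** Lower bounds for the squared size of the box: [b1] serves its faces in the nonpositive
    directions, [b2] the far end of the half line, and [b3] makes the half line cross the sphere
    inside of the box. *)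
Definition b1 : R := 4 * (c + d) / pi.
Definition b2 : R := la / (pi * en * (la / c - 1)).
Definition b3 : R := 2 * al / (sigma1 R n * en).
Definition Rb : R := 1 + b1 + b2 + b3.

Lemma bs_ge0 : [/\ 0 <= b1, 0 <= b2 & 0 <= b3].
Proof.
have p0 := pi_gt0 R; split; apply: divr_ge0.
- by apply: mulr_ge0 => //; apply: addr_ge0; exact: ltW.
- exact: ltW.
- exact: ltW.
- by apply: ltW; apply: mulr_gt0 lac; exact: mulr_gt0.
- by apply: mulr_ge0 => //; exact: ltW al_gt0.
- by apply: ltW; exact: mulr_gt0.
Qed.

Lemma Rb_sqr : [/\ 0 < Rb, b1 <= Rb ^+ 2, b2 <= Rb ^+ 2 & b3 < Rb ^+ 2].
Proof.
have [h1 h2 h3] := bs_ge0; have R1 : 1 <= Rb by rewrite /Rb; lra.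
have : Rb <= Rb ^+ 2 by rewrite expr2 ler_peMr //; lra.
by move: R1; move: (Rb ^+ 2) => Q; rewrite /Rb => R1 h; split; lra.
Qed.

(** Axes 0 and 1 are the two parameters, so the box occupies the axes from 2 on. *)
Definition co p (i : nat) : R := p ord0 (inord i.+2).
Definition vv p : loop := \sum_(i < kV) (Rb * (2 * co p i - 1)) *: b (vI i).
Definition rr p : R := Rb * co p kV.
Definition x0 p : loop := vv p + rr p *: eloop R n.

Lemma ip_vv_in p i : (i < kV)%N -> ip (vv p) (b (vI i)) = Rb * (2 * co p i - 1).
Proof.
move=> hi; rewrite /vv ip_suml (bigD1 (Ordinal hi)) //= ipZl b_on eqxx mulr1 big1 ?addr0 // => j jn.
rewrite ipZl b_on; case: eqP => [E|]; last by rewrite mulr0.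
by case/eqP: jn; apply: val_inj => /=; apply: vI_inj E.
Qed.

Lemma ip_vv_out p j : 0 < s j -> ip (vv p) (b j) = 0.
Proof.
move=> sj; rewrite /vv ip_suml big1 // => i _; rewrite ipZl b_on; case: eqP => [E|]; last by rewrite mulr0.
by have := vI_le (ltn_ord i); rewrite E leNgt sj.
Qed.

Lemma vv_neg p j : ip (vv p) (b j) != 0 -> s j <= 0.
Proof. by move=> h; rewrite leNgt; apply/negP => sj; rewrite ip_vv_out // eqxx in h. Qed.

Lemma ip_e j : s j <= 0 -> ip (eloop R n) (b j) = 0.
Proof.
move=> sj; have := ipL_basis bL (eloop R n) j; rewrite Lop_eloop ipZl => /eqP.
rewrite -subr_eq0 -mulrBl mulf_eq0 => /orP[|/eqP//]; rewrite gt_eqF //.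
by rewrite subr_gt0 (le_lt_trans sj).
Qed.

Lemma Act_x0 z p m : la <= m -> Act F m z (x0 p) <=
  la - la * avg (fun j => Qcd c d (row j (vv p))) - pi * rr p ^+ 2 * en * (la / c - 1).
Proof.
move=> lm; apply: (@action_plane R n b s bL b_span la c d (rr p) (Ham F m z) (vv p)) => //; first by move=> y; exact: Ham_ge.
exact: vv_neg.
Qed.

Lemma avgQ_ge p : ip (vv p) (vv p) <= b1 * avg (fun j => Qcd c d (row j (vv p))).
Proof.
rewrite -avgZ; apply: ler_avg => j; rewrite sum4.
have h i : vv p j i * vv p j i <= (c + d) / pi * Qcd c d (row j (vv p)).
  by have := sup_le_Qcd c0 d0 (row j (vv p)) i; rewrite mxE expr2.
have := h o0; have := h o1; have := h o2; have := h o3; rewrite /b1.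
have -> : 4 * (c + d) / pi * Qcd c d (row j (vv p)) = 4 * ((c + d) / pi * Qcd c d (row j (vv p))) by ring.
by move: (_ * Qcd _ _ _) => q; lra.
Qed.

Lemma tail_ge0 p : 0 <= pi * rr p ^+ 2 * en * (la / c - 1).
Proof.
apply: mulr_ge0; last exact: ltW lac.
by apply: mulr_ge0; [apply: mulr_ge0; [exact: pi_ge0|exact: sqr_ge0]|exact: ltW].
Qed.

Lemma avgQ0 p : 0 <= avg (fun j => Qcd c d (row j (vv p))).
Proof. by apply: avg_ge0 => j; exact: Qcd_ge0. Qed.

Lemma Act_x0_la z p : Act F la z (x0 p) <= la.
Proof.
apply: le_trans (Act_x0 z p (lexx _)) _; have := tail_ge0 p.
by have := mulr_ge0 (ltW l0) (avgQ0 p); lra.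
Qed.

(** At [r = 0] the quadratic part is nonpositive and the Hamiltonian nonnegative; at [r = Rb] the
    excess of [la / c] over 1 costs at least [la]; on the other faces the form of E(c, d) has mean
    at least 1. *)
Lemma Act_bdry z p i : (i < kV.+1)%N -> co p i = 0 \/ co p i = 1 -> Act F la z (x0 p) <= 0.
Proof.
have [R0 Rb1 Rb2 _] := Rb_sqr; have p0 := pi_gt0 R.
rewrite ltnS leq_eqVlt => /predU1P[->|ik] h.
  case: h => h.
    rewrite /Act /x0 /rr h mulr0 scale0r addr0; rewrite subr_le0.
    apply: (@le_trans _ _ 0); last by apply: avg_ge0 => j; apply: Ham_ge0; exact: ltW.
    rewrite (actQ_basis bL b_span) mulr_ge0_le0 // sumr_le0 // => j _.
    have [->|nz] := eqVneq (ip (vv p) (b j)) 0; first by rewrite expr0n mulr0.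
    by apply: mulr_le0_ge0; [exact: vv_neg nz|exact: sqr_ge0].
  apply: le_trans (Act_x0 z p (lexx _)) _.
  have := mulr_ge0 (ltW l0) (avgQ0 p).
  have : la <= pi * rr p ^+ 2 * en * (la / c - 1).
    rewrite /rr h mulr1; have q0 : 0 < pi * en * (la / c - 1).
      by apply: mulr_gt0 lac; exact: mulr_gt0.
    have -> : pi * Rb ^+ 2 * en * (la / c - 1) = Rb ^+ 2 * (pi * en * (la / c - 1)) by ring.
    by rewrite -ler_pdivrMr.
  by move=> h1 h2; rewrite -addrA -opprD subr_le0; apply: le_trans h1 _; rewrite lerDr.
apply: le_trans (Act_x0 z p (lexx _)) _; have := tail_ge0 p.
have : 1 <= avg (fun j => Qcd c d (row j (vv p))).
  have b10 : 0 < b1 by rewrite divr_gt0 // mulr_gt0 // addr_gt0.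
  rewrite -(ler_pM2l b10) mulr1; apply: le_trans (avgQ_ge p); apply: le_trans Rb1 _.
  rewrite (ip_basis b_span) (bigD1 (vI i)) //= ip_vv_in //.
  have -> : Rb * (2 * co p i - 1) * (Rb * (2 * co p i - 1)) = Rb ^+ 2.
    by case: h => ->; ring.
  by rewrite lerDl sumr_ge0 // => j _; rewrite -expr2 sqr_ge0.
by move=> h1 h2; have := ler_wpM2l (ltW l0) h1; rewrite mulr1; lra.
Qed.

Lemma x0_bound : exists R0 : R, forall p, box p -> `|x0 p| <= R0.
Proof.
have [R0 _ _ _] := Rb_sqr.
exists (\sum_(i < kV) Rb * `|b (vI i)| + Rb * `|eloop R n|) => p bp.
have co01 i : 0 <= co p i <= 1 by exact: bp.
apply: le_trans (ler_normD _ _) _; apply: lerD.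
  apply: le_trans (ler_norm_sum _ _ _) _; apply: ler_sum => i _.
  rewrite normrZ ler_wpM2r // normrM gtr0_norm //; apply: ler_piMr; first exact: ltW.
  by have /andP[? ?] := co01 i; rewrite ler_norml; lra.
rewrite normrZ ler_wpM2r // /rr normrM gtr0_norm //; apply: ler_piMr; first exact: ltW.
by have /andP[? ?] := co01 kV; rewrite ger0_norm.
Qed.

(** The equations of the sphere around the centre: no nonpositive components, and action [al] of the
    positive part. Their number [kV.+1] is the dimension of the box. *)
Definition Fz (i : nat) z (y : loop) : R :=
  if (i < kV)%N then ip (y - cst n (ctr F z)) (b (vI i))
  else actQ (pr b (fun j => 0 < s j) (y - cst n (ctr F z))) - al.

Lemma alive z (y : loop) : unitK z -> (forall i, (i < kV.+1)%N -> Fz i z y = 0) ->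
  al / 2 <= Act F (9 * la) z y.
Proof.
move=> Kz H; set xi := y - cst n (ctr F z).
have xpos j : ip xi (b j) != 0 -> 0 < s j.
  move=> h; rewrite ltNge; apply/negP => /vI_ex[i ik E].
  by move: h; rewrite -E; have := H i (ltnW ik); rewrite /Fz ik => ->; rewrite eqxx.
have xpr : pr b (fun j => 0 < s j) xi = xi.
  rewrite [RHS](b_span xi) /pr big_mkcond; apply: eq_bigr => j _; case: ifPn => // h.
  have [->|/xpos] := eqVneq (ip xi (b j)) 0; first by rewrite scale0r.
  by move=> h'; rewrite h' in h.
have xact : actQ xi = r1 ^+ 2 / (320 * C).
  have := H kV (leqnn _); rewrite /Fz ltnn -/xi xpr => /eqP; rewrite subr_eq0 => /eqP ->.
  by [].
have m9 : 0 <= 9 * la <= 9 * la by rewrite lexx mulr_ge0 // ltW.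
have := action_sphere b_on bL b_span C0 r10 xpos xact (fun x => Hquad x Kz m9).
rewrite (_ : cst n (ctr F z) + xi = y); last by rewrite /xi addrC subrK.
apply => x hx; rewrite Hsmall //.
apply/mx_norm_leP; first exact: ltW.
by move=> i j; rewrite ord1 !mxE distrC; exact: hx.
Qed.

Lemma coc i : continuous (fun p : pts => p ord0 i).
Proof. exact: coordc. Qed.

Lemma continuous_sumV (T : topologicalType) (I : Type) (r : seq I) (f : I -> T -> loop) :
  (forall i, continuous (f i)) -> continuous (fun x => \sum_(i <- r) f i x).
Proof.
move=> fc; elim: r => [|i r IH].
  by rewrite (_ : (fun x => _) = fun _ => 0); [exact: contC|apply/funext => x; rewrite big_nil].
rewrite (_ : (fun x => _) = fun x => f i x + \sum_(j <- r) f j x); first exact: contD.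
by apply/funext => x; rewrite big_cons.
Qed.

Lemma x0_cont : continuous x0.
Proof.
apply: contD.
  apply: continuous_sumV => i; apply: contZ; last exact: contC.
  apply: contM; first exact: contC.
  by apply: contB; [apply: contM; [exact: contC|exact: coc]|exact: contC].
by apply: contZ; [apply: contM; [exact: contC|exact: coc]|exact: contC].
Qed.

Lemma Fz_cont i (z : pts -> R * R) (y : pts -> loop) : continuous z -> continuous y ->
  continuous (fun p => Fz i (z p) (y p)).
Proof.
move=> zc yc; have dc : continuous (fun p => y p - cst n (ctr F (z p))).
  apply: contB => //; apply: cont_cst => p; apply: (@continuous_comp _ _ _ z (ctr F)); first exact: zc.
  exact: ctr_cont.
rewrite /Fz; case: (i < kV)%N; first by apply: cont_ip => //; exact: contC.
apply: contB; last exact: contC.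
apply: cont_actQ; rewrite /pr.
rewrite (_ : (fun x => _) = fun x => \sum_j (if 0 < s j then ip (y x - cst n (ctr F (z x))) (b j) *: b j else 0)).
  apply: continuous_sumV => j; case: (0 < s j); last exact: contC.
  by apply: contZ; [apply: cont_ip => //; exact: contC|exact: contC].
by apply/funext => x; rewrite big_mkcond.
Qed.

Lemma flow_tau0 ep S z (x : loop) l : flow F ep 0 S z x l = x.
Proof. by elim: l => [//|l IH]; rewrite /= IH scale0r subr0. Qed.

(** Before the flow starts and with centre 0, each equation involves a single coordinate of the
    box. *)
Definition eq0 (i : nat) (q : R) : R :=
  if (i < kV)%N then Rb * (2 * q - 1) else 2^-1 * sigma1 R n * en * (Rb * q) ^+ 2 - al.

Lemma Fz_x0 z p i : ctr F z = 0 -> (i < kV.+1)%N -> Fz i z (x0 p) = eq0 i (co p i).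
Proof.
move=> cz; have -> : Fz i z (x0 p) = if (i < kV)%N then ip (x0 p) (b (vI i))
   else actQ (pr b (fun j => 0 < s j) (x0 p)) - al.
  rewrite /Fz cz (_ : cst n 0 = 0) ?subr0 //; by apply/matrixP => j k; rewrite !mxE.
rewrite ltnS leq_eqVlt => /predU1P[->|ik]; last first.
  by rewrite /eq0 ik /x0 ipDl ipZl ip_e ?vI_le // mulr0 addr0 ip_vv_in.
rewrite /eq0 ltnn; congr (_ - al).
have -> : pr b (fun j => 0 < s j) (x0 p) = rr p *: eloop R n.
  rewrite [RHS]b_span /pr big_mkcond; apply: eq_bigr => j _; rewrite /x0 ipDl.
  case: ifPn => h; first by rewrite ip_vv_out // add0r.
  by rewrite ipZl ip_e ?mulr0 ?scale0r // leNgt.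
rewrite /actQ.
have -> : Lop (rr p *: eloop R n) = (rr p * sigma1 R n) *: eloop R n.
  have cst0 : cst n (0 : 'rV[R]_4) = 0 by apply/matrixP => j k; rewrite !mxE.
  have L0 : Lop (0 : loop) = 0 by rewrite -cst0 Lop_cst.
  by have := Lop_lin 0 (eloop R n) (rr p); rewrite add0r L0 add0r Lop_eloop scalerA.
by rewrite ipZl ipZr -/en /rr; ring.
Qed.

Lemma eq0_sign i : eq0 i 0 < 0 < eq0 i 1.
Proof.
have [R0 _ _ Rb3] := Rb_sqr; rewrite /eq0; case: ifP => _; first by apply/andP; split; lra.
rewrite mulr0 expr0n mulr0 sub0r oppr_lt0 al_gt0 mulr1 subr_gt0 /=.
have q0 : 0 < sigma1 R n * en by exact: mulr_gt0.
move: Rb3; rewrite /b3 ltr_pdivrMr // => h.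
have -> : 2^-1 * sigma1 R n * en * Rb ^+ 2 = 2^-1 * (Rb ^+ 2 * (sigma1 R n * en)) by ring.
lra.
Qed.

Variables (ep tau0 : R) (S : nat).
Hypothesis Hflow : forall z (x : loop), unitK z -> (exists2 p, box p & x = x0 p) ->
  (forall t, 0 <= t <= 1 -> Act F (9 * la) z (flow F ep (t * tau0) S z x (S + S)) <= Act F la z x) /\
  (Act F la z x <= la -> al / 2 <= Act F (9 * la) z (flow F ep tau0 S z x (S + S)) ->
   ~ (Th1 F z (flow F ep tau0 S z x S) = 0 /\ Th2 F z (flow F ep tau0 S z x S) = 0)).
Hypothesis per : forall u, rel_rot F (u, 0) (u, 1) 0 0.
Hypothesis end1 : forall t, 0 <= t <= 1 -> rel_rot F (1, 0) (1, t) 0 0.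
Hypothesis half1 : forall t, 0 <= t <= 2^-1 -> rel_rot F (0, 0) (0, t) (4 * pi * t) 0.
Hypothesis half2 : forall t, 2^-1 <= t <= 1 -> exists u, rel_rot F (0, 0) (0, t) 0 u.
Hypothesis ctr0 : ctr F (0, 0) = 0.

Definition zz p : R * R := (p ord0 (inord 0), p ord0 (inord 1)).
Definition FF i p := Fz i (zz p) (flow F ep tau0 S (zz p) (x0 p) (S + S)).
Definition G1 p := Th1 F (zz p) (flow F ep tau0 S (zz p) (x0 p) S).
Definition G2 p := Th2 F (zz p) (flow F ep tau0 S (zz p) (x0 p) S).
(** The embedding is fixed at the base point, which frees axis 1 to serve as the duration of the
    flow. *)
Definition EE i p := Fz i (0, 0) (flow F ep (p ord0 (inord 1) * tau0) S (0, 0) (x0 p) (S + S)).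

Lemma zz_cont : continuous zz.
Proof. by apply: cont_pair; exact: coc. Qed.

Lemma inord_eq i j : (i < kV.+3)%N -> (j < kV.+3)%N -> ((inord i : 'I_kV.+3) == inord j) = (i == j).
Proof. by move=> hi hj; rewrite -val_eqE /= !inordK. Qed.

Lemma x0_upd p i v : (i < 2)%N -> x0 (upd p i v) = x0 p.
Proof.
move=> i2; have E j : (j <= kV)%N -> co (upd p i v) j = co p j.
  move=> jk; rewrite /co /upd mxE inord_eq ?ltnS //; last by rewrite (leq_trans (ltnW i2)).
  by case: eqP i2 => // <-.
rewrite /x0 /rr E //; congr (_ + _); apply: eq_bigr => j _; rewrite E //; exact: ltnW.
Qed.

Lemma zz_upd1 p v : zz (upd p 1 v) = (p ord0 (inord 0), v).
Proof. by rewrite /zz /upd !mxE !inord_eq. Qed.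

Lemma rel_FF z z' u t i (x : loop) l : rel_rot F z z' u t ->
  Fz i z' (flow F ep tau0 S z' x l) = Fz i z (flow F ep tau0 S z x l).
Proof. by move=> r; rewrite (rel_flow r) /Fz (rel_ctr r). Qed.

Lemma rel_GG z z' t (x : loop) l : rel_rot F z z' 0 t ->
  Th1 F z' (flow F ep tau0 S z' x l) = Th1 F z (flow F ep tau0 S z x l) /\
  Th2 F z' (flow F ep tau0 S z' x l) = Th2 F z (flow F ep tau0 S z x l).
Proof.
move=> r; rewrite (rel_flow r); have [-> ->] := rel_Th r (flow F ep tau0 S z x l).
by rewrite cos0 sin0; split; ring.
Qed.

Lemma FFE i p v : FF i (upd p 1 v) =
  Fz i (p ord0 (inord 0), v) (flow F ep tau0 S (p ord0 (inord 0), v) (x0 p) (S + S)).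
Proof. by rewrite /FF zz_upd1 x0_upd. Qed.

Lemma G1E p v : G1 (upd p 1 v) =
  Th1 F (p ord0 (inord 0), v) (flow F ep tau0 S (p ord0 (inord 0), v) (x0 p) S).
Proof. by rewrite /G1 zz_upd1 x0_upd. Qed.

Lemma G2E p v : G2 (upd p 1 v) =
  Th2 F (p ord0 (inord 0), v) (flow F ep tau0 S (p ord0 (inord 0), v) (x0 p) S).
Proof. by rewrite /G2 zz_upd1 x0_upd. Qed.

Lemma upd_same p i v : upd p i v ord0 (inord i) = v.
Proof. by rewrite mxE eqxx. Qed.

Lemma EEE i p v : EE i (upd p 1 v) = Fz i (0, 0) (flow F ep (v * tau0) S (0, 0) (x0 p) (S + S)).
Proof. by rewrite /EE (@x0_upd p 1 v isT) upd_same. Qed.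

Lemma boxK p : box p -> unitK (zz p).
Proof. by move=> bp; split; exact: bp. Qed.

Lemma K00 : unitK ((0, 0) : R * R).
Proof. by split; rewrite /= lexx ler01. Qed.

Theorem assembly : False.
Proof.
have be0 : 0 < al / 2 by rewrite divr_gt0 // al_gt0.
have fc : continuous (fun p => flow F ep tau0 S (zz p) (x0 p) S).
  by apply: cont_flow; [exact: contC|exact: zz_cont|exact: x0_cont].
apply: (@no_twist R kV.+1 G1 G2 FF EE eq0).
- by have [] := cont_Th F zz_cont fc.
- by have [] := cont_Th F zz_cont fc.
- by move=> i; apply: Fz_cont; [exact: zz_cont|apply: cont_flow; [exact: contC|exact: zz_cont|exact: x0_cont]].
- move=> i; apply: Fz_cont; first exact: contC.
  apply: cont_flow; [|exact: contC|exact: x0_cont].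
  by apply: contM; [exact: coc|exact: contC].
(* A common zero would be a flow line that ends on the sphere while Theta vanishes at the middle
   time. *)
- move=> p bp F0 g1 g2; have [_ H] := Hflow (boxK bp) (ex_intro2 _ _ p bp erefl).
  by apply: H; [exact: Act_x0_la|exact: alive (boxK bp) F0|split].
(* A line that starts on the boundary of the box has action at most 0 and cannot rise to the
   sphere. *)
- move=> p i bp ik h F0; have [H _] := Hflow (boxK bp) (ex_intro2 _ _ p bp erefl).
  have := alive (boxK bp) F0; have := H 1 ltac:(by rewrite ler01 lexx); rewrite mul1r.
  by have := Act_bdry (zz p) ik h; lra.
- move=> p; have r := per (p ord0 (inord 0)).
  have [h1 h2] := rel_GG (x0 p) S r; split=> [i||].
  + by rewrite !FFE; exact/esym/(rel_FF i _ _ r).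
  + by rewrite !G1E; exact/esym/h1.
  + by rewrite !G2E; exact/esym/h2.
- move=> p t p1 t01; have r := end1 t01; have [h1 h2] := rel_GG (x0 p) S r; split=> [i||].
  + by rewrite !FFE p1; exact: (rel_FF i _ _ r).
  + by rewrite !G1E p1; exact: h1.
  + by rewrite !G2E p1; exact: h2.
- move=> p t i p0 t01; rewrite !FFE p0.
  have [h|h] := leP t 2^-1.
    have r : rel_rot F (0, 0) (0, t) (4 * pi * t) 0 by apply: half1; case/andP: t01 => -> _.
    exact: (rel_FF i _ _ r).
  have [u r] : exists u, rel_rot F (0, 0) (0, t) 0 u by apply: half2; case/andP: t01 => _ ->; rewrite ltW.
  exact: (rel_FF i _ _ r).
(* The angle is [4 * pi * t], so a shift of [t] by 1/4 is a half turn. *)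
- move=> p t p0 /andP[t0 t1].
  have r : rel_rot F (0, 0) (0, t) (4 * pi * t) 0 by apply: half1; apply/andP; split; lra.
  have r' : rel_rot F (0, 0) (0, t + 4^-1) (4 * pi * (t + 4^-1)) 0 by apply: half1; apply/andP; split; lra.
  rewrite !G1E !G2E p0 (rel_flow r) (rel_flow r').
  move: (flow _ _ _ _ _ _ _) => y; have [-> ->] := rel_Th r y; have [-> ->] := rel_Th r' y.
  have -> : 4 * pi * (t + 4^-1) = 4 * pi * t + pi by move: (@pi R) => P; field.
  rewrite cosDpi sinDpi; move: (cos _) (sin _) (Th1 _ _ _) (Th2 _ _ _) => C1 S1 T1 T2.
  by split; ring.
- move=> p t p0 t01; have [u r] := half2 t01.
  rewrite !G1E !G2E p0; exact: rel_GG r.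
- move=> p i bp ik h E0.
  have [H _] := Hflow K00 (ex_intro2 _ _ p bp erefl).
  have := alive K00 E0; have := H _ (bp (inord 1)).
  by have := Act_bdry (0, 0) ik h; lra.
- by move=> p i; rewrite EEE FFE upd_same (@x0_upd p 0 0 isT) mul1r.
- by move=> p i ik; rewrite EEE mul0r flow_tau0; exact: Fz_x0.
- exact: eq0_sign.
Qed.

End Assembly.

Theorem no_contraction (R : realType) (F : sympfam R) :
  (forall u, rel_rot F (u, 0) (u, 1) 0 0) ->
  (forall t, 0 <= t <= 1 -> rel_rot F (1, 0) (1, t) 0 0) ->
  (forall t, 0 <= t <= 2^-1 -> rel_rot F (0, 0) (0, t) (4 * pi * t) 0) ->
  (forall t, 2^-1 <= t <= 1 -> exists u, rel_rot F (0, 0) (0, t) 0 u) ->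
  ctr F (0, 0) = 0 -> False.
Proof.
move=> per end1 half1 half2 ctr0.
have [r0 r00 Hr0] := Ham_small F; have [C C0 HC] := Ham_quad r00 Hr0.
have r10 : 0 < r0 / 2 by rewrite divr_gt0.
have be0 : 0 < (r0 / 2) ^+ 2 / (320 * C) / 2.
  apply: divr_gt0; last by [].
  exact: al_gt0 r10 C0.
(* The number of samples is chosen once the level of the sphere is known; at least two samples are
   taken so that [sigma1] is positive. *)
have [n0 Hn0] := flow_alive F be0; pose n := maxn n0 1.
have n_gt0 : (0 < n)%N by rewrite leq_max orbT.
have [b [s [b_on bL b_span]]] := eigenbasis R n.
have [R0 HR0] := x0_bound F n_gt0 b s r10 C0.
have [ep [tau0 [S [[ep0 t0 S0] Hf]]]] := Hn0 n R0 (leq_maxl _ _).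
apply: (@assembly R F n n_gt0 b s b_on bL b_span (r0 / 2) C r10 C0 HC _ ep tau0 S _ per end1 half1 half2 ctr0).
  by move=> m z x Kz h; apply: Hr0 => //; apply: le_lt_trans h _; lra.
by move=> z x Kz [p bp ->]; apply: Hf => //; exact: HR0.
Qed.

(** * The loop of rotations *)

Section Interface.
Variable R : realType.
Notation R4 := 'rV[R]_4.

Lemma coordE (v : R4) : [/\ Defs.coord v 0 = v ord0 o0, Defs.coord v 1 = v ord0 o1,
  Defs.coord v 2 = v ord0 o2 & Defs.coord v 3 = v ord0 o3].
Proof. by rewrite /Defs.coord; split; congr (v _ _); apply: val_inj; rewrite /= inordK. Qed.

Lemma ellipsoidE (p q : R) (v : R4) : ellipsoid p q v <-> Qcd p q v <= 1.
Proof. by rewrite /ellipsoid /Qcd /=; have [-> -> -> ->] := coordE v. Qed.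

Lemma omegaE (u v : R4) : omega_std u v = dot (u *m Om R) v.
Proof.
rewrite /omega_std /dot sum4; have [-> -> -> ->] := OmE u.
have [-> -> -> ->] := coordE u; have [-> -> -> ->] := coordE v; ring.
Qed.

Lemma mk4E (x1 y1 x2 y2 : R) : [/\ mk4 x1 y1 x2 y2 ord0 o0 = x1, mk4 x1 y1 x2 y2 ord0 o1 = y1,
  mk4 x1 y1 x2 y2 ord0 o2 = x2 & mk4 x1 y1 x2 y2 ord0 o3 = y2].
Proof. by rewrite /mk4; split; rewrite mxE. Qed.

Lemma PhiE (t : R) (y : R4) :
  Phi t y = if t <= 2^-1 then rot2 (4 * pi * t) 0 y else rot2 0 (- (4 * pi * t)) y.
Proof.
rewrite /Phi; have [-> -> -> ->] := coordE y; case: ifP => _.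
  have [e0 e1 e2 e3] := rot2E (4 * pi * t) 0 y; rewrite /=.
  set v := mk4 _ _ _ _; have [f0 f1 f2 f3] : [/\ v ord0 o0 = _, v ord0 o1 = _, v ord0 o2 = _ & v ord0 o3 = _] := mk4E _ _ _ _.
  by apply/rowP; apply: ord4P; rewrite ?(e0, e1, e2, e3) ?(f0, f1, f2, f3) ?cos0 ?sin0; ring.
have [e0 e1 e2 e3] := rot2E 0 (- (4 * pi * t)) y; rewrite /=.
set v := mk4 _ _ _ _; have [f0 f1 f2 f3] : [/\ v ord0 o0 = _, v ord0 o1 = _, v ord0 o2 = _ & v ord0 o3 = _] := mk4E _ _ _ _.
by apply/rowP; apply: ord4P; rewrite ?(e0, e1, e2, e3) ?(f0, f1, f2, f3) ?cos0 ?sin0; ring.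
Qed.

Definition cl (u : R) : R := Num.max 0 (Num.min 1 u).
Definition clz (z : R * R) : R * R := (cl z.1, cl z.2).

Lemma cl_itv u : 0 <= cl u <= 1.
Proof. by rewrite /cl le_max lexx /= ge_max ler01 ge_min lexx. Qed.

Lemma cl_id u : 0 <= u <= 1 -> cl u = u.
Proof. by move=> /andP[u0 u1]; rewrite /cl (min_idPr u1) (max_idPr u0). Qed.

Lemma cl_lip u v : `|cl u - cl v| <= `|u - v|.
Proof.
rewrite /cl; case: (leP 1 u) => h1; case: (leP 1 v) => h2; rewrite ?(max_idPr ler01) ?subrr ?normr0 //;
  [case: (leP 0 v) => h3|case: (leP 0 u) => h3|case: (leP 0 u) => h3; case: (leP 0 v) => h4] => //;
  rewrite ?subrr ?normr0 // ?sub0r ?subr0 ler_norml; case: (ger0P (u - v)) => h5; apply/andP; split; lra.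
Qed.

Lemma clz_K z : unit_square (clz z).
Proof. by split; exact: cl_itv. Qed.

Section Family.
Variables (a b c d : R) (H : R * R -> R4 -> R4).
Notation rho := (Qcd a b).
Hypothesis HS : SympEmb_family (ellipsoid a b) (ellipsoid c d) unit_square H.

Lemma rho_int y : rho y < 1 -> (ellipsoid a b)° y.
Proof.
move=> ry; have [s s0 Hs] := rho_near ry; apply/nbhs_ballP; exists s => // y' yy'.
by apply/ellipsoidE; apply: ltW; apply: Hs; apply: ltW; move: yy'; rewrite -ball_normE.
Qed.

Lemma within_cont (W : normedModType R) (G : (R * R) * R4 -> W) :
  {within unit_square `*` ellipsoid a b, continuous G} -> forall z y, rho y < 1 ->
  {for (z, y), continuous (fun p : (R * R) * R4 => G (clz p.1, p.2))}.
Proof.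
move=> /subspace_continuousP Gc z y ry; apply: cts_ball => e e0 /=.
have Ezy : (unit_square `*` ellipsoid a b) (clz z, y).
  by split; [exact: clz_K|apply/ellipsoidE; exact: ltW].
have /cvgrPdist_lt /(_ e e0) /nbhs_ballP[r /= r0 Hr] := Gc _ Ezy.
have [s s0 Hs] := rho_near ry.
exists (Num.min r s); first by rewrite lt_min r0.
move=> [z' y'] [/= [zz1 zz2] yy]; apply: (Hr (clz z', y')).
  split=> /=; last by apply: le_ball yy; rewrite ge_min lexx.
  have cb (u v : R) : ball u (Num.min r s) v -> ball (cl u) r (cl v).
    rewrite -!ball_normE /= lt_min => /andP[h _]; exact: le_lt_trans (cl_lip _ _) h.
  by split; apply: cb.
split; first exact: clz_K.
apply/ellipsoidE; apply: ltW; apply: Hs; apply: ltW.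
by move: yy; rewrite -ball_normE /= lt_min => /andP[].
Qed.

(* Clamping the parameters to the unit square makes every construction continuous in [z]. *)
Definition fphi z y := H (clz z) y.
Definition fjac z y : 'M[R]_4 := \matrix_(i, j) ('D_(delta_mx ord0 i : R4) (H (clz z)) y) ord0 j.

Lemma fdiff z y : rho y < 1 -> differentiable (H (clz z)) y.
Proof. by have [D _ _ _ _] := HS => ry; exact: (D _ [::] _ (clz_K z) (rho_int ry)). Qed.

Lemma fjacE z y h : rho y < 1 -> h *m fjac z y = 'd (H (clz z)) y h.
Proof.
move=> ry; have df := fdiff z ry.
have -> : 'd (H (clz z)) y h = \sum_i h ord0 i *: 'D_(delta_mx ord0 i : R4) (H (clz z)) y.
  rewrite {1}(row_sum_delta h) linear_sum; apply: eq_bigr => i _.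
  by rewrite linearZ /= deriveE.
by apply/rowP => j; rewrite mxE summxE; apply: eq_bigr => i _; rewrite !mxE.
Qed.

Lemma f_cont z y : rho y < 1 -> {for (z, y), continuous (fun p : (R * R) * R4 => fphi p.1 p.2)}.
Proof.
move=> ry; have [_ Hc _ _ _] := HS.
exact: (@within_cont _ (fun kx => H kx.1 kx.2) Hc z y ry).
Qed.

(** The clause on words of length one in the definition of a family provides joint continuity of
    each partial derivative. *)
Lemma f_jac_cont z y : rho y < 1 -> {for (z, y), continuous (fun p : (R * R) * R4 => fjac p.1 p.2)}.
Proof.
move=> ry; have [_ _ HG _ _] := HS.
apply: (@cvg_mx R _ (nbhs (z, y))) => i j.
have [G [Gc GE]] := HG [:: (delta_mx ord0 i : R4)].
have GE' z' y' : rho y' < 1 -> fjac z' y' i j = G (clz z', y') ord0 j.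
  by move=> ry'; rewrite mxE (GE _ _ (clz_K z') (rho_int ry')).
have gc := @within_cont _ G Gc z y ry.
suff : {for (z, y), continuous (fun p : (R * R) * R4 => fjac p.1 p.2 i j)} by [].
apply: cts_ball => e e0; have [r r0 Hr] := ball_cts gc e0; have [s s0 Hs] := rho_near ry.
exists (Num.min r s); first by rewrite lt_min r0.
move=> [z' y'] zy; have zy' : ball (z, y) r (z', y') by apply: le_ball zy; rewrite ge_min lexx.
have ry' : rho y' < 1.
  case: zy => _ /=; rewrite -ball_normE /= lt_min => /andP[_ h]; apply: Hs; exact: ltW.
rewrite /= !GE' //; apply: le_lt_trans (Hr _ zy'); apply: le_trans (le_mx_norm _ ord0 j).
by rewrite !mxE.
Qed.

Lemma f_diff z y (e : R) : rho y < 1 -> 0 < e -> exists2 r : R, 0 < r &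
  forall h, `|h| < r -> `|fphi z (y + h) - fphi z y - h *m fjac z y| <= e * `|h|.
Proof.
move=> ry e0; have [_ /eqaddoP /(_ e e0) /nbhs_ballP[r /= r0 Hr]] := (diff_locallyP _ _).1 (fdiff z ry).
exists r => // h hr; have := Hr h; rewrite -ball_normE /= sub0r normrN => /(_ hr).
by rewrite fjacE // /fphi !fctE /= [h + y]addrC opprD addrA.
Qed.

Lemma f_symp z y : rho y < 1 -> fjac z y *m Om R *m (fjac z y)^T = Om R.
Proof.
move=> ry; have [_ _ _ _ HO] := HS; apply/matrixP => i j.
have D k : row k (fjac z y) = 'D_(delta_mx ord0 k : R4) (H (clz z)) y.
  by apply/rowP => l; rewrite !mxE.
have -> : (fjac z y *m Om R *m (fjac z y)^T) i j = dot (row i (fjac z y) *m Om R) (row j (fjac z y)).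
  by rewrite dotE -row_mul tr_row [RHS]mxE [LHS]mxE; apply: eq_bigr => k _; rewrite !mxE.
rewrite -omegaE !D HO ?omegaE; [|exact: clz_K|exact: rho_int].
rewrite dotE -rowE trmx_delta -colE !mxE.
by [].
Qed.

Lemma f_inj z y y' : rho y < 1 -> rho y' < 1 -> fphi z y = fphi z y' -> y = y'.
Proof.
have [_ _ _ HI _] := HS; have [inj _] := HI _ (clz_K z).
by move=> ry ry'; apply: inj; apply/ellipsoidE; exact: ltW.
Qed.

Lemma f_img z y : rho y < 1 -> Qcd c d (fphi z y) <= 1.
Proof.
have [_ _ _ HI _] := HS; have [_ img] := HI _ (clz_K z).
by move=> ry; apply/ellipsoidE; apply: img; apply/ellipsoidE; exact: ltW.
Qed.

End Family.
End Interface.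

Theorem theorem1p4 (R : realType) (a b c d : R) :
  a < c -> c < b -> b < d -> c < 2 * a ->
  ~ contractible_loop (ellipsoid a b) (ellipsoid c d) (fun t => Phi t).
Proof.
move=> ac cb bd c2a [H [HS H0 H1 Hp]].
have a0 : 0 < a by lra.
have b0 : 0 < b by lra.
pose mu := Num.min (2 * a) b; have cmu : c < mu by rewrite lt_min c2a cb.
have mu0 : 0 < mu by lra.
(* [la] is the midpoint of [c] and [mu], and [r0] that of [la / mu] and 1, which gives
   [la < mu * r0]. *)
pose la := (c + mu) / 2; pose r0 := (la / mu + 1) / 2.
have lamu : la < mu by rewrite /la; lra.
have q0 : 0 < la / mu by rewrite divr_gt0 // /la; lra.
have q1 : la / mu < 1 by rewrite ltr_pdivrMr // mul1r.
have r00 : 0 < r0 by rewrite /r0; lra.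
have r01 : r0 < 1 by rewrite /r0; lra.
have lar : la < mu * r0.
  by have : mu * r0 = (la + mu) / 2; [rewrite /r0; field; rewrite gt_eqF|move=> ->; lra].
have mua : mu <= 2 * a by rewrite ge_min lexx.
have mub : mu <= b by rewrite ge_min lexx orbT.
have la1 : la < 2 * a * r0 by apply: lt_le_trans lar _; rewrite ler_pM2r.
have la2 : la < b * r0 by apply: lt_le_trans lar _; rewrite ler_pM2r.
have cd : c < d by lra.
have cla : c < la by rewrite /la; lra.
pose F := SympFam a0 ac cb cd cla r00 r01 la1 la2 (f_cont HS) (f_diff HS)
  (f_jac_cont HS) (f_symp HS) (f_inj HS) (f_img HS).
have E (y : 'rV[R]_4) : Qcd a b y < 1 -> ellipsoid a b y by move=> h; apply/ellipsoidE; exact: ltW.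
have phi0 t (y : 'rV[R]_4) : 0 <= t <= 1 -> Qcd a b y < 1 -> phi F (0, t) y = Phi t y.
  move=> t01 ry; rewrite /= /fphi /clz /= cl_id ?lexx ?ler01 // cl_id //; apply: H0 => //; exact: E.
have phi00 (y : 'rV[R]_4) : Qcd a b y < 1 -> phi F (0, 0) y = y.
  by move=> ry; rewrite phi0 ?lexx ?ler01 // PhiE invr_ge0 ler0n mulr0 rot200.
apply: (@no_contraction R F).
(* Clamping extends the periodicity from the unit interval to every real [u]. *)
- move=> u y ry; rewrite rot200 /= /fphi /clz /= (@cl_id _ 0) ?lexx ?ler01 // (@cl_id _ 1) ?lexx ?ler01 //.
  by apply/esym/Hp; [exact: cl_itv|exact: E].
- move=> t t01 y ry; rewrite rot200 /= /fphi /clz /= (@cl_id _ 1) ?lexx ?ler01 // (@cl_id _ 0) ?lexx ?ler01 // cl_id //.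
  by apply: H1; [|exact: E].
- move=> t /andP[t0 t1] y ry; rewrite phi0 ?phi00 ?(rot2_rho F) //; last by apply/andP; split; lra.
  by rewrite PhiE t1.
- move=> t /andP[t0 t1].
  have t01 : 0 <= t <= 1 by apply/andP; split; lra.
  have [h|h] := leP t 2^-1.
    (* At [t = 1/2] the first branch of [Phi] applies: a full turn of the z1-plane, which is the
       identity. *)
    exists 0 => y ry; have -> : t = 2^-1 by apply/eqP; rewrite eq_le h.
    rewrite phi0 ?phi00 ?(rot2_rho F) //; last by rewrite invr_ge0 ler0n invf_le1 ?ler1n.
    rewrite PhiE lexx (_ : 4 * pi * 2^-1 = pi *+ 2); last by rewrite mulr2n; move: (@pi R) => P; field.
    have [e0 e1 e2 e3] := rot2E (pi *+ 2) 0 y; have [f0 f1 f2 f3] := rot2E 0 0 y.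
    by apply/rowP; apply: ord4P; rewrite ?(e0, e1, e2, e3) ?(f0, f1, f2, f3) ?cos2pi ?sin2pi ?cos0 ?sin0.
  exists (- (4 * pi * t)) => y ry; rewrite phi0 ?phi00 ?(rot2_rho F) //.
  by rewrite PhiE leNgt h.
- by rewrite /ctr phi00 // Qcd0 ltr01.
Qed.
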